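(* Let $p\ge3$ be an integer, $T>0$, and suppose that Assumption A (stated in the context) holds with $\zeta_0=2$ and $p'=0$. Then the measure $\mu_p$ on $H^p$, $d\mu_p=e^{-J_p(u)}d\eta_p(u)$, is $\epsilon$-quasi-invariant for the perturbed KdV equation $u_t+u_{xxx}-6uu_x=\epsilon f(u)$ on the space $H^p$, i.e. for every $M>0$ it is $\epsilon$-quasi-invariant on the ball $B^u_p(M)=\{u\in H^p:\|u\|_p\le M\}$.
   Context: $H^p$ is the Sobolev space of real zero-mean functions $u=\sum_{k\ge1}(\hat u_ke_k+\hat u_{-k}e_{-k})$ on $\mathbb T=\mathbb R/\mathbb Z$, where $e_k=\sqrt2\cos2\pi kx$ ($k>0$), $e_k=\sqrt2\sin2\pi kx$ ($k<0$), with $\|u\|_p^2=\sum_{k\ge1}(2\pi k)^{2p}(\hat u_k^2+\hat u_{-k}^2)$. Analytic maps between Banach spaces (real parts of complex spaces) are Fréchet-analytic and assumed uniformly analytic: for any $R$ the map extends to a bounded analytic map on a complex $\delta_R$-neighbourhood ($\delta_R>0$) of the ball of radius $R$. Assumption A with $\zeta_0=2$, $p'=0$ ($\epsilon\in(0,1]$). (i) For any $u_0\in H^p$ there is a unique solution $u(t)\in H^p$ of $u_t+u_{xxx}-6uu_x=\epsilon f(u(\cdot))$, $\int_{\mathbb T}u\,dx=0$, with $u(0)=u_0$, and $\|u(t)\|_p\le C(T,p,\|u_0\|_p)$ for $0\le t\le T\epsilon^{-1}$, with $C$ independent of $\epsilon$ and bounded for bounded $\|u_0\|_p$. (ii) For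 every $q\in[0,p]$ the map $u\mapsto f(u)$ is analytic from $H^q$ to $H^{q+2}$. Conservation laws. KdV $u_t+u_{xxx}-6uu_x=0$ has conservation laws $\mathcal J_n(u)=\frac12\|u\|_n^2+J_{n-1}(u)$, $n\ge0$, with $J_{-1}=0$ and, for $n\ge1$, $J_{n-1}(u)=\int_{\mathbb T}\{c_nu(\partial_x^{n-1}u)^2+\mathcal Q_n(u,\dots,\partial_x^{n-2}u)\}dx$, where $c_n$ are real constants and $\mathcal Q_n$ polynomials. Explicitly, these are the standard ones: $\mathcal J_n=\frac{(-1)^{n+1}}2\int_{\mathbb T}\chi_{2n+3}dx$ with $\chi_1=u$, $\chi_{k+1}=-\partial_x\chi_k-\sum_{i=1}^{k-1}\chi_i\chi_{k-i}$. In particular $J_p(u)$ is defined and bounded on bounded sets of $H^p$, and $\mathcal J_{p+1}=\frac12\|u\|_{p+1}^2+J_p(u)$. Measures. $\eta_p$ is the centered Gaussian measure on $H^p$ with correlation operator $(-\partial_x^2)^{-1}$, i.e. under $\eta_p$ the coefficients $\hat u_{\pm i}$, $i\ge1$, are independent centered Gaussians of variance $(2\pi i)^{-2p-2}$. $\mu_p(\Omega)=\int_\Omega e^{-J_p(u)}d\eta_p(u)$ for Borel $\Omega\subset H^p$. Quasi-invariance. Let $S^\tau_\epsilon$, $0\le\tau\le T$, be the flow on $H^p$ in the slow time $\tau=\epsilon t$: $S^\tau_\epsilon u_0=u(\epsilon^{-1}\tau)$. A measure $\mu$ on $H^p$ is regular if $\mu\{u:g(u)=0\}=0$ for every analytic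 function $g\not\equiv0$ on $H^p$. It is $\epsilon$-quasi-invariant on $B^u_p(M)$ if it is regular, $0<\mu(B^u_p(M))<\infty$, and there is a constant $C(T,M)$, independent of $\epsilon$, such that for every Borel set $A\subset B^u_p(M)$ and $\tau\in[0,T]$: $e^{-\tau C(T,M)}\mu(A)\le\mu(S^\tau_\epsilon(A))\le e^{\tau C(T,M)}\mu(A)$. *)

(* Defs.v *)
From HB Require Import structures.
From mathcomp Require Import all_boot all_order all_algebra.
From mathcomp Require Import all_classical all_reals all_analysis.
From mathcomp.real_closed Require Import complex.
From mathcomp Require Import ring.
From mathcomp Require mpoly.

Set Implicit Arguments.
Unset Strict Implicit.
Unset Printing Implicit Defensive.

Import Order.TTheory GRing.Theory Num.Theory.
Import numFieldNormedType.Exports.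

Local Open Scope classical_set_scope.
Local Open Scope ring_scope.
Local Open Scope complex_scope.

Section coefficient_norm.
Variable R : realType.
Implicit Types (q : R) (a b : int -> R).

Definition weight q (k : nat) : R := (2 * pi * k%:R) `^ (2 * q).

Definition sqsum q a : \bar R :=
  (\sum_(1 <= k <oo) (weight q k * (a k%:Z ^+ 2 + a (- k%:Z) ^+ 2))%:E)%E.

Definition coef_norm q a : R := Num.sqrt (fine (sqsum q a)).

(* A zero-mean function is encoded by its coefficients on the basis [trig]
   below, indexed by all of [int], the entry at 0 being 0. *)
Definition sob_coef q a : Prop := a 0 = 0 /\ (sqsum q a < +oo)%E.

Lemma weight_ge0 q k : 0 <= weight q k.
Proof. exact: powR_ge0. Qed.

Lemma weight_gt0 q k : (0 < k)%N -> 0 < weight q k.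
Proof. by move=> k0; rewrite powR_gt0// !mulr_gt0// ?pi_gt0// ltr0n. Qed.

Lemma sqterm_ge0 q a (k : nat) :
  0 <= weight q k * (a k%:Z ^+ 2 + a (- k%:Z) ^+ 2).
Proof. by rewrite mulr_ge0 ?weight_ge0// addr_ge0// sqr_ge0. Qed.

Lemma sqsum_ge0 q a : (0 <= sqsum q a)%E.
Proof. by apply: nneseries_ge0 => k _ _; rewrite lee_fin sqterm_ge0. Qed.

Lemma le_sqsum q a b :
  (forall k, a k ^+ 2 <= b k ^+ 2) -> (sqsum q a <= sqsum q b)%E.
Proof.
move=> ab; apply: lee_nneseries => [k _ _|k _]; rewrite lee_fin ?sqterm_ge0//.
by rewrite ler_wpM2l ?weight_ge0// lerD.
Qed.

Lemma sqsumZ q (c : R) a :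
  sqsum q (fun k => c * a k) = ((c ^+ 2)%:E * sqsum q a)%E.
Proof.
rewrite -nneseriesZl => [|k _]; last by rewrite lee_fin sqterm_ge0.
apply: eq_eseriesr => k _; rewrite -EFinM; congr (_%:E).
by rewrite !exprMn -mulrDr mulrCA.
Qed.

Lemma young_sqr (t x y : R) : 0 < t ->
  (x + y) ^+ 2 <= (1 + t) * x ^+ 2 + (1 + t^-1) * y ^+ 2.
Proof.
move=> t0; rewrite -subr_ge0.
suff -> : (1 + t) * x ^+ 2 + (1 + t^-1) * y ^+ 2 - (x + y) ^+ 2 =
          t^-1 * (t * x - y) ^+ 2.
  by rewrite mulr_ge0 ?sqr_ge0// invr_ge0 ltW.
by field; rewrite gt_eqF.
Qed.

Lemma sqsum_young q (t : R) a b : 0 < t ->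
  (sqsum q (fun k => (a k + b k)%R) <=
   (1 + t)%:E * sqsum q a + (1 + t^-1)%:E * sqsum q b)%E.
Proof.
move=> t0; have t1 : 0 <= 1 + t by rewrite addr_ge0// ltW.
have t2 : 0 <= 1 + t^-1 by rewrite addr_ge0// invr_ge0 ltW.
rewrite -!nneseriesZl; try by move=> k _; rewrite lee_fin sqterm_ge0.
rewrite -nneseriesD; try by move=> k _ _; apply: mule_ge0; rewrite lee_fin ?sqterm_ge0.
apply: lee_nneseries => [k _ _|k _].
  by rewrite lee_fin; exact: (sqterm_ge0 q (fun k => a k + b k)).
rewrite -!EFinM -EFinD lee_fin !(mulrCA _ (weight q k)) -mulrDr.
rewrite ler_wpM2l ?weight_ge0// !mulrDr addrACA.
by rewrite lerD// young_sqr.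
Qed.

Lemma sqsumD_lty q a b : (sqsum q a < +oo -> sqsum q b < +oo ->
  sqsum q (fun k => (a k + b k)%R) < +oo)%E.
Proof.
move=> ay byy; apply: le_lt_trans (sqsum_young q a b ltr01) _.
by rewrite lte_add_pinfty// lte_mul_pinfty// ?lee_fin ?addr_ge0// ?invr_ge0//.
Qed.

Lemma sqsum_fin q a : (sqsum q a < +oo)%E -> sqsum q a \is a fin_num.
Proof. by move=> ay; rewrite ge0_fin_numE// sqsum_ge0. Qed.

Lemma coef_norm_eq0 q a : sob_coef q a -> coef_norm q a = 0 ->
  forall k, a k = 0.
Proof.
move=> [a0 ay] /eqP; rewrite sqrtr_eq0 => Ale0.
have A0 : sqsum q a = 0%E.
  apply/eqP; rewrite eq_le sqsum_ge0 andbT -(fineK (sqsum_fin ay)).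
  by rewrite lee_fin.
suff H (k : nat) : (0 < k)%N -> a k%:Z ^+ 2 + a (- k%:Z) ^+ 2 = 0.
  have H2 (k : nat) : (0 < k)%N -> a k%:Z = 0 /\ a (- k%:Z) = 0.
    move=> /H/eqP; rewrite paddr_eq0 ?sqr_ge0// !sqrf_eq0.
    by move=> /andP[/eqP ? /eqP].
  case=> [[|k]|k]; first exact: a0.
    by have [] := H2 k.+1 isT.
  by have [_] := H2 k.+1 isT.
move=> k0; set s := (X in X = 0).
have : ((weight q k * s)%:E <= sqsum q a)%E.
  apply: le_trans (nneseries_lim_ge k.+1 _); last first.
    by move=> n _ _; rewrite lee_fin sqterm_ge0.
  rewrite big_nat_recr//= leeDr// sume_ge0// => n _.
  by rewrite lee_fin sqterm_ge0.
rewrite A0 lee_fin pmulr_rle0 ?weight_gt0// => sle0.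
by apply/eqP; rewrite eq_le sle0/= addr_ge0// sqr_ge0.
Qed.

Lemma coef_norm_ge0 q a : 0 <= coef_norm q a.
Proof. exact: sqrtr_ge0. Qed.

Lemma coef_normZ q (c : R) a :
  coef_norm q (fun k => c * a k) = `|c| * coef_norm q a.
Proof.
rewrite /coef_norm sqsumZ; have := sqsum_ge0 q a.
case: (sqsum q a) => [s| |] // s0.
  by rewrite -EFinM /= sqrtrM ?sqr_ge0// sqrtr_sqr.
have [->|c0] := eqVneq c 0; first by rewrite expr0n mul0e /= sqrtr0 normr0 mul0r.
by rewrite gt0_muley ?lte_fin ?exprn_even_gt0//= sqrtr0 mulr0.
Qed.

Lemma le_coef_norm q a b : (sqsum q b < +oo)%E ->
  (forall k, a k ^+ 2 <= b k ^+ 2) -> coef_norm q a <= coef_norm q b.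
Proof.
move=> bfin ab; have le := le_sqsum q ab.
rewrite ler_wsqrtr// fine_le// ?sqsum_fin//; exact: le_lt_trans bfin.
Qed.

Lemma coef_normD q a b : sob_coef q a -> sob_coef q b ->
  coef_norm q (fun k => a k + b k) <= coef_norm q a + coef_norm q b.
Proof.
move=> sa sb; have [[a0 ay] [b0 byy]] := (sa, sb).
have [nb|nb] := eqVneq (coef_norm q b) 0.
  have /funext bz := coef_norm_eq0 sb nb.
  by rewrite nb bz addr0 (_ : (fun k => _) = a)//; apply/funext => k; rewrite addr0.
have [na|na] := eqVneq (coef_norm q a) 0.
  have /funext az := coef_norm_eq0 sa na.
  by rewrite na az add0r (_ : (fun k => _) = b)//; apply/funext => k; rewrite add0r.
have x0 : 0 < coef_norm q a by rewrite lt_neqAle eq_sym na coef_norm_ge0.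
have y0 : 0 < coef_norm q b by rewrite lt_neqAle eq_sym nb coef_norm_ge0.
rewrite -[leRHS]ger0_norm ?addr_ge0 ?coef_norm_ge0// -sqrtr_sqr.
apply: ler_wsqrtr; rewrite -lee_fin fineK; last first.
  exact/sqsum_fin/sqsumD_lty.
have E c : (sqsum q c < +oo)%E -> sqsum q c = (coef_norm q c ^+ 2)%:E.
  move=> cy; rewrite sqr_sqrtr ?fineK ?sqsum_fin//.
  by rewrite fine_ge0// sqsum_ge0.
apply: le_trans (sqsum_young q a b (divr_gt0 y0 x0)) _.
rewrite (E a ay) (E b byy) -!EFinM -EFinD lee_fin.
move: (coef_norm q a) (coef_norm q b) na nb {x0 y0} => x y x0 y0.
suff -> : (1 + y / x) * x ^+ 2 + (1 + (y / x)^-1) * y ^+ 2 = (x + y) ^+ 2 by [].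
by field; rewrite x0 y0.
Qed.

End coefficient_norm.

Section real_sobolev.
Variable R : realType.

Definition sob_pred (q : R) : {pred int -> R} := fun u => `[< sob_coef q u >].

Record sobolev (q : R) := Sobolev { coef :> int -> R ; _ : coef \in sob_pred q }.

HB.instance Definition _ q := [isSub for @coef q].
HB.instance Definition _ q := gen_eqMixin (sobolev q).
HB.instance Definition _ q := gen_choiceMixin (sobolev q).

Lemma coefP q (u : sobolev q) : sob_coef q u.
Proof. by case: u => u /= /asboolP. Qed.

Lemma sob_submod_closed q : submod_closed (sob_pred q).
Proof.
split.
  apply/asboolP; split => //; rewrite /sqsum eseries0 ?ltry// => k _ _ /=.
  by rewrite expr0n/= addr0 mulr0.
move=> c u v /asboolP[u0 uy] /asboolP[v0 vy]; apply/asboolP; split.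
  have -> : (c *: u + v) 0 = c * u 0 + v 0 by [].
  by rewrite u0 v0 addr0 mulr0.
apply: (@sqsumD_lty _ _ (fun k => c * u k) v) => //.
by rewrite sqsumZ lte_mul_pinfty// lee_fin sqr_ge0.
Qed.

HB.instance Definition _ q :=
  GRing.isSubmodClosed.Build R (int -> R) (sob_pred q) (sob_submod_closed q).
HB.instance Definition _ q :=
  [SubChoice_isSubLmodule of sobolev q by <:].

Definition sob_norm q (u : sobolev q) : R := coef_norm q u.

Lemma sob_normD q (u v : sobolev q) :
  sob_norm (u + v) <= sob_norm u + sob_norm v.
Proof. exact: coef_normD (coefP u) (coefP v). Qed.

Lemma sob_normZ q (c : R) (u : sobolev q) :
  sob_norm (c *: u) = `|c| * sob_norm u.
Proof. exact: coef_normZ. Qed.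

Lemma sob_norm0 q (u : sobolev q) : sob_norm u = 0 -> u = 0.
Proof.
by move=> u0; apply: val_inj; apply/funext; exact: (coef_norm_eq0 (coefP u)).
Qed.

HB.instance Definition _ q :=
  Lmodule_isNormed.Build R (sobolev q) (@sob_normD q) (@sob_normZ q) (@sob_norm0 q).

Lemma sob_normE q (u : sobolev q) : `|u| = coef_norm q u.
Proof. by []. Qed.

End real_sobolev.

Section complex_sobolev.
Variable R : realType.
Implicit Types q : R.

Definition modc (z : R[i]) : R := complex.Re `|z|.

Lemma modcE z : (modc z)%:C = `|z|.
Proof. exact: RRe_real (normr_real z). Qed.

Lemma modc_ge0 z : 0 <= modc z.
Proof. by rewrite -lecR modcE; exact: normr_ge0. Qed.

Lemma modcD y z : modc (y + z) <= modc y + modc z.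
Proof. by rewrite -lecR rmorphD/= !modcE ler_normD. Qed.

Lemma modcM y z : modc (y * z) = modc y * modc z.
Proof. by apply: (@complexI R); rewrite rmorphM/= !modcE normrM. Qed.

Lemma modc0 : modc 0 = 0.
Proof. by apply: (@complexI R); rewrite modcE normr0. Qed.

Lemma modc_eq0 z : modc z = 0 -> z = 0.
Proof. by move=> z0; apply/eqP; rewrite -normr_eq0 -modcE z0. Qed.

Lemma modc_real (x : R) : modc x%:C = `|x|.
Proof. by apply: (@complexI R); rewrite modcE normc_def /= expr0n/= addr0 sqrtr_sqr. Qed.

Definition moduli (z : int -> R[i]^o) : int -> R := fun k => modc (z k).

Definition sobC_pred q : {pred int -> R[i]^o} :=
  fun z => `[< sob_coef q (moduli z) >].

Record sobolevC q :=
  SobolevC { coefC :> int -> R[i]^o ; _ : coefC \in sobC_pred q }.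

HB.instance Definition _ q := [isSub for @coefC q].
HB.instance Definition _ q := gen_eqMixin (sobolevC q).
HB.instance Definition _ q := gen_choiceMixin (sobolevC q).

Lemma coefCP q (z : sobolevC q) : sob_coef q (moduli z).
Proof. by case: z => z /= /asboolP. Qed.

Lemma sobC_submod_closed q : submod_closed (sobC_pred q).
Proof.
split.
  apply/asboolP; split; first exact: modc0.
  rewrite /sqsum eseries0 ?ltry// => k _ _ /=.
  by rewrite /moduli /= modc0 expr0n/= addr0 mulr0.
move=> c u v /asboolP[u0 uy] /asboolP[v0 vy]; apply/asboolP; split.
  have -> : moduli (c *: u + v) 0 = modc (c * u 0 + v 0) by [].
  by rewrite (modc_eq0 u0) (modc_eq0 v0) addr0 mulr0 modc0.
apply: (@le_lt_trans _ _ (sqsum q (fun k => modc c * moduli u k + moduli v k))).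
  apply: le_sqsum => k; rewrite ler_sqr ?nnegrE ?addr_ge0 ?mulr_ge0 ?modc_ge0//.
  by apply: le_trans (modcD _ _) _; rewrite lerD2r modcM.
apply: sqsumD_lty => //.
by rewrite sqsumZ lte_mul_pinfty// lee_fin sqr_ge0.
Qed.

HB.instance Definition _ q :=
  GRing.isSubmodClosed.Build R[i] (int -> R[i]^o) (sobC_pred q)
    (sobC_submod_closed q).
HB.instance Definition _ q := [SubChoice_isSubLmodule of sobolevC q by <:].

Definition sobC_norm q (z : sobolevC q) : R[i] := (coef_norm q (moduli z))%:C.

Lemma sobC_normD q (y z : sobolevC q) :
  sobC_norm (y + z) <= sobC_norm y + sobC_norm z.
Proof.
rewrite /sobC_norm -rmorphD/= lecR.
apply: le_trans (coef_normD (coefCP y) (coefCP z)).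
apply: le_coef_norm => [|k].
  by apply: sqsumD_lty; [case: (coefCP y)|case: (coefCP z)].
by rewrite ler_sqr ?nnegrE ?addr_ge0 ?modc_ge0// modcD.
Qed.

Lemma sobC_normZ q (c : R[i]) (z : sobolevC q) :
  sobC_norm (c *: z) = `|c| * sobC_norm z.
Proof.
rewrite /sobC_norm -modcE -rmorphM/= -[in RHS](ger0_norm (modc_ge0 c)).
rewrite -coef_normZ; congr (coef_norm _ _)%:C; apply/funext => k.
exact: modcM.
Qed.

Lemma sobC_norm0 q (z : sobolevC q) : sobC_norm z = 0 -> z = 0.
Proof.
move=> /(@complexI R _ 0) z0; apply: val_inj; apply/funext => k.
exact: modc_eq0 (coef_norm_eq0 (coefCP z) z0 k).
Qed.

HB.instance Definition _ q :=
  Lmodule_isNormed.Build R[i] (sobolevC q)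
    (@sobC_normD q) (@sobC_normZ q) (@sobC_norm0 q).

Lemma sobC_normE q (z : sobolevC q) : `|z| = (coef_norm q (moduli z))%:C.
Proof. by []. Qed.

Lemma complexify_subproof q (u : sobolev q) :
  (fun k => (coef u k)%:C : R[i]^o) \in sobC_pred q.
Proof.
have [u0 uy] := coefP u; apply/asboolP; split; first by rewrite /moduli u0 modc0.
apply: le_lt_trans uy; apply: le_sqsum => k.
by rewrite /moduli modc_real real_normK// num_real.
Qed.

Definition complexify q (u : sobolev q) : sobolevC q :=
  SobolevC (complexify_subproof u).

End complex_sobolev.

Section analytic_maps.
Variable R : realType.

(* [V] and [V'] are the real parts, through [j] and [j'], of the complex
   spaces [W] and [W']; the norm of a complex space takes its values in [R[i]]. *)
Definition uniformly_analytic (V V' : normedModType R) (W W' : normedModType R[i])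
    (j : V -> W) (j' : V' -> W') (f : V -> V') : Prop :=
  forall r : R, exists2 delta : R, 0 < delta & exists F : W -> W',
    let N := [set z | exists2 u, `|u| <= r & `|z - j u| < delta%:C] in
    [/\ forall z, N z -> differentiable F z,
        exists K : R, forall z, N z -> `|F z| <= K%:C &
        forall u, `|u| <= r -> F (j u) = j' (f u)].

Definition analytic_sob (q q' : R) (f : sobolev q -> sobolev q') : Prop :=
  uniformly_analytic (@complexify R q) (@complexify R q') f.

Definition analytic_fun (q : R) (g : sobolev q -> R) : Prop :=
  uniformly_analytic (@complexify R q) (fun x : R^o => x%:C : R[i]^o)
    (g : sobolev q -> R^o).

End analytic_maps.

Section functions_on_the_torus.
Variable R : realType.
Implicit Types (u : int -> R) (F : R -> R).

Definition trig (k : int) (x : R) : R :=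
  if 0 < k then Num.sqrt 2 * cos (2 * pi * k%:~R * x)
  else Num.sqrt 2 * sin (2 * pi * k%:~R * x).

Definition synth u (x : R) : R :=
  limn (fun n => \sum_(1 <= k < n)
    (u k%:Z * trig k%:Z x + u (- k%:Z) * trig (- k%:Z) x)).

Definition torus_int F : R := \int[lebesgue_measure]_(x in `[0, 1]) F x.

End functions_on_the_torus.

Section conservation_laws.
Variable R : realType.
Implicit Types (u : int -> R) (F : R -> R).

(* [chi_seq F m = [:: chi_1; ...; chi_m]]; see [chi1] and [chiS]. *)
Fixpoint chi_seq F (m : nat) : seq (R -> R) :=
  if m is n.+1 then
    let s := chi_seq F n in
    let c i := nth (fun=> 0) s i.-1 in
    rcons s (if n is 0 then F else
      fun x => - derive1 (c n) x - \sum_(1 <= i < n) c i x * c (n - i)%N x)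
  else [::].

Definition chi F (k : nat) : R -> R := nth (fun=> 0) (chi_seq F k) k.-1.

Lemma size_chi_seq F m : size (chi_seq F m) = m.
Proof. by elim: m => //= m IH; rewrite size_rcons IH. Qed.

Lemma nth_chi_seq F m i : (0 < i <= m)%N ->
  nth (fun=> 0) (chi_seq F m) i.-1 = chi F i.
Proof.
elim: m => [|m IH]; first by case: i.
case/andP=> i0; rewrite leq_eqVlt => /predU1P[->//|im].
rewrite /= nth_rcons size_chi_seq.
have -> : (i.-1 < m)%N by rewrite prednK.
by rewrite IH// i0.
Qed.

Lemma chi1 F : chi F 1 = F.
Proof. by []. Qed.

Lemma chiS F k : (0 < k)%N -> chi F k.+1 =
  fun x => - derive1 (chi F k) x - \sum_(1 <= i < k) chi F i x * chi F (k - i)%N x.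
Proof.
case: k => // k _; rewrite {1}/chi.
have -> : chi_seq F k.+2 = rcons (chi_seq F k.+1) (fun x =>
    - derive1 (nth (fun=> 0) (chi_seq F k.+1) k) x
    - \sum_(1 <= i < k.+1) nth (fun=> 0) (chi_seq F k.+1) i.-1 x *
        nth (fun=> 0) (chi_seq F k.+1) (k.+1 - i).-1 x) by [].
rewrite nth_rcons size_chi_seq ltnn eqxx.
apply/funext => x; congr (_ - _); apply: eq_big_nat => i /andP[i0 ik].
by rewrite !nth_chi_seq// ?subn_gt0 ?ik ?leq_subr// i0 ltnW.
Qed.

Definition conserved (n : nat) F : R :=
  (-1) ^+ n.+1 / 2 * torus_int (chi F (2 * n + 3)%N).

(* For [u] in [H^n] the derivatives of order less than [n] of [synth u] exist
   everywhere, and the one of order [n] exists almost everywhere. *)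
Definition J_density (n : nat) (c : R) (Q : mpoly.mpoly n R) u : R :=
  torus_int (fun x => c * synth u x * (derive1n n (synth u) x) ^+ 2 +
    mpoly.meval (fun i : 'I_n => derive1n i (synth u) x) Q).

(* [c] and [Q] are c_{n+1} and Q_{n+1}; they are determined up to terms that
   integrate to zero, so that [J_density n c Q] is J_n on all of [H^n]. *)
Definition is_J (n : nat) (c : R) (Q : mpoly.mpoly n R) : Prop :=
  forall u, (forall q : R, sob_coef q u) ->
    conserved n.+1 (synth u) = coef_norm n.+1%:R u ^+ 2 / 2 + J_density c Q u.

End conservation_laws.

Section perturbed_kdv.
Variables (R : realType) (p : nat).
Local Notation H := (sobolev (p%:R : R)).
(* A perturbation acts on coefficient sequences; only its values on
   [sobolev 0] are used. *)
Variable f : (int -> R) -> (int -> R).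

(* [u] solves the equation in [C([0, L], H^p)]: the equation is tested against
   the basis [trig], with the third derivative moved onto [trig k]. *)
Definition is_solution (eps L : R) (u0 : H) (u : R -> H) : Prop :=
  [/\ u 0 = u0, {within `[0, L], continuous u} &
    forall t, 0 < t < L -> forall k : int, k != 0 ->
      is_derive t 1 (fun s => u s k)
        (torus_int (fun x => synth (u t) x * derive1n 3 (trig k) x +
           6 * synth (u t) x * derive1 (synth (u t)) x * trig k x) +
         eps * f (u t) k)].

(* [C] does not depend on [eps], and is bounded on bounded sets. *)
Definition assumption_i (T : R) : Prop :=
  exists C : R -> R,
    (forall r, exists K, forall s, 0 <= s <= r -> C s <= K) /\
    forall (eps : R) (u0 : H), 0 < eps <= 1 ->
      exists u, [/\ is_solution eps (T / eps) u0 u,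
        forall v, is_solution eps (T / eps) u0 v ->
          forall t, 0 <= t <= T / eps -> v t = u t &
        forall t, 0 <= t <= T / eps -> `|u t| <= C `|u0|].

Definition assumption_ii : Prop :=
  forall q : R, 0 <= q <= p%:R ->
    exists2 fq : sobolev q -> sobolev (q + 2),
      analytic_sob fq & forall u, coef (fq u) = f (coef u).

Definition assumptionA (T : R) : Prop := assumption_i T /\ assumption_ii.

Definition slow_flow (T eps tau : R) (u0 : H) : H :=
  xget (fun=> u0) [set u | is_solution eps (T / eps) u0 u] (tau / eps).

End perturbed_kdv.

Section measures.
Variables (R : realType) (p : nat).
Local Notation H := (sobolev (p%:R : R)).

Definition borelH := g_sigma_algebraType (@open H).

Definition closed_ballH (M : R) : set H := [set u | `|u| <= M].

(* standard deviation of the [k]-th coefficient *)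
Definition gauss_sd (k : int) : R := ((2 * pi * `|k%:~R|) ^+ p.+1)^-1.

Definition is_gaussian (eta : probability borelH R) : Prop :=
  (forall (k : int) (B : set R), k != 0 -> measurable B ->
     eta [set u : H | B (u k)] = normal_prob 0 (gauss_sd k) B) /\
  (forall (s : seq int) (B : int -> set R), uniq s -> 0 \notin s ->
     (forall k, measurable (B k)) ->
     eta [set u : H | forall k, k \in s -> B k (u k)] =
     (\prod_(k <- s) eta [set u : H | B k (u k)])%E).

Definition mu_of (eta : probability borelH R) (J : H -> R) (A : set H) :
    \bar R :=
  (\int[eta]_(u in (A : set borelH)) (expR (- J u))%:E)%E.

Definition regular_measure (mu : set H -> \bar R) : Prop :=
  forall g : H -> R, analytic_fun g -> (exists u, g u <> 0) ->
    mu [set u | g u = 0] = 0%E.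

Definition quasi_invariant (T M : R) (S : R -> R -> H -> H)
    (mu : set H -> \bar R) : Prop :=
  [/\ regular_measure mu, (0 < mu (closed_ballH M) < +oo)%E &
    exists C : R, forall (eps tau : R) (A : set H),
      0 < eps <= 1 -> 0 <= tau <= T ->
      measurable (A : set borelH) -> A `<=` closed_ballH M ->
      ((expR (- (tau * C)))%:E * mu A <= mu (S eps tau @` A)
         <= (expR (tau * C))%:E * mu A)%E].

End measures.

(* Main.v *)
Require Import Defs.
From HB Require Import structures.
From mathcomp Require Import all_boot all_order all_algebra.
From mathcomp Require Import all_classical all_reals all_analysis measurable_realfun.
From mathcomp.real_closed Require Import complex.
From mathcomp Require Import ring lra zify.
From mathcomp Require mpoly.
Set Implicit Arguments.
Unset Strict Implicit.
Unset Printing Implicit Defensive.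
Import Order.TTheory GRing.Theory Num.Theory.
Import numFieldNormedType.Exports.
Local Open Scope classical_set_scope.
Local Open Scope ring_scope.

(**
For sg = 1 and sg = -1 the flow and its inverse are approximated by compositions
of one-coordinate shears u |-> u + h * F_k(P_m u) e_k, where P_m is the truncation
to |k| < m.  The KdV part of F_k is affine in the k-th coefficient and the
perturbation is Lipschitz in it, so that in one dimension a shear expands lengths by an
explicit factor, and conditioning on the other coefficients gives an inequality for
the Gaussian measure.  The product of the factors is at least
exp(- eps C t): the dilations of the modes k and -k of KdV cancel, and those of the
perturbation are summable because Cauchy estimates make f Lipschitz from H^0 to H^2.

The exponent produced by the Gaussian density and by exp(- J_p) is the increment of
the conserved functional of order p + 1.  Along the truncated KdV field it changes only by
n2 (Q_m (X D^p X)) + n2 (Q_m (D^p (X^2))) (Zhidkov), which is bounded and tends to 0 at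
every point of H^p; a first crude comparison of measures turns this into
convergence in L^1 along the scheme.

The scheme converges, coefficient by coefficient, to every trajectory of
the equation, by a Gronwall estimate in L^2.  In the limit mu(A) <= exp(eps C t) mu(S A), because
Borel sets are approximated by sets that are open for coefficientwise convergence.
The limit of the backward scheme shows that S A is a Borel set, and the backward
inequality gives the other half.  The a priori bound only allows steps of a
fixed length in t, which are then concatenated.

Regularity: an analytic function has isolated zeros on
lines, so its zero set has Gaussian measure 0 or contains every translate along finitely
many modes.
*)

(** * Trigonometric polynomials *)

(** Formally $\mu_p$ is $e^{-\mathcal J_{p+1}(u)}\prod_k d\hat u_k$ and KdV preserves both factors,
    but $\|u\|_{p+1}$ is infinite for $\eta_p$-almost every $u$. So only increments of $\mathcal
    J_{p+1}$ at truncated arguments appear, and constants that depend on the truncation level [m]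
    may only multiply powers of the step [h], which is chosen after [m]. Truncation destroys
    conservation; the defect is small at each fixed point, but not uniformly along a moving orbit,
    which is why it is transported by a comparison of measures. The gain of two derivatives by $f$
    is used twice: it makes the diagonal Lipschitz constants of $f$ of size $k^{-2}$, and it turns
    $\langle\partial^{p+1}u,\partial^{p+1}f\rangle$ into
    $-\langle\partial^pu,\partial^{p+2}f\rangle$. Both contributions carry a factor $\epsilon$, so a
    time $\tau/\epsilon$ costs only $C\tau$ in the exponent. A shear needs a lower bound for its
    expansion in one variable, and no determinant. The price is a one-sided inequality, hence the
    two signs. The error of the scheme is controlled in $L^2$ only, hence the weak notion of open
    set. *)

Section trig_polynomials.
Variable R : realType.
Implicit Types (f g : R -> R) (n m k : nat) (x c : R).

Definition wav k x : R := 2 * pi * k%:R * x.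

(** The bound on the frequencies is strict, so that degree less than [n] matches the modes [|k| < n]
    of the truncations; [k = 0] in [trig_deg_cos] supplies the constants. The inductive form turns
    closure under products and derivatives into inductions on the generators. *)
Inductive trig_deg n : (R -> R) -> Prop :=
| trig_deg0 : trig_deg n 0
| trig_deg_cos k : (k < n)%N -> trig_deg n (fun x => cos (wav k x))
| trig_deg_sin k : (k < n)%N -> trig_deg n (fun x => sin (wav k x))
| trig_deg_lin c f g : trig_deg n f -> trig_deg n g ->
    trig_deg n (fun x => c * f x + g x).

Lemma trig_degD n f g : trig_deg n f -> trig_deg n g -> trig_deg n (f + g).
Proof.
move=> nf ng; rewrite (_ : f + g = fun x => 1 * f x + g x); first exact: trig_deg_lin.
by apply/funext => x; rewrite mul1r.
Qed.

Lemma trig_degZ n c f : trig_deg n f -> trig_deg n (fun x => c * f x).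
Proof.
move=> nf; rewrite (_ : (fun x => _) = fun x => c * f x + (0 : R -> R) x).
  exact/trig_deg_lin/trig_deg0.
by apply/funext => x; rewrite addr0.
Qed.

Lemma trig_degN n f : trig_deg n f -> trig_deg n (- f).
Proof.
move=> nf; rewrite (_ : - f = fun x => -1 * f x); first exact: trig_degZ.
by apply/funext => x; rewrite mulN1r.
Qed.

Lemma trig_degS n m f : (n <= m)%N -> trig_deg n f -> trig_deg m f.
Proof.
move=> nm; elim=> [|k kn|k kn|c {}f g _ f' _ g'].
- exact: trig_deg0.
- exact/trig_deg_cos/(leq_trans kn).
- exact/trig_deg_sin/(leq_trans kn).
- exact: trig_deg_lin.
Qed.

Lemma trig_deg_cst n c : (0 < n)%N -> trig_deg n (cst c).
Proof.
move=> n0; rewrite (_ : cst c = fun x => c * cos (wav 0 x)).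
  exact/trig_degZ/trig_deg_cos.
by apply/funext => x; rewrite /wav mulr0 mul0r cos0 mulr1.
Qed.

Lemma wavD n m x : wav (n + m) x = wav n x + wav m x.
Proof. by rewrite /wav natrD; ring. Qed.

Lemma wavB n m x : (m <= n)%N -> wav (n - m) x = wav n x - wav m x.
Proof. by move=> mn; rewrite /wav natrB//; ring. Qed.

Let trig_degE n f g : f = g -> trig_deg n f -> trig_deg n g.
Proof. by move=> ->. Qed.

(** Product-to-sum formula. Frequencies are natural numbers, so the larger one is put first before
    they are subtracted. *)
Lemma trig_deg_cosM n m : trig_deg (n + m).+1 (fun x => cos (wav n x) * cos (wav m x)).
Proof.
wlog mn : n m / (m <= n)%N.
  move=> h; have [/h//|/ltnW/h] := leqP m n.
  by rewrite addnC; apply: trig_degE; apply/funext => x; rewrite mulrC.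
apply: (@trig_degE _ (fun x => 2^-1 * cos (wav (n + m) x) +
   (fun x => 2^-1 * cos (wav (n - m) x)) x)); last first.
  apply: trig_deg_lin; [|apply: trig_degZ]; apply: trig_deg_cos => //.
  by rewrite ltnS (leq_trans (leq_subr _ _))// leq_addr.
by apply/funext => x; rewrite wavD wavB// cosD cosB; field.
Qed.

Lemma trig_deg_sinM n m : trig_deg (n + m).+1 (fun x => sin (wav n x) * sin (wav m x)).
Proof.
wlog mn : n m / (m <= n)%N.
  move=> h; have [/h//|/ltnW/h] := leqP m n.
  by rewrite addnC; apply: trig_degE; apply/funext => x; rewrite mulrC.
apply: (@trig_degE _ (fun x => - 2^-1 * cos (wav (n + m) x) +
   (fun x => 2^-1 * cos (wav (n - m) x)) x)); last first.
  apply: trig_deg_lin; [|apply: trig_degZ]; apply: trig_deg_cos => //.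
  by rewrite ltnS (leq_trans (leq_subr _ _))// leq_addr.
by apply/funext => x; rewrite wavD wavB// cosD cosB; field.
Qed.

Lemma trig_deg_cossinM n m : trig_deg (n + m).+1 (fun x => cos (wav n x) * sin (wav m x)).
Proof.
have [mn|/ltnW nm] := leqP m n.
  apply: (@trig_degE _ (fun x => 2^-1 * sin (wav (n + m) x) +
     (fun x => - 2^-1 * sin (wav (n - m) x)) x)); last first.
    apply: trig_deg_lin; [|apply: trig_degZ]; apply: trig_deg_sin => //.
    by rewrite ltnS (leq_trans (leq_subr _ _))// leq_addr.
  by apply/funext => x; rewrite wavD wavB// sinD sinB; field.
apply: (@trig_degE _ (fun x => 2^-1 * sin (wav (n + m) x) +
   (fun x => 2^-1 * sin (wav (m - n) x)) x)); last first.
  apply: trig_deg_lin; [|apply: trig_degZ]; apply: trig_deg_sin => //.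
  by rewrite ltnS (leq_trans (leq_subr _ _))// leq_addl.
by apply/funext => x; rewrite wavD wavB// sinD sinB; field.
Qed.

Lemma trig_degM n m f g : trig_deg n f -> trig_deg m g -> trig_deg (n + m) (f * g).
Proof.
have W k l : (k < n -> l < m -> (k + l).+1 <= n + m)%N by lia.
move=> nf; elim=> [|l lm|l lm|c {}g1 g2 _ h1 _ h2]; last 1 first.
- apply: trig_degE (trig_deg_lin c h1 h2).
  by apply/funext => x; rewrite !fctE; ring.
- by rewrite mulr0; exact: trig_deg0.
- elim: nf => [|k kn|k kn|c {}f1 f2 _ h1 _ h2].
  + by rewrite mul0r; exact: trig_deg0.
  + exact: trig_degS (W _ _ kn lm) (trig_deg_cosM _ _).
  + rewrite mulrC; apply: trig_degS (trig_deg_cossinM l k); rewrite addnC; exact: W.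
  + apply: trig_degE (trig_deg_lin c h1 h2).
    by apply/funext => x; rewrite !fctE; ring.
- elim: nf => [|k kn|k kn|c {}f1 f2 _ h1 _ h2].
  + by rewrite mul0r; exact: trig_deg0.
  + exact: trig_degS (W _ _ kn lm) (trig_deg_cossinM _ _).
  + exact: trig_degS (W _ _ kn lm) (trig_deg_sinM _ _).
  + apply: trig_degE (trig_deg_lin c h1 h2).
    by apply/funext => x; rewrite !fctE; ring.
Qed.

Lemma trig_deg_derive n f : trig_deg n f ->
  (forall x, derivable f x 1) /\ trig_deg n (derive1 f).
Proof.
elim=> [|k kn|k kn|c {}f g _ [df f'] _ [dg g']].
- split=> [x|]; first exact: derivable_cst.
  rewrite (_ : derive1 _ = 0); first exact: trig_deg0.
  by apply/funext => x; rewrite derive1_cst.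
- have E x : is_derive x 1 (fun x => cos (wav k x)) (- (2 * pi * k%:R) * sin (wav k x)).
    rewrite /wav; apply: is_derive_eq.
    by rewrite /GRing.scale /= mulr1 mulrC mulNr mulrN.
  split=> [x|]; first by case: (E x).
  rewrite (_ : derive1 _ = fun x => - (2 * pi * k%:R) * sin (wav k x)).
    exact/trig_degZ/trig_deg_sin.
  by apply/funext => x; rewrite derive1E; apply: (@derive_val _ _ _ _ _ _ _ (E x)).
- have E x : is_derive x 1 (fun x => sin (wav k x)) ((2 * pi * k%:R) * cos (wav k x)).
    rewrite /wav; apply: is_derive_eq.
    by rewrite /GRing.scale /= mulr1 mulrC.
  split=> [x|]; first by case: (E x).
  rewrite (_ : derive1 _ = fun x => (2 * pi * k%:R) * cos (wav k x)).
    exact/trig_degZ/trig_deg_cos.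
  by apply/funext => x; rewrite derive1E; apply: (@derive_val _ _ _ _ _ _ _ (E x)).
- split=> [x|].
    by apply: derivableD => //; exact: derivableZ.
  rewrite (_ : derive1 _ = fun x => c * derive1 f x + derive1 g x); first exact: trig_deg_lin.
  apply/funext => x; rewrite !derive1E deriveD//; last exact: derivableZ.
  by rewrite deriveZ.
Qed.

Definition tp_pred : {pred R -> R} := fun f => `[< exists n, trig_deg n f >].

(** The commutative ring structure on this type lets [ring] settle identities between functions, and
    makes differentiation and integration total operations without side conditions. *)
Record tpoly := TPoly { tpfun :> R -> R ; _ : tpfun \in tp_pred }.

HB.instance Definition _ := [isSub for tpfun].
HB.instance Definition _ := gen_eqMixin tpoly.
HB.instance Definition _ := gen_choiceMixin tpoly.

Lemma tpP (f : tpoly) : exists n, trig_deg n f.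
Proof. by case: f => f /= /asboolP. Qed.

Lemma tp_subring_closed : subring_closed tp_pred.
Proof.
split.
- by apply/asboolP; exists 1%N; exact: trig_deg_cst.
- move=> f g /asboolP[n nf] /asboolP[m mg]; apply/asboolP; exists (n + m)%N.
  apply: trig_degD; first exact: trig_degS (leq_addr _ _) nf.
  by apply/trig_degN; apply: trig_degS (leq_addl _ _) mg.
- move=> f g /asboolP[n nf] /asboolP[m mg]; apply/asboolP; exists (n + m)%N.
  exact: trig_degM.
Qed.

HB.instance Definition _ := GRing.isSubringClosed.Build (R -> R) tp_pred tp_subring_closed.
HB.instance Definition _ := [SubChoice_isSubComNzRing of tpoly by <:].

End trig_polynomials.

(** * Differentiation and integration of trigonometric polynomials *)

Section trig_calculus.
Variable R : realType.
Implicit Types (X Y Z : tpoly R) (c x y : R) (a b : int -> R) (k : int) (n m : nat).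
Local Notation T := (tpoly R).

Lemma tp_add X Y x : (X + Y) x = X x + Y x. Proof. by []. Qed.
Lemma tp_opp X x : (- X) x = - X x. Proof. by []. Qed.
Lemma tp_mul X Y x : (X * Y) x = X x * Y x. Proof. by []. Qed.

Lemma tp_sum (J : Type) (r : seq J) (P : pred J) (F : J -> T) x :
  (\sum_(j <- r | P j) F j) x = \sum_(j <- r | P j) F j x.
Proof. by elim/big_rec2: _ => // j y1 y2 _ <-. Qed.

Lemma tp_eq X Y : X =1 Y -> X = Y.
Proof. by move=> XY; apply/val_inj/funext. Qed.

Lemma tp_cst_subproof c : (cst c : R -> R) \in @tp_pred R.
Proof. by apply/asboolP; exists 1%N; exact: trig_deg_cst. Qed.
Definition tpC c : T := TPoly (tp_cst_subproof c).

Lemma tpCD c d : tpC (c + d) = tpC c + tpC d. Proof. exact: tp_eq. Qed.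
Lemma tpCM c d : tpC (c * d) = tpC c * tpC d. Proof. exact: tp_eq. Qed.
Lemma tpC0 : tpC 0 = 0. Proof. exact: tp_eq. Qed.
Lemma tpC1 : tpC 1 = 1. Proof. exact: tp_eq. Qed.
Lemma tpCN c : tpC (- c) = - tpC c. Proof. exact: tp_eq. Qed.
Lemma tpCn n : tpC n%:R = n%:R.
Proof. by elim: n => [|n IH]; rewrite ?tpC0// -natr1 tpCD IH tpC1 natr1. Qed.

Lemma tp_derivable X x : derivable X x 1.
Proof. by have [n /trig_deg_derive[]] := tpP X. Qed.

Lemma tp_derive_subproof X : derive1 X \in @tp_pred R.
Proof.
by have [n /trig_deg_derive[_ nX]] := tpP X; apply/asboolP; exists n.
Qed.

(* [D] and [I] are made opaque to keep unification from unfolding them. *)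
Fact D_subdef : {D : T -> T | forall X, tpfun (D X) = derive1 X}.
Proof. by exists (fun X => TPoly (tp_derive_subproof X)). Qed.
Definition D : T -> T := sval D_subdef.
Lemma DE X : tpfun (D X) = derive1 X. Proof. exact: (svalP D_subdef). Qed.

Lemma DD X Y : D (X + Y) = D X + D Y.
Proof.
apply: tp_eq => x; rewrite tp_add !DE !derive1E deriveD//; exact: tp_derivable.
Qed.
Lemma DC c : D (tpC c) = 0.
Proof. by apply: tp_eq => x; rewrite DE derive1_cst. Qed.
Lemma DM X Y : D (X * Y) = D X * Y + X * D Y.
Proof.
apply: tp_eq => x; rewrite tp_add !tp_mul !DE !derive1E deriveM; try exact: tp_derivable.
by rewrite addrC mulrC /GRing.scale /= (mulrC (Y x)).
Qed.
Lemma D0 : D 0 = 0. Proof. by rewrite -[X in D X]tpC0 DC. Qed.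
Lemma D1 : D 1 = 0. Proof. by rewrite -[X in D X]tpC1 DC. Qed.
Lemma DCM c X : D (tpC c * X) = tpC c * D X.
Proof. by rewrite DM DC mul0r add0r. Qed.
Lemma DN X : D (- X) = - D X.
Proof. by rewrite -mulN1r -tpC1 -tpCN DCM tpCN tpC1 mulN1r. Qed.
Lemma DB X Y : D (X - Y) = D X - D Y.
Proof. by rewrite DD DN. Qed.
Lemma Dsum (J : Type) (r : seq J) (P : pred J) (F : J -> T) :
  D (\sum_(j <- r | P j) F j) = \sum_(j <- r | P j) D (F j).
Proof. by apply: (big_morph D DD D0). Qed.

Lemma tp_continuous X : continuous X.
Proof.
by move=> x; apply/differentiable_continuous/derivable1_diffP; exact: tp_derivable.
Qed.

Lemma tp_integrable X : lebesgue_measure.-integrable `[0, 1] (EFin \o X).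
Proof.
apply: continuous_compact_integrable; first exact: segment_compact.
exact/continuous_subspaceT/tp_continuous.
Qed.

Fact I_subdef : {I : T -> R | forall X, I X = torus_int X}.
Proof. by exists (fun X => torus_int X). Qed.
Definition I : T -> R := sval I_subdef.
Lemma IE X : I X = torus_int X. Proof. exact: (svalP I_subdef). Qed.

Lemma ID X Y : I (X + Y) = I X + I Y.
Proof. by rewrite !IE /torus_int -RintegralD//; exact: tp_integrable. Qed.
Lemma IZ c X : I (tpC c * X) = c * I X.
Proof. by rewrite !IE /torus_int -RintegralZl//; exact: tp_integrable. Qed.
Lemma I0 : I 0 = 0.
Proof. by rewrite -[X in I X](mul0r 0) -tpC0 IZ mul0r. Qed.
Lemma IN X : I (- X) = - I X.
Proof. by rewrite -mulN1r -tpC1 -tpCN IZ mulN1r. Qed.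
Lemma IB X Y : I (X - Y) = I X - I Y.
Proof. by rewrite ID IN. Qed.
Lemma Isum (J : Type) (r : seq J) (P : pred J) (F : J -> T) :
  I (\sum_(j <- r | P j) F j) = \sum_(j <- r | P j) I (F j).
Proof. by apply: (big_morph I ID I0). Qed.
Lemma IC c : I (tpC c) = c.
Proof.
rewrite !IE /torus_int Rintegral_cst//= lebesgue_measure_itv /=.
by rewrite lte_fin ltr01 oppr0 adde0 mulr1.
Qed.

Lemma le_I X Y : (forall x, 0 <= x <= 1 -> X x <= Y x) -> I X <= I Y.
Proof.
move=> XY; rewrite !IE; apply: le_Rintegral => //; try exact: tp_integrable.
Qed.

Lemma I_ge0 X : (forall x, 0 <= x <= 1 -> 0 <= X x) -> 0 <= I X.
Proof. by move=> X0; rewrite -I0; exact: le_I. Qed.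

Lemma wav_periodic k : forall n, (cos (@wav R n 1) = 1) * (sin (@wav R n 1) = 0).
Proof.
have h1 : cos (2 * pi : R) = 1 by rewrite mulrC mulr_natr cos2pi.
have h2 : sin (2 * pi : R) = 0 by rewrite mulrC mulr_natr sin2pi.
elim=> [|n [c s]]; first by rewrite /wav mulr0 mul0r cos0 sin0.
have -> : @wav R n.+1 1 = wav n 1 + 2 * pi by rewrite /wav -natr1; ring.
by rewrite cosD sinD c s h1 h2 !mul0r !mulr0 !mulr1 subr0 addr0.
Qed.

Lemma tp_periodic X : X 1 = X 0.
Proof.
have [n] := tpP X; elim=> [|k _|k _|c f g _ hf _ hg] //.
- by rewrite (wav_periodic 0) /wav mulr0 cos0.
- by rewrite (wav_periodic 0) /wav mulr0 sin0.
- by rewrite hf hg.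
Qed.

Lemma I_D X : I (D X) = 0.
Proof.
rewrite !IE /torus_int /Rintegral.
rewrite (@continuous_FTC2 _ (D X) X)//=.
- by rewrite tp_periodic subrr.
- exact/continuous_subspaceT/tp_continuous.
- split.
  + by move=> x _; exact: tp_derivable.
  + exact/cvg_at_right_filter/tp_continuous.
  + exact/cvg_at_left_filter/tp_continuous.
- by move=> x _; rewrite DE.
Qed.

Lemma I_parts X Y : I (D X * Y) = - I (X * D Y).
Proof. by apply/eqP; rewrite -addr_eq0 -ID -DM I_D. Qed.

Lemma I_sqr_ge0 X : 0 <= I (X * X).
Proof. by apply: I_ge0 => x _; rewrite tp_mul -expr2 sqr_ge0. Qed.

(** The quadratic $t\mapsto\int(tX+Y)^2$ is nonnegative. It is evaluated at its minimiser, or, when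
    $\int X^2=0$, at the [t] where the remaining affine function would equal -1. *)
Lemma I_CS X Y : I (X * Y) ^+ 2 <= I (X * X) * I (Y * Y).
Proof.
have q (t : R) : 0 <= I (X * X) * t ^+ 2 + 2 * I (X * Y) * t + I (Y * Y).
  have := I_sqr_ge0 (tpC t * X + Y).
  rewrite (_ : _ * _ = tpC (t ^+ 2) * (X * X) + tpC (2 * t) * (X * Y) + Y * Y).
    rewrite !ID !IZ; move: (I (X * X)) (I (X * Y)) (I (Y * Y)) => u v w; lra.
  by rewrite expr2 !tpCM tpCn; ring.
have [x0|x0] := eqVneq (I (X * X)) 0.
  have [->|xy] := eqVneq (I (X * Y)) 0; first by rewrite x0 mul0r expr0n.
  have := q (- (I (Y * Y) + 1) / (2 * I (X * Y))).
  rewrite x0 mul0r add0r mulrC -mulrA mulVf ?mulf_neq0// mulr1.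
  move: (I (Y * Y)) => w; lra.
have x0' : 0 < I (X * X) by rewrite lt_neqAle eq_sym x0 I_sqr_ge0.
have := q (- I (X * Y) / I (X * X)).
rewrite -(pmulr_rge0 _ x0').
have -> : I (X * X) * (I (X * X) * (- I (X * Y) / I (X * X)) ^+ 2 +
  2 * I (X * Y) * (- I (X * Y) / I (X * X)) + I (Y * Y)) =
  I (X * X) * I (Y * Y) - I (X * Y) ^+ 2 by field.
by rewrite subr_ge0.
Qed.

Lemma I_sqr_le X : I X ^+ 2 <= I (X * X).
Proof. by have := I_CS X 1; rewrite !mulr1 -tpC1 IC mulr1. Qed.

Definition Dn n X := iter n D X.
Lemma Dn0 X : Dn 0 X = X. Proof. by []. Qed.
Lemma DnS n X : Dn n.+1 X = D (Dn n X). Proof. by []. Qed.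
Lemma DnSr n X : Dn n.+1 X = Dn n (D X). Proof. exact: iterSr. Qed.
Lemma Dn_add n m X : Dn (n + m) X = Dn n (Dn m X). Proof. exact: iterD. Qed.
Lemma DnD n X Y : Dn n (X + Y) = Dn n X + Dn n Y.
Proof. by elim: n => // n; rewrite !DnS => ->; rewrite DD. Qed.
Lemma DnCM n c X : Dn n (tpC c * X) = tpC c * Dn n X.
Proof. by elim: n => // n; rewrite !DnS => ->; rewrite DCM. Qed.
Lemma DnN n X : Dn n (- X) = - Dn n X.
Proof. by elim: n => // n; rewrite !DnS => ->; rewrite DN. Qed.
Lemma DnB n X Y : Dn n (X - Y) = Dn n X - Dn n Y.
Proof. by rewrite DnD DnN. Qed.
Lemma DnZ0 n : Dn n 0 = 0.
Proof. by elim: n => // n; rewrite !DnS => ->; rewrite D0. Qed.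

Lemma derive1n_tp n X : derive1n n X = Dn n X.
Proof. by elim: n => // n; rewrite derive1nS => ->; rewrite -DE. Qed.

Lemma I_partsn n X Y : I (Dn n X * Y) = (-1) ^+ n * I (X * Dn n Y).
Proof.
elim: n X Y => [|n IH] X Y; first by rewrite expr0 mul1r.
by rewrite DnS I_parts IH -DnSr exprS mulN1r mulNr.
Qed.

Lemma Leibniz n X Y : Dn n (X * Y) =
  \sum_(i < n.+1) 'C(n, i)%:R * (Dn i X * Dn (n - i) Y).
Proof.
elim: n => [|n IH]; first by rewrite big_ord_recl big_ord0 bin0 mul1r addr0.
rewrite DnS IH Dsum.
under eq_bigr => i _ do rewrite -tpCn DCM tpCn DM -!DnS -subSn ?leq_ord// mulrDr.
rewrite big_split /= addrC.
rewrite [X in _ + X](_ : _ = \sum_(i < n.+2) ('C(n, i.-1) * (0 < i))%N%:R * (Dn i X * Dn (n.+1 - i) Y)); last first.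
  rewrite [RHS]big_ord_recl /= muln0 mul0r add0r; apply: eq_bigr => i _.
  by rewrite muln1 /bump /= subSS.
rewrite [X in X + _](_ : _ = \sum_(i < n.+2) 'C(n, i)%:R * (Dn i X * Dn (n.+1 - i) Y)); last first.
  by rewrite [RHS]big_ord_recr /= bin_small// mul0r addr0.
rewrite -big_split; apply: eq_bigr => -[[|i] /= _] _; rewrite -mulrDl.
  by rewrite muln0 addr0 !bin0.
by rewrite -natrD muln1 binS.
Qed.

End trig_calculus.

(** * The orthonormal basis and its projections *)

Section trig_basis.
Variable R : realType.
Implicit Types (X Y Z : tpoly R) (c x y : R) (a b : int -> R) (k : int) (n m : nat).
Local Notation T := (tpoly R).

Definition wn k : R := 2 * pi * k%:~R.

Lemma wnN k : wn (- k) = - wn k.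
Proof. by rewrite /wn mulrNz mulrN. Qed.

Lemma wn_eq0 k : (wn k == 0) = (k == 0).
Proof. by rewrite /wn !mulf_eq0 pnatr_eq0 (gt_eqF (pi_gt0 R)) intr_eq0. Qed.

Lemma trig_nat n x : (0 < n)%N -> trig n%:Z x = Num.sqrt 2 * cos (@wav R n x).
Proof. by move=> n0; rewrite /trig ltz_nat n0. Qed.

Lemma trig_Nnat n x : trig (- n%:Z) x = - Num.sqrt 2 * sin (@wav R n x).
Proof.
rewrite /trig oppr_gt0 ltNge lez_nat /= mulrNz mulrN mulNr sinN mulrN mulNr.
by rewrite /wav.
Qed.

Lemma trig_deg_trig k : trig_deg `|k|%N.+1 (@trig R k).
Proof.
case: k => [n|n].
  have [->|n0] := posnP n.
    rewrite (_ : trig 0 = 0); first exact: trig_deg0.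
    by apply/funext => x; rewrite /trig ltxx mulr0 mul0r sin0 mulr0.
  rewrite (_ : trig n = fun x => Num.sqrt 2 * cos (wav n x)).
    exact/trig_degZ/trig_deg_cos.
  by apply/funext => x; rewrite -trig_nat.
rewrite NegzE (_ : trig _ = fun x => - Num.sqrt 2 * sin (wav n.+1 x)).
  by rewrite abszN; exact/trig_degZ/trig_deg_sin.
by apply/funext => x; rewrite trig_Nnat.
Qed.

Lemma trig_tp_subproof k : trig k \in @tp_pred R.
Proof. by apply/asboolP; exists `|k|%N.+1; exact: trig_deg_trig. Qed.
Definition e k : T := TPoly (trig_tp_subproof k).

Lemma eE k x : e k x = trig k x. Proof. by []. Qed.

(** Since the sine of [trig k] is taken at the negative frequency [k] itself, one formula serves
    both signs of [k]. *)
Lemma De k : D (e k) = tpC (wn k) * e (- k).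
Proof.
apply: tp_eq => x; rewrite DE tp_mul !eE /=.
have h n (n0 : (0 < n)%N) : derive1 (@trig R n%:Z) x = wn n * trig (- n%:Z) x.
  rewrite (_ : trig n%:Z = fun x => Num.sqrt 2 * cos (wav n x)); last first.
    by apply/funext => y; rewrite -trig_nat.
  rewrite trig_Nnat /wav derive1E.
  apply: (@derive_val _ _ _ _ _ _ _ (is_derive_eq _ _)).
  by rewrite /GRing.scale /= mulr1 /wn; ring.
have h' n (n0 : (0 < n)%N) : derive1 (@trig R (- n%:Z)) x = wn (- n%:Z) * trig n%:Z x.
  rewrite (_ : trig (- n%:Z) = fun x => - Num.sqrt 2 * sin (wav n x)); last first.
    by apply/funext => y; rewrite -trig_Nnat.
  rewrite trig_nat// /wav derive1E.
  apply: (@derive_val _ _ _ _ _ _ _ (is_derive_eq _ _)).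
  by rewrite /GRing.scale /= mulr1 wnN /wn; ring.
case: k => [n|n]; last by rewrite NegzE h'// opprK.
have [->|n0] := posnP n; last exact: h.
rewrite (_ : trig 0%:Z = cst 0) ?derive1_cst ?/wn ?mulr0 ?mul0r//.
by apply/funext => y; rewrite /trig ltxx mulr0 mul0r sin0 mulr0.
Qed.

Lemma D2e k : D (D (e k)) = - tpC (wn k ^+ 2) * e k.
Proof. by rewrite De DCM De wnN opprK tpCN mulrA mulrN -tpCM -expr2. Qed.

Lemma I_e k : k != 0 -> I (e k) = 0.
Proof.
move=> k0; have := I_D (e (- k)); rewrite De opprK IZ => /eqP.
by rewrite mulf_eq0 wn_eq0 oppr_eq0 (negbTE k0) => /eqP.
Qed.

(** No integral is computed. Eigenfunctions of $\partial_x^2$ with distinct eigenvalues are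
    orthogonal; $e_le_{-l}$ is a multiple of the derivative of $e_l^2$; $e_l$ and $e_{-l}$ have
    equal norms by an integration by parts, and their squares add up to 2. *)
Lemma I_ee j k : j != 0 -> k != 0 -> I (e j * e k) = (j == k)%:R.
Proof.
move=> j0 k0.
have [jk|jk] := eqVneq (j ^+ 2) (k ^+ 2); last first.
  have -> : (j == k) = false by apply/eqP => E; move: jk; rewrite E eqxx.
  have h : I (D (D (e j)) * e k) = I (e j * D (D (e k))).
    by rewrite !I_parts opprK -!/(D _) -(opprK (I (e j * _))) -I_parts I_parts opprK.
  move: h; rewrite !D2e -!tpCN -mulrA IZ mulrCA IZ => /eqP.
  rewrite -subr_eq0 -mulrBl mulf_eq0 => /orP[|/eqP//].
  rewrite opprK addrC subr_eq0 /wn !exprMn => /eqP.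
  move=> /mulfI; rewrite -!rmorphXn/= => /(_ _)/intr_inj E.
  by move: jk; rewrite E ?eqxx// mulf_neq0 ?expf_neq0 ?pnatr_eq0// gt_eqF ?pi_gt0.
have opp l : l != 0 -> I (e l * e (- l)) = 0.
  move=> l0; have := I_D (e l * e l); rewrite DM (mulrC (D _)) -mulr2n.
  rewrite De mulrCA -mulr_natl -tpCn !IZ => /eqP.
  by rewrite mulf_eq0 pnatr_eq0 /= mulf_eq0 wn_eq0 (negbTE l0) => /eqP.
have dia l : l != 0 -> I (e l * e l) = 1.
  move=> l0.
  have h : I (e l * e l) = I (e (- l) * e (- l)).
    have : I (D (e l) * D (e l)) = - I (e l * D (D (e l))) by rewrite I_parts.
    rewrite D2e De -tpCN (mulrCA (e l)) mulrACA -tpCM !IZ mulNr opprK -expr2 => /mulfI.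
    by rewrite expf_neq0 ?wn_eq0// => /(_ isT).
  have s : e l * e l + e (- l) * e (- l) = tpC 2.
    apply: tp_eq => x; rewrite tp_add !tp_mul !eE /=.
    have H n (n0 : (0 < n)%N) : (@trig R n%:Z x) * trig n%:Z x +
        trig (- n%:Z) x * trig (- n%:Z) x = 2.
      rewrite trig_nat// trig_Nnat -!expr2 !exprMn sqrrN sqr_sqrtr ?ler0n//.
      by rewrite -mulrDr cos2Dsin2 mulr1.
    case: l l0 {h} => n n0; first by rewrite H// lt0n.
    by rewrite NegzE opprK addrC H.
  have := congr1 (@I R) s; rewrite ID -h IC => h2; lra.
move/eqP: jk; rewrite eqf_sqr => /orP[/eqP->|/eqP->].
  by rewrite eqxx dia.
rewrite mulrC opp//; case: eqP => // E; exfalso; move/eqP: k0; apply; lia.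
Qed.

(** The order 1, -1, 2, -2, ... is that of the series [synth] and [sqsum], whose partial sums
    thereby become sums over [idx n]. *)
Definition idx n : seq int := flatten [seq [:: i%:Z; - i%:Z] | i <- index_iota 1 n].

Lemma big_idx (V : nmodType) (F : int -> V) n :
  \sum_(k <- idx n) F k = \sum_(1 <= i < n) (F i%:Z + F (- i%:Z)).
Proof.
rewrite /idx big_flatten big_map /=; apply: eq_bigr => k _.
by rewrite big_cons big_seq1.
Qed.

Lemma mem_idx n k : (k \in idx n) = (k != 0) && (`|k| < n)%N.
Proof.
apply/flattenP/andP => [[s /mapP[j]]|[k0 kn]].
  by rewrite mem_index_iota => /andP[j1 jn] -> ; rewrite !inE => /orP[]/eqP->; split => //; lia.
exists [:: `|k|%N%:Z; - `|k|%N%:Z]; last by rewrite !inE; lia.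
by apply/mapP; exists `|k|%N => //; rewrite mem_index_iota; lia.
Qed.

Lemma idx_neq0 n k : k \in idx n -> k != 0.
Proof. by rewrite mem_idx => /andP[]. Qed.

Lemma idxS n : idx n.+1 = if n is 0 then [::] else idx n ++ [:: n%:Z; - n%:Z].
Proof.
case: n => // n; rewrite /idx /index_iota !subn1 !succnK.
have -> : iota 1 n.+1 = iota 1 n ++ [:: n.+1] by rewrite -{1}(addn1 n) iotaD.
by rewrite map_cat flatten_cat.
Qed.

Lemma uniq_idx n : uniq (idx n).
Proof.
elim: n => // n IH; rewrite idxS; case: n IH => // n IH.
rewrite cat_uniq IH andTb -all_predC; apply/andP; split.
  by apply/allP => k; rewrite !inE /= mem_idx; lia.
by rewrite !cons_uniq !inE andbT; apply/eqP; lia.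
Qed.

Lemma big_idxN (V : nmodType) (F : int -> V) n :
  \sum_(k <- idx n) F (- k) = \sum_(k <- idx n) F k.
Proof. by rewrite !big_idx; apply: eq_bigr => k _; rewrite opprK addrC. Qed.

Lemma sum_idx_delta n (F : int -> R) k :
  \sum_(j <- idx n) F j * (j == k)%:R = F k * (k \in idx n)%:R.
Proof.
have [kn|kn] := boolP (k \in idx n).
  rewrite (bigD1_seq k)//= ?uniq_idx// eqxx big1 ?addr0//.
  by move=> j /negbTE ->; rewrite mulr0.
rewrite mulr0 big_seq big1// => j jn; case: eqP => [E|]; last by rewrite mulr0.
by move: kn; rewrite -E jn.
Qed.

Definition S n a : T := \sum_(k <- idx n) tpC (a k) * e k.

Lemma SE n a x : S n a x = \sum_(1 <= i < n) (a i%:Z * trig i%:Z x + a (- i%:Z) * trig (- i%:Z) x).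
Proof. by rewrite /S tp_sum big_idx. Qed.

Lemma eq_S n a b : (forall k, k \in idx n -> a k = b k) -> S n a = S n b.
Proof. by move=> ab; apply: eq_big_seq => k kn; rewrite ab. Qed.

Lemma SD n a b : S n (fun k => a k + b k) = S n a + S n b.
Proof. by rewrite -big_split; apply: eq_bigr => k _; rewrite tpCD mulrDl. Qed.
Lemma SZ n c a : S n (fun k => c * a k) = tpC c * S n a.
Proof. by rewrite mulr_sumr; apply: eq_bigr => k _; rewrite tpCM mulrA. Qed.
Lemma SN n a : S n (fun k => - a k) = - S n a.
Proof. by rewrite -sumrN; apply: eq_bigr => k _; rewrite tpCN mulNr. Qed.
Lemma SB n a b : S n (fun k => a k - b k) = S n a - S n b.
Proof. by rewrite SD SN. Qed.

Definition dco a : int -> R := fun k => - wn k * a (- k).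

Lemma D_S n a : D (S n a) = S n (dco a).
Proof.
rewrite /S Dsum -[RHS]big_idxN; apply: eq_bigr => k _.
by rewrite DCM De /dco wnN !opprK mulrA -tpCM (mulrC (a k)).
Qed.

Lemma Dn2_S q n a : Dn (2 * q) (S n a) = S n (fun k => (-1) ^+ q * wn k ^+ (2 * q) * a k).
Proof.
elim: q => [|q IH].
  by rewrite muln0 Dn0; apply: eq_S => k _; rewrite !expr0 !mul1r.
have -> : (2 * q.+1)%N = (2 * q).+2 by lia.
rewrite !DnS IH !D_S; apply: eq_S => k _; rewrite /dco wnN !opprK.
by rewrite !exprS; ring.
Qed.

Lemma I_S n a : I (S n a) = 0.
Proof.
by rewrite Isum big_seq big1// => k /idx_neq0 k0; rewrite IZ I_e ?mulr0.
Qed.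

Lemma coef_S n a k : k != 0 -> I (S n a * e k) = a k * (k \in idx n)%:R.
Proof.
move=> k0; rewrite mulr_suml Isum -sum_idx_delta; apply: eq_big_seq => j /idx_neq0 j0.
by rewrite -mulrA IZ I_ee.
Qed.

Lemma I_Sl n a X : I (X * S n a) = \sum_(k <- idx n) a k * I (X * e k).
Proof. by rewrite mulr_sumr Isum; apply: eq_bigr => k _; rewrite mulrCA IZ. Qed.

Lemma Parseval n a b : I (S n a * S n b) = \sum_(k <- idx n) a k * b k.
Proof.
rewrite I_Sl; apply: eq_big_seq => k kn.
by rewrite coef_S ?(idx_neq0 kn)// kn mulr1 mulrC.
Qed.

Lemma Parseval_Dn q n a :
  I (Dn q (S n a) * Dn q (S n a)) = \sum_(k <- idx n) wn k ^+ (2 * q) * a k ^+ 2.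
Proof.
rewrite I_partsn -Dn_add addnn -mul2n Dn2_S Parseval mulr_sumr; apply: eq_bigr => k _.
have -> : (-1) ^+ q * (a k * ((-1) ^+ q * wn k ^+ (2 * q) * a k)) =
  ((-1) ^+ q * (-1) ^+ q) * (wn k ^+ (2 * q) * a k ^+ 2) by ring.
by rewrite -exprD addnn -mul2n exprM sqrrN expr1n expr1n mul1r.
Qed.

Lemma sum_CS n a b :
  (\sum_(k <- idx n) a k * b k) ^+ 2 <=
  (\sum_(k <- idx n) a k ^+ 2) * (\sum_(k <- idx n) b k ^+ 2).
Proof. by have := I_CS (S n a) (S n b); rewrite !Parseval. Qed.

Definition coe X : int -> R := fun k => I (X * e k).
(** [P n] and [Pi n] are the orthogonal projections of $L^2$ onto the trigonometric polynomials of
    degree less than [n], with and without the condition of zero mean; [Q n] is complementary to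
    [Pi n]. *)
Definition P n X : T := S n (coe X).
Definition Pi n X : T := tpC (I X) + P n X.
Definition Q n X : T := X - Pi n X.

Lemma PD n X Y : P n (X + Y) = P n X + P n Y.
Proof. by rewrite -SD; apply: eq_S => k _; rewrite /coe mulrDl ID. Qed.
Lemma PZ n c X : P n (tpC c * X) = tpC c * P n X.
Proof. by rewrite -SZ; apply: eq_S => k _; rewrite /coe -mulrA IZ. Qed.
Lemma P_D n X : P n (D X) = D (P n X).
Proof.
rewrite /P D_S; apply: eq_S => k _; rewrite /dco /coe I_parts De.
by rewrite mulrCA IZ mulNr.
Qed.
Lemma P_S n a : P n (S n a) = S n a.
Proof.
by apply: eq_S => k kn; rewrite /coe coef_S ?(idx_neq0 kn)// kn mulr1.
Qed.
Lemma QD n X Y : Q n (X + Y) = Q n X + Q n Y.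
Proof. by rewrite /Q /Pi PD ID tpCD; ring. Qed.
Lemma QZ n c X : Q n (tpC c * X) = tpC c * Q n X.
Proof. by rewrite /Q /Pi PZ IZ tpCM; ring. Qed.
Lemma QN n X : Q n (- X) = - Q n X.
Proof. by rewrite -mulN1r -tpC1 -tpCN QZ tpCN tpC1 mulN1r. Qed.
Lemma QB n X Y : Q n (X - Y) = Q n X - Q n Y.
Proof. by rewrite QD QN. Qed.
Lemma Q_D n X : Q n (D X) = D (Q n X).
Proof. by rewrite /Q /Pi P_D I_D DB DD DC tpC0. Qed.
Lemma Q_Dn n q X : Q n (Dn q X) = Dn q (Q n X).
Proof. by elim: q => // q IH; rewrite !DnS Q_D IH. Qed.

Lemma I_Q n X : I (Q n X) = 0.
Proof. by rewrite IB ID IC I_S addr0 subrr. Qed.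

Lemma Q_S n X a : I (Q n X * S n a) = 0.
Proof.
rewrite I_Sl big_seq big1// => k kn; have k0 := idx_neq0 kn.
rewrite mulrBl mulrDl IB ID IZ I_e// mulr0 add0r coef_S// kn mulr1 subrr mulr0 //.
Qed.

Lemma Q_orth n X Y : I (Q n X * Pi n Y) = 0.
Proof. by rewrite mulrDr ID (mulrC _ (tpC _)) IZ I_Q mulr0 add0r Q_S. Qed.

Lemma I_QQ n X Y : I (Q n X * Y) = I (Q n X * Q n Y).
Proof. by rewrite [in RHS]/Q mulrBr IB Q_orth subr0. Qed.

Lemma Q_le n X : I (Q n X * Q n X) <= I (X * X).
Proof.
have -> : X * X = Q n X * Q n X + tpC 2 * (Q n X * Pi n X) + Pi n X * Pi n X.
  by rewrite -[X in LHS](subrK (Pi n X)) -/(Q n X) tpCn; ring.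
by rewrite !ID IZ Q_orth mulr0 addr0 lerDl I_sqr_ge0.
Qed.

Lemma deg_Pi n X : trig_deg n X -> X = Pi n X.
Proof.
move=> nX; have [f fX] : exists f, tpfun X = f by exists X.
move: nX; rewrite fX => nf; elim: nf X fX => [|k kn|k kn|c {}f g hf IHf hg IHg] X fX.
- have -> : X = 0 by apply: tp_eq => x; rewrite fX.
  by rewrite /Pi /P I0 tpC0 add0r /S big1// => k _; rewrite /coe mul0r I0 tpC0 mul0r.
- have [k0|k0] := posnP k.
    have -> : X = tpC 1 by apply: tp_eq => x; rewrite fX k0 /wav mulr0 mul0r cos0.
    rewrite /Pi IC /P /S big_seq big1 ?addr0// => j /idx_neq0 j0.
    by rewrite /coe tpC1 mul1r I_e// tpC0 mul0r.
  have -> : X = S n (fun j => (Num.sqrt 2)^-1 * (j == k%:Z)%:R).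
    apply: tp_eq => x; rewrite fX /S tp_sum.
    under eq_bigr => j _ do rewrite tp_mul /= mulrAC.
    rewrite sum_idx_delta mem_idx absz_nat kn andbT (_ : _ != _)//; last by lia.
    by rewrite mulr1 trig_nat// mulrA mulVf ?mul1r// gt_eqF// sqrtr_gt0.
  by rewrite /Pi I_S tpC0 add0r P_S.
- have [k0|k0] := posnP k.
    have -> : X = tpC 0 by apply: tp_eq => x; rewrite fX k0 /wav mulr0 mul0r sin0.
    rewrite /Pi IC /P /S big_seq big1 ?addr0// => j /idx_neq0 j0.
    by rewrite /coe tpC0 mul0r I0 tpC0 mul0r.
  have -> : X = S n (fun j => - (Num.sqrt 2)^-1 * (j == - k%:Z)%:R).
    apply: tp_eq => x; rewrite fX /S tp_sum.
    under eq_bigr => j _ do rewrite tp_mul /= mulrAC.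
    rewrite sum_idx_delta mem_idx abszN absz_nat kn andbT (_ : _ != _)//; last by lia.
    rewrite mulr1 trig_Nnat mulrA mulNr mulrN opprK mulVf ?mul1r// gt_eqF// sqrtr_gt0 //.
  by rewrite /Pi I_S tpC0 add0r P_S.
- have fT : f \in @tp_pred R by apply/asboolP; exists n.
  have gT : g \in @tp_pred R by apply/asboolP; exists n.
  have -> : X = tpC c * TPoly fT + TPoly gT by apply: tp_eq => x; rewrite fX.
  rewrite {1}(IHf (TPoly fT))// {1}(IHg (TPoly gT))// /Pi PD PZ ID IZ tpCD tpCM; ring.
Qed.

Lemma Q_deg n X : trig_deg n X -> Q n X = 0.
Proof. by move=> nX; rewrite /Q -deg_Pi// subrr. Qed.

Lemma deg_S n a : trig_deg n (S n a).
Proof.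
rewrite /S big_seq; elim/big_ind: _ => [|X Y|k].
- exact: trig_deg0.
- exact: trig_degD.
- rewrite mem_idx => /andP[_ kn]; apply: trig_degZ.
  by apply: trig_degS (trig_deg_trig k).
Qed.

Lemma deg_D n X : trig_deg n X -> trig_deg n (D X).
Proof. by move=> /trig_deg_derive[_]; rewrite DE. Qed.
Lemma deg_Dn n q X : trig_deg n X -> trig_deg n (Dn q X).
Proof. by move=> nX; elim: q => // q; exact: deg_D. Qed.

Lemma mean0_S X : I X = 0 -> exists n, X = S n (coe X).
Proof.
move=> IX; have [n nX] := tpP X; exists n.
by rewrite {1}(deg_Pi nX) /Pi IX tpC0 add0r.
Qed.

Lemma sum_invsqr n : \sum_(1 <= i < n) (i%:R ^+ 2)^-1 <= 2 :> R.
Proof.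
suff h m : (\sum_(1 <= i < m.+2) (i%:R ^+ 2)^-1 <= 2 - m.+1%:R^-1 :> R).
  case: n => [|[|n]]; try by rewrite big_geq.
  by apply: le_trans (h n) _; rewrite gerBl invr_ge0.
elim: m => [|m IH]; first by rewrite big_nat1 expr1n !invr1; lra.
rewrite big_nat_recr//=; apply: le_trans (lerD IH (lexx _)) _.
rewrite -subr_ge0.
have -> : 2 - m.+2%:R^-1 - (2 - m.+1%:R^-1 + (m.+2%:R ^+ 2)^-1) =
  (m.+1%:R * m.+2%:R ^+ 2)^-1 :> R.
  rewrite -(natr1 m.+1); field.
  by rewrite !(addrC 1) !natr1 !pnatr_eq0.
by rewrite invr_ge0 mulr_ge0// exprn_ge0.
Qed.

(** With $\pi\ge2$ a pair of modes contributes at most $1/(8i^2)$, and $\sum i^{-2}\le2$. The crude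
    constant is enough: the sup bound below asks for 1/2, the sum of the dilations of the
    perturbation for 1. *)
Lemma sum_wn n : \sum_(k <- idx n) (wn k ^+ 2)^-1 <= 4^-1.
Proof.
rewrite big_idx.
have h (i : nat) : (wn i%:Z ^+ 2)^-1 + (wn (- i%:Z) ^+ 2)^-1 <= 8^-1 * (i%:R ^+ 2)^-1.
  rewrite wnN sqrrN /wn -pmulrn !exprMn.
  have p4 : (pi ^+ 2)^-1 <= 4^-1 :> R.
    rewrite lef_pV2 ?posrE ?exprn_gt0 ?pi_gt0//.
    by have := pi_ge2 R; nra.
  have E (u v w : R) : (u * v * w)^-1 = u^-1 * v^-1 * w^-1 by rewrite !invfM.
  have k0 : 0 <= (i%:R ^+ 2 : R)^-1 by rewrite invr_ge0 sqr_ge0.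
  rewrite !E (_ : (2 ^+ 2)^-1 = 4^-1 :> R); last by congr (_ ^-1); lra.
  by move: ((pi ^+ 2)^-1) ((i%:R ^+ 2)^-1) p4 k0 => u v; nra.
apply: le_trans; first by apply: ler_sum => i _; exact: h.
rewrite -mulr_sumr.
by have := sum_invsqr n; lra.
Qed.

(** Cauchy-Schwarz for $\sum_k\omega_k^{-1}e_k(x)\cdot\omega_ka_k$, with $\omega_k$ standing for
    [wn k]: since $e_k(x)^2\le2$, the first factor has square sum at most $2\cdot\frac14$. *)
Lemma sup_bound X x : I X = 0 -> X x ^+ 2 <= I (D X * D X).
Proof.
move=> /mean0_S[n ->]; set a := coe X.
have := Parseval_Dn 1 n a; rewrite DnS Dn0 => ->.
have -> : S n a x = \sum_(k <- idx n) (wn k)^-1 * trig k x * (wn k * a k).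
  rewrite /S tp_sum; apply: eq_big_seq => k /idx_neq0 k0.
  by rewrite tp_mul eE /= -wn_eq0 in k0 *; field.
apply: le_trans (sum_CS _ _ _) _.
have -> : \sum_(k <- idx n) (wn k * a k) ^+ 2 = \sum_(k <- idx n) wn k ^+ (2 * 1) * a k ^+ 2.
  by apply: eq_bigr => k _; rewrite exprMn.
rewrite ler_piMl//.
  by apply: sumr_ge0 => k _; rewrite mulr_ge0 ?sqr_ge0.
have : 2 * \sum_(k <- idx n) (wn k ^+ 2)^-1 <= 1 by have := sum_wn n; lra.
apply: le_trans; rewrite mulr_sumr; apply: ler_sum => k _.
rewrite exprMn exprVn mulrC ler_wpM2r ?invr_ge0 ?sqr_ge0//.
rewrite /trig; case: ifP => _; rewrite exprMn sqr_sqrtr// ler_piMr//.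
  Qed.

Lemma Poincare X : I X = 0 -> I (X * X) <= I (D X * D X).
Proof.
move=> X0; rewrite -[leRHS]IC; apply: le_I => x _.
by rewrite tp_mul -expr2; exact: sup_bound.
Qed.

End trig_basis.

(** * Conservation laws of KdV *)

Section conservation.
Variable R : realType.
Implicit Types (F X Y : tpoly R) (s : R) (k n i : nat).
Local Notation T := (tpoly R).

Lemma chi_tp F k : (0 < k)%N -> chi F k \in @tp_pred R.
Proof.
elim/ltn_ind: k => -[//|[_ _|k IH _]].
  by rewrite chi1; exact: (valP F).
pose Y i : T := insubd 0 (chi F i).
have YE i : (0 < i <= k.+1)%N -> chi F i = Y i.
  by move=> /andP[i0 ik]; rewrite /Y (insubdK _ (IH i ik i0)).
rewrite chiS// (_ : (fun x => _) =
    tpfun (- D (Y k.+1) - \sum_(1 <= i < k.+1) Y i * Y (k.+1 - i)%N)).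
  exact: valP.
apply/funext => x; rewrite tp_add !tp_opp DE -YE ?ltnS ?leqnn// tp_sum; congr (_ - _).
by apply: eq_big_nat => i /andP[i1 ik]; rewrite tp_mul !YE//; lia.
Qed.

(** By [chi_tp] the default value 0 of [insubd] is not reached when [0 < k]. *)
Definition chiT F k : T := insubd 0 (chi F k).

Lemma chiTE F k : (0 < k)%N -> tpfun (chiT F k) = chi F k.
Proof. by move=> k0; rewrite (insubdK _ (chi_tp F k0)). Qed.

Lemma chiT1 F : chiT F 1 = F.
Proof. by apply: tp_eq => x; rewrite chiTE. Qed.

Lemma chiTS F k : (0 < k)%N -> chiT F k.+1 =
  - D (chiT F k) - \sum_(1 <= i < k) chiT F i * chiT F (k - i).
Proof.
move=> k0; apply: tp_eq => x; rewrite chiTE// chiS// tp_add !tp_opp DE chiTE//.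
congr (_ - _); rewrite tp_sum; apply: eq_big_nat => i /andP[i1 ik].
by rewrite tp_mul !chiTE// subn_gt0.
Qed.

(* Lax-pair form of KdV: the generating series of the [chi_k] satisfies a
   Riccati equation, whose evolution is the [x]-derivative of this flux. *)
Definition chi_flux F k : T := D (2 * F * chiT F k - chiT F k.+2).

Definition kdvW F : T := - Dn 3 F + 6 * (F * D F).

Lemma D_nat n X : D (n%:R * X) = n%:R * D X.
Proof. by rewrite -tpCn DCM. Qed.

Lemma chi_flux1 F : chi_flux F 1 = kdvW F.
Proof.
have c2 : chiT F 2 = - D F by rewrite chiTS// big_geq// subr0 chiT1.
have c3 : chiT F 3 = D (D F) - F * F by rewrite chiTS// big_nat1 c2 chiT1 DN opprK.
by rewrite /chi_flux /kdvW c3 chiT1 -mulrA DB D_nat DB !DM /Dn /=; ring.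
Qed.

(** This is the linearisation of the recursion [chiTS], so that with [chi_flux1] it identifies
    [chi_flux F k] with the derivative of $\chi_k$ along the KdV field. The proof differentiates the
    recursion for $\chi_{k+3}$, splits off the terms in which $\chi_1$ and $\chi_2$ occur, and uses
    the symmetry $i\mapsto k-i$ to write each quadratic sum as twice a one-sided sum. *)
Lemma chi_fluxS F k : (0 < k)%N -> chi_flux F k.+1 = - D (chi_flux F k)
  - \sum_(1 <= i < k) (chi_flux F i * chiT F (k - i) + chiT F i * chi_flux F (k - i)).
Proof.
move=> k0; set c := chiT F.
have rev (f : nat -> T) n : \sum_(1 <= i < n) f (n - i)%N = \sum_(1 <= i < n) f i.
  by rewrite [RHS]big_nat_rev /=; apply: eq_big_nat => i _; congr (f _); lia.
set S1 := \sum_(1 <= i < k) c i * c (k - i)%N.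
set S2 := \sum_(1 <= i < k) c (k - i)%N * D (c i).
set S3 := \sum_(1 <= i < k) c (k - i)%N * D (c i.+2).
have c1 : c k.+1 = - D (c k) - S1 by rewrite /c chiTS.
have DS1 : D S1 = 2 * S2.
  rewrite /S1 Dsum; under eq_bigr do rewrite DM.
  rewrite big_split /= (_ : 2 * S2 = S2 + S2); last by ring.
  congr (_ + _); first by apply: eq_bigr => i _; rewrite mulrC.
  rewrite -(rev (fun i => c i * D (c (k - i)%N))); apply: eq_big_nat => i h.
  by congr (_ * D (c _)); lia.
have sum2 : \sum_(1 <= i < k)
    (chi_flux F i * c (k - i)%N + c i * chi_flux F (k - i)) =
    2 * (2 * (D F * S1) + 2 * (F * S2) - S3).
  rewrite big_split /= -(rev (fun i => c i * _)) -big_split /=.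
  rewrite (_ : D F * S1 = \sum_(1 <= i < k) D F * (c i * c (k - i)%N)); last by rewrite mulr_sumr.
  rewrite (_ : F * S2 = \sum_(1 <= i < k) F * (c (k - i)%N * D (c i))); last by rewrite mulr_sumr.
  rewrite !mulr_sumr -!big_split /= -sumrB mulr_sumr; apply: eq_big_nat => i h.
  have -> : (k - (k - i) = i)%N by lia.
  by rewrite /chi_flux -/c -!mulrA DB D_nat DM; ring.
have c3 : c k.+3 = - D (c k.+2) - \sum_(1 <= i < k.+2) c i * c (k.+2 - i)%N.
  by rewrite /c chiTS.
have Dsum3 : D (\sum_(1 <= i < k.+2) c i * c (k.+2 - i)%N) =
    2 * (c k.+1 * D F + c k * D (c 2) + S3).
  rewrite Dsum; under eq_bigr do rewrite DM.
  rewrite big_split /= -[X in _ + X](rev (fun i => c i * D (c (k.+2 - i)%N))).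
  rewrite -big_split /= big_nat_recl//= big_nat_recl//= mulrDr mulrDr addrA.
  congr (_ + _ + _).
  - rewrite /c chiT1 subn1 /= (_ : (k.+2 - k.+1 = 1)%N); last by lia.
    by rewrite chiT1; ring.
  - rewrite (_ : (k.+2 - 2 = k)%N); last by lia.
    rewrite (_ : (k.+2 - k = 2)%N); last by lia.
    by ring.
  - rewrite /S3 mulr_sumr; apply: eq_big_nat => i h.
    rewrite (_ : (k.+2 - i.+2 = k - i)%N); last by lia.
    rewrite (_ : (k.+2 - (k - i) = i.+2)%N); last by lia.
    by ring.
have c2 : c 2 = - D F by rewrite /c chiTS// big_geq// subr0 chiT1.
have fl n : chi_flux F n = 2 * D (F * c n) - D (c n.+2).
  by rewrite /chi_flux -mulrA DB D_nat.
have Dfl : D (chi_flux F k) = 2 * D (D (F * c k)) - D (D (c k.+2)).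
  by rewrite fl DB D_nat.
rewrite sum2 Dfl fl c3 DB DN Dsum3 c2.
have hS2 : 2 * S2 = - D (c k.+1) - D (D (c k)) by rewrite -DS1 c1 !DB !DN; ring.
have hS1 : S1 = - D (c k) - c k.+1 by rewrite c1; ring.
rewrite (_ : 2 * (2 * (D F * S1) + 2 * (F * S2) - S3) =
  2 * (2 * (D F * S1) + F * (2 * S2) - S3)); last by ring.
by rewrite hS2 hS1 !DM !DN !DD !DM; ring.
Qed.

Lemma map_poly_D (p : {poly T}) s : (map_poly (@D R) p).[tpC s] = D p.[tpC s].
Proof.
rewrite [in RHS]horner_coef Dsum (@horner_coef_wide _ (size p)).
  apply: eq_bigr => i _; rewrite coef_map_id0 ?D0// DM.
  suff -> : D (tpC s ^+ i) = 0 by rewrite mulr0 addr0.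
  elim: (nat_of_ord i) => [|j IH]; first by rewrite expr0 D1.
  by rewrite exprS DM DC IH mul0r mulr0 addr0.
exact: size_poly.
Qed.

(** Along a line, $\chi_k(F+sW)$ is a polynomial in $s$ with coefficients in the ring of
    trigonometric polynomials. Its derivative at 0 is then a coefficient, and the linearised
    recursion becomes an identity between coefficients. *)
Lemma chi_poly F k : (0 < k)%N -> exists p : {poly T},
  [/\ forall s, chiT (F + tpC s * kdvW F) k = p.[tpC s],
      p`_0 = chiT F k & p`_1 = chi_flux F k].
Proof.
elim/ltn_ind: k => -[//|[_ _|k IH _]].
  exists (F%:P + kdvW F *: 'X); split=> [s||].
  - by rewrite chiT1 hornerD hornerC hornerZ hornerX mulrC.
  - by rewrite coefD coefC coefZ coefX mulr0 addr0 chiT1.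
  - by rewrite coefD coefC coefZ coefX mulr1 add0r chi_flux1.
have H i : exists p : {poly T}, (0 < i <= k.+1)%N ->
  [/\ forall s, chiT (F + tpC s * kdvW F) i = p.[tpC s],
      p`_0 = chiT F i & p`_1 = chi_flux F i].
  have [/andP[i0 ik]|] := boolP (0 < i <= k.+1)%N; last by exists 0.
  by have [p hp] := IH i ik i0; exists p.
have [pp hpp] := choice H.
exists (- map_poly (@D R) (pp k.+1) - \sum_(1 <= i < k.+1) pp i * pp (k.+1 - i)%N).
have [h1 h2 h3] := hpp k.+1 (ltac:(lia)).
split=> [s||].
- rewrite hornerD !hornerN map_poly_D -h1 horner_sum (@chiTS _ k.+1)//; congr (_ - _).
  apply: eq_big_nat => i h; rewrite hornerM.
  have [<- _ _] := hpp i (ltac:(lia)).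
  by have [<- _ _] := hpp (k.+1 - i)%N (ltac:(lia)).
- rewrite coefB coefN coef_map_id0 ?D0// h2 (@chiTS _ k.+1)// coef_sum; congr (_ - _).
  apply: eq_big_nat => i h; rewrite coefM big_ord1 subn0.
  have [_ -> _] := hpp i (ltac:(lia)).
  by have [_ -> _] := hpp (k.+1 - i)%N (ltac:(lia)).
- rewrite coefB coefN coef_map_id0 ?D0// h3 (@chi_fluxS _ k.+1)// coef_sum; congr (_ - _).
  apply: eq_big_nat => i h; rewrite coefM !big_ord_recl big_ord0 addr0 /= subn0 subnn.
  have [_ -> ->] := hpp i (ltac:(lia)).
  have [_ -> ->] := hpp (k.+1 - i)%N (ltac:(lia)).
  by rewrite addrC.
Qed.

(** The linear coefficient of the density is the flux, a derivative in [x], so it integrates to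
    zero: conservation to first order, without any flow. *)
Lemma conserved_poly n F : exists2 q : {poly R},
  forall s, conserved n (F + tpC s * kdvW F) = q.[s] & q`_1 = 0.
Proof.
have [p [h1 h2 h3]] := @chi_poly F (2 * n + 3)%N (ltac:(lia)).
exists (((-1) ^+ n.+1 / 2) *: map_poly (@I R) p) => [s|]; last first.
  by rewrite coefZ coef_map_id0 ?I0// h3 I_D mulr0.
rewrite /conserved hornerZ; congr (_ * _).
rewrite -chiTE; last by lia.
rewrite -IE h1 horner_coef Isum (@horner_coef_wide _ (size p)).
  apply: eq_bigr => i _; rewrite coef_map_id0 ?I0// mulrC.
  suff -> : tpC s ^+ i = tpC (s ^+ i) by rewrite IZ mulrC.
  elim: (nat_of_ord i) => [|j IH]; first by rewrite !expr0 tpC1.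
  by rewrite !exprS tpCM IH.
exact: size_poly.
Qed.

End conservation.

(** * The L^2 norm and Sobolev inequalities *)

Section trig_norms.
Variable R : realType.
Implicit Types (X Y Z : tpoly R) (c x y : R) (a b : int -> R) (n m i j q : nat).
Local Notation T := (tpoly R).

Definition n2 X : R := Num.sqrt (I (X * X)).

Lemma n2_ge0 X : 0 <= n2 X. Proof. exact: sqrtr_ge0. Qed.
Lemma sqr_n2 X : n2 X ^+ 2 = I (X * X).
Proof. by rewrite sqr_sqrtr ?I_sqr_ge0. Qed.
Lemma n2_0 : n2 0 = 0. Proof. by rewrite /n2 mulr0 I0 sqrtr0. Qed.

Lemma le_n2 X M : 0 <= M -> I (X * X) <= M ^+ 2 -> n2 X <= M.
Proof. by move=> M0 XM; rewrite -(ler_sqr (n2_ge0 X) M0) sqr_n2. Qed.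

Lemma n2_CS X Y : `|I (X * Y)| <= n2 X * n2 Y.
Proof.
rewrite -ler_sqr ?nnegrE ?mulr_ge0 ?n2_ge0// exprMn !sqr_n2 real_normK ?num_real//.
exact: I_CS.
Qed.

Lemma n2D X Y : n2 (X + Y) <= n2 X + n2 Y.
Proof.
apply: le_n2; first by rewrite addr_ge0 ?n2_ge0.
rewrite (_ : _ * _ = X * X + tpC 2 * (X * Y) + Y * Y); last by rewrite tpCn; ring.
rewrite !ID IZ sqrrD !sqr_n2 lerD2r lerD2l.
by have := n2_CS X Y; have := ler_norm (I (X * Y)); lra.
Qed.

Lemma n2N X : n2 (- X) = n2 X. Proof. by rewrite /n2 mulrNN. Qed.
Lemma n2B X Y : n2 (X - Y) <= n2 X + n2 Y.
Proof. by rewrite -(n2N Y) n2D. Qed.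
Lemma n2_distC X Y : n2 (X - Y) = n2 (Y - X).
Proof. by rewrite -n2N opprB. Qed.
Lemma n2Z c X : n2 (tpC c * X) = `|c| * n2 X.
Proof. by rewrite /n2 mulrACA -tpCM IZ sqrtrM -?expr2 ?sqr_ge0// sqrtr_sqr. Qed.
Lemma n2_sum (J : Type) (r : seq J) (F : J -> T) :
  n2 (\sum_(j <- r) F j) <= \sum_(j <- r) n2 (F j).
Proof.
elim: r => [|j r IH]; first by rewrite !big_nil n2_0.
by rewrite !big_cons; apply: le_trans (n2D _ _) _; rewrite lerD2l.
Qed.

Lemma n2M M X Y : (forall x, 0 <= x <= 1 -> `|X x| <= M) -> n2 (X * Y) <= M * n2 Y.
Proof.
move=> XM; have M0 : 0 <= M by apply: le_trans (XM 0 _) => //; rewrite lexx ler01.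
apply: le_n2; first by rewrite mulr_ge0 ?n2_ge0.
rewrite exprMn sqr_n2 -IZ; apply: le_I => x /XM xM.
rewrite !tp_mul mulrACA ler_wpM2r -?expr2 ?sqr_ge0//=.
by rewrite -[X in X <= _]real_normK ?num_real// ler_sqr ?nnegrE.
Qed.

Lemma I_le_n2 X : `|I X| <= n2 X.
Proof.
rewrite -ler_sqr ?nnegrE ?n2_ge0// sqr_n2 real_normK ?num_real//.
exact: I_sqr_le.
Qed.

Lemma I_norm_le X M : (forall x, 0 <= x <= 1 -> `|X x| <= M) -> `|I X| <= M.
Proof.
move=> XM; rewrite ler_norml -[X in - X <= _]IC -IN -[X in _ && (_ <= X)]IC.
apply/andP; split; apply: le_I => x /XM; rewrite ?tp_opp /= ler_norml => /andP[]//.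
Qed.

Lemma sup_n2 X x : I X = 0 -> `|X x| <= n2 (D X).
Proof.
move=> X0; rewrite -ler_sqr ?nnegrE ?n2_ge0// sqr_n2 real_normK ?num_real//.
exact: sup_bound.
Qed.

Lemma Poincare_n2 X : I X = 0 -> n2 X <= n2 (D X).
Proof. by move=> X0; apply: le_n2; rewrite ?n2_ge0// sqr_n2 Poincare. Qed.

Lemma n2_Q m X : n2 (Q m X) <= n2 X.
Proof. by apply: le_n2; rewrite ?n2_ge0// sqr_n2 Q_le. Qed.

Lemma I_Dn q X : I X = 0 -> I (Dn q X) = 0.
Proof. by case: q => // q _; rewrite DnS I_D. Qed.

Lemma le_n2Dn i j X : I X = 0 -> (i <= j)%N -> n2 (Dn i X) <= n2 (Dn j X).
Proof.
move=> X0 /subnK <-; elim: (j - i)%N => // q IH.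
by apply: le_trans IH _; rewrite addSn DnS; exact/Poincare_n2/I_Dn.
Qed.

(** One extra derivative pays for the sup norm, and the inequality of Poincare for all further ones;
    the constant is 1 at every order. *)
Lemma sup_Dn i j X x : I X = 0 -> (i < j)%N -> `|Dn i X x| <= n2 (Dn j X).
Proof.
move=> X0 ij; apply: le_trans (sup_n2 _ (I_Dn i X0)) _.
by rewrite -DnS le_n2Dn.
Qed.

End trig_norms.

Lemma sum_mul_CS (R : realType) (J : Type) (s : seq J) (f g : J -> R) :
  (\sum_(j <- s) f j * g j) ^+ 2 <= (\sum_(j <- s) f j ^+ 2) * \sum_(j <- s) g j ^+ 2.
Proof.
elim: s => [|j s IH]; first by rewrite !big_nil mulr0 expr0n.
rewrite !big_cons; set x := \sum_(_ <- _) _ * _ in IH *.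
set y := \sum_(_ <- _) f _ ^+ 2 in IH *; set z := \sum_(_ <- _) g _ ^+ 2 in IH *.
have y0 : 0 <= y by apply: sumr_ge0 => k _; exact: sqr_ge0.
have z0 : 0 <= z by apply: sumr_ge0 => k _; exact: sqr_ge0.
move: (f j) (g j) => a b.
suff : 2 * (a * b * x) <= a ^+ 2 * z + y * b ^+ 2.
  rewrite sqrrD exprMn mulrDl !mulrDr mulr2n; lra.
apply: le_trans (ler_norm _) _.
have r0 : 0 <= a ^+ 2 * z + y * b ^+ 2 by apply: addr_ge0; apply: mulr_ge0 => //; exact: sqr_ge0.
rewrite -(ger0_norm r0) -ler_sqr ?nnegrE// !real_normK ?num_real//.
have h1 := sqr_ge0 (a ^+ 2 * z - y * b ^+ 2).
have h2 : (a * b) ^+ 2 * x ^+ 2 <= (a * b) ^+ 2 * (y * z).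
  by rewrite ler_wpM2l ?sqr_ge0.
rewrite -subr_ge0.
have -> : (a ^+ 2 * z + y * b ^+ 2) ^+ 2 - (2 * (a * b * x)) ^+ 2 =
  (a ^+ 2 * z - y * b ^+ 2) ^+ 2 + 4 * ((a * b) ^+ 2 * (y * z) - (a * b) ^+ 2 * x ^+ 2) by ring.
by rewrite addr_ge0// mulr_ge0// subr_ge0.
Qed.

(** * Energy estimates and the conserved functional *)

Section polynomial_functions.
Variables (R : realType) (p : nat).
Local Notation V := ('I_p -> R).
Implicit Types (K L : V -> R) (v w : V) (d : 'I_p -> V -> R).

Let l1 w : R := \sum_i `|w i|.
Let lin d v w : R := \sum_i d i v * w i.

Definition tpstable K :=
  forall h : 'I_p -> tpoly R, (fun x => K (fun i => h i x)) \in @tp_pred R.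

Definition taylor1 K d := forall r : R, exists2 C : R, 0 <= C &
  forall v w, (forall i, `|v i| <= r) -> (forall i, `|w i| <= r) ->
  [/\ `|K v| <= C, forall i, `|d i v| <= C &
   `|K (v \+ w) - K v - \sum_i d i v * w i| <= C * (\sum_i `|w i|) ^+ 2].

(** Collects what is needed of a polynomial in the jet of [u]: substitution of trigonometric
    polynomials stays in the ring, and the first order Taylor remainder is quadratic, uniformly on
    bounded sets. The class contains constants and projections and is stable under sums and
    products, so partial derivatives of multivariate polynomials never have to be written down. *)
Definition polyfun K :=
  exists d, [/\ tpstable K, forall i, tpstable (d i) & taylor1 K d].

Let l1_ge0 w : 0 <= l1 w. Proof. exact: sumr_ge0. Qed.

Let linP d v w (C : R) : (forall i, `|d i v| <= C) -> `|lin d v w| <= C * l1 w.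
Proof.
move=> dC; apply: le_trans (ler_norm_sum _ _ _) _; rewrite mulr_sumr.
by apply: ler_sum => i _; rewrite normrM ler_wpM2r.
Qed.

Lemma tpstable_cst (c : R) : tpstable (fun=> c).
Proof. by move=> h; exact: tp_cst_subproof. Qed.

Lemma tpstableD K L : tpstable K -> tpstable L -> tpstable (fun v => K v + L v).
Proof. by move=> k l h; exact: (rpredD (k h) (l h)). Qed.

Lemma tpstableM K L : tpstable K -> tpstable L -> tpstable (fun v => K v * L v).
Proof. by move=> k l h; exact: (@rpredM _ (@tp_pred R) _ _ (k h) (l h)). Qed.

Lemma polyfun_cst (c : R) : polyfun (fun=> c).
Proof.
exists (fun _ _ => 0); split=> [|i|r]; try exact: tpstable_cst.
exists `|c| => // v w _ _; split=> // [i|].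
  by rewrite normr0.
rewrite subrr sub0r big1; last by move=> i _; rewrite mul0r.
by rewrite normrN normr0; apply: mulr_ge0 => //; exact: sqr_ge0.
Qed.

Lemma polyfun_proj (i : 'I_p) : polyfun (fun v => v i).
Proof.
exists (fun j _ => (i == j)%:R); split=> [h|j|r]; [exact: valP|exact: tpstable_cst|].
exists (`|r| + 1); first by rewrite addr_ge0.
move=> v w vr wr; split.
- by apply: le_trans (vr i) _; have := ler_norm r; lra.
- by move=> j; case: eqP; rewrite ?normr1 ?normr0; have := normr_ge0 r; lra.
- rewrite (bigD1 i)//= eqxx mul1r big1 ?addr0; last first.
    by move=> j /negbTE ji; rewrite eq_sym ji mul0r.
  rewrite (_ : v i + w i - v i - w i = 0); last by ring.
  by rewrite normr0; apply: mulr_ge0; rewrite ?sqr_ge0// addr_ge0.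
Qed.

Lemma polyfunD K L : polyfun K -> polyfun L -> polyfun (fun v => K v + L v).
Proof.
move=> [d [tK td hd]] [e [tL te he]]; exists (fun i v => d i v + e i v).
split=> [|i|r]; [exact: tpstableD|exact: tpstableD|].
have [C C0 h1] := hd r; have [E E0 h2] := he r; exists (C + E); first exact: addr_ge0.
move=> v w vr wr; have [a1 b1 c1] := h1 v w vr wr; have [a2 b2 c2] := h2 v w vr wr.
split=> [|i|].
- by apply: le_trans (ler_normD _ _) _; rewrite lerD.
- by apply: le_trans (ler_normD _ _) _; rewrite lerD.
- have -> : \sum_i (d i v + e i v) * w i = lin d v w + lin e v w.
    by rewrite -big_split; apply: eq_bigr => i _; rewrite mulrDl.
  set t := (X in `|X|).
  have -> : t = (K (v \+ w) - K v - lin d v w) + (L (v \+ w) - L v - lin e v w).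
    by rewrite /t; ring.
  by apply: le_trans (ler_normD _ _) _; rewrite mulrDl lerD.
Qed.

Lemma polyfunM K L : polyfun K -> polyfun L -> polyfun (fun v => K v * L v).
Proof.
move=> [d [tK td hd]] [e [tL te he]]; exists (fun i v => d i v * L v + K v * e i v).
split=> [|i|r]; [exact: tpstableM|by apply: tpstableD; exact: tpstableM|].
have [C C0 h1] := hd r; have [E E0 h2] := he r.
have CE0 : 0 <= C * E by rewrite mulr_ge0.
have pr0 : 0 <= p%:R * `|r| by rewrite mulr_ge0.
have B0 : 0 <= C * E * ((p%:R * `|r| + 1) ^+ 2 + 2).
  by rewrite mulr_ge0 // addr_ge0 // sqr_ge0.
have B1 : C * E * 2 <= C * E * ((p%:R * `|r| + 1) ^+ 2 + 2).
  by rewrite ler_wpM2l// lerDr sqr_ge0.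
(* With $W=\sum_i|w_i|$ the two expansions multiply out to exactly $CE((W+1)^2+2)W^2$, and $W\le
   p|r|$. *)
exists (C * E * ((p%:R * `|r| + 1) ^+ 2 + 2)) => //.
move=> v w vr wr; have [a1 b1 c1] := h1 v w vr wr; have [a2 b2 c2] := h2 v w vr wr.
have nn (x y a b : R) : `|x| <= a -> `|y| <= b -> `|x * y| <= a * b.
  by move=> xa yb; rewrite normrM ler_pM.
split=> [|i|].
- by apply: le_trans (nn _ _ _ _ a1 a2) _; lra.
- apply: le_trans (ler_normD _ _) _.
  by apply: le_trans (lerD (nn _ _ _ _ (b1 i) a2) (nn _ _ _ _ a1 (b2 i))) _; lra.
- have -> : \sum_i (d i v * L v + K v * e i v) * w i = lin d v w * L v + K v * lin e v w.
    rewrite mulr_suml mulr_sumr -big_split; apply: eq_bigr => i _ /=; ring.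
  have hx := linP w b1; have hy := linP w b2; have W0 := l1_ge0 w.
  have Wr : l1 w <= p%:R * `|r|.
    apply: le_trans (ler_sum _ (G := fun=> `|r|) _) _.
      by move=> i _; apply: le_trans (wr i) (ler_norm r).
    by rewrite sumr_const card_ord mulr_natl.
  rewrite -/(lin d v w) -/(l1 w) in c1; rewrite -/(lin e v w) -/(l1 w) in c2.
  rewrite -/(l1 w).
  move: (l1 w) W0 Wr hx hy c1 c2 => W W0 Wr hx hy c1 c2.
  move: (K v) (L v) a1 a2 c1 c2 => k l a1 a2 c1 c2.
  move: (K (v \+ w)) (L (v \+ w)) c1 c2 => k' l'.
  move: (lin d v w) (lin e v w) hx hy => x y hx hy c1 c2.
  have -> : k' * l' - k * l - (x * l + k * y) =
    k * (l' - l - y) + (k' - k - x) * l + (k' - k - x + x) * (l' - l - y + y) by ring.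
  have u1 : `|k' - k - x + x| <= C * W ^+ 2 + C * W.
    by apply: le_trans (ler_normD _ _) _; rewrite lerD.
  have u2 : `|l' - l - y + y| <= E * W ^+ 2 + E * W.
    by apply: le_trans (ler_normD _ _) _; rewrite lerD.
  apply: le_trans (ler_normD _ _) _.
  apply: le_trans (lerD (ler_normD _ _) (nn _ _ _ _ u1 u2)) _.
  apply: le_trans (lerD (lerD (nn _ _ _ _ a1 c2) (nn _ _ _ _ c1 a2)) (lexx _)) _.
  have -> : C * (E * W ^+ 2) + C * W ^+ 2 * E + (C * W ^+ 2 + C * W) * (E * W ^+ 2 + E * W)
    = C * E * ((W + 1) ^+ 2 + 2) * W ^+ 2 by ring.
  rewrite ler_wpM2r ?sqr_ge0// ler_wpM2l// lerD2r ler_sqr ?nnegrE ?addr_ge0//.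
  by rewrite lerD2r.
Qed.

Lemma polyfun_meval (Q : mpoly.mpoly p R) : polyfun (fun v => mpoly.meval v Q).
Proof.
rewrite (_ : (fun v => _) = fun v => \sum_(m <- mpoly.msupp Q)
    mpoly.mcoeff m Q * \prod_i v i ^+ mpoly.fun_of_multinom m i); last first.
  by apply/funext => v; rewrite mpoly.mevalE.
elim: (mpoly.msupp Q) => [|m s IH].
  by under eq_fun do rewrite big_nil; exact: polyfun_cst.
under eq_fun do rewrite big_cons.
apply: polyfunD => //; apply: polyfunM; first exact: polyfun_cst.
elim: (index_enum _) => [|i u IHu].
  by under eq_fun do rewrite big_nil; exact: polyfun_cst.
under eq_fun do rewrite big_cons.
apply: polyfunM => //; elim: (mpoly.fun_of_multinom m i) => [|n IHn].
  by under eq_fun do rewrite expr0; exact: polyfun_cst.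
under eq_fun do rewrite exprS.
by apply: polyfunM => //; exact: polyfun_proj.
Qed.

End polynomial_functions.

Ltac gen_real := repeat match goal with
  | |- context [@I ?R ?t] => let u := fresh "u" in move: (@I R t) => u
  | |- context [@n2 ?R ?t] => let u := fresh "u" in move: (@n2 R t) => u
  end.

Section energy_estimates.
Variable R : realType.
Implicit Types (X Y Z W U : tpoly R) (r M : R) (n m i j q p : nat).
Local Notation T := (tpoly R).

Lemma I3_le M X Y Z : (forall x, 0 <= x <= 1 -> `|X x| <= M) ->
  `|I (X * Y * Z)| <= M * n2 Y * n2 Z.
Proof.
move=> XM; apply: le_trans (n2_CS _ _) _.
by rewrite ler_wpM2r ?n2_ge0// n2M.
Qed.

(** The terms of top order are gathered into an exact derivative. Every product left in [B] has both
    orders between 1 and [p] and, as [2 <= p], one of them below [p], which is estimated in sup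
    norm. The exact derivative is harmless in both uses: the energy estimate and the truncation
    defect. *)
Lemma Dn_Sqr p X : (2 <= p)%N -> I X = 0 -> exists B : T,
  [/\ Dn p.+1 (X * X) = 2 * D (X * Dn p X) + B &
     n2 B <= (2 ^ p.+1 + 2)%N%:R * n2 (Dn p X) ^+ 2].
Proof.
move=> p2 X0; exists (Dn p.+1 (X * X) - 2 * D (X * Dn p X)).
split; first by rewrite addrC subrK.
have pr i j : (i < p)%N -> (j <= p)%N -> n2 (Dn i X * Dn j X) <= n2 (Dn p X) ^+ 2.
  move=> ip jp; apply: le_trans (n2M _ (M := n2 (Dn p X)) _) _.
    by move=> x _; exact: sup_Dn.
  by rewrite expr2 ler_wpM2l ?n2_ge0// le_n2Dn.
have -> : Dn p.+1 (X * X) - 2 * D (X * Dn p X) =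
    \sum_(i < p) 'C(p.+1, i.+1)%:R * (Dn i.+1 X * Dn (p - i) X)
    - 2 * (Dn 1 X * Dn p X).
  rewrite Leibniz big_ord_recl big_ord_recr /= bin0 /bump /= add1n binn ?subn0 subnn !mul1r.
  rewrite DM -/(Dn 1 X) -DnS !Dn0 mulrDr.
  rewrite (_ : \sum_(i < p) _ = \sum_(i < p) 'C(p.+1, i.+1)%:R * (Dn i.+1 X * Dn (p - i) X)).
    by ring.
  by apply: eq_bigr => i _; rewrite add1n subSS.
apply: le_trans (n2B _ _) _; rewrite (natrD _ (2 ^ p.+1) 2) [leRHS]mulrDl; apply: lerD; last first.
  by rewrite -tpCn n2Z ger0_norm// ler_wpM2l// pr.
apply: le_trans (n2_sum _ _) _.
have H (i : 'I_p) : n2 ('C(p.+1, i.+1)%:R * (Dn i.+1 X * Dn (p - i) X)) <=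
    'C(p.+1, i.+1)%:R * n2 (Dn p X) ^+ 2.
  rewrite -tpCn n2Z ger0_norm ?ler0n// ler_wpM2l//.
  have [ip|ip] := ltnP i.+1 p; first by rewrite pr// leq_subr.
  by rewrite mulrC pr//; move: (ltn_ord i); lia.
apply: le_trans; first by apply: ler_sum => i _; exact: H.
rewrite -mulr_suml ler_wpM2r ?sqr_ge0// -natr_sum ler_nat.
(* The coefficients ['C(p.+1, i.+1)] with [i < p] sum to at most $2^{p+1}$; the extra 2 of the
   statement pays for the subtracted term. *)
have := Pascal 1 1 p.+1; rewrite addn1 => ->.
rewrite big_ord_recl big_ord_recr /= /bump; apply: leq_trans (leq_addl _ _).
apply: leq_trans (leq_addr _ _); apply: leq_sum => i _.
by rewrite add1n !exp1n !muln1.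
Qed.

Lemma I_DXX X : I (D X * X) = 0.
Proof. by have := I_parts X X; rewrite (mulrC X); lra. Qed.

Lemma I_D3X X : I (Dn 3 X * X) = 0.
Proof. by rewrite /Dn /= I_parts I_DXX oppr0. Qed.

(** A transport term tested against its own argument costs no derivative of that argument: the
    derivative falls on the coefficient [Z]. *)
Lemma I_transport W Z : I (D (W * Z) * W) = 2^-1 * I (D Z * W * W).
Proof.
rewrite I_parts.
have := I_D (Z * W * W); rewrite !DM !mulrDl !ID => h.
have E1 : I (Z * W * D W) = I (W * Z * D W) by congr I; ring.
have E2 : I (Z * D W * W) = I (W * Z * D W) by congr I; ring.
by rewrite E1 E2 in h; lra.
Qed.

Lemma kdvWE X : kdvW X = - Dn 3 X + 3%:R * D (X * X).
Proof. by rewrite /kdvW DM; ring. Qed.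

Lemma I_kdvW X : I (kdvW X) = 0.
Proof. by rewrite kdvWE ID IN -tpCn IZ !I_D mulr0 oppr0 addr0. Qed.

(** The dispersive part is antisymmetric and disappears. The top part of the nonlinearity is a
    transport term for $\partial^pX$, and the remainder [B] is quadratic in the norm, whence the
    cube. *)
Lemma energy_kdv p : (2 <= p)%N -> exists2 C, 0 <= C & forall X, I X = 0 ->
  `|I (Dn p X * Dn p (kdvW X))| <= C * n2 (Dn p X) ^+ 3.
Proof.
move=> p2; exists (3 * (2 ^ p.+1 + 3)%N%:R); first by rewrite mulr_ge0.
move=> X X0; rewrite kdvWE DnD DnN -tpCn DnCM -DnSr mulrDr mulrN ID IN.
have -> : Dn p (Dn 3 X) = Dn 3 (Dn p X) by rewrite -!Dn_add addnC.
rewrite mulrC I_D3X oppr0 add0r mulrCA IZ normrM ger0_norm// -mulrA ler_wpM2l//.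
have [B [-> hB]] := Dn_Sqr p2 X0; set A := Dn p X in hB *.
rewrite mulrDr ID -tpCn mulrCA IZ (mulrC A (D _)) (mulrC X) I_transport.
have h1 : `|I (D X * A * A)| <= n2 A * n2 A * n2 A.
  by apply: I3_le => x _; exact: (@sup_Dn _ 1 p X x X0 p2).
have h2 : `|I (A * B)| <= n2 A * n2 B := n2_CS A B.
apply: le_trans (ler_normD _ _) _; rewrite !normrM ger0_norm// ger0_norm ?invr_ge0//.
have A0 := n2_ge0 A.
have h3 : n2 A * n2 B <= n2 A * ((2 ^ p.+1 + 2)%N%:R * n2 A ^+ 2) by rewrite ler_wpM2l.
rewrite mulrA mulfV// mul1r !natrD; move: h1 h2 h3; rewrite !natrD.
move: (I (D X * A * A)) (I (A * B)) (n2 A) (n2 B) ((2 ^ p.+1)%:R : R) => u v a b c.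
rewrite !exprS expr0 mulr1; lra.
Qed.

Lemma n2_P m X : I X = 0 -> n2 (P m X) <= n2 X.
Proof.
move=> X0; apply: le_n2; first exact: n2_ge0.
have E : P m X + Q m X = X by rewrite /Q /Pi X0 tpC0 add0r addrC subrK.
rewrite sqr_n2 -[in leRHS]E.
have -> : (P m X + Q m X) * (P m X + Q m X) =
  P m X * P m X + tpC 2 * (Q m X * P m X) + Q m X * Q m X by rewrite tpCn; ring.
by rewrite !ID IZ Q_S mulr0 addr0 lerDl I_sqr_ge0.
Qed.

(** [Y] plays the scheme and [U] the solution, whose high modes are [q]. In the difference of the
    two fields, tested against [W], the term $\partial^3W$ is antisymmetric and $\partial^3q$ is
    orthogonal to low modes; the factor $Y+V$ transports [W]; and the derivative in
    $\partial(q(U+V))$ is moved onto [W]. So the high modes enter only through the $L^2$ norm of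
    [q]. *)
Lemma stability m Y U r : trig_deg m Y -> I Y = 0 -> I U = 0 ->
  n2 (Dn 3 Y) <= r -> n2 (Dn 3 U) <= r ->
  `|I ((kdvW Y - kdvW U) * (Y - P m U))| <=
    3 * r * n2 (Y - P m U) ^+ 2 + 12 * r ^+ 2 * n2 (Q m U).
Proof.
move=> mY Y0 U0 Yr Ur; set V := P m U; set W := Y - V; set q := Q m U.
have UE : U = V + q by rewrite /q /Q /Pi U0 tpC0 add0r addrC subrK.
have V0 : I V = 0 by exact: I_S.
have W0 : I W = 0 by rewrite IB Y0 V0 subrr.
have mW : trig_deg m W := trig_degD mY (trig_degN (deg_S m (coe U))).
have QW Z : I (Q m Z * W) = 0 by rewrite (deg_Pi mW) Q_orth.
have r0 : 0 <= r := le_trans (n2_ge0 _) Yr.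
have QD3 : I (Dn 3 q * W) = 0 by rewrite -Q_Dn QW.
have le3 Z i : I Z = 0 -> n2 (Dn 3 Z) <= r -> (i < 3)%N -> forall x, `|Dn i Z x| <= r.
  by move=> Z0 Zr i3 x; apply: le_trans (sup_Dn x Z0 i3) Zr.
have Vr : n2 (Dn 3 V) <= r.
  have -> : Dn 3 V = P m (Dn 3 U) by rewrite /Dn /= !P_D.
  by apply: le_trans Ur; exact/n2_P/I_Dn.
have key (A B C : T) : kdvW A - kdvW (B + C) = - Dn 3 (A - B) + Dn 3 C
    + 3%:R * D ((A - B) * (A + B)) - 3%:R * D (C * (B + C + B)).
  rewrite !kdvWE DnB DnD.
  have -> : (A - B) * (A + B) = A * A - B * B by ring.
  have -> : C * (B + C + B) = (B + C) * (B + C) - B * B by ring.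
  by rewrite !DB; ring.
rewrite [in kdvW U]UE key -/W -UE; set G := Y + V; set G' := U + V.
have E (a b : T) : I ((- Dn 3 W + Dn 3 q + 3%:R * a - 3%:R * b) * W) =
    3 * I (a * W) - 3 * I (b * W).
  rewrite mulrBl 2!mulrDl IB 2!ID mulNr IN I_D3X QD3 oppr0 !add0r.
  by rewrite -(tpCn R 3) -2!mulrA !IZ.
rewrite E.
rewrite I_transport (I_parts (q * _)) /G.
have h1 : `|I (D (Y + V) * W * W)| <= (2 * r) * n2 W * n2 W.
  apply: I3_le => x _; rewrite DD tp_add; apply: le_trans (ler_normD _ _) _.
  have := @le3 Y 1%N Y0 Yr isT x; have := @le3 V 1%N V0 Vr isT x.
  by rewrite /Dn /=; lra.
have h2 : `|I ((U + V) * q * D W)| <= (2 * r) * n2 q * n2 (D W).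
  apply: I3_le => x _; rewrite tp_add; apply: le_trans (ler_normD _ _) _.
  have := @le3 U 0%N U0 Ur isT x; have := @le3 V 0%N V0 Vr isT x.
  by rewrite /Dn /=; lra.
have h3 : n2 (D W) <= 2 * r.
  rewrite DB; apply: le_trans (n2B _ _) _.
  rewrite (_ : 2 * r = r + r); last by ring.
  apply: lerD; first exact: (le_trans (@le_n2Dn _ 1 3 Y Y0 isT) Yr).
  exact: (le_trans (@le_n2Dn _ 1 3 V V0 isT) Vr).
have h4 : (2 * r) * n2 q * n2 (D W) <= (2 * r) * n2 q * (2 * r).
  by rewrite ler_wpM2l ?mulr_ge0 ?n2_ge0.
rewrite (mulrC q) /G'.
have alg (u v w t d : R) : `|u| <= (2 * r) * w * w -> `|v| <= (2 * r) * t * d ->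
    (2 * r) * t * d <= (2 * r) * t * (2 * r) ->
    `|3 * (2^-1 * u) - 3 * - v| <= 3 * r * w ^+ 2 + 12 * r ^+ 2 * t.
  move=> /ler_normlP[u1 u2] /ler_normlP[v1 v2] ht.
  by apply/ler_normlP; split; lra.
exact: alg h1 h2 h4.
Qed.

Lemma kdvW_weak X Z : I X = 0 ->
  I (kdvW X * Z) = I (X * (Dn 3 Z - 3 * (X * D Z))).
Proof.
move=> X0; rewrite kdvWE mulrDl ID mulNr IN I_partsn -mulrA -(tpCn R 3) IZ I_parts.
rewrite [in RHS]mulrBr IB (mulrCA X) IZ (mulrA X X); gen_real; ring.
Qed.

(** With all derivatives on the fixed test function [Z], the KdV field is Lipschitz for the $L^2$
    distance on bounded sets. *)
Lemma kdvW_lip X Y Z r : I X = 0 -> I Y = 0 -> n2 (Dn 3 X) <= r -> n2 (Dn 3 Y) <= r ->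
  `|I (kdvW X * Z) - I (kdvW Y * Z)| <= n2 (X - Y) * (n2 (Dn 3 Z) + 6 * r * n2 (D Z)).
Proof.
move=> X0 Y0 Xr Yr; rewrite !kdvW_weak// -IB.
rewrite (_ : _ - _ = (X - Y) * (Dn 3 Z - 3 * ((X + Y) * D Z))); last by ring.
apply: le_trans (n2_CS _ _) _; rewrite ler_wpM2l ?n2_ge0//.
apply: le_trans (n2B _ _) _; rewrite lerD2l -tpCn n2Z ger0_norm//.
apply: le_trans (ler_wpM2l _ (n2M _ (M := 2 * r) _)) _ => //.
  move=> x _; rewrite tp_add; apply: le_trans (ler_normD _ _) _.
  have := @sup_Dn _ 0 3 X x X0 isT; have := @sup_Dn _ 0 3 Y x Y0 isT.
  by rewrite !Dn0; lra.
by rewrite (_ : 3 * _ = 6 * r * n2 (D Z)) //; gen_real; ring.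
Qed.

End energy_estimates.

(** * The functional $J_p$ on trigonometric polynomials *)

Section conserved_functional.
Variables (R : realType) (p : nat) (c : R) (K : mpoly.mpoly p R).
Implicit Types (X Y Z : tpoly R) (r M : R).
Local Notation T := (tpoly R).

Definition evT (h : 'I_p -> T) : T := insubd 0 (fun x => mpoly.meval (fun i => h i x) K).

Lemma evTE h x : evT h x = mpoly.meval (fun i => h i x) K.
Proof.
have [d [tK _ _]] := polyfun_meval K.
by rewrite /evT (insubdK _ (tK h)).
Qed.

Definition jet X (i : 'I_p) : T := Dn i X.

Definition JX X : R := I (tpC c * (X * (Dn p X * Dn p X)) + evT (jet X)).

(** The differential of [JX] at [X] in the direction [Z]. [G X i] stands for the partial derivative
    of the polynomial in its [i]-th variable along the jet of [X], and is known through bounds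
    only. *)
Definition dJ (G : T -> 'I_p -> T) X Z : R :=
  c * (I (Z * Dn p X * Dn p X) + 2 * I (X * Dn p X * Dn p Z)) + \sum_i I (G X i * Dn i Z).

Lemma I_abs_sum_sqr (h : 'I_p -> T) (Z : T) C : 0 <= C ->
  (forall x, 0 <= x <= 1 -> `|Z x| <= C * (\sum_i `|h i x|) ^+ 2) ->
  `|I Z| <= C * (p%:R * \sum_i n2 (h i) ^+ 2).
Proof.
move=> C0 ZC.
pose B : T := tpC (C * p%:R) * \sum_i h i * h i.
have ZB x : 0 <= x <= 1 -> `|Z x| <= B x.
  move=> x01; apply: le_trans (ZC x x01) _.
  rewrite /B tp_mul tp_sum /= -mulrA ler_wpM2l//.
  have := @sum_mul_CS R _ (index_enum _) (fun _ : 'I_p => 1) (fun i => `|h i x|).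
  rewrite (eq_bigr (fun i => `|h i x|)); last by move=> i _; rewrite mul1r.
  move=> /le_trans; apply; rewrite (eq_bigr (fun=> 1)); last by move=> i _; rewrite expr1n.
  rewrite sumr_const card_ord ler_wpM2l//.
  by apply: ler_sum => i _; rewrite real_normK ?num_real// expr2.
have -> : C * (p%:R * \sum_i n2 (h i) ^+ 2) = I B.
  by rewrite IZ Isum mulrA; congr (_ * _); apply: eq_bigr => i _; rewrite sqr_n2.
rewrite ler_norml -IN; apply/andP; split; apply: le_I => x /ZB;
  by rewrite ?tp_opp ler_norml => /andP[].
Qed.

Lemma JXE X : JX X = c * I (X * Dn p X * Dn p X) + I (evT (jet X)).
Proof. by rewrite /JX ID IZ mulrA. Qed.

(** The remainder is quadratic in the norm of $H^p$. The cubic term $u(\partial^pu)^2$ is expanded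
    exactly, its undifferentiated factor being bounded in sup norm; the polynomial part, which
    contains derivatives of order below [p] only, is expanded pointwise and integrated. *)
Lemma J_taylor : (0 < p)%N -> exists G : T -> 'I_p -> T,
  (forall r, exists2 C, 0 <= C & forall X, I X = 0 -> n2 (Dn p X) <= r ->
     forall i x, `|G X i x| <= C) /\
  (forall r, exists2 C, 0 <= C & forall X Z, I X = 0 -> I Z = 0 ->
     n2 (Dn p X) <= r -> n2 (Dn p Z) <= r ->
     [/\ `|JX X| <= C, `|dJ G X Z| <= C * n2 (Dn p Z) &
       `|JX (X + Z) - JX X - dJ G X Z| <= C * n2 (Dn p Z) ^+ 2]).
Proof.
move=> p0; have [d [tK td tay]] := polyfun_meval K.
pose G X i : T := insubd 0 (fun x => d i (fun j => jet X j x)).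
have GE X i x : G X i x = d i (fun j => jet X j x) by rewrite /G (insubdK _ (td i (jet X))).
have jr X r : I X = 0 -> n2 (Dn p X) <= r -> forall x (i : 'I_p), `|jet X i x| <= r.
  by move=> X0 Xr x i; apply: le_trans (sup_Dn x X0 (ltn_ord i)) Xr.
exists G; split=> r.
  have [C C0 H] := tay r; exists C => // X X0 Xr i x; rewrite GE.
  by have [_ ] := H _ _ (jr _ _ X0 Xr x) (jr _ _ X0 Xr x).
have [C C0 H] := tay r.
pose s := `|r|.
have s0 : 0 <= s := normr_ge0 r.
(* For the cubic term, [4 * s] bounds the part of order at least two, [3 * s ^+ 2] the linear part
   and [s ^+ 3] the value; the other summands do the same for the polynomial part. *)
pose E := C * (p%:R * p%:R) + `|c| * (4 * s + 3 * s ^+ 2 + s ^+ 3) + C + p%:R * C.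
have k1 : 0 <= C * (p%:R * p%:R) by rewrite !mulr_ge0.
have k2 : 0 <= `|c| * (4 * s + 3 * s ^+ 2 + s ^+ 3).
  by rewrite mulr_ge0// !addr_ge0// ?mulr_ge0// ?exprn_ge0.
have k3 : 0 <= p%:R * C by rewrite mulr_ge0.
exists E; first by rewrite /E !addr_ge0.
move=> X Z X0 Z0 Xr Zr.
have Xs : n2 (Dn p X) <= s := le_trans Xr (ler_norm r).
have Zs : n2 (Dn p Z) <= s := le_trans Zr (ler_norm r).
set A := Dn p X in Xs *; set B := Dn p Z in Zs *.
have a0 := n2_ge0 A; have b0 := n2_ge0 B.
have GC i x : `|G X i x| <= C.
  by rewrite GE; have [_ ] := H _ _ (jr _ _ X0 Xr x) (jr _ _ X0 Xr x).
have ev0 : `|I (evT (jet X))| <= C.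
  apply: I_norm_le => x _; rewrite evTE.
  by have [] := H _ _ (jr _ _ X0 Xr x) (jr _ _ X0 Xr x).
have tri Y1 Y2 Y3 : I Y1 = 0 -> `|I (Y1 * Y2 * Y3)| <= n2 (Dn p Y1) * n2 Y2 * n2 Y3.
  by move=> Y10; apply: I3_le => x _; exact: (sup_Dn x Y10 p0).
have rem : `|I (evT (jet (X + Z))) - I (evT (jet X)) - \sum_i I (G X i * Dn i Z)|
    <= C * (p%:R * p%:R) * n2 B ^+ 2.
  rewrite -Isum -!IB; apply: le_trans (I_abs_sum_sqr (h := jet Z) C0 _) _.
    move=> x _; rewrite !tp_add !tp_opp !evTE tp_sum.
    have [_ _] := H _ _ (jr _ _ X0 Xr x) (jr _ _ Z0 Zr x).
    rewrite (_ : (fun i => jet (X + Z) i x) = (fun i => jet X i x) \+ (fun i => jet Z i x)).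
      by rewrite (eq_bigr (fun i => G X i x * jet Z i x)) // => i _; rewrite GE.
    by apply/funext => i; rewrite /jet DnD.
  rewrite -!mulrA; do 2 apply: ler_wpM2l => //.
  apply: le_trans (ler_sum _ (G := fun=> n2 B ^+ 2) _) _.
    by move=> i _; rewrite ler_sqr ?nnegrE ?n2_ge0// le_n2Dn// ltnW.
  by rewrite sumr_const card_ord mulr_natl.
have dsum : `|\sum_i I (G X i * Dn i Z)| <= p%:R * C * n2 B.
  apply: le_trans (ler_norm_sum _ _ _) _.
  apply: le_trans (ler_sum _ (G := fun=> C * n2 B) _) _.
    move=> i _; apply: le_trans (I_le_n2 _) _; apply: le_trans (n2M _ (M := C) _) _ => //.
    by rewrite ler_wpM2l// le_n2Dn// ltnW.
  by rewrite sumr_const card_ord -mulrA mulr_natl.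
have t1 := tri X A A X0; have t2 := tri Z A A Z0; have t3 := tri X A B X0.
have t4 := tri Z A B Z0; have t5 := tri X B B X0; have t6 := tri Z B B Z0.
rewrite -/A -/B in t1 t2 t3 t4 t5 t6.
have exp3 : I ((X + Z) * (A + B) * (A + B)) = I (X * A * A) + I (Z * A * A) +
    2 * I (X * A * B) + 2 * I (Z * A * B) + I (X * B * B) + I (Z * B * B).
  have -> : (X + Z) * (A + B) * (A + B) = X * A * A + Z * A * A + tpC 2 * (X * A * B)
    + tpC 2 * (Z * A * B) + X * B * B + Z * B * B by rewrite tpCn; ring.
  by rewrite !ID !IZ.
have bnd (u v b x y z : R) : 0 <= b -> `|u| <= x * y * z -> x * y * z <= v * b -> `|u| <= v * b.
  by move=> _ /le_trans; exact.
have alg (t u v w x y : R) : `|t| <= u * v * w -> 0 <= u -> 0 <= v -> 0 <= w ->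
    u <= x -> v <= y -> `|t| <= x * y * w.
  move=> h u0 v0 w0 ux vy; apply: le_trans h _; rewrite ler_wpM2r// ler_pM//.
have {}t1 := alg _ _ _ _ _ _ t1 a0 a0 a0 Xs Xs.
have {}t2 : `|I (Z * A * A)| <= s * s * n2 B.
  by apply: le_trans t2 _; rewrite -mulrA mulrC ler_wpM2r// ler_pM.
have {}t3 := alg _ _ _ _ _ _ t3 a0 a0 b0 Xs Xs.
have {}t4 : `|I (Z * A * B)| <= s * n2 B ^+ 2.
  by apply: le_trans t4 _; rewrite (mulrC (n2 B)) -mulrA -expr2 ler_wpM2r ?sqr_ge0.
have {}t5 : `|I (X * B * B)| <= s * n2 B ^+ 2.
  by apply: le_trans t5 _; rewrite -mulrA -expr2 ler_wpM2r ?sqr_ge0.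
have {}t6 : `|I (Z * B * B)| <= s * n2 B ^+ 2.
  by apply: le_trans t6 _; rewrite -mulrA -expr2 ler_wpM2r ?sqr_ge0.
have nn4 : 0 <= 4 * s by rewrite mulr_ge0.
have nn3 : 0 <= 3 * s ^+ 2 by rewrite mulr_ge0 ?sqr_ge0.
have nn1 : 0 <= s ^+ 3 by rewrite exprn_ge0.
have nnC : 0 <= p%:R * C by rewrite mulr_ge0.
have nnE (x y z w k l : R) : 0 <= x -> 0 <= y -> 0 <= z -> 0 <= w -> 0 <= k -> 0 <= l ->
    [/\ w + `|c| * x <= w + `|c| * (x + y + z) + k + l, `|c| * y + l <= w + `|c| * (x + y + z) + k + l &
      `|c| * z + k <= w + `|c| * (x + y + z) + k + l].
  move=> x0 y0 z0 w0 k0 l0; have cx := mulr_ge0 (normr_ge0 c) x0; have cy := mulr_ge0 (normr_ge0 c) y0.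
  have cz := mulr_ge0 (normr_ge0 c) z0; rewrite !mulrDr.
  move: (`|c| * x) (`|c| * y) (`|c| * z) cx cy cz => cx cy cz cx0 cy0 cz0.
  by split; rewrite -subr_ge0; [have -> : w + (cx + cy + cz) + k + l - (w + cx) = cy + cz + k + l by ring
    |have -> : w + (cx + cy + cz) + k + l - (cy + l) = w + cx + cz + k by ring
    |have -> : w + (cx + cy + cz) + k + l - (cz + k) = w + cx + cy + l by ring]; rewrite !addr_ge0.
have nnP : 0 <= C * (p%:R * p%:R) by rewrite !mulr_ge0.
have [E1 E2 E3] := nnE _ _ _ _ _ _ nn4 nn3 nn1 nnP C0 nnC.
clear tri bnd alg.
split.
- apply: le_trans E3; rewrite JXE; apply: le_trans (ler_normD _ _) _; apply: lerD => //.
  rewrite normrM ler_wpM2l//; apply: le_trans t1 _.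
  by rewrite !exprS expr0 mulr1 mulrA ler_wpM2l// mulr_ge0.
- apply: le_trans (ler_wpM2r b0 E2); rewrite mulrDl; apply: le_trans (ler_normD _ _) _.
  apply: lerD => //; rewrite normrM -[leRHS]mulrA ler_wpM2l//.
  move: t2 t3; rewrite -/A -/B; move: (I _) (I _) (n2 B) => u v b hu hv.
  apply: le_trans (ler_normD _ _) _; rewrite (_ : 3 * s ^+ 2 * b = s * s * b + 2 * (s * s * b)); last by ring.
  by apply: lerD => //; rewrite normrM ger0_norm// ler_wpM2l.
- apply: le_trans (ler_wpM2r (sqr_ge0 _) E1); rewrite !JXE /dJ DnD -/A -/B exp3.
  have alg2 (x1 x2 x3 x4 x5 x6 e1 e2 e3 k b m : R) :
     `|x4| <= s * b -> `|x5| <= s * b -> `|x6| <= s * b -> `|e1 - e2 - e3| <= m * b ->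
     `|k * (x1 + x2 + 2 * x3 + 2 * x4 + x5 + x6) + e1 - (k * x1 + e2) -
       (k * (x2 + 2 * x3) + e3)| <= (m + `|k| * (4 * s)) * b.
    move=> h4 h5 h6 he.
    have -> : k * (x1 + x2 + 2 * x3 + 2 * x4 + x5 + x6) + e1 - (k * x1 + e2) -
       (k * (x2 + 2 * x3) + e3) = (e1 - e2 - e3) + k * (2 * x4 + x5 + x6) by ring.
    apply: le_trans (ler_normD _ _) _; rewrite [leRHS]mulrDl; apply: lerD => //.
    rewrite normrM -[leRHS]mulrA ler_wpM2l//.
    rewrite (_ : 4 * s * b = 2 * (s * b) + s * b + s * b); last by ring.
    apply: le_trans (ler_normD _ _) _; apply: lerD => //.
    apply: le_trans (ler_normD _ _) _; apply: lerD => //.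
    by rewrite normrM ger0_norm// ler_wpM2l.
  exact: alg2.
Qed.

End conserved_functional.

Local Notation bounded_gradient p G := (forall r, exists2 C, 0 <= C &
  forall X, I X = 0 -> n2 (Dn p X) <= r -> forall i x, `|G X i x| <= C).
Local Notation taylor_functional p c K G := (forall r, exists2 C, 0 <= C & forall X Z, I X = 0 -> I Z = 0 ->
  n2 (Dn p X) <= r -> n2 (Dn p Z) <= r ->
  [/\ `|JX c K X| <= C, `|dJ c G X Z| <= C * n2 (Dn p Z) &
     `|JX c K (X + Z) - JX c K X - dJ c G X Z| <= C * n2 (Dn p Z) ^+ 2]).

Lemma small_lin_eq0 (R : realType) (a M : R) :
  (forall s, 0 < s <= 1 -> s * `|a| <= M * s ^+ 2) -> a = 0.
Proof.
move=> H; apply/eqP; rewrite -normr_le0 leNgt; apply/negP => a0.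
have M0 : `|a| <= M by have := H 1 _; rewrite expr1n mulr1 mul1r ltr01 lexx; exact.
have MM : 0 < M by exact: lt_le_trans a0 M0.
pose s := `|a| / (2 * M).
have s0 : 0 < s by rewrite divr_gt0 ?mulr_gt0.
have s1 : s <= 1 by rewrite ler_pdivrMr ?mulr_gt0// mul1r; lra.
have sE : M * s = `|a| / 2 by rewrite /s; field; rewrite gt_eqF.
have := H s; rewrite s0 s1 expr2 mulrA sE mulrC => /(_ isT).
by rewrite (ler_pM2r s0); lra.
Qed.

Lemma poly_coef1 (R : realType) (q : {poly R}) (d C : R) :
  (forall s, 0 < s <= 1 -> `|q.[s] - q.[0] - s * d| <= C * s ^+ 2) -> q`_1 = d.
Proof.
move=> H; apply/eqP; rewrite -subr_eq0; apply/eqP.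
pose r := drop_poly 2 q.
pose B := \sum_(i < size r) `|r`_i|.
have qE s : q.[s] = q`_0 + q`_1 * s + r.[s] * s ^+ 2.
  rewrite -[in LHS](poly_take_drop 2 q) hornerD hornerM hornerXn; congr (_ + _).
  rewrite (@horner_coef_wide _ 2); last exact: size_take_poly.
  by rewrite !big_ord_recl big_ord0 !coef_take_poly/= addr0 expr0 mulr1 expr1.
have rB s : 0 < s <= 1 -> `|r.[s]| <= B.
  move=> /andP[s0 s1]; rewrite horner_coef; apply: le_trans (ler_norm_sum _ _ _) _.
  apply: ler_sum => i _; rewrite normrM normrX ler_piMr// exprn_ile1//.
  by rewrite ger0_norm// ltW.
apply: (@small_lin_eq0 _ _ (C + B)) => s s01.
have := H s s01; have := rB s s01; case/andP: s01 => s0 s1.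
rewrite !qE expr0n /= !mulr0 !addr0 => hr hq.
rewrite -[X in X * _](ger0_norm (ltW s0)) -normrM.
have -> : s * (q`_1 - d) = (q`_0 + q`_1 * s + r.[s] * s ^+ 2 - q`_0 - s * d) - r.[s] * s ^+ 2 by ring.
apply: le_trans (ler_normB _ _) _; rewrite mulrDl; apply: lerD => //.
by rewrite normrM ler_pM// ger0_norm// exprn_ge0// ltW.
Qed.

(** * The differential of $\mathcal J_{p+1}$ along KdV and along its truncation *)

Section invariance.
Variables (R : realType) (p : nat) (c : R) (K : mpoly.mpoly p R).
Implicit Types (X Y Z : tpoly R) (r M : R) (G : tpoly R -> 'I_p -> tpoly R).
Local Notation T := (tpoly R).
Hypothesis p2 : (2 <= p)%N.

Lemma dJD G X Y Z : dJ c G X (Y + Z) = dJ c G X Y + dJ c G X Z.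
Proof.
rewrite /dJ (mulrDl Y Z) (mulrDl (Y * _)) ID DnD (mulrDr (X * _)) ID.
rewrite (eq_bigr (fun i => I (G X i * Dn i Y) + I (G X i * Dn i Z))).
  by rewrite big_split /=; gen_real; ring.
by move=> i _; rewrite DnD mulrDr ID.
Qed.

Lemma dJZ G X s Z : dJ c G X (tpC s * Z) = s * dJ c G X Z.
Proof.
rewrite /dJ -(mulrA (tpC s)) -(mulrA (tpC s)) IZ DnCM mulrCA IZ.
rewrite (eq_bigr (fun i => s * I (G X i * Dn i Z))).
  by rewrite -mulr_sumr; gen_real; ring.
by move=> i _; rewrite DnCM mulrCA IZ.
Qed.

(** On trigonometric polynomials [Psi] below is the functional $\mathcal J_{p+1}$, and [dPsi] is its
    differential. *)
Definition dPsi G X Z := I (Dn p.+1 X * Dn p.+1 Z) + dJ c G X Z.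
Definition Psi X := 2^-1 * n2 (Dn p.+1 X) ^+ 2 + JX c K X.

Lemma dPsiD G X Y Z : dPsi G X (Y + Z) = dPsi G X Y + dPsi G X Z.
Proof. by rewrite /dPsi dJD DnD mulrDr ID; ring. Qed.

Lemma dPsiZ G X s Z : dPsi G X (tpC s * Z) = s * dPsi G X Z.
Proof. by rewrite /dPsi dJZ DnCM mulrCA IZ; ring. Qed.

Variable G : T -> 'I_p -> T.
Hypothesis G_bnd : bounded_gradient p G.
Hypothesis G_taylor : taylor_functional p c K G.

Lemma PsiD X Z : Psi (X + Z) - Psi X - dPsi G X Z =
  2^-1 * n2 (Dn p.+1 Z) ^+ 2 + (JX c K (X + Z) - JX c K X - dJ c G X Z).
Proof.
rewrite /Psi /dPsi DnD !sqr_n2 mulrDl !mulrDr !ID (mulrC (Dn p.+1 Z) (Dn p.+1 X)).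
by move: (dJ _ _ _ _) (JX _ _ _) (JX _ _ _) => u v w; gen_real; field.
Qed.

(** On the line in the direction of the KdV field [Psi] is a polynomial whose linear coefficient
    vanishes by [conserved_poly]; the Taylor expansion of [Psi] identifies this coefficient with
    [dPsi]. *)
Lemma dPsi_kdvW : (forall X, I X = 0 -> conserved p.+1 X = Psi X) ->
  forall X, I X = 0 -> dPsi G X (kdvW X) = 0.
Proof.
move=> HJ X X0; set Z := kdvW X; have Z0 : I Z = 0 := I_kdvW X.
pose r := Num.max (n2 (Dn p X)) (n2 (Dn p Z)).
have Xr : n2 (Dn p X) <= r by rewrite le_max lexx.
have Zr : n2 (Dn p Z) <= r by rewrite le_max lexx orbT.
have [C C0 tay] := G_taylor r.
have [q qE q1] := conserved_poly p.+1 X.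
have {}qE s : q.[s] = Psi (X + tpC s * Z).
  by rewrite -qE HJ// ID IZ X0 Z0 mulr0 addr0.
rewrite -q1; apply/esym/(poly_coef1 (C := 2^-1 * n2 (Dn p.+1 Z) ^+ 2 + C * n2 (Dn p Z) ^+ 2)).
move=> s /andP[s0 s1]; rewrite !qE tpC0 mul0r addr0 -dPsiZ PsiD.
apply: le_trans (ler_normD _ _) _; rewrite mulrDl; apply: lerD.
  rewrite DnCM n2Z exprMn real_normK ?num_real// mulrCA mulrC ger0_norm//.
  by apply: mulr_ge0; [apply: mulr_ge0; [|exact: sqr_ge0]|exact: sqr_ge0].
have sZ0 : I (tpC s * Z) = 0 by rewrite IZ Z0 mulr0.
have sZr : n2 (Dn p (tpC s * Z)) <= r.
  by rewrite DnCM n2Z; apply: le_trans Zr; rewrite ler_piMl ?n2_ge0// ger0_norm// ltW.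
have [_ _] := tay X (tpC s * Z) X0 sZ0 Xr sZr.
move=> /le_trans; apply.
by rewrite DnCM n2Z exprMn real_normK ?num_real// mulrCA mulrC.
Qed.

(** The dangerous term pairs $X\partial^pX$ with $\partial^{p+1}Q_m(X^2)$, one derivative too many.
    By [Dn_Sqr] the latter is $Q_m(2\partial(X\partial^pX)+B)$: against $Q_m(X\partial^pX)$ its
    derivative part integrates to zero, and [B] is bounded. All other terms contain at most [p]
    derivatives of $Q_m(X^2)$. *)
Lemma zhidkov r : exists2 C, 0 <= C & forall m X, trig_deg m X -> I X = 0 ->
  n2 (Dn p X) <= r -> `|dJ c G X (3%:R * D (Q m (X * X)))| <=
    C * (n2 (Q m (X * Dn p X)) + n2 (Q m (Dn p (X * X)))).
Proof.
have [C C0 GC] := G_bnd r.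
pose s := `|r|; have s0 : 0 <= s := normr_ge0 r.
pose k : R := (2 ^ p.+1 + 2)%N%:R.
exists (`|c| * (3 * s * s + 6 * (k * s ^+ 2)) + 3 * (p%:R * C)).
  by rewrite addr_ge0// ?mulr_ge0// addr_ge0// !mulr_ge0.
move=> m X mX X0 Xr; have Xs : n2 (Dn p X) <= s := le_trans Xr (ler_norm r).
set q := Q m (X * X); set z := 3%:R * D q; set A := Dn p X in Xs *.
have q0 : I q = 0 := I_Q m _.
have zE i : Dn i z = tpC 3 * Dn i.+1 q by rewrite /z -tpCn DnCM -DnSr.
have zle i : (i < p)%N -> n2 (Dn i z) <= 3 * n2 (Q m (Dn p (X * X))).
  by move=> ip; rewrite zE n2Z ger0_norm// ler_wpM2l// Q_Dn le_n2Dn.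
have z0 : I z = 0 by rewrite /z -tpCn IZ I_D mulr0.
have zsup x : `|z x| <= 3 * n2 (Q m (Dn p (X * X))).
  by apply: le_trans (zle 1%N p2); exact: (@sup_Dn _ 0 1 z x z0 isT).
set v := n2 (Q m (Dn p (X * X))) in zle zsup *; set u := n2 (Q m (X * A)).
have u0 : 0 <= u by exact: n2_ge0. have v0 : 0 <= v by exact: n2_ge0.
have a0 := n2_ge0 A.
have h1 : `|I (z * A * A)| <= 3 * s * s * v.
  apply: le_trans (I3_le (M := 3 * v) _ _ _) _; first by move=> x _; exact: zsup.
  rewrite (_ : 3 * s * s * v = 3 * v * s * s); last by ring.
  by rewrite ler_pM ?mulr_ge0// ler_wpM2l// mulr_ge0.
have h2 : `|I (X * A * Dn p z)| <= 3 * (k * s ^+ 2) * u.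
  have [B [hB1 hB2]] := Dn_Sqr p2 X0.
  rewrite zE mulrCA IZ normrM ger0_norm// -mulrA ler_wpM2l// /q -Q_Dn.
  rewrite mulrC I_QQ -/A hB1 -tpCn QD QZ mulrDl -mulrA ID IZ Q_D I_DXX mulr0 add0r.
  rewrite mulrC -I_QQ; apply: le_trans (n2_CS _ _) _.
  rewrite mulrC ler_wpM2r//; apply: le_trans hB2 _.
  by rewrite ler_wpM2l// ler_sqr.
have h3 : `|\sum_i I (G X i * Dn i z)| <= 3 * (p%:R * C) * v.
  apply: le_trans (ler_norm_sum _ _ _) _.
  apply: le_trans (ler_sum _ (G := fun=> C * (3 * v)) _) _.
    move=> i _; apply: le_trans (I_le_n2 _) _; apply: le_trans (n2M _ (M := C) _) _.
      by move=> x _; exact: GC.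
    by rewrite ler_wpM2l// zle.
  rewrite sumr_const card_ord -mulr_natl; rewrite le_eqVlt.
  by apply/orP; left; apply/eqP; ring.
rewrite /dJ; apply: le_trans (ler_normD _ _) _.
rewrite [leRHS]mulrDl; apply: lerD; last first.
  by apply: le_trans h3 _; rewrite ler_wpM2l ?mulr_ge0// lerDr.
rewrite normrM -[leRHS]mulrA ler_wpM2l//.
apply: le_trans (ler_normD _ _) _; rewrite normrM ger0_norm// -/A.
have : 0 <= 3 * s * s * u by rewrite !mulr_ge0.
have : 0 <= 6 * (k * s ^+ 2) * v by rewrite !mulr_ge0.
by clear - h1 h2; move: (I _) (I _) h1 h2 => x y h1 h2; lra.
Qed.

(** The truncated field is the KdV field minus its high modes. Since [X] has degree less than [m],
    the quadratic part of [Psi] is orthogonal to these, and only [dJ] sees them. *)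
Lemma dPsi_galerkin m X : trig_deg m X -> I X = 0 ->
  dPsi G X (kdvW X) = 0 ->
  dPsi G X (P m (kdvW X)) = - dJ c G X (3%:R * D (Q m (X * X))).
Proof.
move=> mX X0 h.
have PW : P m (kdvW X) = kdvW X + tpC (-1) * (3%:R * D (Q m (X * X))).
  have -> : 3%:R * D (Q m (X * X)) = Q m (kdvW X).
    rewrite kdvWE QD QN -tpCn QZ Q_D (Q_deg (deg_Dn 3 mX)).
    by rewrite oppr0 add0r.
  by rewrite tpCN tpC1 mulN1r /Q /Pi I_kdvW tpC0 add0r; ring.
rewrite PW dPsiD h add0r dPsiZ mulN1r; congr (- _).
have h2 : I (Dn p.+1 X * Dn p.+1 (D (Q m (X * X)))) = 0.
  rewrite mulrC -Q_D -Q_Dn; have := Q_orth m (Dn p.+1 (D (X * X))) (Dn p.+1 X).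
  by rewrite -deg_Pi//; exact: deg_Dn.
by rewrite /dPsi -[in X in X + _ = _]tpCn DnCM (mulrCA (Dn p.+1 X)) IZ h2 mulr0 add0r.
Qed.

End invariance.

(** * Holomorphic functions and analytic maps *)

Section integral_segments.
Variable R : realType.
Implicit Types (f g : R -> R) (a b c M : R).

Definition itg f a b : R := \int[lebesgue_measure]_(x in `[a, b]) f x.

Lemma itg_integrable f a b : {within `[a, b], continuous f} ->
  lebesgue_measure.-integrable `[a, b] (EFin \o f).
Proof.
by move=> cf; apply: continuous_compact_integrable => //; exact: segment_compact.
Qed.

Lemma itg_cat f a b c : a <= b -> b <= c -> continuous f ->
  itg f a c = itg f a b + itg f b c.
Proof.
move=> ab bc cf; apply/eqP; rewrite addrC -subr_eq; apply/eqP.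
have h : lebesgue_measure.-integrable `[a, c] (EFin \o f).
  exact/itg_integrable/continuous_subspaceT.
rewrite /itg (Rintegral_itvB h)//= Rintegral_itv_obnd_cbnd//.
apply: integrableS h => //=.
by move=> x /=; rewrite !in_itv/= => /andP[bx ->]; rewrite (le_trans ab (ltW bx)).
Qed.

Lemma itgB f g a b : continuous f -> continuous g ->
  itg (fun x => f x - g x) a b = itg f a b - itg g a b.
Proof.
by move=> cf cg; rewrite /itg RintegralB//; exact/itg_integrable/continuous_subspaceT.
Qed.

Lemma itg_cst c a b : a <= b -> itg (fun=> c) a b = c * (b - a).
Proof.
move=> ab; rewrite /itg Rintegral_cst//= lebesgue_measure_itv/= lte_fin.
case: ltP => [ab'|ba]; first by rewrite -EFinD.
by rewrite (_ : a = b) ?subrr//; apply/eqP; rewrite eq_le ab ba.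
Qed.

Lemma itg_le M f a b : a <= b -> continuous f -> (forall x, a <= x <= b -> `|f x| <= M) ->
  `|itg f a b| <= M * (b - a).
Proof.
move=> ab cf fM; rewrite -(itg_cst M ab).
apply: le_trans (le_normr_Rintegral _ _) _ => //.
  exact/itg_integrable/continuous_subspaceT.
apply: le_Rintegral => //=.
- apply: itg_integrable; apply: continuous_subspaceT => x.
  by apply: continuous_comp; [exact: cf|exact: norm_continuous].
- by apply: itg_integrable; apply: continuous_subspaceT => x; exact: cvg_cst.
Qed.

End integral_segments.

Lemma dist_seg (R : realType) (a w u x : R) :
  a <= u <= a + w -> a <= x <= a + w -> `|u - x| <= w.
Proof. by move=> /andP[? ?] /andP[? ?]; apply/ler_normlP; split; lra. Qed.

(** * The theorem of Goursat on rectangles *)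

Section goursat.
Variable R : realType.
Variables P Q : R -> R -> R.

(* boundary integral of the pair [(P, Q)] over the rectangle with lower left
   corner [(a, c)], width [w] and height [h] *)
Let J a w c h := itg (fun y => P (a + w) y - P a y) c (c + h)
               - itg (fun x => Q x (c + h) - Q x c) a (a + w).

Hypotheses (Px : forall x, continuous (P x)) (Qy : forall y, continuous (Q^~ y)).

Let JX w1 w2 a c h : 0 <= w1 -> 0 <= w2 -> J a (w1 + w2) c h = J a w1 c h + J (a + w1) w2 c h.
Proof.
move=> w10 w20; rewrite /J.
have c1 y1 y2 : continuous (fun x => Q x y1 - Q x y2).
  by move=> x; apply: cvgB; exact: Qy.
rewrite (@itg_cat _ _ a (a + w1) (a + (w1 + w2))); [|lra|lra|exact: c1].
rewrite addrA !itgB; try (exact: Px || exact: Qy).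
by ring.
Qed.

Let JY h1 h2 a w c : 0 <= h1 -> 0 <= h2 -> J a w c (h1 + h2) = J a w c h1 + J a w (c + h1) h2.
Proof.
move=> w10 w20; rewrite /J.
have c1 y1 y2 : continuous (fun x => P y1 x - P y2 x).
  by move=> x; apply: cvgB; exact: Px.
rewrite (@itg_cat _ _ c (c + h1) (c + (h1 + h2))); [|lra|lra|exact: c1].
rewrite addrA !itgB; try (exact: Px || exact: Qy).
by ring.
Qed.

Variables a0 w0 c0 h0 : R.
Hypotheses (w00 : 0 < w0) (h00 : 0 < h0).
Hypothesis PQd : forall x y, a0 <= x <= a0 + w0 -> c0 <= y <= c0 + h0 ->
  exists A B A', forall eps, 0 < eps -> exists2 eta, 0 < eta &
  forall u v, `|u| <= eta -> `|v| <= eta ->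
   `|P (x + u) (y + v) - P x y - A * u - B * v| <= eps * (`|u| + `|v|) /\
   `|Q (x + u) (y + v) - Q x y - A' * u - A * v| <= eps * (`|u| + `|v|).

Let w n : R := w0 / 2 ^+ n.
Let h n : R := h0 / 2 ^+ n.

Let w_gt0 n : 0 < w n. Proof. by rewrite divr_gt0// exprn_gt0. Qed.
Let h_gt0 n : 0 < h n. Proof. by rewrite divr_gt0// exprn_gt0. Qed.
Let wS n : w n = w n.+1 + w n.+1.
Proof. by rewrite /w exprS; field; rewrite expf_neq0. Qed.
Let hS n : h n = h n.+1 + h n.+1.
Proof. by rewrite /h exprS; field; rewrite expf_neq0. Qed.

(** Repeated quartering: the boundary integral is additive, so one quarter keeps at least a quarter
    of it. Near the common point of the nested rectangles the first order parts cancel because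
    $P_x=Q_y$, and the boundary integral is negligible against the area. Differentiability at each
    point suffices; the derivatives need not be continuous. *)
Lemma goursat : J a0 w0 c0 h0 = 0.
Proof.
apply/eqP; rewrite -normr_le0 leNgt; apply/negP => J0.
(* Half of the ratio of the integral to the area, so that the strict inequality of [bad] holds at
   the start. *)
pose k := `|J a0 w0 c0 h0| / (2 * (w0 * h0)).
have k0 : 0 < k by rewrite divr_gt0// !mulr_gt0.
pose bad n (z : R * R) := k * (w n * h n) < `|J z.1 (w n) z.2 (h n)|.
have step n z : exists z', bad n z -> [/\ bad n.+1 z',
    z.1 <= z'.1 <= z.1 + w n.+1 & z.2 <= z'.2 <= z.2 + h n.+1].
  have := w_gt0 n.+1; have := h_gt0 n.+1.
  set x := w n.+1; set y := h n.+1 => y0 x0.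
  have [b1|b1] := pselect (bad n.+1 z); first by exists z; split=> //; lra.
  have [b2|b2] := pselect (bad n.+1 (z.1 + x, z.2)).
    by exists (z.1 + x, z.2); split=> //=; lra.
  have [b3|b3] := pselect (bad n.+1 (z.1, z.2 + y)).
    by exists (z.1, z.2 + y); split=> //=; lra.
  have [b4|b4] := pselect (bad n.+1 (z.1 + x, z.2 + y)).
    by exists (z.1 + x, z.2 + y); split=> //=; lra.
  exists z => B; exfalso; move: B b1 b2 b3 b4; rewrite /bad /= wS hS -/x -/y.
  rewrite JX ?(ltW x0)// !JY ?(ltW y0)//.
  move: (J _ _ _ _) (J _ _ _ _) (J _ _ _ _) (J _ _ _ _) => j1 j2 j3 j4.
  move=> B /negP; rewrite -leNgt => b1 /negP; rewrite -leNgt => b2.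
  move=> /negP; rewrite -leNgt => b3 /negP; rewrite -leNgt => b4.
  move: B; apply/negP; rewrite -leNgt.
  apply: le_trans (ler_normD _ _) _.
  apply: le_trans (lerD (ler_normD _ _) (ler_normD _ _)) _; nra.
have [F HF] := choice (fun nz : nat * (R * R) => step nz.1 nz.2).
pose z := fix z n := if n is m.+1 then F (m, z m) else (a0, c0).
have zbad n : bad n (z n).
  elim: n => [|n IH]; last by have [] := HF (n, z n) IH.
  rewrite /bad /= /w /h expr0 !divr1 /k.
  set A := w0 * h0; have A0 : 0 < A by rewrite mulr_gt0.
  have -> : `|J a0 w0 c0 h0| / (2 * A) * A = `|J a0 w0 c0 h0| / 2 by field; rewrite gt_eqF.
  by lra.
have zS n : [/\ (z n).1 <= (z n.+1).1, (z n.+1).1 + w n.+1 <= (z n).1 + w n,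
                (z n).2 <= (z n.+1).2 & (z n.+1).2 + h n.+1 <= (z n).2 + h n].
  have [_ /andP[u1 u2] /andP[v1 v2]] := HF (n, z n) (zbad n).
  by rewrite /= in u1 u2 v1 v2 *; split=> //; rewrite ?(wS n) ?(hS n) addrA lerD2r.
have nest (f g : nat -> R) : (forall n, 0 < g n) -> (forall n, f n <= f n.+1) ->
    (forall n, f n.+1 + g n.+1 <= f n + g n) ->
    exists x, forall n, f n <= x <= f n + g n.
  move=> g0 fS gS; exists (sup (range f)) => n.
  have up m : f n <= f (n + m)%N.
    by elim: m => [|m IH]; rewrite ?addn0// addnS (le_trans IH).
  have dn m : f (n + m)%N + g (n + m)%N <= f n + g n.
    by elim: m => [|m IH]; rewrite ?addn0// addnS (le_trans (gS _)).
  have ubf m : f m <= f n + g n.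
    have [/subnKC {1}<-|/ltnW mn] := leqP n m.
      by apply: (le_trans _ (dn (m - n)%N)); rewrite lerDl ltW.
    suff : f m <= f n by have := g0 n; lra.
    rewrite -(subnKC mn); elim: (n - m)%N => [|j IH]; first by rewrite addn0.
    by rewrite addnS (le_trans IH).
  apply/andP; split.
    apply: ub_le_sup; last by exists n.
    by exists (f n + g n) => _ [m _ <-].
  apply: ge_sup; first by exists (f 0%N); exists 0%N.
  by move=> _ [m _ <-].
have [x hx] := nest (fun n => (z n).1) w w_gt0 (fun n => let: And4 a _ _ _ := zS n in a)
  (fun n => let: And4 _ a _ _ := zS n in a).
have [y hy] := nest (fun n => (z n).2) h h_gt0 (fun n => let: And4 _ _ a _ := zS n in a)
  (fun n => let: And4 _ _ _ a := zS n in a).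
have hx0 := hx 0%N; have hy0 := hy 0%N.
rewrite /= /w /h expr0 !divr1 in hx0 hy0.
have [A [B [A' HD]]] := PQd hx0 hy0.
pose L := w0 + h0; have L0 : 0 < L by rewrite addr_gt0.
(* At level [n] the bound $2\epsilon(W+H)^2$ obtained below is then exactly [k] times the area of
   the rectangle. *)
pose eps := k * (w0 * h0) / (2 * L ^+ 2).
have eps0 : 0 < eps.
  by apply: divr_gt0; apply: mulr_gt0 => //; [exact: mulr_gt0|exact: exprn_gt0].
have [eta eta0 Heta] := HD eps eps0.
have [n hn] : exists n, w n <= eta /\ h n <= eta.
  have [n hn] : exists n : nat, (w0 + h0) / eta < n%:R.
    by have := archi_boundP (ltW (divr_gt0 L0 eta0)); exists (Num.bound (L / eta)).
  exists n.
  have n2 : (w0 + h0) <= eta * 2 ^+ n.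
    rewrite mulrC -ler_pdivrMr//; apply: le_trans (ltW hn) _.
    by rewrite -natrX ler_nat ltnW// ltn_expl.
  by split; rewrite ler_pdivrMr ?exprn_gt0//; apply: le_trans n2; rewrite /L ?lerDl ?lerDr ltW.
case: hn => wn hn.
have := zbad n; rewrite /bad; apply/negP; rewrite -leNgt.
have /andP[x1 x2] := hx n; have /andP[y1 y2] := hy n.
set a := (z n).1 in x1 x2 *; set c := (z n).2 in y1 y2 *.
have w0n := w_gt0 n; have h0n := h_gt0 n.
set W := w n in wn x2 w0n *; set H := h n in hn y2 h0n *.
have dP u v : a <= u <= a + W -> c <= v <= c + H ->
    `|P u v - P x y - A * (u - x) - B * (v - y)| <= eps * (W + H) /\
    `|Q u v - Q x y - A' * (u - x) - A * (v - y)| <= eps * (W + H).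
  move=> /andP[u1 u2] /andP[v1 v2].
  have ux : `|u - x| <= W by apply: (dist_seg (a := a)); rewrite ?u1 ?x1.
  have vy : `|v - y| <= H by apply: (dist_seg (a := c)); rewrite ?v1 ?y1.
  have [] := Heta (u - x) (v - y) (le_trans ux wn) (le_trans vy hn).
  rewrite !(addrC x) !(addrC y) !subrK => p1 p2.
  by split; [apply: le_trans p1 _|apply: le_trans p2 _]; rewrite ler_pM2l// lerD.
have aW : a <= a + W by rewrite lerDl ltW.
have cH : c <= c + H by rewrite lerDl ltW.
have aW1 : a <= a + W <= a + W by rewrite aW lexx.
have aW0 : a <= a <= a + W by rewrite lexx aW.
have cH1 : c <= c + H <= c + H by rewrite cH lexx.
have cH0 : c <= c <= c + H by rewrite lexx cH.
have B1 : `|itg (fun y => P (a + W) y - P a y) c (c + H) - A * W * H| <= 2 * eps * (W + H) * H.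
  have -> : A * W * H = itg (fun=> A * W) c (c + H) by rewrite itg_cst//; ring.
  rewrite -itgB; [|by move=> v; apply: cvgB; exact: Px|by move=> v; exact: cvg_cst].
  rewrite [X in _ <= _ * X](_ : H = c + H - c); last by ring.
  apply: itg_le => //; first by move=> v; apply: cvgB; [apply: cvgB; exact: Px|exact: cvg_cst].
  move=> v vH; have [p1 _] := dP (a + W) v aW1 vH.
  have [p2 _] := dP a v aW0 vH.
  rewrite (_ : P (a + W) v - P a v - A * W = (P (a + W) v - P x y - A * (a + W - x) -
    B * (v - y)) - (P a v - P x y - A * (a - x) - B * (v - y))); last by ring.
  rewrite (_ : 2 * eps * (W + H) = eps * (W + H) + eps * (W + H)); last by ring.
  by apply: le_trans (ler_normB _ _) _; exact: lerD.
have B2 : `|itg (fun x => Q x (c + H) - Q x c) a (a + W) - A * H * W| <= 2 * eps * (W + H) * W.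
  have -> : A * H * W = itg (fun=> A * H) a (a + W) by rewrite itg_cst//; ring.
  rewrite -itgB; [|by move=> v; apply: cvgB; exact: Qy|by move=> v; exact: cvg_cst].
  rewrite [X in _ <= _ * X](_ : W = a + W - a); last by ring.
  apply: itg_le => //; first by move=> v; apply: cvgB; [apply: cvgB; exact: Qy|exact: cvg_cst].
  move=> u uW; have [_ p1] := dP u (c + H) uW cH1.
  have [_ p2] := dP u c uW cH0.
  rewrite (_ : Q u (c + H) - Q u c - A * H = (Q u (c + H) - Q x y - A' * (u - x) -
    A * (c + H - y)) - (Q u c - Q x y - A' * (u - x) - A * (c - y))); last by ring.
  rewrite (_ : 2 * eps * (W + H) = eps * (W + H) + eps * (W + H)); last by ring.
  by apply: le_trans (ler_normB _ _) _; exact: lerD.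
have B3 : `|J a W c H| <= 2 * eps * (W + H) ^+ 2.
  rewrite /J; set i1 := itg _ c _ in B1 *; set i2 := itg _ a _ in B2 *.
  rewrite (_ : i1 - i2 = (i1 - A * W * H) - (i2 - A * H * W)); last by ring.
  rewrite (_ : 2 * eps * (W + H) ^+ 2 = 2 * eps * (W + H) * H + 2 * eps * (W + H) * W).
    by apply: le_trans (ler_normB _ _) _; exact: lerD.
  by ring.
apply: le_trans B3 _.
have -> : W + H = L / 2 ^+ n by rewrite /W /H /w /h /L; field; rewrite expf_neq0.
have -> : W * H = w0 * h0 / (2 ^+ n * 2 ^+ n) by rewrite /W /H /w /h; field; rewrite expf_neq0.
rewrite /eps le_eqVlt; apply/orP; left; apply/eqP; field.
by rewrite expf_neq0// gt_eqF.
Qed.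

End goursat.

(** * Complex derivatives and Cauchy estimates *)

Section complex_derivative.
Variable R : realType.
Local Notation C := R[i].
Implicit Types (f g : C -> C) (z w x D : C) (eps eta r K : R).
Local Open Scope complex_scope.

(** Complex differentiability in terms of the real modulus and with explicit derivative, so that all
    estimates stay inequalities between real numbers. *)
Definition cdiff f z D := forall eps, 0 < eps -> exists2 eta, 0 < eta &
  forall x, modc x <= eta -> modc (f (z + x) - f z - x * D) <= eps * modc x.

Lemma modcN x : modc (- x) = modc x.
Proof. by apply: (@complexI R); rewrite !modcE normrN. Qed.
Lemma modcB x y : modc (x - y) <= modc x + modc y.
Proof. by rewrite -(modcN y) modcD. Qed.
Lemma modc_sqr x : modc x ^+ 2 = complex.Re x ^+ 2 + complex.Im x ^+ 2.
Proof.
case: x => a b; apply: (@complexI R); rewrite rmorphXn /= modcE normc_def -rmorphXn /=.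
by rewrite sqr_sqrtr // addr_ge0 ?sqr_ge0.
Qed.
Lemma Re_le_modc x : `|complex.Re x| <= modc x.
Proof.
rewrite -ler_sqr ?nnegrE ?modc_ge0// modc_sqr real_normK ?num_real// lerDl; exact: sqr_ge0.
Qed.
Lemma Im_le_modc x : `|complex.Im x| <= modc x.
Proof.
rewrite -ler_sqr ?nnegrE ?modc_ge0// modc_sqr real_normK ?num_real// lerDr; exact: sqr_ge0.
Qed.
Lemma modc_le_ReIm x : modc x <= `|complex.Re x| + `|complex.Im x|.
Proof.
rewrite -ler_sqr ?nnegrE ?modc_ge0 ?addr_ge0// modc_sqr sqrrD !real_normK ?num_real//.
by rewrite lerD2r lerDl mulrn_wge0// mulr_ge0.
Qed.
Lemma modc1 : modc (1 : C) = 1.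
Proof. by rewrite (_ : 1 = 1%:C) // modc_real normr1. Qed.
Lemma modcV x : x != 0 -> modc x^-1 = (modc x)^-1.
Proof.
move=> x0; have m0 : modc x != 0 by apply: contraNneq x0 => /modc_eq0 ->.
by apply: (mulfI m0); rewrite -modcM !mulfV// modc1.
Qed.
Lemma modc_gt0 x : x != 0 -> 0 < modc x.
Proof. by move=> x0; rewrite lt_neqAle modc_ge0 andbT eq_sym; apply: contraNneq x0 => /modc_eq0 ->. Qed.

Lemma cdiff_lip f z D : cdiff f z D -> exists2 eta, 0 < eta &
  forall x, modc x <= eta -> modc (f (z + x) - f z) <= (modc D + 1) * modc x.
Proof.
move=> /(_ _ ltr01)[eta e0 H]; exists eta => // x /H {}H.
rewrite -[f _ - _](subrK (x * D)); apply: le_trans (modcD _ _) _.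
by rewrite modcM mulrDl addrC (mulrC (modc D)) lerD2l.
Qed.

Lemma cdiff_ext f g z D : f =1 g -> cdiff f z D -> cdiff g z D.
Proof.
move=> fg H eps /H[eta e0 {}H]; exists eta => // x.
by rewrite -!fg; exact: H.
Qed.

Lemma cdiff_cst c z : cdiff (fun=> c) z 0.
Proof.
move=> eps e0; exists 1 => // x _.
by rewrite subrr mulr0 subrr modc0 mulr_ge0 ?modc_ge0// ltW.
Qed.

Lemma cdiffD f g z D E : cdiff f z D -> cdiff g z E -> cdiff (fun w => f w + g w) z (D + E).
Proof.
move=> hf hg eps e0; have e2 : 0 < eps / 2 by rewrite divr_gt0.
have [a a0 Ha] := hf _ e2; have [b b0 Hb] := hg _ e2.
exists (Num.min a b); first by rewrite lt_min a0.
move=> x; rewrite le_min => /andP[/Ha {}Ha /Hb {}Hb].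
rewrite (_ : _ - _ = (f (z + x) - f z - x * D) + (g (z + x) - g z - x * E)); last by ring.
by apply: le_trans (modcD _ _) _; have := lerD Ha Hb; rewrite -mulrDl -splitr.
Qed.

Lemma cdiffM f g z D E : cdiff f z D -> cdiff g z E ->
  cdiff (fun w => f w * g w) z (D * g z + f z * E).
Proof.
move=> hf hg eps e0.
pose M := modc (f z) + modc (g z) + modc D + modc E + 2.
have m1 := modc_ge0 (f z); have m2 := modc_ge0 (g z).
have m3 := modc_ge0 D; have m4 := modc_ge0 E.
have M0 : 0 < M by rewrite /M; lra.
have e2 : 0 < eps / (3 * M) by rewrite divr_gt0// mulr_gt0.
have [a a0 Ha] := hf _ e2; have [b b0 Hb] := hg _ e2.
have [a' a0' Ha'] := cdiff_lip hf; have [b' b0' Hb'] := cdiff_lip hg.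
pose d := eps / (3 * M * M).
have d0 : 0 < d by rewrite divr_gt0// !mulr_gt0.
exists (Num.min (Num.min a b) (Num.min (Num.min a' b') d)).
  by rewrite !lt_min a0 b0 a0' b0' d0.
move=> x; rewrite !le_min => /andP[/andP[/Ha {}Ha /Hb {}Hb] /andP[/andP[/Ha' {}Ha' /Hb' {}Hb'] xd]].
rewrite (_ : _ - _ = (f (z + x) - f z - x * D) * g z + (g (z + x) - g z - x * E) * f z +
   (f (z + x) - f z) * (g (z + x) - g z)); last by ring.
apply: le_trans (modcD _ _) _; apply: le_trans (lerD (modcD _ _) (lexx _)) _.
rewrite !modcM.
have x0 := modc_ge0 x.
have e3 : eps / (3 * M) * M = eps / 3 by field; rewrite gt_eqF.
have f1 : modc (f (z + x) - f z - x * D) * modc (g z) <= eps / 3 * modc x.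
  rewrite -e3 mulrAC; apply: ler_pM; rewrite ?modc_ge0//.
  by rewrite /M; lra.
have f2 : modc (g (z + x) - g z - x * E) * modc (f z) <= eps / 3 * modc x.
  rewrite -e3 mulrAC; apply: ler_pM; rewrite ?modc_ge0//.
  by rewrite /M; lra.
have f3 : modc (f (z + x) - f z) * modc (g (z + x) - g z) <= eps / 3 * modc x.
  apply: le_trans (ler_pM (modc_ge0 _) (modc_ge0 _) Ha' Hb') _.
  rewrite mulrACA mulrA ler_wpM2r// (_ : eps / 3 = M * M * d); last first.
    by rewrite /d; field; rewrite gt_eqF.
  by rewrite ler_pM ?mulr_ge0 ?addr_ge0// ler_pM ?addr_ge0// /M; lra.
rewrite (_ : eps * modc x = eps / 3 * modc x + eps / 3 * modc x + eps / 3 * modc x); last by field.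
by apply: lerD => //; exact: lerD.
Qed.

Lemma cdiff_comp f g z D E : cdiff g z E -> cdiff f (g z) D ->
  cdiff (fun w => f (g w)) z (E * D).
Proof.
move=> hg hf eps e0.
have m3 := modc_ge0 D; have m4 := modc_ge0 E.
have e1 : 0 < eps / (2 * (modc E + 1)) by rewrite divr_gt0// mulr_gt0//; lra.
have e2 : 0 < eps / (2 * (modc D + 1)) by rewrite divr_gt0// mulr_gt0//; lra.
have [a a0 Ha] := hf _ e1; have [b b0 Hb] := hg _ e2.
have [b' b0' Hb'] := cdiff_lip hg.
exists (Num.min (Num.min b b') (a / (modc E + 1))).
  by rewrite !lt_min b0 b0' divr_gt0//; lra.
move=> x; rewrite !le_min => /andP[/andP[/Hb {}Hb /Hb' {}Hb'] xd].
have x0 := modc_ge0 x.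
set y := g (z + x) - g z in Hb Hb'.
have ya : modc y <= a.
  by apply: le_trans Hb' _; rewrite mulrC -ler_pdivlMr//; lra.
have gy : g z + y = g (z + x) by rewrite /y; ring.
have {}Ha := Ha _ ya; rewrite gy in Ha.
rewrite (_ : _ - _ = (f (g (z + x)) - f (g z) - y * D) + (y - x * E) * D); last by ring.
apply: le_trans (modcD _ _) _; rewrite modcM.
rewrite (_ : eps * modc x = eps / 2 * modc x + eps / 2 * modc x); last by field.
apply: lerD.
  apply: le_trans Ha _; apply: le_trans (ler_wpM2l (ltW e1) Hb') _.
  rewrite mulrA (_ : eps / (2 * (modc E + 1)) * (modc E + 1) = eps / 2) //.
  by field; rewrite gt_eqF//; lra.
apply: le_trans (ler_pM (modc_ge0 _) m3 Hb (ltac:(lra) : modc D <= modc D + 1)) _.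
rewrite mulrAC (_ : eps / (2 * (modc D + 1)) * (modc D + 1) = eps / 2) //.
by field; rewrite gt_eqF//; lra.
Qed.

Lemma cdiff_lin a z : cdiff (fun w => a * w) z a.
Proof.
move=> eps e0; exists 1 => // x _.
by rewrite (_ : _ - _ = 0) ?modc0 ?mulr_ge0 ?modc_ge0 ?ltW//; ring.
Qed.

Lemma cdiff_shift f a z D : cdiff f (a + z) D -> cdiff (fun w => f (a + w)) z D.
Proof.
move=> H eps /H[eta e0 {}H]; exists eta => // x xe.
by rewrite addrA; exact: H.
Qed.

Lemma cdiff_uniq f z D E : cdiff f z D -> cdiff f z E -> D = E.
Proof.
move=> hD hE; apply/eqP; rewrite -subr_eq0; apply/eqP/modc_eq0.
apply/eqP; rewrite eq_le modc_ge0 andbT leNgt; apply/negP => d0.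
have e0 : 0 < modc (D - E) / 4 by rewrite divr_gt0.
have [a a0 Ha] := hD _ e0; have [b b0 Hb] := hE _ e0.
pose t := Num.min a b; have t0 : 0 < t by rewrite lt_min a0.
have mt : modc t%:C = t by rewrite modc_real ger0_norm// ltW.
have := Ha t%:C; rewrite mt ge_min lexx => /(_ isT) {}Ha.
have := Hb t%:C; rewrite mt ge_min lexx orbT => /(_ isT) {}Hb.
have : modc (t%:C * (D - E)) <= modc (D - E) / 4 * t + modc (D - E) / 4 * t.
  rewrite (_ : t%:C * _ = (f (z + t%:C) - f z - t%:C * E) - (f (z + t%:C) - f z - t%:C * D)).
    by apply: le_trans (modcB _ _) _; exact: lerD.
  by ring.
by rewrite modcM mt; nra.
Qed.

Lemma is_derive_eps (h : R -> R) (x d : R) : is_derive x 1 h d ->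
  forall eps : R, 0 < eps -> exists2 eta : R, 0 < eta &
  forall t, `|t| <= eta -> `|h (x + t) - h x - t * d| <= eps * `|t|.
Proof.
move=> [dh <-] eps e0.
have hl : (fun t => t^-1 *: ((h \o shift x) (t *: 1) - h x)) @ 0^' --> 'D_1 h x by exact: dh.
move/cvgrPdist_le : hl => /(_ _ e0); rewrite near_withinE => /nbhs_ballP[eta /= eta0 H].
exists (eta / 2); first by rewrite divr_gt0.
move=> t te; have [->|t0] := eqVneq t 0.
  by rewrite addr0 subrr mul0r subrr normr0 mulr0.
have := H t; rewrite /ball /= sub0r normrN => /(_ _ t0).
have tt : `|t| < eta by apply: le_lt_trans te _; rewrite ltr_pdivrMr// ltr_pMr// ltr1n.
move=> /(_ tt); rewrite /GRing.scale /= mulr1 (addrC t) => {}H.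
rewrite -(ler_pM2l (_ : 0 < `|t|^-1)) ?invr_gt0 ?normr_gt0//.
rewrite -normfV -normrM mulrCA -normrM mulVf// normr1 mulr1.
rewrite mulrBr mulrA mulVf// mul1r distrC.
exact: H.
Qed.

Definition cexp w : C := (expR (complex.Re w) * cos (complex.Im w)) +i*
                         (expR (complex.Re w) * sin (complex.Im w)).

Lemma cexpD w x : cexp (w + x) = cexp w * cexp x.
Proof.
case: w x => a b [c d]; rewrite /cexp /= expRD cosD sinD.
by apply/eqP; rewrite eq_complex /=; apply/andP; split; apply/eqP; ring.
Qed.

Lemma cexp0 : cexp 0 = 1.
Proof. by rewrite /cexp /= expR0 cos0 sin0 mulr0 mulr1. Qed.

Lemma modc_cexp w : modc (cexp w) = expR (complex.Re w).
Proof.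
apply/eqP; rewrite -(eqrXn2 (n := 2))// ?modc_ge0 ?expR_ge0// modc_sqr /cexp /=.
by rewrite !exprMn -mulrDr cos2Dsin2 mulr1.
Qed.

Lemma cexp_neq0 w : cexp w != 0.
Proof. by apply/eqP => E; have := modc_cexp w; rewrite E modc0; have := expR_gt0 (complex.Re w); lra. Qed.

Lemma cexp_diff0 : cdiff cexp 0 1.
Proof.
move=> eps e0.
pose d := Num.min 1 (eps / 8).
have d0 : 0 < d by rewrite lt_min ltr01 divr_gt0.
have d1 : d <= 1 by rewrite ge_min lexx.
have d2 : d <= eps / 8 by rewrite ge_min lexx orbT.
have [a a0 Ha] := is_derive_eps (is_derive_expR 0) d0.
have [b b0 Hb] := is_derive_eps (is_derive_cos 0) d0.
have [c c0 Hc] := is_derive_eps (is_derive_sin 0) d0.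
exists (Num.min (Num.min a b) (Num.min c (d / 2))).
  by rewrite !lt_min a0 b0 c0 divr_gt0.
move=> x; rewrite !le_min => /andP[/andP[xa xb] /andP[xc xd]].
have := Re_le_modc x; have := Im_le_modc x; have x0 := modc_ge0 x.
move: (modc x) x0 xa xb xc xd => m m0 ma mb mc md.
rewrite add0r cexp0 mulr1; case: x => u v /= vm um.
have := Ha u (le_trans um ma); have := Hb v (le_trans vm mb); have := Hc v (le_trans vm mc).
rewrite !add0r expR0 cos0 sin0 !mulr1 !oppr0 !mulr0 !subr0.
rewrite addr0 => s1 c1 e1; apply: le_trans (modc_le_ReIm _) _.
rewrite /cexp /= oppr0 addr0.
have eu : expR u <= 3.
  move: e1 => /ler_normlP[_]; have : `|u| <= 1 by lra.
  by move=> /ler_normlP[]; nra.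
have e0u := expR_ge0 u.
have eu1 : `|expR u - 1| <= 2 * `|u|.
  rewrite (_ : expR u - 1 = (expR u - 1 - u) + u); last by ring.
  by apply: le_trans (ler_normD _ _) _; have := normr_ge0 u; nra.
have r1 : `|expR u * cos v - 1 - u| <= 4 * d * m.
  rewrite (_ : _ - _ = expR u * (cos v - 1) + (expR u - 1 - u)); last by ring.
  apply: le_trans (ler_normD _ _) _; rewrite normrM (ger0_norm e0u).
  have := normr_ge0 (cos v - 1); nra.
have r2 : `|expR u * sin v + 0 - v| <= 4 * d * m.
  rewrite (_ : _ - _ = expR u * (sin v - v) + (expR u - 1) * v); last by ring.
  apply: le_trans (ler_normD _ _) _; rewrite !normrM (ger0_norm e0u).
  have h1 : expR u * `|sin v - v| <= 3 * (d * m).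
    by apply: ler_pM => //; apply: le_trans s1 _; rewrite ler_pM2l.
  have h2 : `|expR u - 1| * `|v| <= (2 * m) * (d / 2).
    by apply: ler_pM => //; [lra|apply: le_trans vm md].
  lra.
have : eps * m >= 8 * d * m by nra.
by move: r1 r2; rewrite addr0; lra.
Qed.

Lemma cexp_diff w : cdiff cexp w (cexp w).
Proof.
move=> eps e0; have m0 : 0 < modc (cexp w) by rewrite modc_gt0// cexp_neq0.
have [eta eta0 H] := cexp_diff0 (divr_gt0 e0 m0).
exists eta => // x /H {}H.
rewrite cexpD (_ : _ - _ = cexp w * (cexp x - 1 - x * 1)); last by ring.
rewrite modcM; rewrite add0r cexp0 in H.
by apply: le_trans (ler_wpM2l (ltW m0) H) _; rewrite mulrA mulrCA mulfV ?mulr1// gt_eqF.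
Qed.

Lemma cdiff_continuous f z D : cdiff f z D -> forall eps, 0 < eps ->
  exists2 eta, 0 < eta & forall x, modc x <= eta -> modc (f (z + x) - f z) <= eps.
Proof.
move=> /cdiff_lip[eta eta0 H] eps e0; have m0 := modc_ge0 D.
exists (Num.min eta (eps / (modc D + 1))).
  by rewrite lt_min eta0 divr_gt0//; lra.
move=> x; rewrite le_min => /andP[/H {}H xe]; apply: le_trans H _.
by rewrite mulrC -ler_pdivlMr//; lra.
Qed.

Lemma Re_sub (x y : C) : complex.Re (x - y) = complex.Re x - complex.Re y.
Proof. by case: x y => ? ? []. Qed.
Lemma Im_sub (x y : C) : complex.Im (x - y) = complex.Im x - complex.Im y.
Proof. by case: x y => ? ? []. Qed.
Lemma Re_add (x y : C) : complex.Re (x + y) = complex.Re x + complex.Re y.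
Proof. by case: x y => ? ? []. Qed.
Lemma Re_mul (x y : C) : complex.Re (x * y) =
  complex.Re x * complex.Re y - complex.Im x * complex.Im y.
Proof. by case: x y => ? ? []. Qed.
Lemma Im_mul (x y : C) : complex.Im (x * y) =
  complex.Re x * complex.Im y + complex.Im x * complex.Re y.
Proof. by case: x y => ? ? []. Qed.

Lemma cont_eps (h : R -> R) :
  (forall x eps : R, 0 < eps -> exists2 eta : R, 0 < eta &
     forall u, `|u| <= eta -> `|h (x + u) - h x| <= eps) -> continuous h.
Proof.
move=> H x; apply/cvgrPdist_le => eps e0; have [eta eta0 {}H] := H x eps e0.
apply/nbhs_ballP; exists eta => // t; rewrite /ball /= => /ltW xt.
have := H (t - x); rewrite (_ : x + (t - x) = t); last by ring.
by rewrite distrC => /(_ xt); rewrite distrC.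
Qed.

(* Cauchy estimate. In logarithmic polar coordinates [z + cexp (x + iy)] the
   function [(f (z + cexp w) - f z) / cexp w] is holomorphic and [2 i pi]-periodic,
   so by Goursat its integral over [y] does not depend on [x]; it tends to
   [2 pi f'(z)] as [x] tends to [- oo]. *)
Lemma cauchy_Re f z D r K : 0 < r ->
  (forall x, modc x <= r -> exists E, cdiff f (z + x) E) ->
  (forall x, modc x <= r -> modc (f (z + x)) <= K) ->
  cdiff f z D -> `|complex.Re D| <= 4 * K / r.
Proof.
move=> r0 fd fK fD.
pose g w := (f (z + cexp w) - f z) * cexp (- w).
pose L := ln r; have eL : expR L = r by rewrite lnK.
have gd w : complex.Re w <= L -> exists E, cdiff g w E.
  move=> wL; have [E hE] := fd (cexp w) (ltac:(by rewrite modc_cexp -eL ler_expR)).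
  have h1 : cdiff (fun w => f (z + cexp w)) w (cexp w * E).
    exact: (cdiff_comp (cexp_diff w) (cdiff_shift hE)).
  have h2 : cdiff (fun w => cexp (- w)) w (-1 * cexp (- w)).
    have h : cdiff (fun w => -1 * w) w (-1) := cdiff_lin _ _.
    apply: (@cdiff_ext (fun w => cexp (-1 * w))); first by move=> y; rewrite mulN1r.
    by apply: cdiff_comp h _; rewrite mulN1r; exact: cexp_diff.
  have h3 := cdiffM (cdiffD h1 (cdiff_cst (- f z) w)) h2.
  by eexists; exact: h3.
(* Clamping at [L] makes [P] and [Q] continuous on the whole plane, as [goursat] asks, although [g]
   is controlled only where the real part is at most [L]. *)
pose P (x y : R) : R := complex.Re (g (Num.min x L +i* y)).
pose Q (x y : R) : R := complex.Im (g (Num.min x L +i* y)).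
have minle (x : R) : Num.min x L <= L by rewrite ge_min lexx orbT.
have PQc (x y eps : R) : 0 < eps -> exists2 eta : R, 0 < eta & forall u v : R, `|u| <= eta -> `|v| <= eta ->
    `|P (x + u) (y + v) - P x y| <= eps /\ `|Q (x + u) (y + v) - Q x y| <= eps.
  move=> e0; have [E hE] := gd (Num.min x L +i* y) (minle x).
  have [eta eta0 H] := cdiff_continuous hE e0.
  exists (eta / 2); first by rewrite divr_gt0.
  move=> u v ue ve.
  have mu : `|Num.min (x + u) L - Num.min x L| <= `|u|.
    have u1 := ler_norm u; have := ler_norm (- u); rewrite normrN => u2.
    by apply/ler_normlP; rewrite !minEle; do 2 case: ifPn; rewrite -?ltNge => ? ?; split; lra.
  have := H ((Num.min (x + u) L - Num.min x L) +i* v).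
  have -> : Num.min x L +i* y + (Num.min (x + u) L - Num.min x L) +i* v =
      Num.min (x + u) L +i* (y + v).
    by apply/eqP; rewrite eq_complex /=; apply/andP; split => //; apply/eqP; ring.
  have hm : modc ((Num.min (x + u) L - Num.min x L) +i* v) <= eta.
    by apply: le_trans (modc_le_ReIm _) _ => /=; lra.
  move=> /(_ hm) {}H; split.
    by rewrite /P -Re_sub; apply: le_trans (Re_le_modc _) H.
  by rewrite /Q -Im_sub; apply: le_trans (Im_le_modc _) H.
have cP (x : R) : continuous (P x).
  apply: cont_eps => y eps e0; have [eta eta0 H] := PQc x y eps e0.
  exists eta => // u ue; have := H 0 u; rewrite normr0 addr0 => /(_ (ltW eta0) ue)[].
  by [].
have cQ (y : R) : continuous (Q^~ y).
  apply: cont_eps => x eps e0; have [eta eta0 H] := PQc x y eps e0.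
  exists eta => // u ue; have := H u 0; rewrite normr0 addr0 => /(_ ue (ltW eta0))[].
  by [].
(* The contour is the circle of radius [r / 2], on which the quotient is at most [2 * K] divided by
   [r / 2]. *)
pose b := ln (r / 2); have r20 : 0 < r / 2 by rewrite divr_gt0.
have eb : expR b = r / 2 by rewrite lnK.
have bL : b < L by rewrite -ltr_expR eb eL ltr_pdivrMr// ltr_pMr// ltr1n.
have pi0 := pi_gt0 R.
have PQd (w : R) : 0 < w -> forall x y : R, b - w <= x <= b - w + w -> 0 <= y <= 0 + 2 * pi ->
    exists A B A' : R, forall eps : R, 0 < eps -> exists2 eta : R, 0 < eta &
  forall u v, `|u| <= eta -> `|v| <= eta ->
   `|P (x + u) (y + v) - P x y - A * u - B * v| <= eps * (`|u| + `|v|) /\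
   `|Q (x + u) (y + v) - Q x y - A' * u - A * v| <= eps * (`|u| + `|v|).
  move=> w0 x y /andP[_]; rewrite subrK => xb _.
  have xL : x < L := le_lt_trans xb bL.
  have [E hE] := gd (x +i* y) (ltW xL).
  exists (complex.Re E), (- complex.Im E), (complex.Im E) => eps e0.
  have [eta eta0 H] := hE _ e0.
  exists (Num.min (eta / 2) (L - x)); first by rewrite lt_min divr_gt0// subr_gt0.
  move=> u v; rewrite !le_min => /andP[ue uL] /andP[ve _].
  have u1 := ler_norm u.
  have m1 : Num.min x L = x by apply/min_idPl/ltW.
  have m2 : Num.min (x + u) L = x + u by apply/min_idPl; lra.
  have hm : modc (u +i* v) <= eta.
    by apply: le_trans (modc_le_ReIm _) _ => /=; lra.
  have := H _ hm.
  have -> : x +i* y + u +i* v = (x + u) +i* (y + v) by [].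
  set d := g _ - _ - _ => {}H.
  have {}H : modc d <= eps * (`|u| + `|v|).
    by apply: le_trans H _; rewrite ler_pM2l//; apply: le_trans (modc_le_ReIm _) _.
  have E1 : P (x + u) (y + v) - P x y - complex.Re E * u - - complex.Im E * v = complex.Re d.
    rewrite /P m1 m2 /d !Re_sub (Re_mul (u +i* v)).
    by move: (g ((x + u) +i* (y + v))) (g (x +i* y)) => g1 g2 /=; ring.
  have E2 : Q (x + u) (y + v) - Q x y - complex.Im E * u - complex.Re E * v = complex.Im d.
    rewrite /Q m1 m2 /d !Im_sub (Im_mul (u +i* v)).
    by move: (g ((x + u) +i* (y + v))) (g (x +i* y)) => g1 g2 /=; ring.
  split; first by rewrite E1; apply: le_trans (Re_le_modc _) H.
  by rewrite E2; apply: le_trans (Im_le_modc _) H.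
have Qper (x : R) : Q x (0 + 2 * pi) = Q x 0.
  rewrite add0r /Q; congr complex.Im; rewrite /g.
  have c2 : cos (2 * pi : R) = 1 by rewrite mulrC mulr_natr cos2pi.
  have s2 : sin (2 * pi : R) = 0 by rewrite mulrC mulr_natr sin2pi.
  have -> : cexp (Num.min x L +i* (2 * pi)) = cexp (Num.min x L +i* 0).
    by rewrite /cexp /= c2 s2 cos0 sin0.
  have -> : cexp (- (Num.min x L +i* (2 * pi))) = cexp (- (Num.min x L +i* 0)).
    by rewrite /cexp /= !cosN !sinN c2 s2 cos0 sin0.
  by [].
have invar (w : R) : 0 < w -> itg (P (b - w)) 0 (2 * pi) = itg (P b) 0 (2 * pi).
  move=> w0; have p20 : 0 < 2 * pi :> R by rewrite mulr_gt0.
  have := goursat cP cQ w0 p20 (PQd w w0).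
  rewrite subrK add0r.
  have -> : itg (fun x : R => Q x (2 * pi) - Q x 0) (b - w) b = 0.
    rewrite (_ : (fun x : R => _) = fun=> 0); first by rewrite itg_cst ?mul0r//; lra.
    by apply/funext => x; rewrite -Qper add0r subrr.
  rewrite subr0 itgB; [|exact: cP|exact: cP].
  by move/subr0_eq/esym.
have near_D (eps : R) : 0 < eps -> exists2 w : R, 0 < w & forall y, `|P (b - w) y - complex.Re D| <= eps.
  move=> e0; have [eta eta0 H] := fD _ e0.
  exists (Num.max 1 (b - ln eta)); first by rewrite lt_max ltr01.
  set w := Num.max _ _ => y.
  have we : b - w <= ln eta.
    by have : b - ln eta <= w; [rewrite le_max lexx orbT|lra].
  have w1 : 1 <= w by rewrite le_max lexx.
  have -> : P (b - w) y - complex.Re D = complex.Re (g ((b - w) +i* y) - D).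
    by rewrite /P Re_sub (_ : Num.min _ _ = b - w)//; apply/min_idPl; lra.
  apply: le_trans (Re_le_modc _) _; rewrite /g; set v := _ +i* y.
  have := H (cexp v); rewrite modc_cexp /=.
  have -> : expR (b - w) <= eta by rewrite -[leRHS]lnK// ler_expR.
  move=> /(_ isT) {}H.
  have cc : cexp v * cexp (- v) = 1 by rewrite -cexpD subrr cexp0.
  have -> : (f (z + cexp v) - f z) * cexp (- v) - D =
     (f (z + cexp v) - f z - cexp v * D) * cexp (- v).
    by rewrite [RHS]mulrBl mulrAC cc mul1r.
  rewrite modcM modc_cexp /=; apply: le_trans (ler_wpM2r (expR_ge0 _) H) _.
  by rewrite -mulrA -expRD subrr expR0 mulr1.
have p20 : 0 <= 2 * pi :> R by lra.
have cst_c (k : R) : continuous (fun _ : R => k) by move=> ?; exact: cvg_cst.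
have val : itg (P b) 0 (2 * pi) = complex.Re D * (2 * pi).
  apply/eqP; rewrite -subr_eq0 -normr_le0 leNgt; apply/negP.
  set t := `|_| => t0; have e0 : 0 < t / 2 / (2 * pi) by rewrite !divr_gt0// mulr_gt0.
  have [w w0 H] := near_D _ e0.
  have : `|itg (fun y => P (b - w) y - complex.Re D) 0 (2 * pi)| <=
      t / 2 / (2 * pi) * (2 * pi - 0).
    apply: itg_le => //; first by move=> y; apply: cvgB; [exact: cP|exact: cst_c].
  rewrite itgB; [|exact: cP|exact: cst_c].
  rewrite itg_cst// invar// subr0 -/t.
  rewrite divfK; last by rewrite gt_eqF// mulr_gt0.
  by lra.
have K0 x : modc x <= r -> modc (f (z + x) - f z) <= 2 * K.
  move=> xr; apply: le_trans (modcB _ _) _; have := fK x xr; have := fK 0.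
  by rewrite modc0 addr0 => /(_ (ltW r0)); lra.
have bnd : `|itg (P b) 0 (2 * pi)| <= 4 * K / r * (2 * pi - 0).
  apply: itg_le => // y _; apply: le_trans (Re_le_modc _) _.
  have -> : Num.min b L = b by apply/min_idPl/ltW.
  rewrite /g modcM modc_cexp /= expRN eb.
  have -> : 4 * K / r = 2 * K * (r / 2)^-1 by field; rewrite gt_eqF.
  rewrite ler_wpM2r ?invr_ge0 ?(ltW r20)// K0// modc_cexp /= eb.
  by clear -r0; lra.
move: bnd; rewrite val subr0 normrM (ger0_norm p20) ler_pM2r//.
by rewrite mulr_gt0.
Qed.

(** The estimate of the real part is applied to [f] and to $-if$, which doubles the constant. *)
Lemma cauchy_bound f z D r K : 0 < r ->
  (forall x, modc x <= r -> exists E, cdiff f (z + x) E) ->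
  (forall x, modc x <= r -> modc (f (z + x)) <= K) ->
  cdiff f z D -> modc D <= 8 * K / r.
Proof.
move=> r0 fd fK fD; apply: le_trans (modc_le_ReIm _) _.
have h1 := cauchy_Re r0 fd fK fD.
have mi : modc (0 -i* 1 : C) = 1.
  apply/eqP; rewrite -(eqrXn2 (n := 2))// ?modc_ge0// modc_sqr /=.
  by apply/eqP; ring.
pose h w := (0 -i* 1) * f w.
have hd w E : cdiff f w E -> cdiff h w ((0 -i* 1) * E).
  move=> fE; have := cdiffM (cdiff_cst (0 -i* 1) w) fE.
  by rewrite mul0r add0r.
have : `|complex.Re ((0 -i* 1) * D)| <= 4 * K / r.
  apply: (@cauchy_Re h z _ r K r0) => [x xr|x xr|].
  - by have [E /hd hE] := fd x xr; eexists; exact: hE.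
  - by rewrite /h modcM mi mul1r fK.
  - exact: hd.
rewrite Re_mul /= mul0r sub0r mulN1r opprK => h2.
by rewrite (_ : 8 * K / r = 4 * K / r + 4 * K / r) ?lerD//; field; rewrite gt_eqF.
Qed.

End complex_derivative.

Section holomorphic.
Variable R : realType.
Local Notation C := R[i].
Implicit Types (f g : C -> C) (z w : C).
Local Open Scope complex_scope.

Lemma eps_is_derive (h : R -> R) (x d : R) :
  (forall eps : R, 0 < eps -> exists2 eta : R, 0 < eta &
    forall t, `|t| <= eta -> `|h (x + t) - h x - t * d| <= eps * `|t|) ->
  is_derive x 1 h d.
Proof.
move=> H.
have hl : (fun t => t^-1 *: ((h \o shift x) (t *: 1) - h x)) @ 0^' --> d.
  apply/cvgrPdist_le => eps e0; have [eta eta0 He] := H eps e0.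
  rewrite near_withinE; apply/nbhs_ballP; exists eta => //= t.
  rewrite /ball /= sub0r normrN => /ltW te t0.
  rewrite /GRing.scale /= mulr1 (addrC t).
  have -> : d - t^-1 * (h (x + t) - h x) = - t^-1 * (h (x + t) - h x - t * d) by field.
  rewrite normrM normrN normfV ler_pdivrMl ?normr_gt0// [leRHS]mulrC.
  exact: He.
by apply: DeriveDef; [apply/cvg_ex; exists d|exact/cvg_lim].
Qed.

Lemma cdiff_Re f a x (t : R) D : cdiff f (a + t%:C * x) D ->
  is_derive t 1 (fun s : R => complex.Re (f (a + s%:C * x))) (complex.Re (x * D)).
Proof.
move=> H; apply: eps_is_derive => eps e0.
have m0 : 0 < modc x + 1 by have := modc_ge0 x; lra.
have [eta eta0 {}H] := H _ (divr_gt0 e0 m0).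
exists (eta / (modc x + 1)); first by rewrite divr_gt0.
move=> s se; have ms : modc (s%:C * x) = `|s| * modc x by rewrite modcM modc_real.
have := H (s%:C * x); rewrite ms.
have -> : `|s| * modc x <= eta.
  apply: le_trans (_ : `|s| * (modc x + 1) <= _); first by rewrite ler_wpM2l// lerDl.
  by rewrite -ler_pdivlMr.
move=> /(_ isT) {}H.
have -> : a + (t + s)%:C * x = a + t%:C * x + s%:C * x by rewrite rmorphD /=; ring.
have -> : complex.Re (f (a + t%:C * x + s%:C * x)) - complex.Re (f (a + t%:C * x)) - s * complex.Re (x * D)
   = complex.Re (f (a + t%:C * x + s%:C * x) - f (a + t%:C * x) - s%:C * x * D).
  by rewrite !Re_sub -[s%:C * x * D]mulrA [in RHS](Re_mul s%:C) /=; ring.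
apply: le_trans (Re_le_modc _) _; apply: le_trans H _.
rewrite mulrA mulrAC ler_wpM2r ?normr_ge0//.
by rewrite -mulrA ler_piMr ?(ltW e0)// mulrC ler_pdivrMr// mul1r lerDl.
Qed.

Lemma deriv_lip (h dh : R -> R) (M : R) : (forall t : R, 0 <= t <= 1 -> is_derive t 1 h (dh t)) ->
  (forall t : R, 0 <= t <= 1 -> `|dh t| <= M) -> `|h 1 - h 0| <= M.
Proof.
move=> hd hM.
have [||t t01 ->] := @MVT_segment R h dh 0 1 ler01.
- by move=> t; rewrite in_itv/= => /andP[a b]; apply: hd; rewrite !ltW.
- apply: derivable_within_continuous => t; rewrite in_itv/= => /hd H.
  by case: H.
- by rewrite subr0 mulr1; apply: hM; move: t01; rewrite in_itv.
Qed.

(** The real mean value theorem is applied to the real and to the imaginary part along the segment,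
    whence the factor 2. *)
Lemma complex_mvt f w x (M : R) :
  (forall s : R, 0 <= s <= 1 -> exists2 E, cdiff f (w + s%:C * x) E & modc E <= M) ->
  modc (f (w + x) - f w) <= 2 * M * modc x.
Proof.
move=> H.
have H' (s : R) : exists E, 0 <= s <= 1 -> cdiff f (w + s%:C * x) E /\ modc E <= M.
  have [s01|ns] := boolP (0 <= s <= 1); last by exists 0.
  by have [E h1 h2] := H s s01; exists E.
have [E HE] := choice H'.
have aux (g : C -> C) (k : C) : modc k = 1 -> (forall u, g u = k * f u) ->
    `|complex.Re (g (w + x)) - complex.Re (g w)| <= M * modc x.
  move=> k1 gk.
  have := @deriv_lip (fun s => complex.Re (g (w + s%:C * x))) (fun s => complex.Re (x * (k * E s)))
    (M * modc x).
  rewrite mul1r mul0r addr0; apply.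
    move=> t /HE[hE _]; apply: cdiff_Re; apply: (@cdiff_ext _ (fun u => k * f u)) => //.
    by have := cdiffM (cdiff_cst k (w + t%:C * x)) hE; rewrite mul0r add0r.
  move=> t /HE[_ EM]; apply: le_trans (Re_le_modc _) _.
  by rewrite !modcM k1 mul1r mulrC ler_wpM2r// modc_ge0.
have h1 := @aux f 1 (modc1 R) (fun u => esym (mul1r _)).
have mi : modc (0 +i* (-1) : C) = 1.
  apply/eqP; rewrite -(eqrXn2 (n := 2))// ?modc_ge0// modc_sqr /=.
  by apply/eqP; ring.
have h2 := @aux (fun u => (0 +i* (-1)) * f u) _ mi (fun u => erefl).
rewrite !Re_mul /= !mul0r !sub0r !mulN1r !opprK in h2.
apply: le_trans (modc_le_ReIm _) _; rewrite Re_sub Im_sub.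
by rewrite -mulrA (_ : 2 * (M * modc x) = M * modc x + M * modc x) ?lerD//; ring.
Qed.

Definition Dop f z : C := xget 0 [set D | cdiff f z D].

Lemma DopP f z D : cdiff f z D -> cdiff f z (Dop f z).
Proof. by move=> h; rewrite /Dop; case: xgetP => [E -> //|/(_ D)]. Qed.

Lemma DopE f z D : cdiff f z D -> Dop f z = D.
Proof. by move=> h; apply: (cdiff_uniq (DopP h) h). Qed.

(** The local bound is part of the definition because the Cauchy estimates start from it; it then
    passes to all derivatives. *)
Definition holo (Om : set C) f := forall w, Om w -> exists2 r : R, 0 < r &
  exists K : R, forall x, modc x <= r ->
    [/\ Om (w + x), modc (f (w + x)) <= K & exists D, cdiff f (w + x) D].

(** Completeness in order form: it produces limits from estimates between pairs of indices. *)
Lemma sup_between (T : Type) (lo hi : T -> R) (t0 : T) : (forall i j, lo i <= hi j) ->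
  exists l, forall i, lo i <= l <= hi i.
Proof.
move=> H; exists (sup (range lo)) => i; apply/andP; split.
  by apply: ub_le_sup; [exists (hi t0) => _ [j _ <-]|exists i].
by apply: ge_sup; [exists (lo t0), t0|move=> _ [j _ <-]].
Qed.

(** Everything follows from the estimate of the first derivative, applied repeatedly on smaller
    discs: it bounds $f'$, then makes $f'$ Lipschitz, which makes the remainder of [f] quadratic.
    Finally it applies to the difference of two difference quotients of [f], whose derivative is the
    difference of the corresponding quotients of $f'$; these are therefore Cauchy. *)
Lemma Dop_holo Om f : holo Om f -> holo Om (Dop f).
Proof.
move=> hf w /hf[r0 r00 [K HK]].
(* Each application of the Cauchy estimate shrinks the disc; radius 16r leaves room for all of them
   and for the increments. *)
pose r := r0 / 16; have r_gt0 : 0 < r by rewrite divr_gt0.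
have r16 : r0 = 16 * r by rewrite /r; field.
have fd x : modc x <= 16 * r -> cdiff f (w + x) (Dop f (w + x)).
  by rewrite -r16 => /HK[_ _ [D /DopP]].
have fK x : modc x <= 16 * r -> modc (f (w + x)) <= K by rewrite -r16 => /HK[].
pose M1 := K / r.
have sm x y (a b c : R) : modc x <= a -> modc y <= b -> a + b <= c -> modc (x + y) <= c.
  by move=> xa yb; apply: le_trans; apply: le_trans (modcD _ _) _; exact: lerD.
have A x : modc x <= 8 * r -> modc (Dop f (w + x)) <= M1.
  move=> x8; rewrite (_ : M1 = 8 * K / (8 * r)); last by rewrite /M1; field; rewrite gt_eqF.
  have r8 : 0 < 8 * r by lra.
  apply: (cauchy_bound (f := f) (z := w + x)) => //.
  - move=> y y8; rewrite -addrA; exists (Dop f (w + (x + y))); apply: fd.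
    by apply: sm x8 y8 _; lra.
  - by move=> y y8; rewrite -addrA fK//; apply: sm x8 y8 _; lra.
  - by apply: fd; lra.
have seg y (s : R) : 0 <= s <= 1 -> modc (s%:C * y) <= modc y.
  by move=> /andP[s0 s1]; rewrite modcM modc_real ger0_norm// ler_piMl ?modc_ge0.
have B x y : modc x <= 4 * r -> modc y <= 4 * r ->
    modc (f (w + x + y) - f (w + x)) <= 2 * M1 * modc y.
  move=> x4 y4; apply: complex_mvt => s s01; rewrite -addrA.
  have xy : modc (x + s%:C * y) <= 8 * r.
    by apply: sm x4 (le_trans (seg y s s01) y4) _; lra.
  by exists (Dop f (w + (x + s%:C * y))); [apply: fd; lra|exact: A].
have sub_d (k : C) y x : modc x <= 8 * r -> modc y <= 8 * r ->
    cdiff (fun u => (f (u + y) - f u) * k) (w + x) ((Dop f (w + x + y) - Dop f (w + x)) * k).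
  move=> x8 y8.
  have h1 : cdiff (fun u => f (u + y)) (w + x) (Dop f (w + x + y)).
    have : cdiff f (y + (w + x)) (Dop f (w + x + y)).
      rewrite (addrC y) -addrA; apply: fd.
      by apply: sm x8 y8 _; lra.
    move=> /cdiff_shift; apply: cdiff_ext => u; by rewrite addrC.
  have h2 := fd x (ltac:(lra)).
  have h3 : cdiff (fun u => (-1) * f u) (w + x) (- Dop f (w + x)).
    by have := cdiffM (cdiff_cst (-1) (w + x)) h2; rewrite mul0r add0r mulN1r.
  have h4 := cdiffM (cdiffD h1 h3) (cdiff_cst k (w + x)).
  rewrite mulr0 addr0 in h4; apply: cdiff_ext h4 => u.
  by rewrite mulN1r.
pose M2 := 8 * M1 / r.
have B2 x y : modc x <= 2 * r -> modc y <= 4 * r ->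
    modc (Dop f (w + x + y) - Dop f (w + x)) <= M2 * modc y.
  move=> x2 y4; have r2 : 0 < 2 * r by lra.
  rewrite (_ : M2 * modc y = 8 * (2 * M1 * modc y) / (2 * r)); last first.
    by rewrite /M2; field; rewrite gt_eqF.
  have e z : (f (z + y) - f z) * 1 = f (z + y) - f z by rewrite mulr1.
  apply: (cauchy_bound (f := fun u => f (u + y) - f u) (z := w + x)) => //.
  - move=> z z2; rewrite -addrA; eexists; apply: cdiff_ext (e) _.
    by apply: sub_d; [apply: sm x2 z2 _|]; lra.
  - by move=> z z2; rewrite -[w + x + z]addrA B//; apply: sm x2 z2 _; lra.
  - rewrite -[X in cdiff _ _ X]mulr1; apply: cdiff_ext (e) _.
    by apply: sub_d; lra.
have M20 : 0 <= M2 * r.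
  have := @B2 0 r%:C; rewrite modc0 modc_real (ger0_norm (ltW r_gt0)).
  move=> /(_ (ltac:(lra)) (ltac:(lra))); apply: le_trans; exact: modc_ge0.
have {}M20 : 0 <= M2 by rewrite pmulr_lge0 in M20.
have Cc x y : modc x <= 2 * r -> modc y <= 2 * r ->
    modc (f (w + x + y) - f (w + x) - y * Dop f (w + x)) <= 2 * M2 * modc y ^+ 2.
  move=> x2 y2; pose h u := f (w + x + u) - u * Dop f (w + x).
  have := @complex_mvt h 0 y (M2 * modc y); rewrite add0r /h addr0 mul0r subr0.
  rewrite addrAC expr2 !mulrA; apply => s s01; rewrite add0r.
  have sy := seg y s s01.
  exists (Dop f (w + x + s%:C * y) - Dop f (w + x)).
    have h1 : cdiff (fun u => f (w + x + u)) (s%:C * y) (Dop f (w + x + s%:C * y)).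
      apply: cdiff_shift; rewrite -addrA; apply: fd; apply: sm x2 (le_trans sy y2) _; lra.
    have := cdiffD h1 (@cdiff_lin R (- Dop f (w + x)) (s%:C * y)).
    by apply: cdiff_ext => u; rewrite mulNr (mulrC u).
  apply: le_trans (B2 _ _ x2 _) _; first by apply: le_trans sy _; lra.
  by rewrite ler_wpM2l.
pose M3 := 16 * M2 / r.
have M30 : 0 <= M3 by apply: divr_ge0; [exact: mulr_ge0|exact: ltW].
pose phi a y := (Dop f (a + y) - Dop f a) * y^-1.
have Dd x y1 y2 : modc x <= r -> y1 != 0 -> y2 != 0 -> modc y1 <= r -> modc y2 <= r ->
    modc (phi (w + x) y1 - phi (w + x) y2) <= M3 * (modc y1 + modc y2).
  move=> xr y10 y20 y1r y2r.
  rewrite (_ : M3 * _ = 8 * (2 * M2 * (modc y1 + modc y2)) / r); last first.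
    by rewrite /M3; field; rewrite gt_eqF.
  apply: (cauchy_bound (f := fun u => (f (u + y1) - f u) * y1^-1 + (f (u + y2) - f u) * - y2^-1)
     (z := w + x)) => //.
  - move=> z zr; rewrite -addrA; eexists.
    have xz : modc (x + z) <= 8 * r by apply: sm xr zr _; lra.
    by apply: cdiffD; apply: sub_d => //; lra.
  - move=> z zr; rewrite -[w + x + z]addrA; set v := x + z.
    have v2 : modc v <= 2 * r by apply: sm xr zr _; lra.
    have c1 := Cc v y1 v2 (ltac:(lra)); have c2 := Cc v y2 v2 (ltac:(lra)).
    rewrite (_ : _ + _ = (f (w + v + y1) - f (w + v) - y1 * Dop f (w + v)) * y1^-1 -
        (f (w + v + y2) - f (w + v) - y2 * Dop f (w + v)) * y2^-1); last first.
      by field; rewrite y10 y20.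
    apply: le_trans (modcB _ _) _; rewrite !modcM !modcV// mulrDr; apply: lerD.
      by rewrite ler_pdivrMr ?modc_gt0// -[leRHS]mulrA -expr2.
    by rewrite ler_pdivrMr ?modc_gt0// -[leRHS]mulrA -expr2.
  - rewrite /phi -mulrN; apply: cdiffD; apply: sub_d; lra.
exists r => //; exists M1 => x xr; split.
- by have [] := HK x (ltac:(rewrite r16; lra)).
- by apply: A; lra.
- pose T := {y : C | (y != 0) && (modc y <= r)}.
  have t0 : T.
    exists r%:C; rewrite modc_real (ger0_norm (ltW r_gt0)) lexx andbT.
    by apply: contraTneq r_gt0 => /(@complexI R _ 0) ->; rewrite ltxx.
  have Tp (y : T) : (sval y != 0) /\ (modc (sval y) <= r) by case: y => y /= /andP.
  have bt (pr : C -> R) : (forall u v, `|pr u - pr v| <= modc (u - v)) ->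
      exists l : R, forall y : T, `|pr (phi (w + x) (sval y)) - l| <= M3 * modc (sval y).
    move=> hpr.
    have [|l hl] := @sup_between T (fun y => pr (phi (w + x) (sval y)) - M3 * modc (sval y))
      (fun y => pr (phi (w + x) (sval y)) + M3 * modc (sval y)) t0.
      move=> y1 y2; have [p1 q1] := Tp y1; have [p2 q2] := Tp y2.
      have := Dd x _ _ xr p1 p2 q1 q2; have := hpr (phi (w + x) (sval y1)) (phi (w + x) (sval y2)).
      move=> h1 h2; have := le_trans h1 h2; rewrite mulrDr => /ler_normlP[_]; lra.
    by exists l => y; have /andP[h1 h2] := hl y; apply/ler_normlP; split; lra.
  have [|a ha] := bt (@complex.Re R).
    by move=> u v; rewrite -Re_sub; exact: Re_le_modc.
  have [|b hb] := bt (@complex.Im R).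
    by move=> u v; rewrite -Im_sub; exact: Im_le_modc.
  exists (a +i* b) => eps e0.
  exists (Num.min r (eps / (2 * M3 + 1))).
    by rewrite lt_min r_gt0 divr_gt0//; lra.
  move=> y; rewrite le_min => /andP[yr ye].
  have [->|y0] := eqVneq y 0; first by rewrite addr0 subrr mul0r subrr modc0 mulr0.
  have py : (y != 0) && (modc y <= r) by rewrite y0.
  have := ha (exist _ y py); have := hb (exist _ y py); rewrite /= => hb1 ha1.
  rewrite (_ : _ - _ - _ = y * (phi (w + x) y - a +i* b)); last first.
    by rewrite /phi; field.
  rewrite modcM mulrC ler_wpM2r ?modc_ge0//.
  apply: le_trans (modc_le_ReIm _) _; rewrite Re_sub Im_sub /=.
  apply: le_trans (lerD ha1 hb1) _.
  move: ye; rewrite ler_pdivlMr; last by lra.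
  by have := modc_ge0 y; nra.
Qed.

End holomorphic.

(** * Isolated zeros from bounds on all derivatives *)

Section real_identity.
Variable R : realType.
Implicit Types (h dh : R -> R) (a rho M : R).

Lemma is_derive_affine (h : R -> R) (a d s dh : R) : is_derive (a + s * d) 1 h dh ->
  is_derive s 1 (fun s => h (a + s * d)) (d * dh).
Proof.
move=> hd; apply: eps_is_derive => eps e0.
have d0 : 0 < `|d| + 1 by have := normr_ge0 d; lra.
have [eta eta0 H] := is_derive_eps hd (divr_gt0 e0 d0).
exists (eta / (`|d| + 1)); first by rewrite divr_gt0.
move=> t te; have td : `|t * d| <= eta.
  rewrite normrM; apply: le_trans (_ : `|t| * (`|d| + 1) <= _).
    by rewrite ler_wpM2l// lerDl.
  by rewrite -ler_pdivlMr.
have := H _ td; rewrite -[a + s * d + _]addrA -[s * d + _]mulrDl -[t * d * dh]mulrA => {}H.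
apply: le_trans H _; rewrite normrM mulrCA mulrC ler_wpM2r// mulrAC ler_pdivrMr//.
by rewrite ler_wpM2l ?(ltW e0)// lerDl.
Qed.

Lemma derive_ge0_le (h dh : R -> R) : (forall t : R, 0 <= t <= 1 -> is_derive t 1 h (dh t)) ->
  (forall t : R, 0 <= t <= 1 -> 0 <= dh t) -> h 0 <= h 1.
Proof.
move=> hd h0.
have [||t t01 E] := @MVT_segment R h dh 0 1 ler01.
- by move=> t; rewrite in_itv/= => /andP[u v]; apply: hd; rewrite !ltW.
- apply: derivable_within_continuous => t; rewrite in_itv/= => /hd H.
  by case: H.
- by rewrite -subr_ge0 E subr0 mulr1; apply: h0; move: t01; rewrite in_itv.
Qed.

Lemma is_derive_pow (m : nat) (s : R) : is_derive s 1 (fun s : R => s ^+ m.+1) (m.+1%:R * s ^+ m).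
Proof.
apply: DeriveDef; first exact: exprn_derivable.
by rewrite exp_derive /GRing.scale /= mulr1.
Qed.

(** The zeros are kept in [[-T, T]], where derivatives are controlled; [a] is not itself assumed to
    be a zero. *)
Definition acc (T : R) h a := forall eta : R, 0 < eta ->
  exists t, [/\ t != a, `|t - a| < eta, `|t| <= T & h t = 0].

Lemma acc_eq0 T h a d : is_derive a 1 h d -> acc T h a -> h a = 0.
Proof.
move=> hd ac; apply/eqP; rewrite -normr_le0 leNgt; apply/negP => h0.
have c0 : 0 < `|d| + 1 by have := normr_ge0 d; lra.
have [eta eta0 H] := is_derive_eps hd ltr01.
have m0 : 0 < Num.min eta (`|h a| / (`|d| + 1)) by rewrite lt_min eta0 divr_gt0.
have [t [_ ta _ ht]] := ac _ m0; move: ta; rewrite lt_min => /andP[t1 t2].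
have := H _ (ltW t1); rewrite [a + _]addrC subrK ht sub0r mul1r => {}H.
have := ler_normD (- h a - (t - a) * d) ((t - a) * d).
rewrite subrK normrN normrM; move: t2; rewrite ltr_pdivlMr//; lra.
Qed.

(** Rolle between [a], a zero by continuity, and the zeros that accumulate at it. *)
Lemma acc_derive T h dh a : `|a| <= T -> (forall t : R, `|t| <= T -> is_derive t 1 h (dh t)) ->
  acc T h a -> acc T dh a.
Proof.
move=> aT hd ac eta eta0; have [t [ta te tT ht]] := ac _ eta0.
have ha := acc_eq0 (hd a aT) ac.
have roll (x y : R) : x < y -> `|x| <= T -> `|y| <= T -> h x = 0 -> h y = 0 ->
    exists2 z, x < z < y & dh z = 0.
  move=> xy /ler_normlP[x1 x2] /ler_normlP[y1 y2] hx hy.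
  have inT z : x <= z <= y -> `|z| <= T.
    by move=> /andP[z1 z2]; apply/ler_normlP; split; lra.
  have [||z z1 z2] := @MVT R h dh x y xy.
  - by move=> z; rewrite in_itv/= => /andP[z1 z2]; apply/hd/inT; rewrite !ltW.
  - apply: derivable_within_continuous => z; rewrite in_itv/= => /inT/hd H.
    by case: H.
  - exists z; first by move: z1; rewrite in_itv.
    move: z2; rewrite hx hy subrr => /esym/eqP; rewrite mulf_eq0 => /orP[/eqP//|].
    by rewrite subr_eq0 => /eqP xy'; move: xy; rewrite xy' ltxx.
move: aT tT te => /ler_normlP[a1 a2] /ler_normlP[t1 t2] /ltr_normlP[e1 e2].
have [lt|gt|e] := ltgtP t a; last by rewrite e eqxx in ta.
- have [z /andP[z1 z2] z0] := roll t a lt (ltac:(apply/ler_normlP; split; lra)) (ltac:(apply/ler_normlP; split; lra)) ht ha.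
  exists z; split=> //; first by rewrite lt_eqF.
    by apply/ltr_normlP; split; lra.
  by apply/ler_normlP; split; lra.
- have [z /andP[z1 z2] z0] := roll a t gt (ltac:(apply/ler_normlP; split; lra)) (ltac:(apply/ler_normlP; split; lra)) ha ht.
  exists z; split=> //; first by rewrite gt_eqF.
    by apply/ltr_normlP; split; lra.
  by apply/ler_normlP; split; lra.
Qed.

Lemma geom_le0 (x K q : R) : 0 <= q < 1 -> (forall n, x <= K * q ^+ n) -> x <= 0.
Proof.
move=> /andP[q0 q1] H.
have c : (fun n => K * q ^+ n) @ \oo --> K * 0.
  by apply: cvgMr; apply: cvg_expr; rewrite ger0_norm.
rewrite mulr0 in c; rewrite -(cvg_lim _ c)//.
apply: limr_ge; first by apply: cvgP c.
by apply: nearW => n; exact: H.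
Qed.

Variables (g : nat -> R -> R) (T K A : R).
Hypotheses (K0 : 0 <= K) (A0 : 0 < A).
Hypothesis gd : forall n (t : R), `|t| <= T -> is_derive t 1 (g n) (g n.+1 t).
Hypothesis gK : forall n (t : R), `|t| <= T -> `|g n t| <= K * (A * n%:R) ^+ n.

Let rho := (2 * A * expR 1)^-1.

(** Taylor's formula at a point where all derivatives vanish gives $K(An)^n|t-a|^n/n!$. As
    $n^n/n!\le e^n$, the radius [rho] makes this at most $K2^{-n}$ for every [n]. *)
Lemma flat_ball a : `|a| <= T -> (forall n, g n a = 0) ->
  forall t : R, `|t| <= T -> `|t - a| <= rho -> g 0 t = 0.
Proof.
move=> aT ga t tT tr.
have e0 : 0 < expR (1 : R) by exact: expR_gt0.
have inT (s : R) : `|s - a| <= `|t - a| -> (forall u, 0 <= u <= 1 -> s = a + u * (t - a) -> `|s| <= T).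
  move=> _ u /andP[u0 u1] ->.
  have -> : a + u * (t - a) = (1 - u) * a + u * t by ring.
  apply: le_trans (ler_normD _ _) _; rewrite !normrM (ger0_norm u0) ger0_norm ?subr_ge0//.
  have : (1 - u) * `|a| <= (1 - u) * T by rewrite ler_wpM2l ?subr_ge0.
  have : u * `|t| <= u * T by rewrite ler_wpM2l.
  lra.
pose d := t - a.
(* The bound on the [n]-th derivative is integrated [j] times from [a]. Each integration is a
   monotonicity argument, carried out with both signs [sg] to obtain the absolute value. *)
have dn n : forall j, (j <= n)%N -> forall s : R, 0 <= s <= 1 ->
    `|g (n - j)%N (a + s * d)| <= K * (A * n%:R) ^+ n * (s * `|d|) ^+ j / j`!%:R.
  elim=> [|j IH] jn s /andP[s0 s1].
    rewrite subn0 expr0 mulr1 fact0 divr1; apply: gK.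
    by apply: (@inT _ _ s); rewrite ?s0// addrAC subrr add0r normrM ger0_norm// ler_piMl.
  have IH' := IH (ltnW jn).
  set C := K * _ in IH' *.
  have key (sg : R) : `|sg| <= 1 -> sg * g (n - j.+1)%N (a + s * d) <= C * (s * `|d|) ^+ j.+1 / j.+1`!%:R.
    move=> sg1.
    have := @derive_ge0_le
      (fun u => (C * (s * `|d|) ^+ j.+1 / j.+1`!%:R) * u ^+ j.+1 - sg * g (n - j.+1)%N (a + u * (s * d)))
      (fun u => (C * (s * `|d|) ^+ j.+1 / j.+1`!%:R) * (j.+1%:R * u ^+ j) - sg * ((s * d) * g (n - j)%N (a + u * (s * d)))).
    rewrite expr0n mul0r addr0 ga mulr0 mulr0 subr0 expr1n mulr1 mul1r.
    rewrite subr_ge0; apply.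
      move=> u /andP[u0 u1].
      have us : 0 <= u * s <= 1 by rewrite mulr_ge0// mulr_ile1.
      have h1 : is_derive u 1 (fun u => g (n - j.+1)%N (a + u * (s * d))) ((s * d) * g (n - j)%N (a + u * (s * d))).
        apply: is_derive_affine; rewrite -[in X in is_derive _ _ _ X](subnSK jn); apply: gd.
        rewrite mulrA; case/andP: us => us0 us1.
        by apply: (@inT _ _ (u * s)); rewrite ?us0// addrAC subrr add0r normrM ger0_norm// ler_piMl.
      have h2 : is_derive u 1 (fun s : R => s ^+ j.+1) (j.+1%:R * u ^+ j).
        exact: is_derive_pow.
      exact: is_deriveB (is_deriveZ (C * (s * `|d|) ^+ j.+1 / j.+1`!%:R) h2) (is_deriveZ sg h1).
    move=> u /andP[u0 u1].
    have us : 0 <= u * s <= 1 by rewrite mulr_ge0// mulr_ile1.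
    rewrite subr_ge0; apply: le_trans (ler_norm _) _.
    rewrite !normrM (ger0_norm s0); have H := IH' _ us.
    have -> : C * (s * `|d|) ^+ j.+1 / j.+1`!%:R * (j.+1%:R * u ^+ j)
        = s * `|d| * (C * (u * (s * `|d|)) ^+ j / j`!%:R).
      rewrite factS natrM [(u * _) ^+ _]exprMn [(s * _) ^+ j.+1]exprS.
      have f1 : j`!%:R != 0 :> R by rewrite pnatr_eq0 -lt0n fact_gt0.
      have f2 : j.+1%:R != 0 :> R by rewrite pnatr_eq0.
      by move: (j`!%:R) (j.+1%:R) f1 f2 => x y x0 y0; field; rewrite x0 y0.
    apply: le_trans (ler_piMl _ sg1) _; first by rewrite !mulr_ge0.
    by rewrite ler_wpM2l ?mulr_ge0// (mulrA u s `|d|) (mulrA u s d).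
  apply/ler_normlP; split.
    by have := key (-1); rewrite normrN1 lexx mulN1r; apply.
  by have := key 1; rewrite normr1 lexx mul1r; apply.
apply/eqP; rewrite -normr_le0; apply: (@geom_le0 _ K (2^-1)).
  by rewrite invr_ge0 ler0n invf_lt1// ltr1n.
move=> n; have := dn n n (leqnn _) 1; rewrite ler01 lexx subnn !mul1r.
have -> : a + d = t by rewrite /d; ring.
move=> /(_ isT) H; apply: le_trans H _.
rewrite -!mulrA ler_wpM2l// mulrA -exprMn.
have f0 : 0 < n`!%:R :> R by rewrite ltr0n fact_gt0.
have dd : A * n%:R * `|d| <= n%:R * (2 * expR 1)^-1.
  have : A * `|d| <= (2 * expR 1)^-1.
    apply: le_trans (_ : A * rho <= _); first by rewrite ler_wpM2l// ltW.
    by rewrite /rho -mulrA (mulrCA 2 A) invfM mulrA mulfV ?gt_eqF// mul1r.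
  by move=> dd; rewrite (mulrAC A) (mulrC _ n%:R) ler_wpM2l.
apply: le_trans (_ : (n%:R * (2 * expR 1)^-1) ^+ n / n`!%:R <= _).
  rewrite ler_pM2r ?invr_gt0// lerXn2r ?nnegrE ?mulr_ge0 ?invr_ge0 ?mulr_ge0// ltW//.
rewrite invfM mulrCA !exprMn -mulrA ler_piMr ?exprn_ge0 ?invr_ge0//.
have nn k : k%:R ^+ k / k`!%:R <= expR k%:R :> R.
  case: k => [|k]; first by rewrite expr0 fact0 divr1 expR0.
  by have := @expR_ge1Dxn R k.+1%:R k (ler0n _ _); lra.
rewrite mulrAC exprVn -expRM_natl mulr1.
by rewrite ler_pdivrMr ?expR_gt0// mul1r nn.
Qed.
End real_identity.

Section analytic_line.
Variable R : realType.
Local Notation C := R[i].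
Local Open Scope complex_scope.

Lemma Im_add (x y : C) : complex.Im (x + y) = complex.Im x + complex.Im y.
Proof. by case: x y => ? ? []. Qed.

Lemma differentiable_line (W W' : normedModType C) (F : W -> W') z v :
  differentiable F z -> exists D : W', forall eps : R, 0 < eps -> exists2 eta : R, 0 < eta &
    forall x : C, modc x <= eta -> `|F (z + x *: v) - F z - x *: D| <= eps%:C * `|x|.
Proof.
move=> dF; have /cvg_ex[D /= hl] : derivable F z v by exact: diff_derivable.
exists D => eps e0.
move/cvgrPdist_le : hl => /(_ eps%:C); rewrite ltcR => /(_ e0).
rewrite near_withinE => /nbhs_ballP[eta /= eta0 H].
have [er ei] : complex.Im eta = 0 /\ 0 < complex.Re eta by move: eta0; rewrite ltcE /= => /andP[/eqP -> ->].
have ee : eta = (complex.Re eta)%:C by move: er; case: (eta) => a b /= ->.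
exists (complex.Re eta / 2); first by rewrite divr_gt0.
move=> x xe; have [->|x0] := eqVneq x 0.
  by rewrite !scale0r addr0 !subrr !normr0 mulr0.
have := H x; rewrite /ball /= sub0r normrN ee -modcE ltcR.
have xl : modc x < complex.Re eta by apply: le_lt_trans xe _; rewrite ltr_pdivrMr// ltr_pMr// ltr1n.
move=> /(_ xl x0); rewrite (addrC (x *: v)) => {}H.
rewrite -(ler_pM2l (_ : 0 < `|x|^-1)) ?invr_gt0 ?normr_gt0//.
rewrite -normfV -normrZ mulrCA -normrM mulVf// normr1 mulr1.
by rewrite scalerBr scalerA mulVf// scale1r distrC.
Qed.

Lemma cdiff_line (W W' : normedModType C) (F : W -> W') (L : W' -> C) (c : R) z v :
  (forall x y, L (x + y) = L x + L y) -> (forall a x, L (a *: x) = a * L x) ->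
  (forall x, modc (L x) <= c * complex.Re `|x|) ->
  differentiable F z -> exists D, cdiff (fun x : C => L (F (z + x *: v))) 0 D.
Proof.
move=> LD LZ Lc dF; have [D HD] := differentiable_line v dF.
have LB x y : L (x - y) = L x - L y by rewrite LD -scaleN1r LZ mulN1r.
have c0 : 0 < `|c| + 1 by have := normr_ge0 c; lra.
exists (L D) => eps e0; have [eta eta0 H] := HD _ (divr_gt0 e0 c0).
exists eta => // x /H {}H; rewrite add0r scale0r addr0 -LZ -!LB.
apply: le_trans (Lc _) _.
have Hr : complex.Re `|F (z + x *: v) - F z - x *: D| <= eps / (`|c| + 1) * modc x.
  by move: H; rewrite -modcE -rmorphM lecE /= => /andP[_].
have N0 : 0 <= complex.Re `|F (z + x *: v) - F z - x *: D|.
  by have := normr_ge0 (F (z + x *: v) - F z - x *: D); rewrite lecE /= => /andP[].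
apply: le_trans (_ : (`|c| + 1) * (eps / (`|c| + 1) * modc x) <= _); last first.
  by rewrite mulrA mulrCA mulfV ?mulr1// gt_eqF.
apply: le_trans (_ : (`|c| + 1) * complex.Re `|F (z + x *: v) - F z - x *: D| <= _).
  by rewrite ler_wpM2r//; have := ler_norm c; lra.
by rewrite ler_wpM2l// ltW.
Qed.

(* Bound on iterated derivatives: apply the Cauchy estimate [n] times with radius [r / n]. *)
Lemma iter_Dop_bound f z (r K : R) n : 0 < r ->
  (forall x, modc x <= r -> modc (f (z + x)) <= K) ->
  (forall j x, modc x <= r -> exists E, cdiff (iter j (@Dop R) f) (z + x) E) ->
  modc (iter n (@Dop R) f z) <= K * (8 / r * n%:R) ^+ n.
Proof.
move=> r0 fK fd; case: n => [|n].
  by rewrite expr0 mulr1 /=; have := fK 0; rewrite modc0 addr0; apply; apply: ltW.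
pose d := r / n.+1%:R; have d0 : 0 < d by rewrite divr_gt0.
have K0 : 0 <= K by apply: le_trans (modc_ge0 _) (fK 0 _); rewrite modc0 ltW.
suff H j : (j <= n.+1)%N -> forall x, modc x <= (n.+1 - j)%:R * d ->
    modc (iter j (@Dop R) f (z + x)) <= K * (8 / r * n.+1%:R) ^+ j.
  by have := H n.+1 (leqnn _) 0; rewrite subnn mul0r modc0 addr0; apply.
elim: j => [|j IH] jn x.
  rewrite subn0 /d mulrCA mulfV ?pnatr_eq0// !mulr1 => xd; exact: fK.
move=> xd; have [|E hE] := fd j x.
  apply: le_trans xd _; rewrite /d mulrCA ler_piMr ?(ltW r0)// ler_pdivrMr// mul1r.
  by rewrite ler_nat leq_subr.
rewrite /= (DopE hE) exprS mulrCA.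
have -> : 8 / r * n.+1%:R * (K * (8 / r * n.+1%:R) ^+ j) = 8 * (K * (8 / r * n.+1%:R) ^+ j) / d.
  have := pnatr_eq0 R n.+1; rewrite /d; move: (n.+1%:R : R) => y /negbT y0.
    by field; rewrite (gt_eqF r0) y0.
have dd : (n.+1 - j)%:R * d = (n.+1 - j.+1)%:R * d + d.
  by rewrite -(subnSK jn) -natr1 mulrDl mul1r.
apply: (cauchy_bound (f := iter j (@Dop R) f) (z := z + x)) => // y yd.
  rewrite -addrA; apply: fd; apply: le_trans (modcD _ _) _; apply: le_trans (lerD xd yd) _.
  rewrite -dd /d mulrCA ler_piMr ?(ltW r0)// ler_pdivrMr// mul1r.
  by rewrite ler_nat leq_subr.
by rewrite -addrA; apply: IH; [exact: ltnW|apply: le_trans (modcD _ _) _; rewrite dd; exact: lerD].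
Qed.

(** If the zeros of the real part on the segment are infinite in number, they accumulate at some
    [a], where all derivatives vanish by Rolle. The function vanishes near [a] within a distance
    [rho] that does not depend on the point, so the argument propagates to the whole segment in
    finitely many steps. *)
Lemma analytic_zeros (f : C -> C) (T d K : R) : 0 < T -> 0 < d ->
  (forall w, `|complex.Re w| <= T + d -> `|complex.Im w| <= d ->
     modc (f w) <= K /\ exists D, cdiff f w D) ->
  finite_set [set t : R | `|t| <= T /\ complex.Re (f t%:C) = 0] \/
  (forall t : R, `|t| <= T -> complex.Re (f t%:C) = 0).
Proof.
move=> T0 d0 Hf.
pose Om := [set w : C | `|complex.Re w| < T + d /\ `|complex.Im w| < d].
have Omo w : Om w -> exists2 r : R, 0 < r & forall x, modc x <= r -> Om (w + x).
  move=> [w1 w2]; exists (Num.min (T + d - `|complex.Re w|) (d - `|complex.Im w|) / 2).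
    by rewrite divr_gt0// lt_min !subr_gt0 w1.
  move=> x; rewrite ler_pdivlMr// le_min => /andP[x1 x2].
  have h1 := Re_le_modc x; have h2 := Im_le_modc x; have h3 := modc_ge0 x.
  split; rewrite ?Re_add ?Im_add.
    by apply: le_lt_trans (ler_normD _ _) _; lra.
  by apply: le_lt_trans (ler_normD _ _) _; lra.
have h0 : holo Om f.
  move=> w /Omo[r r0 Hr]; exists r => //; exists K => x /Hr [x1 x2].
  by have [k1 k2] := Hf (w + x) (ltW x1) (ltW x2); split.
have hn n : holo Om (iter n (@Dop R) f) by elim: n => // n IH; exact: Dop_holo.
pose r := d / 2; have r0 : 0 < r by rewrite divr_gt0.
have OmT (t : R) x : `|t| <= T -> modc x <= r -> Om (t%:C + x).
  move=> tT xr; have h1 := Re_le_modc x; have h2 := Im_le_modc x.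
  rewrite /r in xr; split; rewrite ?Re_add ?Im_add /= ?add0r.
    by apply: le_lt_trans (ler_normD _ _) _; lra.
  by lra.
pose g n (t : R) := complex.Re (iter n (@Dop R) f t%:C).
have gd n (t : R) : `|t| <= T -> is_derive t 1 (g n) (g n.+1 t).
  move=> tT; have := OmT t 0 tT; rewrite modc0 addr0 => /(_ (ltW r0)) /(hn n)[s s0 [K' /(_ 0)]].
  rewrite modc0 addr0 => /(_ (ltW s0))[_ _ [D hD]].
  have := @cdiff_Re R (iter n (@Dop R) f) 0 1 t D; rewrite mulr1 add0r => /(_ hD).
  rewrite mul1r -(DopE hD).
  by under [X in is_derive _ _ X]eq_fun do rewrite mulr1 add0r.
have K0 : 0 <= K.
  apply: le_trans (modc_ge0 (f 0)) _; have [] := Hf 0 => //=; rewrite normr0.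
    by rewrite addr_ge0 ?ltW.
  exact: ltW.
have gK n (t : R) : `|t| <= T -> `|g n t| <= K * (8 / r * n%:R) ^+ n.
  move=> tT; apply: le_trans (Re_le_modc _) _; apply: iter_Dop_bound => //.
    by move=> x /(OmT t _ tT)[x1 x2]; have [] := Hf _ (ltW x1) (ltW x2).
  move=> j x /(OmT t _ tT)/(hn j)[s s0 [K' /(_ 0)]].
  by rewrite modc0 addr0 => /(_ (ltW s0))[_ _].
have A0 : 0 < 8 / r by rewrite divr_gt0.
have flat := @flat_ball R g T K (8 / r) K0 A0 gd gK.
set Z := [set t | _]; have [fin|inf] := pselect (finite_set Z); [by left|right].
have [a aZ] : limit_point Z !=set0.
  apply: infinite_bounded_limit_point_nonempty => //.
  exists T; split; first exact: num_real.
  by move=> x Tx t [tT _] /=; apply: le_trans tT (ltW Tx).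
have acZ : acc T (g 0) a.
  move=> eta e0; have [y [ya [yT y0] yb]] := aZ (ball a eta) (nbhsx_ballx a eta e0).
  by exists y; split => //; move: yb; rewrite /ball /= distrC.
have aT : `|a| <= T.
  apply/ler_addgt0Pr => e e0; have [t [_ te tT _]] := acZ _ e0.
  have := ler_normD (a - t) t; rewrite subrK distrC; lra.
pose rho := (2 * (8 / r) * expR 1)^-1.
have rho0 : 0 < rho by rewrite invr_gt0 !mulr_gt0// ?invr_gt0// expR_gt0.
have acn n b : `|b| <= T -> acc T (g 0) b -> acc T (g n) b.
  by move=> bT; elim: n => // n IH /IH; apply: acc_derive bT (gd n).
have all0 b : `|b| <= T -> acc T (g 0) b -> forall n, g n b = 0.
  by move=> bT /(acn _ _ bT) H n; apply: acc_eq0 (gd n b bT) (H n).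
(* Induction on the number of steps of length [rho / 2] needed to reach [t] from [a]; the point [b]
   on the segment from [a] to [t] is one step closer to [a]. *)
suff H j : forall t : R, `|t| <= T -> `|t - a| <= j%:R * (rho / 2) -> acc T (g 0) t.
  move=> t tT; have := H (Num.truncn (`|t - a| / (rho / 2))).+1 t tT.
  have : `|t - a| / (rho / 2) < (Num.truncn (`|t - a| / (rho / 2))).+1%:R by exact: truncnS_gt.
  rewrite ltr_pdivrMr; last by rewrite divr_gt0.
  by move=> /ltW -> /(_ isT) /(acc_eq0 (gd 0%N t tT)).
elim: j => [|j IH] t tT.
  by rewrite mul0r normr_le0 subr_eq0 => /eqP ->.
move=> tj; pose th : R := j%:R / j.+1%:R.
have th01 : 0 <= th <= 1 by rewrite divr_ge0//= ler_pdivrMr// mul1r ler_nat.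
pose b := a + th * (t - a).
have bT : `|b| <= T.
  rewrite /b (_ : a + _ = (1 - th) * a + th * t); last by ring.
  apply: le_trans (ler_normD _ _) _; rewrite (normrM (1 - th)) (normrM th); case/andP: th01 => t0 t1.
  rewrite (ger0_norm t0) ger0_norm ?subr_ge0//.
  have : (1 - th) * `|a| <= (1 - th) * T by rewrite ler_wpM2l ?subr_ge0.
  have : th * `|t| <= th * T by rewrite ler_wpM2l.
  lra.
have jb : acc T (g 0) b.
  apply: IH => //; rewrite /b addrAC subrr add0r (normrM th) ger0_norm; last by case/andP: th01.
  apply: le_trans (ler_wpM2l _ tj) _; first by case/andP: th01.
  by rewrite /th (mulrA _ _ (rho / 2)) divfK// pnatr_eq0.
have tb : `|t - b| <= rho / 2.
  rewrite /b (_ : t - _ = (1 - th) * (t - a)); last by ring.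
  have -> : 1 - th = j.+1%:R^-1 by rewrite /th -natr1; field; rewrite natr1 pnatr_eq0.
  by rewrite normrM ger0_norm ?invr_ge0// ler_pdivrMl.
have gz : forall s : R, `|s| <= T -> `|s - b| <= rho -> g 0 s = 0.
  exact: flat (all0 b bT jb).
move=> eta e0; pose e := Num.min (eta / 2) (Num.min (rho / 2) T).
have ee : 0 < e by rewrite !lt_min !divr_gt0.
have [e1 [e2 e3]] : e <= eta / 2 /\ e <= rho / 2 /\ e <= T.
  by rewrite /e !ge_min !lexx !orbT.
(* A zero near [t] is taken on the side of the origin, so as to stay in [[-T, T]]. *)
exists (if 0 <= t then t - e else t + e); move: tT tb => /ler_normlP[t1 t2] /ler_normlP[b1 b2].
case: (leP 0 t) => t0; split.
- by rewrite -subr_eq0 addrAC subrr add0r oppr_eq0 gt_eqF.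
- by rewrite addrAC subrr add0r normrN gtr0_norm//; lra.
- by apply/ler_normlP; split; clear -t1 t2 b1 b2 e1 e2 e3 t0 ee rho0; lra.
- by apply: gz; apply/ler_normlP; split; clear -t1 t2 b1 b2 e1 e2 e3 t0 ee rho0; lra.
- by rewrite -subr_eq0 addrAC subrr add0r gt_eqF.
- by rewrite addrAC subrr add0r gtr0_norm//; lra.
- by apply/ler_normlP; split; clear -t1 t2 b1 b2 e1 e2 e3 t0 ee rho0; lra.
- by apply: gz; apply/ler_normlP; split; clear -t1 t2 b1 b2 e1 e2 e3 t0 ee rho0; lra.
Qed.

End analytic_line.

Section coefficient_sums.
Variable R : realType.
Implicit Types (q M : R) (a b : int -> R) (n : nat).

Definition nq q n a : R := \sum_(k <- idx n) weight q `|k|%N * a k ^+ 2.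

Lemma nqE q n a : nq q n a =
  \sum_(1 <= i < n) weight q i * (a i%:Z ^+ 2 + a (- i%:Z) ^+ 2).
Proof. by rewrite /nq big_idx; apply: eq_bigr => i _; rewrite abszN absz_nat mulrDr. Qed.

Lemma nq_ge0 q n a : 0 <= nq q n a.
Proof. by apply: sumr_ge0 => k _; rewrite mulr_ge0 ?weight_ge0 ?sqr_ge0. Qed.

Lemma sqsumE q a n : (\sum_(1 <= k < n) (weight q k * (a k%:Z ^+ 2 + a (- k%:Z) ^+ 2))%:E)%E
   = (nq q n a)%:E.
Proof. by rewrite nqE sumEFin. Qed.

Lemma nq_le_sqsum q n a : ((nq q n a)%:E <= sqsum q a)%E.
Proof.
rewrite -sqsumE; apply: nneseries_lim_ge => k _ _.
by rewrite lee_fin sqterm_ge0.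
Qed.

Lemma sqr_coef_norm q a : (sqsum q a < +oo)%E -> sqsum q a = (coef_norm q a ^+ 2)%:E.
Proof.
by move=> ay; rewrite sqr_sqrtr ?fineK ?sqsum_fin// fine_ge0// sqsum_ge0.
Qed.

Lemma nq_le q n a : (sqsum q a < +oo)%E -> nq q n a <= coef_norm q a ^+ 2.
Proof. by move=> ay; rewrite -lee_fin -sqr_coef_norm// nq_le_sqsum. Qed.

Lemma sqsum_le q a M : (forall n, nq q n a <= M) -> (sqsum q a <= M%:E)%E.
Proof.
move=> H; apply: lime_le; first by apply: is_cvg_nneseries => k _ _; rewrite lee_fin sqterm_ge0.
by apply: nearW => n; rewrite sqsumE lee_fin.
Qed.

Lemma coef_norm_le q a M : 0 <= M -> (forall n, nq q n a <= M ^+ 2) ->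
  (sqsum q a < +oo)%E /\ coef_norm q a <= M.
Proof.
move=> M0 H; have h := sqsum_le H.
have ay : (sqsum q a < +oo)%E by apply: le_lt_trans h (ltry _).
split=> //; rewrite -ler_sqr ?nnegrE ?coef_norm_ge0//.
by rewrite -lee_fin -sqr_coef_norm.
Qed.

Lemma nq_cvg q a : (sqsum q a < +oo)%E -> (fun n => nq q n a) @ \oo --> coef_norm q a ^+ 2.
Proof.
move=> ay; suff : (fun n => (nq q n a)%:E) @ \oo --> (coef_norm q a ^+ 2)%:E by move=> /fine_cvgP[_].
rewrite (_ : (fun n => (nq q n a)%:E) =
  (fun n => \sum_(1 <= k < n) (weight q k * (a k%:Z ^+ 2 + a (- k%:Z) ^+ 2))%:E)%E).
  rewrite -sqr_coef_norm//; apply: is_cvg_nneseries => k _ _; by rewrite lee_fin sqterm_ge0.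
by apply/funext => n; rewrite sqsumE.
Qed.

Lemma weight_nat (p i : nat) : weight p%:R i = (2 * pi * i%:R : R) ^+ (2 * p).
Proof. by rewrite /weight -natrM powR_mulrn// !mulr_ge0 ?pi_ge0. Qed.

End coefficient_sums.

(** * Consequences of uniform analyticity *)

Section analytic_consequences.
Variable R : realType.
Local Notation C := R[i].
Local Open Scope complex_scope.
Implicit Types (q r : R).

Lemma complexifyD q (u v : sobolev q) : complexify (u + v) = complexify u + complexify v.
Proof. by apply/val_inj/funext => k; rewrite /= rmorphD. Qed.
Lemma complexifyZ q (t : R) (v : sobolev q) : complexify (t *: v) = t%:C *: complexify v.
Proof. by apply/val_inj/funext => k; rewrite /= rmorphM. Qed.
Lemma norm_complexify q (u : sobolev q) : `|complexify u| = `|u|%:C.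
Proof.
rewrite sobC_normE sob_normE; congr (_%:C); rewrite /coef_norm /sqsum.
congr (Num.sqrt (fine _)); apply: eq_eseriesr => k _; congr (_%:E).
by rewrite /moduli /= !modc_real !real_normK// num_real.
Qed.

Lemma modc_scaler q (W : normedModType C) (x : C) (w : W) : `|x *: w| = (modc x)%:C * `|w|.
Proof. by rewrite normrZ modcE. Qed.

Lemma cdiff_at f z (D : C) : cdiff (fun y => f (z + y)) 0 D -> cdiff f z D.
Proof.
by move=> H eps /H[eta e0 {}H]; exists eta => // x /H; rewrite add0r addr0.
Qed.

Section uan.
Variables (q : R) (V' : normedModType R) (W' : normedModType C) (j' : V' -> W').
Variable f : sobolev q -> V'.
Hypothesis fan : uniformly_analytic (@complexify R q) j' f.

(** On the complex line through [u] and [v] the extension, composed with a bounded linear functional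
    [L], is a scalar holomorphic function; the Cauchy estimate bounds its derivative along the real
    segment. The functional is left arbitrary, so that a suitable choice later yields the norm of
    the target. *)
Lemma uan_lip r : exists2 K : R, 0 <= K & forall u v : sobolev q, `|u| <= r -> `|v| <= r ->
  forall (L : W' -> C) (c : R), 0 <= c ->
  (forall x y, L (x + y) = L x + L y) -> (forall a x, L (a *: x) = a * L x) ->
  (forall x, modc (L x) <= c * complex.Re `|x|) ->
  modc (L (j' (f u)) - L (j' (f v))) <= c * (K * `|u - v|).
Proof.
have [d d0 [F [Fd [K FK] Ff]]] := fan r.
have K0 (u : sobolev q) : `|u| <= r -> 0 <= K.
  move=> ur; have := FK (complexify u); rewrite /mkset.
  have N : exists2 u0 : sobolev q, `|u0| <= r & `|complexify u - complexify u0| < d%:C.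
    by exists u => //; rewrite subrr normr0 ltcR.
  by move=> /(_ N) /(le_trans (normr_ge0 _)); rewrite lecR.
(* The factor 2 of [complex_mvt], the 8 of [cauchy_bound], and the 2 of the radius
   [d / (2 * |w|)]. *)
exists (32 * `|K| / d); first by rewrite divr_ge0 ?(ltW d0)// mulr_ge0.
move=> u v ur vr L c c0 LD LZ Lc; have {}K0 := K0 u ur; rewrite (ger0_norm K0).
have [->|uv] := eqVneq u v; first by rewrite subrr modc0 mulr_ge0// mulr_ge0// divr_ge0 ?(ltW d0)// mulr_ge0.
set w := u - v; have w0 : 0 < `|w| by rewrite normr_gt0 subr_eq0.
pose phi (x : C) := L (F (complexify v + x *: complexify w)).
pose rho := d / (2 * `|w|); have rho0 : 0 < rho by rewrite divr_gt0// mulr_gt0.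
have seg (s : R) : 0 <= s <= 1 -> `|v + s *: w| <= r.
  move=> /andP[s0 s1]; rewrite (_ : v + s *: w = (1 - s) *: v + s *: u); last first.
    by rewrite /w scalerBr scalerBl scale1r addrA addrAC.
  apply: le_trans (ler_normD _ _) _; rewrite !normrZ (ger0_norm s0) ger0_norm ?subr_ge0//.
  have : (1 - s) * `|v| <= (1 - s) * r by rewrite ler_wpM2l ?subr_ge0.
  have : s * `|u| <= s * r by rewrite ler_wpM2l.
  lra.
have near (s : R) (x : C) : 0 <= s <= 1 -> modc x <= rho ->
    exists2 u0 : sobolev q, `|u0| <= r & `|complexify v + (s%:C + x) *: complexify w - complexify u0| < d%:C.
  move=> s01 xr; exists (v + s *: w); first exact: seg.
  rewrite complexifyD complexifyZ scalerDl addrA [_ + x *: _]addrC addrK.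
  rewrite (modc_scaler q) norm_complexify -rmorphM ltcR /=.
  apply: le_lt_trans (ler_wpM2r (ltW w0) xr) _.
  by rewrite /rho invfM mulrA divfK ?gt_eqF// ltr_pdivrMr// ltr_pMr// ltr1n.
have phid (s : R) (x : C) : 0 <= s <= 1 -> modc x <= rho -> exists D, cdiff phi (s%:C + x) D.
  move=> s01 xr; have := Fd _ (near s x s01 xr).
  move=> /(cdiff_line (complexify w) LD LZ Lc)[D hD]; exists D; apply: cdiff_at.
  by apply: cdiff_ext hD => y; rewrite /phi -addrA -scalerDl.
have phiK (s : R) (x : C) : 0 <= s <= 1 -> modc x <= rho -> modc (phi (s%:C + x)) <= c * K.
  move=> s01 xr; apply: le_trans (Lc _) _; rewrite ler_wpM2l//.
  by have := FK _ (near s x s01 xr); rewrite lecE /= => /andP[].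
have e1 : phi (0 + 1) = L (j' (f u)).
  rewrite /phi add0r scale1r -complexifyD (_ : v + w = u); last by rewrite /w addrC subrK.
  by rewrite Ff.
have e0 : phi 0 = L (j' (f v)) by rewrite /phi scale0r addr0 Ff.
rewrite -e1 -e0.
apply: le_trans (complex_mvt (M := 8 * (c * K) / rho) _) _; last first.
  rewrite modc1 mulr1 /rho le_eqVlt; apply/orP; left; apply/eqP.
  by field; rewrite !gt_eqF.
move=> s s01; have := phid s 0 s01; rewrite modc0 addr0 => /(_ (ltW rho0))[D hD].
exists D; first by rewrite add0r mulr1.
exact: (cauchy_bound rho0 (fun x => phid s x s01) (fun x => phiK s x s01) hD).
Qed.

Lemma uan_bound r : exists K : R, forall u : sobolev q, `|u| <= r -> `|j' (f u)| <= K%:C.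
Proof.
have [d d0 [F [Fd [K FK] Ff]]] := fan r; exists K => u ur; rewrite -Ff//.
by apply: FK; exists u => //; rewrite subrr normr0 ltcR.
Qed.
End uan.

(** On each bounded window the zeros are finite in number or fill it. Once some value at [t0] is
    nonzero, windows that contain [t0] fall under the first case, and countably many of them cover
    the line. *)
Lemma analytic_fun_zeros q (g : sobolev q -> R) (u v : sobolev q) : analytic_fun g ->
  countable [set t : R | g (u + t *: v) = 0] \/ (forall t : R, g (u + t *: v) = 0).
Proof.
move=> gan.
have key (T : R) : 0 < T -> finite_set [set t : R | `|t| <= T /\ g (u + t *: v) = 0] \/
    (forall t : R, `|t| <= T -> g (u + t *: v) = 0).
  move=> T0; have [d d0 [F [Fd [K FK] Ff]]] := gan (`|u| + (T + 1) * `|v|).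
  (* [e <= 1] keeps the real points in the ball where the extension is available, and [e] times the
     norm of [v] is below [d], so imaginary shifts stay in the complex neighbourhood. *)
  pose e := Num.min 1 (d / (2 * (`|v| + 1))).
  have v0 : 0 < `|v| + 1 by have := normr_ge0 v; lra.
  have e0 : 0 < e by rewrite lt_min ltr01 divr_gt0// mulr_gt0.
  have e1 : e <= 1 by rewrite ge_min lexx.
  have ev : e * `|v| < d.
    apply: le_lt_trans (_ : e * (`|v| + 1) < _); first by rewrite ler_wpM2l ?(ltW e0)// lerDl.
    apply: le_lt_trans (_ : d / (2 * (`|v| + 1)) * (`|v| + 1) < _).
      by rewrite ler_wpM2r ?(ltW v0)// ge_min lexx orbT.
    by rewrite invfM mulrA divfK ?gt_eqF// ltr_pdivrMr// ltr_pMr// ltr1n.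
  have inb (t : R) : `|t| <= T + e -> `|u + t *: v| <= `|u| + (T + 1) * `|v|.
    move=> te; apply: le_trans (ler_normD _ _) _; rewrite lerD2l normrZ ler_wpM2r//; lra.
  pose phi (w : C) : C := F (complexify u + w *: complexify v).
  have near (w : C) : `|complex.Re w| <= T + e -> `|complex.Im w| <= e ->
      exists2 u0 : sobolev q, `|u0| <= `|u| + (T + 1) * `|v| &
        `|complexify u + w *: complexify v - complexify u0| < d%:C.
    move=> w1 w2; exists (u + complex.Re w *: v); first exact: inb.
    rewrite complexifyD complexifyZ opprD addrACA subrr add0r -scalerBl.
    rewrite (modc_scaler q) norm_complexify -rmorphM ltcR /=.
    apply: le_lt_trans ev; rewrite ler_wpM2r//.
    apply: le_trans (modc_le_ReIm _) _; rewrite Re_sub Im_sub /= subrr normr0 add0r subr0 //.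
  have [|h|h] := @analytic_zeros R phi T e K T0 e0.
  - move=> w w1 w2; split.
      have := FK _ (near w w1 w2); rewrite -[`|_|]modcE lecR; exact.
    have := Fd _ (near w w1 w2).
    move=> /(@cdiff_line R _ _ F id 1 _ (complexify v)) [] //.
      by move=> x; rewrite mul1r.
    move=> D hD; exists D; apply: cdiff_at; apply: cdiff_ext hD => y.
    by rewrite /phi scalerDl addrA.
  - left; apply: sub_finite_set h => t [tT gt]; split=> //.
    rewrite /phi -complexifyZ -complexifyD Ff ?gt//; apply: inb; lra.
  - right=> t tT; have := h t tT.
    by rewrite /phi -complexifyZ -complexifyD Ff//; apply: inb; lra.
have [[t0 g0]|nz] := pselect (exists t : R, g (u + t *: v) <> 0); last first.
  by right=> t; apply: contrapT => gt; apply: nz; exists t.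
left; have fin (n : nat) : finite_set [set t : R | `|t| <= n.+1%:R + `|t0| /\ g (u + t *: v) = 0].
  have [|//|h] := key (n.+1%:R + `|t0|); first by rewrite ltr_wpDr.
  by exfalso; apply/g0/h; rewrite lerDr.
apply: (@sub_countable _ _ _ (\bigcup_n [set t : R | `|t| <= n.+1%:R + `|t0| /\ g (u + t *: v) = 0])).
  apply: subset_card_le => t gt; exists (Num.truncn `|t|) => //; split=> //.
  by apply: ler_wpDr => //; apply/ltW/truncnS_gt.
by apply: bigcup_countable => // n _; apply: finite_set_countable.
Qed.

End analytic_consequences.

Section analytic_sobolev_maps.
Variable R : realType.
Local Open Scope complex_scope.
Implicit Types (q r : R).

Lemma weighted_CS (J : Type) (s : seq J) (w a b : J -> R) : (forall j, 0 <= w j) ->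
  `|\sum_(j <- s) w j * (a j * b j)| <=
    Num.sqrt (\sum_(j <- s) w j * a j ^+ 2) * Num.sqrt (\sum_(j <- s) w j * b j ^+ 2).
Proof.
move=> w0; have A0 (c : J -> R) : 0 <= \sum_(j <- s) w j * c j ^+ 2.
  by apply: sumr_ge0 => j _; rewrite mulr_ge0 ?sqr_ge0.
rewrite -ler_sqr ?nnegrE ?mulr_ge0 ?sqrtr_ge0// exprMn !sqr_sqrtr ?A0// real_normK ?num_real//.
have := @sum_mul_CS R _ s (fun j => Num.sqrt (w j) * a j) (fun j => Num.sqrt (w j) * b j).
rewrite (eq_bigr (fun j => w j * (a j * b j))) => [|j _]; last by rewrite mulrACA -expr2 sqr_sqrtr.
rewrite [X in X * _](eq_bigr (fun j => w j * a j ^+ 2)) => [|j _]; last by rewrite exprMn sqr_sqrtr.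
by rewrite [X in _ * X](eq_bigr (fun j => w j * b j ^+ 2)) => [|j _]; last by rewrite exprMn sqr_sqrtr.
Qed.

Lemma nq_le_norm q n (u : sobolev q) : nq q n u <= `|u| ^+ 2.
Proof. by apply: nq_le; case: (coefP u). Qed.

Lemma sob_norm_le q (u : sobolev q) M : 0 <= M -> (forall n, nq q n u <= M ^+ 2) -> `|u| <= M.
Proof. by move=> M0 H; have [] := coef_norm_le M0 H. Qed.

Lemma analytic_sob_bound q q' (f : sobolev q -> sobolev q') r : analytic_sob f ->
  exists2 K : R, 0 <= K & forall u, `|u| <= r -> `|f u| <= K.
Proof.
move=> /uan_bound-/(_ r)[K HK]; exists `|K| => // u ur.
by have := HK u ur; rewrite norm_complexify lecR => /le_trans; apply; exact: ler_norm.
Qed.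

(** Duality: the functional is the weighted pairing with the truncated difference of the two values.
    On that difference it takes the value [nq q' n d], while its norm is at most the square root of
    this number. *)
Lemma analytic_sob_lip q q' (f : sobolev q -> sobolev q') r : analytic_sob f ->
  exists2 K : R, 0 <= K & forall u v, `|u| <= r -> `|v| <= r -> `|f u - f v| <= K * `|u - v|.
Proof.
move=> /uan_lip-/(_ r)[K K0 H]; exists K => // u v ur vr.
set d := (X in `|X| <= _); have KM : 0 <= K * `|u - v| by exact: mulr_ge0.
apply: (sob_norm_le KM) => n.
pose L (w : sobolevC q') : R[i] := \sum_(k <- idx n) (weight q' `|k|%N * d k)%:C * (w : int -> R[i]^o) k.
have [->|d0] := eqVneq (nq q' n d) 0; first by rewrite sqr_ge0.
have {}d0 : 0 < nq q' n d by rewrite lt_neqAle eq_sym d0 nq_ge0.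
have := H u v ur vr L (Num.sqrt (nq q' n d)) (sqrtr_ge0 _).
have -> : L (complexify (f u)) - L (complexify (f v)) = (nq q' n d)%:C.
  rewrite -sumrB rmorph_sum; apply: eq_bigr => k _.
  by rewrite -mulrBr /= -rmorphB /= -rmorphM /= -mulrA expr2.
rewrite modc_real ger0_norm ?nq_ge0// => {}H.
have {}H : nq q' n d <= Num.sqrt (nq q' n d) * (K * `|u - v|).
  apply: H => [x y|a x|x].
  - rewrite -big_split; apply: eq_bigr => k _; exact: mulrDr.
  - by rewrite mulr_sumr; apply: eq_bigr => k _; rewrite mulrCA.
  - apply: le_trans (_ : `|\sum_(k <- idx n) weight q' `|k|%N * (`|d k| * moduli x k)| <= _).
      rewrite ger0_norm; last first.
        by apply: sumr_ge0 => k _; rewrite mulr_ge0 ?weight_ge0// mulr_ge0 ?modc_ge0.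
      rewrite /L; elim: (idx n) => [|k s IH]; first by rewrite !big_nil modc0.
      rewrite !big_cons; apply: le_trans (modcD _ _) _; apply: lerD IH.
      by rewrite modcM modc_real normrM (ger0_norm (weight_ge0 _ _)) mulrA.
    apply: le_trans (weighted_CS _ _ _ _) _; first by move=> k; exact: weight_ge0.
    rewrite (eq_bigr (fun k => weight q' `|k|%N * d k ^+ 2)); last first.
      by move=> k _; rewrite real_normK ?num_real.
    rewrite ler_wpM2l ?sqrtr_ge0//=.
    rewrite -[leRHS]ger0_norm ?coef_norm_ge0// -sqrtr_sqr ler_wsqrtr//.
    by apply: nq_le; case: (coefCP x).
have s0 : 0 < Num.sqrt (nq q' n d) by rewrite sqrtr_gt0.
rewrite -{1}(sqr_sqrtr (ltW d0)) expr2 ler_pM2l// in H.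
by rewrite -(sqr_sqrtr (ltW d0)) ler_sqr ?nnegrE ?sqrtr_ge0 ?mulr_ge0.
Qed.

Lemma analytic_fun_lip q (g : sobolev q -> R) r : analytic_fun g ->
  exists2 K : R, 0 <= K & forall u v, `|u| <= r -> `|v| <= r -> `|g u - g v| <= K * `|u - v|.
Proof.
move=> /uan_lip-/(_ r)[K K0 H]; exists K => // u v ur vr.
have := H u v ur vr id 1 ler01 _ _ _; rewrite mul1r -rmorphB modc_real; apply=> //.
by move=> x; rewrite mul1r.
Qed.

Lemma analytic_fun_continuous q (g : sobolev q -> R) : analytic_fun g -> continuous g.
Proof.
move=> gan u; have FF : Filter (nbhs u) by exact: nbhs_filter.
have [K K0 HK] := analytic_fun_lip (`|u| + 1) gan.
apply/(@cvgrPdist_le R R^o _ (nbhs u) FF g (g u)) => eps e0; apply/nbhs_ballP.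
exists (Num.min 1 (eps / (K + 1))); first by rewrite /= lt_min ltr01 divr_gt0//; lra.
move=> v; rewrite -ball_normE /= lt_min => /andP[v1 v2].
apply: le_trans (HK u v _ _) _; first by rewrite lerDl.
  by rewrite -[v](subrK u) addrC (le_trans (ler_normD _ _))// lerD2l distrC ltW.
apply: le_trans (_ : (K + 1) * `|u - v| <= _); first by rewrite ler_wpM2r// lerDl.
by rewrite mulrC -ler_pdivlMr ?ltW//; lra.
Qed.

End analytic_sobolev_maps.

(** * Shears and the Gaussian measure *)

Section measure_comparison.
Local Open Scope ereal_scope.
Context d1 d2 (X : measurableType d1) (Y : measurableType d2) (R : realType).
Variables (mu : {measure set X -> \bar R}) (nu : {measure set Y -> \bar R}).
Variables (phi : X -> Y) (w : X -> R).
Hypotheses (mphi : measurable_fun setT phi) (mw : measurable_fun setT w).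
Hypothesis w0 : forall x, (0 <= w x)%R.

Import HBNNSimple.

Let rho (B : set Y) := \int[mu]_x (w x * \1_B (phi x))%:E.

Let mindic B : measurable B -> measurable_fun setT (fun x => \1_B (phi x) : R).
Proof.
move=> mB; rewrite (_ : (fun x => _) = \1_(phi @^-1` B)); last by apply/funext => x; rewrite !indicE.
by apply: measurable_indic; rewrite -[X in measurable X]setTI; exact: mphi.
Qed.

Let weighted_simple (h : {nnsfun Y >-> R}) :
  \int[mu]_x ((w x)%:E * (h (phi x))%:E) = \sum_(r \in range h) r%:E * rho (h @^-1` [set r]).
Proof.
transitivity (\int[mu]_x (\sum_(r \in range h) (r%:E * (w x * \1_(h @^-1` [set r]) (phi x))%:E))).
  apply: eq_integral => x _; rewrite [in LHS](fimfunE h) -fsumEFin //.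
  rewrite ge0_mule_fsumr; last by move=> r; exact: nnfun_muleindic_ge0.
  by apply: eq_fsbigr => r _; rewrite -!EFinM mulrCA.
rewrite ge0_integral_fsum//.
- apply: eq_fsbigr => r rh; rewrite ge0_integralZl//.
  + by apply/measurable_EFinP/measurable_funM => //; exact: mindic.
  + by move=> x _; rewrite lee_fin mulr_ge0.
  + by move: rh; rewrite inE => -[t _ <-]; rewrite lee_fin.
- move=> r; apply: emeasurable_funM => //.
  by apply/measurable_EFinP/measurable_funM => //; exact: mindic.
- move=> r x _; have [rh|rh] := pselect (exists t, h t = r).
    by case: rh => t <-; rewrite mule_ge0// lee_fin ?mulr_ge0.
  rewrite (_ : \1__ _ = 0)%R ?mulr0 ?mule0// indicE memNset// => hx.
  by apply: rh; exists (phi x).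
Qed.

Variable f : Y -> \bar R.
Hypotheses (mf : measurable_fun setT f) (f0 : forall y, 0 <= f y).
Let h := nnsfun_approx measurableT mf.

Let lim1 : \sum_(r \in range (h n)) r%:E * rho (h n @^-1` [set r]) @[n --> \oo] -->
  \int[mu]_x ((w x)%:E * f (phi x)).
Proof.
under eq_fun do rewrite -weighted_simple.
have wf x : (w x)%:E * f (phi x) = limn (fun n => (w x)%:E * (h n (phi x))%:E).
  by apply/esym/cvg_lim => //; apply: cvgeZl => //; exact: cvg_nnsfun_approx.
have -> : \int[mu]_x ((w x)%:E * f (phi x)) = \int[mu]_x limn (fun n => (w x)%:E * (h n (phi x))%:E).
  by apply: eq_integral => x _; exact: wf.
apply: cvg_monotone_convergence => //.
- move=> n; apply: emeasurable_funM; first exact/measurable_EFinP.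
  by apply/measurable_EFinP; exact: measurableT_comp.
- by move=> n x _; rewrite mule_ge0// lee_fin.
- move=> x _ a b ab; rewrite lee_wpmul2l ?lee_fin//; exact/lefP/nd_nnsfun_approx.
Qed.

Let lim2 : \sum_(r \in range (h n)) r%:E * nu (h n @^-1` [set r]) @[n --> \oo] -->
  \int[nu]_y f y.
Proof.
under eq_fun do rewrite -sintegralE -integralT_nnsfun.
have fE y : f y = limn (fun n => (h n y)%:E).
  by apply/esym/cvg_lim => //; exact: cvg_nnsfun_approx.
have -> : \int[nu]_y f y = \int[nu]_y limn (fun n => (h n y)%:E).
  by apply: eq_integral => y _; exact: fE.
apply: cvg_monotone_convergence => //.
- by move=> n; exact/measurable_EFinP.
- by move=> n x _; rewrite lee_fin.
- move=> x _ a b ab; rewrite lee_fin; exact/lefP/nd_nnsfun_approx.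
Qed.

(** A comparison on sets extends to nonnegative functions by simple approximation. The weighted
    image of [mu] by [phi] is used as a mere set function, and is never built as a measure. *)
Lemma le_integral_weighted : (forall B, measurable B -> \int[mu]_x (w x * \1_B (phi x))%:E <= nu B) ->
  \int[mu]_x ((w x)%:E * f (phi x)) <= \int[nu]_y f y.
Proof.
move=> H; rewrite -(cvg_lim _ lim1)// -(cvg_lim _ lim2)//.
apply: lee_lim; [exact: cvgP lim1|exact: cvgP lim2|].
apply: nearW => n; apply: lee_fsum => // r [t _ <-].
by rewrite lee_wpmul2l ?lee_fin ?H.
Qed.

Lemma eq_integral_weighted : (forall B, measurable B -> \int[mu]_x (w x * \1_B (phi x))%:E = nu B) ->
  \int[mu]_x ((w x)%:E * f (phi x)) = \int[nu]_y f y.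
Proof.
move=> H; rewrite -(cvg_lim _ lim1)// -(cvg_lim _ lim2)//.
by congr (limn _); apply/funext => n; apply: eq_fsbigr => r _; rewrite -H.
Qed.

End measure_comparison.

Section one_dimensional_shear.
Variable R : realType.
Local Notation leb := (@lebesgue_measure R).
Implicit Types (psi : R -> R) (D B : set R) (J : R).

(** Cover [B] by intervals: the part of [D] sent into an interval has diameter at most its length
    divided by [J], hence lies in an interval of that length. This uses neither differentiability
    nor the measurability of images. *)
Lemma lebesgue_expansion psi D J : 0 < J -> measurable D -> measurable_fun setT psi ->
  (forall x y, D x -> D y -> J * `|x - y| <= `|psi x - psi y|) ->
  forall B, measurable B -> (J%:E * leb (D `&` psi @^-1` B) <= leb B)%E.
Proof.
move=> J0 mD mpsi H B mB.
have mE (A : set R) : measurable A -> measurable (D `&` psi @^-1` A).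
  by move=> mA; apply: measurableI => //; rewrite -[X in measurable X]setTI; exact: mpsi.
apply: le_ereal_inf_tmp => _ [A [mA BA] <-].
have mA' k : measurable (A k : set R).
  by have [[a b] _ <-] := mA k; exact: measurable_itv.
have key k : (J%:E * leb (D `&` psi @^-1` (A k)) <= wlength idfun (A k))%E.
  have [[a b] _ AE] := mA k; rewrite -AE /=.
  set E := D `&` _.
  have [->|/set0P[x0 Ex0]] := eqVneq E set0; first by rewrite measure0 mule0 wlength_ge0.
  have ab : a <= b.
    by case: Ex0 => _; rewrite /= in_itv/= => /andP[u v]; apply: ltW; exact: lt_le_trans u v.
  pose L := (b - a) / J.
  have EL x y : E x -> E y -> x - L <= y.
    move=> [Dx]; rewrite /= in_itv/= => /andP[x1 x2] [Dy]; rewrite /= in_itv/= => /andP[y1 y2].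
    have hJ := H x y Dx Dy; rewrite lerBlDl -lerBlDr.
    rewrite /L ler_pdivlMr// mulrC; apply: le_trans (_ : J * `|x - y| <= _).
      by rewrite ler_pM2l// ler_norm.
    apply: le_trans hJ _; apply/ler_normlP; split; lra.
  have Einf : has_inf E by split; [exists x0|exists (x0 - L) => y; exact: EL].
  rewrite wlength_itv_bnd//=.
  have hE : (leb E <= leb `[inf E, (inf E + L)%R]%classic)%E.
    apply: le_measure; rewrite ?inE//.
      by apply: mE; exact: measurable_itv.
    move=> x Ex; rewrite /= in_itv/=; apply/andP; split.
      by apply: ge_inf => //; case: Einf.
    rewrite -lerBlDr; apply: lb_le_inf; first by exists x0.
    by move=> y; exact: EL.
  apply: le_trans (lee_wpmul2l _ hE) _; first by rewrite lee_fin ltW.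
  rewrite lebesgue_measure_itv/= lte_fin; case: ifPn => _; last by rewrite mule0 lee_fin subr_ge0.
  rewrite -EFinD -EFinM lee_fin [inf E + L]addrC addrK /L mulrC divfK ?gt_eqF//.
have h1 : (leb (D `&` psi @^-1` B) <= leb (\bigcup_k (D `&` psi @^-1` (A k))))%E.
  apply: le_measure; rewrite ?inE; [exact: mE|by apply: bigcup_measurable => k _; exact: mE|].
  by move=> x [Dx /BA[k _ Ak]]; exists k.
have h2 : (leb (\bigcup_k (D `&` psi @^-1` (A k))) <= \sum_(k <oo) leb (D `&` psi @^-1` (A k)))%E.
  apply: measure_sigma_subadditive => //.
  - by move=> k; exact: mE.
  - by apply: bigcup_measurable => k _; exact: mE.
apply: le_trans (lee_wpmul2l _ (le_trans h1 h2)) _; first by rewrite lee_fin ltW.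
rewrite -nneseriesZl//.
by apply: lee_nneseries => [k _ _|k _]; [rewrite mule_ge0// lee_fin ltW|exact: key].
Qed.

Lemma normal_density (s : R) (f : R -> \bar R) : measurable_fun setT f -> (forall x, 0 <= f x)%E ->
  (\int[normal_prob 0%R s]_x f x = \int[leb]_x ((normal_pdf 0 s x)%:E * f x))%E.
Proof.
move=> mf f0; apply/esym; apply: (@eq_integral_weighted _ _ _ _ _ _ _ id) => //.
- exact: measurable_normal_pdf.
- by move=> x; exact: normal_pdf_ge0.
- move=> B mB; rewrite /normal_prob [RHS]integral_mkcond; apply: eq_integral => x _.
  by rewrite patchE indicE; case: ifPn => _; rewrite ?mulr1 ?mulr0.
Qed.

(** The exponential is the ratio of the Gaussian densities at [psi x] and at [x]; multiplied by the
    density it reduces the claim to the expansion of Lebesgue measure. *)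
Lemma normal_shear (s : R) psi D J (f : R -> \bar R) : s != 0 -> 0 < J -> measurable D ->
  measurable_fun setT psi -> (forall x y, D x -> D y -> J * `|x - y| <= `|psi x - psi y|) ->
  measurable_fun setT f -> (forall x, 0 <= f x)%E ->
  (\int[normal_prob 0%R s]_x ((\1_D x * (J * expR (- (psi x ^+ 2 - x ^+ 2) / (s ^+ 2 *+ 2))))%:E * f (psi x))
   <= \int[normal_prob 0%R s]_x f x)%E.
Proof.
move=> s0 J0 mD mpsi H mf f0.
have mw : measurable_fun setT (fun x => \1_D x * (J * expR (- (psi x ^+ 2 - x ^+ 2) / (s ^+ 2 *+ 2)))).
  apply: measurable_funM; first exact: measurable_indic.
  apply: measurable_funM => //; apply: measurableT_comp => //; apply: measurable_funM => //.
  by apply: measurableT_comp => //; apply: measurable_funB; apply: measurable_funX.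
rewrite !normal_density//; last 2 first.
- apply: emeasurable_funM; first exact/measurable_EFinP.
  exact: measurableT_comp.
- by move=> x; rewrite mule_ge0// lee_fin mulr_ge0 ?mulr_ge0 ?expR_ge0 ?(ltW J0).
pose g x : \bar R := ((normal_pdf 0 s x)%:E * f x)%E.
apply: le_trans (_ : (\int[leb]_x ((J * \1_D x)%:E * g (psi x)) <= _)%E).
  rewrite le_eqVlt; apply/orP; left; apply/eqP; apply: eq_integral => x _.
  rewrite /g muleA [RHS]muleA; congr (_ * _)%E; rewrite -!EFinM; congr (_%:E).
  have pdfE y : normal_pdf 0 s y = normal_peak s * expR (- y ^+ 2 / (s ^+ 2 *+ 2)).
    by rewrite -[in RHS](subr0 y) /normal_pdf (negbTE s0).
  rewrite !pdfE [LHS](_ : _ = J * \1_D x * (normal_peak s * (expR (- x ^+ 2 / (s ^+ 2 *+ 2)) * expR (- (psi x ^+ 2 - x ^+ 2) / (s ^+ 2 *+ 2))))); last by ring.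
  by rewrite -expRD; congr (_ * (_ * expR _)); rewrite -mulrDl; congr (_ / _); ring.
have le_w := @le_integral_weighted _ _ _ _ R leb leb psi (fun x => J * \1_D x) mpsi.
apply: (le_w _ _ g) => //; clear le_w.
- by apply: measurable_funM => //; exact: measurable_indic.
- by move=> x; rewrite mulr_ge0// ltW.
- apply: emeasurable_funM => //; apply/measurable_EFinP; exact: measurable_normal_pdf.
- by move=> x; rewrite mule_ge0// lee_fin normal_pdf_ge0.
move=> B mB; apply: le_trans (lebesgue_expansion J0 mD mpsi H mB).
have mE : measurable (D `&` psi @^-1` B).
  by apply: measurableI => //; rewrite -[X in measurable X]setTI; exact: mpsi.
rewrite -[X in leb X]setIT -(integral_indic leb measurableT mE) -ge0_integralZl//; last 2 first.
- exact/measurable_EFinP/measurable_indic.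
- by rewrite lee_fin ltW.
rewrite le_eqVlt; apply/orP; left; apply/eqP; apply: eq_integral => x _.
by rewrite -EFinM indicI /= -mulrA; congr (_ * (_ * _))%:E; rewrite !indicE.
Qed.

End one_dimensional_shear.

(** * Truncations, cylinders and Borel sets *)

Section sobolev_space.
Variables (R : realType) (p : nat).
Local Notation q := (p%:R : R).
Local Notation H := (sobolev q).
Local Notation bH := (borelH R p).
Implicit Types (u v : H) (k : int) (n : nat).

Lemma weight_ge1 k : k != 0 -> 1 <= weight q `|k|%N.
Proof.
move=> k0; rewrite weight_nat; apply: exprn_ege1.
have k1 : 1 <= `|k|%N%:R :> R by rewrite ler1n absz_gt0.
have p1 : 1 <= 2 * pi :> R by have := pi_ge2 R; lra.
by rewrite -[leLHS]mulr1 ler_pM.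
Qed.

Lemma coef_le u k : `|coef u k| <= `|u|.
Proof.
have [->|k0] := eqVneq k 0; first by have [-> _] := coefP u; rewrite normr0.
rewrite -ler_sqr ?nnegrE// real_normK ?num_real//.
apply: le_trans (nq_le_norm `|k|.+1 u).
rewrite /nq (bigD1_seq k) ?uniq_idx//=; last by rewrite mem_idx k0 ltnS leqnn.
rewrite -[leLHS]mul1r -[leLHS]addr0; apply: lerD.
  by rewrite ler_wpM2r ?sqr_ge0// weight_ge1.
by apply: sumr_ge0 => j _; rewrite mulr_ge0 ?weight_ge0 ?sqr_ge0.
Qed.

Lemma sob_coefD u v k : coef (u + v) k = coef u k + coef v k. Proof. by []. Qed.

Lemma sob_coefB u v k : coef (u - v) k = coef u k - coef v k. Proof. by []. Qed.
Lemma sob_coefZ c u k : coef (c *: u) k = c * coef u k. Proof. by []. Qed.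

Lemma sum_idx_sub (V : nmodType) (F : int -> V) n m : (n <= m)%N ->
  \sum_(k <- idx m | k \in idx n) F k = \sum_(k <- idx n) F k.
Proof.
move=> nm; have sub : {subset idx n <= idx m}.
  by move=> k; rewrite !mem_idx => /andP[-> /leq_trans]; apply.
rewrite -big_filter; apply: perm_big; apply: uniq_perm; rewrite ?filter_uniq ?uniq_idx//.
by move=> k; rewrite mem_filter; apply/andP/idP => [[]//|km]; split => //; exact: sub.
Qed.

Lemma nq_mono a n m : (n <= m)%N -> nq q n a <= nq q m a.
Proof.
move=> nm; rewrite /nq -(sum_idx_sub _ nm) big_mkcond; apply: ler_sum => k _.
by case: ifP => // _; rewrite mulr_ge0 ?weight_ge0 ?sqr_ge0.
Qed.

Lemma finite_sob_subproof (n : nat) (a : int -> R) :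
  (fun k => if k \in idx n then a k else 0) \in sob_pred q.
Proof.
apply/asboolP; split; first by rewrite mem_idx eqxx.
set b := (fun k => _).
apply: le_lt_trans (ltry (nq q n b)); apply: sqsum_le => m.
apply: le_trans (nq_mono _ (leq_maxl m n)) _.
rewrite /nq -(sum_idx_sub _ (leq_maxr m n)) [leRHS]big_mkcond; apply: ler_sum => k _.
by rewrite /b; case: ifP => //; rewrite expr0n mulr0.
Qed.

(** Acts on arbitrary sequences, and therefore also builds elements of the space from finitely many
    prescribed coefficients. *)
Definition trunc n (a : int -> R) : H := Sobolev (finite_sob_subproof n a).
Lemma truncE n a k : coef (trunc n a) k = if k \in idx n then a k else 0.
Proof. by []. Qed.

Definition bas k : H := trunc `|k|.+1 (fun j => (j == k)%:R).
Lemma basE k j : k != 0 -> coef (bas k) j = (j == k)%:R.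
Proof.
move=> k0; rewrite truncE; case: ifP => //; rewrite mem_idx => jk.
case: eqP => // jE; move: jk; by rewrite jE k0 ltnS leqnn.
Qed.

Lemma sob_ext u v : (forall k, k != 0 -> coef u k = coef v k) -> u = v.
Proof.
move=> uv; apply/val_inj/funext => k; have [->|k0] := eqVneq k 0; last exact: uv.
have [eu _] := coefP u; have [ev _] := coefP v; exact: etrans eu (esym ev).
Qed.

Lemma norm_tail u n : `|u - trunc n u| ^+ 2 = `|u| ^+ 2 - nq q n u.
Proof.
have h1 := nq_cvg (coefP u).2; have h2 := nq_cvg (coefP (u - trunc n u)).2.
rewrite !sob_normE; apply: (cvg_unique (@Rhausdorff R) h2).
apply: (@cvg_trans _ ((fun m => nq q m u - nq q n u) @ \oo)); last first.
  by apply: cvgB => //; exact: cvg_cst.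
apply: near_eq_cvg; exists n => // m /= nm.
have -> : nq q m (u - trunc n u) =
    \sum_(k <- idx m) (if k \in idx n then 0 else weight q `|k|%N * coef u k ^+ 2).
  apply: eq_bigr => k _.
  have -> : coef (u - trunc n u) k = coef u k - (if k \in idx n then coef u k else 0) by [].
  by case: ifP => // _; rewrite ?subrr ?expr0n ?mulr0 ?subr0.
rewrite /nq -(sum_idx_sub _ nm) (bigID (mem (idx n))) /= addrAC subrr add0r big_mkcond.
by apply: eq_bigr => k _; rewrite if_neg.
Qed.

Lemma trunc_cvg u : (fun n => `|u - trunc n u|) @ \oo --> (0 : R).
Proof.
have h : (fun n => `|u - trunc n u| ^+ 2) @ \oo --> (0 : R).
  under eq_fun do rewrite norm_tail.
  rewrite -(subrr (`|u| ^+ 2)); apply: cvgB; first exact: cvg_cst.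
  by have := nq_cvg (coefP u).2; rewrite sob_normE.
have := cvg_comp _ _ h (@sqrt_continuous R 0); rewrite sqrtr0.
rewrite (_ : _ \o _ = fun n => `|u - trunc n u|)//.
by apply/funext => n /=; rewrite sqrtr_sqr ger0_norm.
Qed.

Lemma nq_trunc_le n m u : nq q m (trunc n u) <= nq q m u.
Proof.
apply: ler_sum => k _; rewrite ler_wpM2l ?weight_ge0// truncE; case: ifP => // _.
by rewrite expr0n sqr_ge0.
Qed.

Lemma norm_trunc_le n u : `|trunc n u| <= `|u|.
Proof.
apply: sob_norm_le => // m; apply: le_trans (nq_trunc_le n m u) _; exact: nq_le_norm.
Qed.

Lemma lip_continuous (g : H -> R) :
  (forall r, exists2 K : R, 0 <= K & forall u v, `|u| <= r -> `|v| <= r -> `|g u - g v| <= K * `|u - v|) ->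
  continuous g.
Proof.
move=> Hg u; have FF : Filter (nbhs u) by exact: nbhs_filter.
have [K K0 HK] := Hg (`|u| + 1).
apply/(@cvgrPdist_le R R^o _ (nbhs u) FF g (g u)) => eps e0; apply/nbhs_ballP.
exists (Num.min 1 (eps / (K + 1))); first by rewrite /= lt_min ltr01 divr_gt0//; lra.
move=> v; rewrite -ball_normE /= lt_min => /andP[v1 v2].
apply: le_trans (HK u v _ _) _; first by rewrite lerDl.
  by rewrite -[v](subrK u) addrC (le_trans (ler_normD _ _))// lerD2l distrC ltW.
apply: le_trans (_ : (K + 1) * `|u - v| <= _); first by rewrite ler_wpM2r// lerDl.
by rewrite mulrC -ler_pdivlMr ?ltW//; lra.
Qed.

Lemma coef_continuous k : continuous (fun u : H => coef u k).
Proof.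
apply: lip_continuous => r; exists 1 => // u v _ _.
by rewrite mul1r; exact: (coef_le (u - v)).
Qed.

Lemma continuous_measurableH (g : H -> R) : continuous g -> measurable_fun [set: bH] (g : bH -> R).
Proof.
move=> gc; apply: (measurability _ (RGenOInfty.measurableE R)) => _ [_ [x ->] <-].
rewrite setTI; apply: sub_sigma_algebra.
by move/continuousP : gc; apply; exact: itv_open_ends_open.
Qed.

Definition cyl : set (set H) := [set A | exists (s : seq int) (B : int -> set R),
  [/\ uniq s, 0 \notin s, forall k, measurable (B k) & A = [set u | forall k, k \in s -> B k (coef u k)]]].

Lemma cyl_setI : setI_closed cyl.
Proof.
move=> _ _ [s [B [us s0 mB ->]]] [t [D [ut t0 mD ->]]].
exists (undup (s ++ t)), (fun k => (if k \in s then B k else setT) `&` (if k \in t then D k else setT)).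
split.
- exact: undup_uniq.
- by rewrite mem_undup mem_cat negb_or s0.
- by move=> k; apply: measurableI; case: ifP.
- apply/seteqP; split=> [u [h1 h2] k _|u h].
    by split; case: ifP => //; [exact: h1|exact: h2].
  split=> k ks; have := h k; rewrite mem_undup mem_cat ks ?orbT.
    by move=> /(_ isT)[].
  by move=> /(_ isT)[].
Qed.

Let cH := g_sigma_algebraType cyl.

Lemma cyl_coef k : measurable_fun [set: cH] (fun u : cH => coef (u : H) k).
Proof.
move=> _ B mB; rewrite setTI; apply: sub_sigma_algebra.
have [->|k0] := eqVneq k 0.
  have E : (fun u : H => coef u 0) = cst 0 by apply/funext => u; have [-> _] := coefP u.
  have [B0|B0] := pselect (B 0).
    exists [::], (fun=> setT); split => //; rewrite E; apply/seteqP; split => //.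
  exists [:: 1], (fun=> set0); split => //; rewrite E; apply/seteqP; split => // u.
  by move=> /(_ 1) h; exfalso; apply: h; rewrite inE.
exists [:: k], (fun=> B); split => //; first by rewrite inE eq_sym.
apply/seteqP; split=> [u Bu j|u /(_ k)]; first by rewrite inE => /eqP ->.
by rewrite inE => /(_ (eqxx _)).
Qed.

Lemma closed_ballE (d : H) (r : R) : 0 <= r ->
  [set u : H | `|u - d| <= r] = \bigcap_n [set u | nq q n (u - d) <= r ^+ 2].
Proof.
move=> r0; apply/seteqP; split=> [u /= ur n _|u ur].
  rewrite /mkset; apply: le_trans (nq_le_norm n (u - d)) _; rewrite ler_sqr ?nnegrE//.
by apply: sob_norm_le => // n; exact: ur.
Qed.

Lemma cyl_closed_ball (d : H) (r : R) : 0 <= r -> <<s cyl >> [set u : H | `|u - d| <= r].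
Proof.
move=> r0; rewrite closed_ballE//.
apply: (@bigcapT_measurable _ cH) => n.
have m : measurable_fun [set: cH] (fun u : cH => nq q n (u - d)).
  rewrite /nq; apply: measurable_sum => k.
  apply: measurable_funM => //; apply: measurable_funX; apply: measurable_funB => //.
  exact: cyl_coef.
have := m measurableT `]-oo, (r ^+ 2)]%classic (measurable_itv _); rewrite setTI.
by congr (_ _); apply/seteqP; split => u /=; rewrite in_itv.
Qed.

(** A dense family of finitely supported rational sequences, indexed by a countable type:
    association lists from modes to rationals, together with a cutoff. *)
Definition ratH (x : seq (int * rat) * nat) : H :=
  trunc x.2 (fun k => ratr (nth (0, 0) x.1 (index k [seq i.1 | i <- x.1])).2).

Lemma ratH_dense u (e : R) : 0 < e -> exists x, `|u - ratH x| < e.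
Proof.
move=> e0; have e2 : 0 < e / 2 by rewrite divr_gt0.
have [n /(_ n (leqnn n)) Hn] : exists n, forall m, (n <= m)%N -> `|u - trunc m u| < e / 2.
  have /cvgrPdist_lt/(_ _ e2)[n _ h] := trunc_cvg u; exists n => m nm.
  by have := h m nm; rewrite sub0r normrN ger0_norm.
pose W := nq q n (fun=> 1) + 1; have W0 : 0 < W by have := nq_ge0 q n (fun=> 1 : R); rewrite /W; lra.
pose d := e / (4 * W).
have d0 : 0 < d by rewrite divr_gt0// mulr_gt0.
have rt k : exists a : rat, `|coef u k - ratr a| < d.
  have [a /andP[a1 a2]] : exists a : rat, (coef u k - d < ratr a) && (ratr a < coef u k + d).
    have lt : coef u k - d < coef u k + d by lra.
    have [a] := @rat_in_itvoo R _ _ lt; rewrite in_itv/= => ha; by exists a.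
  by exists a; rewrite ltr_distlC a1 a2.
have [a Ha] := choice rt.
exists ([seq (k, a k) | k <- idx n], n).
rewrite -[u](subrK (trunc n u)) -addrA; apply: le_lt_trans (ler_normD _ _) _.
rewrite [e]splitr; apply: ltr_leD Hn _.
set v := ratH _; apply: sob_norm_le => [|m]; first exact: ltW.
apply: le_trans (_ : nq q m (trunc n (fun=> d)) <= _).
  apply: ler_sum => k _; rewrite ler_wpM2l ?weight_ge0//.
  have -> : coef (trunc n u - v) k = coef (trunc n u) k - coef v k by [].
  rewrite !truncE; case: ifP => kn; last by rewrite subrr.
  rewrite /= -map_comp (_ : [seq _ | i <- idx n] = idx n); last by rewrite -[RHS]map_id; apply: eq_map.
  rewrite (nth_map 0) ?index_mem// nth_index//=.
  by rewrite -[leLHS]real_normK ?num_real// ler_sqr ?nnegrE ?(ltW d0)// ltW.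
apply: le_trans (nq_mono _ (leq_maxl m n)) _.
rewrite /nq (eq_bigr (fun k => if k \in idx n then weight q `|k|%N * d ^+ 2 else 0)); last first.
  by move=> k _; rewrite truncE; case: ifP => // _; rewrite expr0n mulr0.
rewrite -big_mkcond (sum_idx_sub _ (leq_maxr m n)).
have -> : \sum_(k <- idx n) weight q `|k|%N * d ^+ 2 = nq q n (fun=> 1) * d ^+ 2.
  by rewrite mulr_suml; apply: eq_bigr => k _; rewrite expr1n mulr1.
have W1 : nq q n (fun=> 1) <= W by rewrite /W lerDl.
apply: le_trans (_ : W * d ^+ 2 <= _); first by rewrite ler_wpM2r ?sqr_ge0.
have -> : W * d ^+ 2 = W^-1 * (e / 4) ^+ 2 by rewrite /d; field; rewrite gt_eqF.
have W2 : 1 <= W by rewrite /W lerDr nq_ge0.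
apply: le_trans (_ : (e / 4) ^+ 2 <= _); first by rewrite ler_piMl ?sqr_ge0// invf_le1.
by rewrite ler_sqr ?nnegrE ?divr_ge0 ?(ltW e0)//; lra.
Qed.

(** Separability: an open set is a countable union of closed balls centred at the points [ratH], and
    a closed ball is a countable intersection of conditions on finitely many coefficients. Hence
    Borel sets and measurable maps can be tested coefficient by coefficient. *)
Lemma open_cyl (O : set H) : open O -> <<s cyl >> O.
Proof.
move=> oO.
pose I := [set x : (seq (int * rat) * nat) * nat | [set u : H | `|u - ratH x.1| <= x.2.+1%:R^-1] `<=` O].
have -> : O = \bigcup_(x in I) [set u : H | `|u - ratH x.1| <= x.2.+1%:R^-1].
  apply/seteqP; split=> [u Ou|u [x Ix ux]]; last exact: Ix ux.
  have : nbhs u O by exact: open_nbhs_nbhs.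
  move=> /nbhs_ballP[e /= e0 He].
  have [n Hn] : exists n : nat, n.+1%:R^-1 < e / 2.
    exists (Num.truncn (e / 2)^-1); rewrite -[ltRHS]invrK ltf_pV2 ?posrE ?invr_gt0 ?divr_gt0//.
    exact: truncnS_gt.
  have n0 : 0 < n.+1%:R^-1 :> R by rewrite invr_gt0.
  have [x Hx] := ratH_dense u n0; exists (x, n); last by rewrite /mkset ltW.
  move=> v /= vx; apply: He; rewrite -ball_normE /=.
  rewrite -[u](subrK (ratH x)) -addrA; apply: le_lt_trans (ler_normD _ _) _.
  have h1 : `|u - ratH x| < e / 2 by exact: lt_trans Hx Hn.
  have h2 : `|ratH x - v| < e / 2 by rewrite distrC; exact: le_lt_trans vx Hn.
  by rewrite [e]splitr ltrD.
rewrite bigcup_mkcond; apply: (@countable_bigcupT_measurable _ cH); first exact: countableP.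
move=> x.
case: ifP => _; last exact: measurable0.
by apply: cyl_closed_ball; rewrite invr_ge0.
Qed.

Lemma measurable_coef k : measurable_fun [set: bH] (fun u : bH => coef (u : H) k).
Proof. by apply: continuous_measurableH; exact: coef_continuous. Qed.

Lemma measurable_cyl : (@measurable _ bH) = <<s cyl >>.
Proof.
apply/seteqP; split.
  apply: smallest_sub; [exact: smallest_sigma_algebra|by move=> O; exact: open_cyl].
apply: smallest_sub; first exact: sigma_algebra_measurable.
move=> _ [s [B [us s0 mB ->]]].
have -> : [set u : H | forall k, k \in s -> B k (coef u k)] =
    \bigcap_(k in [set` s]) [set u : H | B k (coef u k)] by [].
apply: (@fin_bigcap_measurable _ bH) => // k _.
by have := measurable_coef k measurableT (mB k); rewrite setTI.
Qed.

Lemma measurable_toH d (T : measurableType d) (g : T -> bH) :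
  (forall k, k != 0 -> measurable_fun [set: T] (fun t => coef (g t : H) k)) ->
  measurable_fun [set: T] g.
Proof.
move=> mg; apply: (measurability _ measurable_cyl) => _ [_ [s [B [us s0 mB ->]]] <-].
rewrite setTI.
have -> : g @^-1` [set u : H | forall k, k \in s -> B k (coef u k)] =
    \bigcap_(k in [set` s]) [set t | B k (coef (g t : H) k)] by [].
apply: fin_bigcap_measurable => // k ks.
have k0 : k != 0 by apply: contraNneq s0 => <-.
by have := mg k k0 measurableT (B k) (mB k); rewrite setTI.
Qed.

Lemma measurable_normH : measurable_fun [set: bH] (fun u : bH => `|u : H|).
Proof.
apply: continuous_measurableH; apply: lip_continuous => r; exists 1 => // u v _ _.
by rewrite mul1r ler_dist_dist.
Qed.

Lemma measurable_closed_ballH (M : R) : measurable (closed_ballH M : set bH).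
Proof.
have := measurable_normH measurableT (measurable_itv `]-oo, M]); rewrite setTI.
by congr measurable; apply/seteqP; split => u; rewrite /= in_itv.
Qed.

End sobolev_space.

Section gaussian_measure.
Variables (R : realType) (p : nat).
Local Notation q := (p%:R : R).
Local Notation H := (sobolev q).
Local Notation bH := (borelH R p).
Variable eta : probability bH R.
Hypothesis eta_gauss : is_gaussian eta.
Implicit Types (u v : H) (k : int) (n : nat).

Definition upd k (u : H) (x : R) : H := u + (x - coef u k) *: bas R p k.

Lemma updE k u x j : k != 0 -> coef (upd k u x) j = if j == k then x else coef u j.
Proof.
move=> k0; rewrite /upd sob_coefD sob_coefZ basE//; case: eqP => [->|_]; last by rewrite mulr0 addr0.
by rewrite mulr1 addrC subrK.
Qed.

Lemma upd_id k u : upd k u (coef u k) = u.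
Proof. by rewrite /upd subrr scale0r addr0. Qed.

Lemma upd_upd k u x y : k != 0 -> upd k (upd k u x) y = upd k u y.
Proof. by move=> k0; apply: sob_ext => j _; rewrite !updE//; case: eqP. Qed.

Lemma upd_add k u x s : upd k u (x + s) = upd k u x + s *: bas R p k.
Proof. by rewrite /upd -[RHS]addrA -scalerDl addrAC. Qed.

Lemma measurable_upd k : k != 0 ->
  measurable_fun [set: bH * measurableTypeR R] (fun z : bH * measurableTypeR R => upd k (z.1 : H) z.2 : bH).
Proof.
move=> k0; apply: measurable_toH => j j0.
have [->|jk] := eqVneq j k.
  by apply: (eq_measurable_fun snd) => // z _; rewrite updE// eqxx.
apply: (eq_measurable_fun (fun z : bH * measurableTypeR R => coef (z.1 : H) j)).
  by move=> z _; rewrite updE// (negbTE jk).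
have := measurableT_comp (measurable_coef j) (@measurable_fst _ _ bH (measurableTypeR R)).
exact.
Qed.

Lemma measurable_upd_snd k (u : H) : k != 0 -> measurable_fun [set: R] (fun x : R => upd k u x : bH).
Proof.
move=> k0; apply: measurable_toH => j j0.
apply: (eq_measurable_fun (if j == k then id else cst (coef u j))).
  by move=> x _; rewrite updE//; case: ifP.
by case: ifP.
Qed.

Lemma gauss_sd_gt0 k : k != 0 -> 0 < gauss_sd R p k.
Proof.
move=> k0; rewrite /gauss_sd invr_gt0 exprn_gt0// !mulr_gt0 ?pi_gt0//.
by rewrite normr_gt0 intr_eq0.
Qed.

Local Notation N k := (normal_prob 0 (gauss_sd R p k)).

(** Independence: replacing the [k]-th coefficient by an independent Gaussian variable of the same
    law preserves [eta]. This is checked on the cylinders, which are stable under intersection and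
    generate the Borel sets; then Tonelli applies. *)
Lemma gaussian_fibration k (phi : bH -> \bar R) : k != 0 ->
  measurable_fun [set: bH] phi -> (forall u, 0 <= phi u)%E ->
  (\int[eta]_u phi u = \int[eta]_u \int[N k]_x phi (upd k (u : H) x))%E.
Proof.
move=> k0 mphi phi0.
pose Phi (z : bH * measurableTypeR R) : bH := upd k (z.1 : H) z.2.
have mPhi : measurable_fun [set: bH * measurableTypeR R] Phi := measurable_upd k0.
have -> : (\int[eta]_u \int[N k]_x phi (upd k (u : H) x) = \int[eta \x (N k)]_z phi (Phi z))%E.
  apply/esym; apply: (@fubini_tonelli1 _ _ _ _ _ eta (N k) (phi \o Phi)) => [|z]; last exact: phi0.
  exact: measurableT_comp.
pose m : {measure set (bH * measurableTypeR R) -> \bar R} := (eta \x (N k))%E.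
have mA (s : seq int) (B : int -> set R) : (forall k, measurable (B k)) ->
    measurable ([set u : H | forall k, k \in s -> B k (coef u k)] : set bH).
  move=> mB; have -> : [set u : H | forall k, k \in s -> B k (coef u k)] =
    \bigcap_(k in [set` s]) [set u : H | B k (coef u k)] by [].
  apply: (@fin_bigcap_measurable _ bH) => // j _.
  by have := @measurable_coef R p j measurableT _ (mB j); rewrite setTI.
have E (A : set bH) : measurable A -> eta A = m (Phi @^-1` A).
  move=> mAA; apply: (@measure_unique _ R bH (@cyl R p) (fun=> setT) (@measurable_cyl R p) (@cyl_setI R p)
    _ _ eta (pushforward m Phi)) => //.
  - move=> _; exists [::], (fun=> setT); split => //; apply/seteqP; split => //.
  - by apply/seteqP; split => // u _; exists 0%N.
  - move=> _ [s [B [us s0 mB ->]]].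
    change (eta [set u : H | forall j, j \in s -> B j (coef u j)] = m (Phi @^-1` [set u : H | forall j, j \in s -> B j (coef u j)])).
    have [ks|ks] := boolP (k \in s); last first.
      have -> : Phi @^-1` [set u | forall j, j \in s -> B j (coef u j)] =
         [set u : H | forall j, j \in s -> B j (coef u j)] `*` setT.
        apply/seteqP; split=> [z Hz|z [Hz _] j js].
          split=> // j js; have := Hz j js; rewrite updE//; case: eqP => // jk.
          by rewrite -jk js in ks.
        by rewrite updE//; case: eqP => [jk|_]; [rewrite -jk js in ks|exact: Hz].
      have := @product_measure1E _ _ _ _ R eta (N k) _ _ (mA s B mB) measurableT.
      by move=> EE; refine (etrans _ (esym EE)); rewrite [X in (_ * X)%E](@probability_setT _ _ _ (N k)) mule1.
    have -> : Phi @^-1` [set u | forall j, j \in s -> B j (coef u j)] =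
         [set u : H | forall j, j \in rem k s -> B j (coef u j)] `*` B k.
      apply/seteqP; split=> [z Hz|z [Hz1 Hz2] j js].
        split; last by have := Hz k ks; rewrite updE// eqxx.
        move=> j; rewrite mem_rem_uniq// inE => /andP[jk js]; have := Hz j js.
        by rewrite updE// (negbTE jk).
      rewrite updE//; case: eqP => [->//|/eqP jk]; apply: Hz1.
      by rewrite mem_rem_uniq// inE jk.
    have := @product_measure1E _ _ _ _ R eta (N k) _ _ (mA (rem k s) B mB) (mB k).
    move=> EE; refine (etrans _ (esym EE)); have [eta1 eta2] := eta_gauss.
    have s0' : 0 \notin rem k s by apply/negP => /mem_rem h; rewrite h in s0.
    refine (etrans (eta2 s B us s0 mB) _).
    refine (etrans _ (congr1 (fun x => x * N k (B k))%E (esym (eta2 (rem k s) B (rem_uniq k us) s0' mB)))).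
    rewrite (perm_big _ (perm_to_rem ks)) big_cons muleC; congr (_ * _)%E.
    exact: eta1.
  - by move=> _; exact: (eq_ind_r (fun x => x < +oo)%E (ltry 1) (@probability_setT _ _ _ eta)).
have := @eq_integral_weighted _ _ _ _ R m eta Phi (fun=> 1) mPhi (measurable_cst _).
move=> /(_ (fun=> ler01) phi mphi phi0) <-.
  by apply: eq_integral => z _; rewrite mul1e.
move=> B mB; refine (etrans _ (esym (E B mB))).
have mB' : measurable (Phi @^-1` B) by rewrite -[X in measurable X]setTI; exact: mPhi.
rewrite -[X in m X]setIT -(integral_indic m measurableT mB').
by apply: eq_integral => z _; rewrite mul1r !indicE.
Qed.

Lemma measurable_fibration k (phi : bH -> \bar R) : k != 0 ->
  measurable_fun [set: bH] phi -> (forall u, 0 <= phi u)%E ->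
  measurable_fun [set: bH] (fun u : bH => \int[N k]_x phi (upd k (u : H) x))%E.
Proof.
move=> k0 mphi phi0.
pose Phi (z : bH * measurableTypeR R) : bH := upd k (z.1 : H) z.2.
have mPhi : measurable_fun [set: bH * measurableTypeR R] Phi := measurable_upd k0.
have h := @measurable_fun_fubini_tonelli_F _ _ _ _ R (N k) (phi \o Phi).
by apply: h => [|z]; [exact: measurableT_comp|exact: phi0].
Qed.

Definition shear k (b : H -> R) u : H := u + b u *: bas R p k.

Lemma coef_shear k b u j : k != 0 -> coef (shear k b u) j = coef u j + b u * (j == k)%:R.
Proof. by move=> k0; rewrite /shear sob_coefD sob_coefZ basE. Qed.

Lemma measurable_shear k (b : H -> R) : k != 0 -> measurable_fun [set: bH] (b : bH -> R) ->
  measurable_fun [set: bH] (shear k b : bH -> bH).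
Proof.
move=> k0 mb; apply: measurable_toH => j j0.
apply: (eq_measurable_fun (fun u : bH => coef (u : H) j + b u * (j == k)%:R)).
  by move=> u _; rewrite coef_shear.
by apply: measurable_funD; [exact: measurable_coef|exact: measurable_funM].
Qed.

(** On the fibre obtained by freezing the other coefficients [J] is constant and the shear is a map
    of the line, so [normal_shear] applies; the fibres are then integrated. *)
Lemma coordinate_shear k (b J : H -> R) (D : set bH) (phi : bH -> \bar R) : k != 0 ->
  measurable D -> measurable_fun [set: bH] (b : bH -> R) ->
  measurable_fun [set: bH] (J : bH -> R) -> (forall u, D u -> 0 < J u) ->
  (forall u x, J (upd k u x) = J u) ->
  (forall u x, D u -> D (upd k u x) -> J u * `|x - coef u k| <= `|x + b (upd k u x) - (coef u k + b u)|) ->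
  measurable_fun [set: bH] phi -> (forall u, 0 <= phi u)%E ->
  (\int[eta]_u ((\1_D u * (J u * expR (- (coef (shear k b u) k ^+ 2 - coef u k ^+ 2) / (gauss_sd R p k ^+ 2 *+ 2))))%:E * phi (shear k b u))
   <= \int[eta]_u phi u)%E.
Proof.
move=> k0 mD mb mJ J0 Jk HJ mphi phi0.
have Gk u : coef (shear k b u) k = coef u k + b u by rewrite coef_shear// eqxx mulr1.
have mG := measurable_shear k0 mb.
have J0' u : 0 <= \1_D u * J u.
  by rewrite indicE; case: (boolP (u \in D)) => [|_]; rewrite ?mul0r// inE => /J0; rewrite mul1r => /ltW.
set psi0 := (fun u : bH => _ : \bar R).
have m0 : measurable_fun [set: bH] psi0.
  apply: emeasurable_funM; last exact: (measurableT_comp mphi mG).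
  apply/measurable_EFinP; apply: measurable_funM; first exact: measurable_indic.
  apply: measurable_funM => //; apply: measurableT_comp => //; apply: measurable_funM => //.
  apply: measurableT_comp => //; apply: measurable_funB; apply: measurable_funX; last exact: measurable_coef.
  by have := measurableT_comp (@measurable_coef R p k) mG.
have psi00 u : (0 <= psi0 u)%E by rewrite mule_ge0// lee_fin mulrA mulr_ge0 ?expR_ge0.
rewrite [leRHS](gaussian_fibration k0 mphi phi0) (gaussian_fibration k0 m0 psi00).
apply: ge0_le_integral => //.
- by move=> u _; apply: integral_ge0.
- exact: measurable_fibration.
- exact: measurable_fibration.
move=> v _.
pose Dv : set R := [set x | D (upd k v x)].
have mu' := @measurable_upd_snd k v k0.
have mDv : measurable Dv by rewrite -[X in measurable X]setTI; exact: mu'.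
have sG x : shear k b (upd k v x) = upd k v (x + b (upd k v x)) by rewrite /shear upd_add.
have E x : psi0 (upd k v x) = ((\1_Dv x * (J v * expR (- ((x + b (upd k v x)) ^+ 2 - x ^+ 2) / (gauss_sd R p k ^+ 2 *+ 2))))%:E
    * phi (upd k v (x + b (upd k v x))))%E.
  by rewrite /psi0 Jk sG !updE// eqxx !indicE.
under eq_integral do rewrite E.
(* Positivity of [J] is known only on [D]; a fibre that misses [D] contributes nothing to the
   left-hand side. *)
have [Dv0|/set0P[x0 Dx0]] := eqVneq Dv set0.
  under eq_integral do rewrite Dv0 indic0 mul0r mul0e.
  by rewrite integral0 integral_ge0.
have J0v : 0 < J v by rewrite -(Jk v x0); exact: J0.
have s0 : gauss_sd R p k != 0 by rewrite gt_eqF ?gauss_sd_gt0.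
have mpsi : measurable_fun [set: R] (fun x : R => x + b (upd k v x)).
  by apply: measurable_funD => //; exact: (measurableT_comp mb mu').
have := @normal_shear R _ (fun x => x + b (upd k v x)) Dv (J v) (fun x => phi (upd k v x)) s0 J0v mDv mpsi.
apply => //; last exact: (measurableT_comp mphi mu').
move=> x y Dx Dy; have := HJ (upd k v y) x Dy.
by rewrite Jk upd_upd// !updE// eqxx; apply.
Qed.

End gaussian_measure.

(** * Regularity of the Gaussian measure *)

Section regularity.
Variables (R : realType) (p : nat).
Local Notation q := (p%:R : R).
Local Notation H := (sobolev q).
Local Notation bH := (borelH R p).
Variable eta : probability bH R.
Hypothesis eta_gauss : is_gaussian eta.
Implicit Types (u v : H) (k : int) (n : nat).
Local Notation N k := (normal_prob 0 (gauss_sd R p k)).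

Lemma normal_countable0 (s : R) (A : set R) : countable A -> normal_prob 0 s A = 0%E.
Proof.
move=> cA; have mA : measurable A by exact: countable_measurable.
have := @normal_prob_dominates R 0 s; rewrite null_content_dominatesP; apply => //.
exact: countable_lebesgue_measure0.
Qed.

Section zero_sets.
Variable g : H -> R.
Hypothesis gan : analytic_fun g.

Fixpoint zero_along (s : seq int) u : Prop :=
  if s is k :: s' then forall x : R, zero_along s' (upd k u x) else g u = 0.

(** The alternative of [analytic_fun_zeros] passes to intersections: if one member of the family has
    a countable trace on the line, so has the intersection, and otherwise all members contain the
    line. *)
Lemma zero_along_line s u v : all (fun k => k != 0) s ->
  countable [set t : R | zero_along s (u + t *: v)] \/ (forall t : R, zero_along s (u + t *: v)).
Proof.
elim: s u v => [|k s IH] u v /=; first by move=> _; exact: analytic_fun_zeros.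
move=> /andP[k0 s0].
have E t x : upd k (u + t *: v) x = upd k u x + t *: upd k v 0.
  apply: sob_ext => j _; rewrite [LHS]updE// [RHS]sob_coefD [in RHS]sob_coefZ !updE//; case: eqP => // _.
  by rewrite mulr0 addr0.
have [[x nx]|all] := pselect (exists x, ~ forall t, zero_along s (upd k u x + t *: upd k v 0)).
  left; have [c|//] := IH (upd k u x) (upd k v 0) s0.
  by apply: sub_countable c; apply: subset_card_le => t /= /(_ x); rewrite E.
right=> t x; rewrite E; apply: contrapT => h; apply: all; exists x => h'; exact: h.
Qed.

(** A countable set is null for a Gaussian law on the line, so the conditional probability of the
    set, given the other coefficients, is 0 or 1. *)
Lemma section_dichotomy s k u : k != 0 -> all (fun k => k != 0) s ->
  (N k [set x | zero_along s (upd k u x)] = (\1_[set v | zero_along (k :: s) v] u)%:E)%E.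
Proof.
move=> k0 s0.
have E x : upd k u x = upd k u 0 + x *: bas R p k by rewrite -upd_add// add0r.
rewrite indicE; have [all|nall] := pselect (zero_along (k :: s) u).
  rewrite mem_set// (_ : [set x | _] = setT); last by apply/seteqP; split => // x _; exact: all.
  exact: (@probability_setT _ _ _ (N k)).
rewrite memNset//; have [c|h] := zero_along_line (upd k u 0) (bas R p k) s0.
  by apply: normal_countable0; apply: sub_countable c; apply: subset_card_le => x /=; rewrite E.
by exfalso; apply: nall => x; rewrite E; exact: h.
Qed.

(** By the fibration formula, the set of points whose whole fibre lies in the zero set has the same
    measure as the set itself; hence one more mode in [s] changes nothing. Measurability is obtained
    in the same induction, from that of the conditional probability. *)
Lemma zero_along_measure s : all (fun k => k != 0) s ->
  measurable ([set u | zero_along s u] : set bH) /\ eta [set u | zero_along s u] = eta [set u | g u = 0].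
Proof.
elim: s => [_|k s IH /= /andP[k0 s0]].
  split=> //; have := continuous_measurableH (analytic_fun_continuous gan) measurableT (@measurable_set1 _ 0).
  by rewrite setTI.
have [ms <-] := IH s0.
set A : set bH := [set u | zero_along s u] in ms *.
set B : set bH := [set u | _].
have m1 : measurable_fun [set: bH] (fun u => (\1_A u)%:E : \bar R).
  exact/measurable_EFinP/measurable_indic.
have p1 u : (0 <= (\1_A u)%:E :> \bar R)%E by rewrite lee_fin.
have mAk u : measurable [set x : R | zero_along s (upd k u x)].
  by have := measurable_upd_snd u k0 measurableT ms; rewrite setTI.
have E u : (\int[N k]_x (\1_A (upd k (u : H) x))%:E)%E = (\1_B u)%:E.
  have -> : (fun x : R => (\1_A (upd k u x))%:E) = (fun x => (\1_[set x : R | zero_along s (upd k u x)] x)%:E) :> (R -> \bar R).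
    by apply/funext => x; rewrite !indicE.
  refine (etrans (integral_indic (N k) measurableT (mAk u)) _).
  by refine (etrans _ (section_dichotomy u k0 s0)); rewrite setIT.
have mB1 : measurable_fun [set: bH] (\1_B : bH -> R).
  have := measurable_fibration k0 m1 p1; under eq_fun do rewrite E.
  by move/measurable_EFinP.
have mB : measurable B.
  have := mB1 measurableT (set1 1) (@measurable_set1 _ 1); rewrite setTI.
  congr measurable; apply/seteqP; split => u /=; rewrite indicE.
    by case: (boolP (u \in B)) => [|_ /esym/eqP]; rewrite ?inE// oner_eq0.
  by move=> Bu; rewrite mem_set.
split=> //.
have := gaussian_fibration eta_gauss k0 m1 p1.
under [X in _ = X -> _]eq_integral do rewrite E.
by rewrite !integral_indic// !setIT => ->.
Qed.

Fixpoint modes n : seq int := if n is n'.+1 then n%:Z :: - n%:Z :: modes n' else [::].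

Lemma modes_neq0 n : all (fun k => k != 0) (modes n).
Proof. by elim: n => // n IH /=; rewrite IH andbT oppr_eq0. Qed.

Lemma mem_modes n k : k != 0 -> (`|k| <= n)%N -> k \in modes n.
Proof.
move=> k0; elim: n => [|n IH] /=; first by rewrite leqn0 absz_eq0 (negbTE k0).
by rewrite leq_eqVlt => /predU1P[kn|/IH]; rewrite !inE; [|move=> ->; rewrite !orbT]; lia.
Qed.

Lemma zero_along_agree s u v : all (fun k => k != 0) s -> zero_along s u ->
  (forall k, k != 0 -> k \notin s -> coef v k = coef u k) -> g v = 0.
Proof.
elim: s u => [|k s IH] u /=.
  by move=> _ gu vu; rewrite (_ : v = u)//; apply: sob_ext => k k0; exact: vu.
move=> /andP[k0 s0] H vu; apply: (IH _ s0 (H (coef v k))) => j j0 js.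
by rewrite updE//; case: eqP => [->//|/eqP jk]; apply: vu => //; rewrite inE negb_or jk.
Qed.

(** The sets [Z n] decrease and all have the measure of the zero set, so it is enough that their
    intersection is empty. A point [u] of it would satisfy $g=0$ at [u] plus the truncations of
    [u0 - u], hence at [u0] by continuity. *)
Lemma zero_set_null : (exists u, g u <> 0) -> eta [set u | g u = 0] = 0%E.
Proof.
move=> [u0 gu0].
pose Z n : set bH := [set u | zero_along (modes n) u].
have mZ n : measurable (Z n) by have [] := zero_along_measure (modes_neq0 n).
have dec : nonincreasing_seq Z.
  apply/nonincreasing_seqP => n; apply/subsetPset => u /= /(_ (coef u n.+1%:Z)).
  by rewrite upd_id => /(_ (coef u (- n.+1%:Z))); rewrite upd_id.
have capZ : \bigcap_n Z n = set0.
  apply/seteqP; split=> // u Hu; apply: gu0.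
  have conv : (fun n => g (u + trunc p n (u0 - u))) @ \oo --> g u0.
    have [K K0 HK] := analytic_fun_lip (`|u0| + (`|u| + `|u0 - u|)) gan.
    apply/cvgrPdist_le => e e0.
    have := trunc_cvg (u0 - u); move/cvgrPdist_le => /(_ (e / (K + 1))).
    have K1 : 0 < K + 1 by lra.
    move=> /(_ (divr_gt0 e0 K1)); apply: filterS => n; rewrite sub0r normrN normr_id => Hn.
    apply: le_trans (HK _ _ _ _) _.
    - by rewrite lerDl addr_ge0.
    - apply: ler_wpDl => //; apply: le_trans (ler_normD _ _) _; rewrite lerD2l.
      exact: norm_trunc_le.
    - rewrite opprD addrA; apply: le_trans (ler_wpM2l K0 Hn) _.
      rewrite mulrA ler_pdivrMr// mulrC ler_pM2l//; lra.
  have z n : g (u + trunc p n (u0 - u)) = 0.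
    apply: (@zero_along_agree (modes n) u _ (modes_neq0 n) (Hu n Logic.I)) => k k0 kn.
    rewrite sob_coefD truncE; case: ifP; rewrite ?addr0// mem_idx => /andP[_ kn'].
    by rewrite mem_modes// ltnW in kn.
  rewrite -(cvg_lim _ conv)//; under eq_fun do rewrite z.
  exact: lim_cst.
have := @nonincreasing_cvg_mu _ _ _ eta Z; rewrite capZ measure0.
have c0 : (eta (Z 0%N) < +oo)%E.
  by apply: le_lt_trans (ltry 1); exact: probability_le1.
move=> /(_ c0 mZ measurable0 dec).
have -> : eta \o Z = fun=> eta [set u | g u = 0].
  by apply/funext => n /=; have [_ ->] := zero_along_measure (modes_neq0 n).
move=> /cvg_lim <- //; apply/esym/cvg_lim => //; exact: cvg_cst.
Qed.

End zero_sets.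

(** The shear inequality is applied to $+\infty\cdot1_A$: its integral is 0, and the positive weight
    of the left-hand side is absorbed by the infinite value. *)
Lemma null_shift k (c : R) (A : set bH) : k != 0 -> measurable A -> eta A = 0%E ->
  eta [set u | A (shear k (fun=> c) u)] = 0%E.
Proof.
move=> k0 mA A0; have mc : measurable_fun [set: bH] (cst c : bH -> R) by [].
have mB : measurable ([set u | A (shear k (fun=> c) u)] : set bH).
  by have := measurable_shear k0 mc measurableT mA; rewrite setTI.
pose phi (u : bH) : \bar R := (+oo * (\1_A u)%:E)%E.
have mphi : measurable_fun [set: bH] phi.
  by apply: emeasurable_funM => //; exact/measurable_EFinP/measurable_indic.
have phi0 u : (0 <= phi u)%E by rewrite mule_ge0// lee_fin.
have := @coordinate_shear _ _ eta eta_gauss k (fun=> c) (fun=> 1) setT phi k0 measurableT mc.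
move=> /(_ (measurable_cst _) (fun _ _ => ltr01) (fun _ _ => erefl)).
have h (u : H) (x : R) : setT u -> setT (upd k u x) -> 1 * `|x - coef u k| <= `|x + c - (coef u k + c)|.
  by move=> _ _; rewrite mul1r (_ : x + c - _ = x - coef u k)//; ring.
move=> /(_ h mphi phi0).
have -> : (\int[eta]_u phi u = 0)%E.
  rewrite /phi ge0_integralZl//; last exact/measurable_EFinP/measurable_indic.
  have -> : (\int[eta]_u (\1_A u)%:E = 0)%E.
    by refine (etrans (integral_indic eta measurableT mA) _); rewrite setIT.
  by rewrite mule0.
move=> le0; apply/eqP; rewrite eq_le measure_ge0 andbT; apply: le_trans le0.
rewrite -[leLHS](_ : (\int[eta]_u (\1_[set u | A (shear k (fun=> c) u)] u)%:E = _)%E); last first.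
  by rewrite integral_indic// setIT.
apply: ge0_le_integral => //.
- exact/measurable_EFinP/measurable_indic.
- apply: emeasurable_funM; last exact: (measurableT_comp mphi (measurable_shear k0 mc)).
  apply/measurable_EFinP; apply: measurable_funM; first exact: measurable_indic.
  apply: measurable_funM => //; apply: measurableT_comp => //; apply: measurable_funM => //.
  apply: measurableT_comp => //; apply: measurable_funB; apply: measurable_funX; last exact: measurable_coef.
  by have := measurableT_comp (@measurable_coef R p k) (measurable_shear k0 mc).
- move=> u _; rewrite indicE /phi !indicE.
  have [Au|Au] := pselect (A (shear k (fun=> c) u)).
    rewrite !mem_set// mule1 mul1r mul1r gt0_muley ?leey//.
    by rewrite lte_fin expR_gt0.
  by rewrite memNset// mule_ge0// ?lee_fin ?mulr_ge0 ?expR_ge0// mule_ge0// lee_fin.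
Qed.

Lemma null_translate (s : seq int) (c : int -> R) (A : set bH) : all (fun k => k != 0) s ->
  measurable A -> eta A = 0%E ->
  eta [set u | A (u + \sum_(k <- s) c k *: bas R p k)] = 0%E.
Proof.
elim: s A => [|k s IH] A /=.
  move=> _ _ A0; rewrite -[RHS]A0; congr (eta _); apply/funext => u.
  rewrite /mkset; by have -> : u + \sum_(k <- [::]) c k *: bas R p k = u by rewrite big_nil addr0.
move=> /andP[k0 s0] mA A0.
have mc : measurable_fun [set: bH] (cst (c k) : bH -> R) by [].
have mB : measurable ([set u | A (shear k (fun=> c k) u)] : set bH).
  by have := measurable_shear k0 mc measurableT mA; rewrite setTI.
have := IH _ s0 mB (null_shift (c k) k0 mA A0).
by under eq_set do rewrite /= /shear -addrA [X in _ + X]addrC -(big_cons _ _ k s xpredT).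
Qed.

Lemma trunc_sum n (a : int -> R) : trunc p n a = \sum_(k <- idx n) a k *: bas R p k :> H.
Proof.
apply: sob_ext => j j0.
have -> : coef (\sum_(k <- idx n) a k *: bas R p k) j = \sum_(k <- idx n) a k * (k == j)%:R.
  have sE (s : seq int) : all (fun k => k != 0) s -> coef (\sum_(k <- s) a k *: bas R p k) j = \sum_(k <- s) a k * (k == j)%:R.
    elim: s => [|k s IH]; first by rewrite !big_nil.
    by move=> /= /andP[k0 s0]; rewrite !big_cons sob_coefD sob_coefZ basE// IH// [j == k]eq_sym.
  by apply: sE; apply/allP => k; exact: idx_neq0.
by rewrite sum_idx_delta truncE; case: ifP; rewrite ?mulr1 ?mulr0.
Qed.

(** If the centred ball were null, so would be its translates along finitely many modes, and
    countably many of these cover the space. *)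
Lemma closed_ball_gt0 (M : R) : 0 < M -> (0 < eta (closed_ballH M))%E.
Proof.
move=> M0; rewrite lt0e measure_ge0 andbT; apply/eqP => h0.
have mB (d : H) : measurable ([set u | `|u - d| <= M] : set bH).
  by rewrite measurable_cyl; apply: cyl_closed_ball; exact: ltW.
have z x : eta [set u | `|u - ratH R p x| <= M] = 0%E.
  have := @null_translate (idx x.2) (fun k => - coef (ratH R p x) k) _ _ (@measurable_closed_ballH R p M) h0.
  have -> : all (fun k => k != 0) (idx x.2) by apply/allP => k; exact: idx_neq0.
  move=> /(_ isT); congr (eta _ = _); apply/funext => u.
  rewrite /closed_ballH /=; congr (`|u + _| <= M).
  transitivity (- trunc p x.2 (coef (ratH R p x))).
    by rewrite trunc_sum -sumrN; apply: eq_bigr => k _; rewrite scaleNr.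
  congr (- _); apply: sob_ext => k _.
  by rewrite [LHS]truncE /ratH !truncE; case: (k \in idx x.2).
have : eta [set: bH] = 0%E.
  have -> : [set: bH] = \bigcup_x [set u | `|u - ratH R p x| <= M].
    by apply/seteqP; split => // u _; have [x /ltW ux] := ratH_dense u M0; exists x.
  apply/eqP; rewrite eq_le measure_ge0 andbT.
  pose F n : set bH := if unpickle n is Some x then [set u | `|u - ratH R p x| <= M] else set0.
  have mF n : measurable (F n) by rewrite /F; case: unpickle.
  have F0 n : eta (F n) = 0%E by rewrite /F; case: unpickle => [x|]; rewrite ?z ?measure0.
  apply: (@le_trans _ _ (eta (\bigcup_n F n))).
    apply: le_measure; rewrite ?inE.
    - by apply: countable_bigcupT_measurable => //; exact: countableP.
    - exact: bigcupT_measurable.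
    - by move=> u [x _ ux]; exists (pickle x) => //; rewrite /F pickleK.
  apply: le_trans (measure_sigma_subadditive _ mF _ _) _ => //; first exact: bigcupT_measurable.
  by rewrite eseries0// => n _ _; exact: F0.
by move=> E; have := etrans (esym (@probability_setT _ _ _ eta)) E => /eqP; rewrite onee_eq0.
Qed.

End regularity.

(** * Truncations in the Sobolev space *)

Section uniform_limits.
Variable R : realType.
Implicit Types (X : nat -> tpoly R) (L : R -> R) (tau : nat -> R).

Lemma le_add_null (a b c : R) tau : tau @ \oo --> (0 : R) ->
  (forall n, a <= b + c * tau n) -> a <= b.
Proof.
move=> t0 H; have h : (fun n => b + c * tau n) @ \oo --> b + c * 0.
  by apply: cvgD; [exact: cvg_cst|exact: cvgMr].
rewrite mulr0 addr0 in h; rewrite -(cvg_lim _ h)//.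
by apply: limr_ge; [exact: cvgP h|exact: nearW].
Qed.

Lemma cvg_dist_le (f : nat -> R) (l : R) tau : tau @ \oo --> (0 : R) ->
  (forall n, `|f n - l| <= tau n) -> f @ \oo --> l.
Proof.
move=> t0 H; apply/cvgrPdist_le => e e0; move/cvgrPdist_le: t0 => /(_ e e0).
apply: filterS => n; rewrite sub0r normrN => Hn.
by rewrite distrC; apply: le_trans (H n) _; apply: le_trans (ler_norm _) Hn.
Qed.

Lemma uniform_limit X tau : tau @ \oo --> (0 : R) ->
  (forall m n x, (m <= n)%N -> `|X n x - X m x| <= tau m) ->
  exists L, forall m x, `|X m x - L x| <= tau m.
Proof.
move=> t0 H.
have HL (x : R) : exists l : R, forall m, `|X m x - l| <= tau m.
  have [|l Hl] := @sup_between R nat (fun m => X m x - tau m) (fun m => X m x + tau m) 0%N.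
    move=> i j; have [ij|ji] := leqP i j.
      have := H i j x ij; have := le_trans (normr_ge0 _) (H j j x (leqnn j)).
      by move=> h1 /ler_normlP[h2 h3]; lra.
    have := H j i x (ltnW ji); have := le_trans (normr_ge0 _) (H i i x (leqnn i)).
    by move=> h1 /ler_normlP[h2 h3]; lra.
  by exists l => m; have /andP[h1 h2] := Hl m; apply/ler_normlP; split; lra.
by have [L HL'] := choice HL; exists L => m x.
Qed.

Lemma tp_mvt (Y : tpoly R) (x t M : R) : (forall s, `|s| <= `|t| -> `|D Y (x + s) - D Y x| <= M) ->
  `|Y (x + t) - Y x - t * D Y x| <= `|t| * M.
Proof.
move=> H.
have dY (s : R) : is_derive s 1 Y (D Y s).
  by apply: DeriveDef; [exact: tp_derivable|rewrite -derive1E DE].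
have := @deriv_lip R (fun s => Y (x + s * t) - s * t * D Y x) (fun s => t * D Y (x + s * t) - t * D Y x) (`|t| * M).
rewrite !mul1r !mul0r addr0 subr0; rewrite addrAC; apply.
  move=> s s01; apply: is_deriveB; first exact: is_derive_affine.
  have -> : (fun s : R => s * t * D Y x) = (fun s : R => (t * D Y x) * s) by apply/funext => z; ring.
  have h := is_deriveZ (t * D Y x) (is_derive_id s (1 : R)).
  by rewrite /GRing.scale /= mulr1 in h; exact: h.
move=> s /andP[s0 s1]; rewrite -mulrBr normrM ler_wpM2l//; apply: H.
by rewrite normrM ger0_norm// ler_piMl.
Qed.

(** Differentiation of a uniform limit: the oscillation of every [D (X n)] near [x] is compared with
    that of a single continuous [D (X m)], uniformly in [n]. *)
Lemma uniform_derive X tau L L' : tau @ \oo --> (0 : R) ->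
  (forall m x, `|X m x - L x| <= tau m) -> (forall m x, `|D (X m) x - L' x| <= tau m) ->
  forall x : R, is_derive x 1 L (L' x).
Proof.
move=> t0 XL XL' x; apply: eps_is_derive => e e0.
have [m tm] : exists m, tau m <= e / 4.
  have e4 : 0 < e / 4 by rewrite divr_gt0.
  move/cvgrPdist_le: t0 => /(_ _ e4)[m _ /(_ m (leqnn m))]; rewrite sub0r normrN => h.
  by exists m; apply: le_trans (ler_norm _) h.
have e4 : 0 < e / 4 by rewrite divr_gt0.
have /cvgrPdist_le/(_ _ e4)/nbhs_ballP[d /= d0 Hd] := @tp_continuous R (D (X m)) x.
exists (d / 2); first by rewrite divr_gt0.
move=> t td.
have key s : `|s| <= `|t| -> `|D (X m) (x + s) - D (X m) x| <= e / 4.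
  move=> st; rewrite distrC; apply: Hd; rewrite /ball /= opprD addrA subrr add0r normrN.
  by apply: le_lt_trans st (le_lt_trans td _); rewrite ltr_pdivrMr// ltr_pMr// ltr1n.
apply: (@le_add_null _ _ (2 + 3 * `|t|) tau t0) => n.
have h : `|X n (x + t) - X n x - t * D (X n) x| <= `|t| * (2 * tau n + 2 * tau m + e / 4).
  apply: tp_mvt => s /key.
  have := XL' n (x + s); have := XL' n x; have := XL' m (x + s); have := XL' m x.
  move: (D (X n) (x + s)) (D (X n) x) (D (X m) (x + s)) (D (X m) x) (L' (x + s)) (L' x).
  move=> a b c d' f g /ler_normlP[? ?] /ler_normlP[? ?] /ler_normlP[? ?] /ler_normlP[? ?] /ler_normlP[? ?].
  apply/ler_normlP; split; lra.
have h1 := XL n (x + t); have h2 := XL n x; have h3 := XL' n x.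
rewrite (_ : L (x + t) - L x - t * L' x = (L (x + t) - X n (x + t)) + (X n x - L x) +
  t * (D (X n) x - L' x) + (X n (x + t) - X n x - t * D (X n) x)); last by ring.
apply: le_trans (ler_normD _ _) _; apply: le_trans (lerD (ler_normD _ _) h) _.
apply: le_trans (lerD (lerD (ler_normD _ _) (lexx _)) (lexx _)) _.
rewrite normrM distrC in h1 *; have h4 : `|t| * `|D (X n) x - L' x| <= `|t| * tau n by rewrite ler_wpM2l.
have h5 : `|t| * (2 * tau m + e / 4) <= `|t| * (3 * (e / 4)) by rewrite ler_wpM2l//; lra.
have h6 : 0 <= `|t| * (e / 4) by rewrite mulr_ge0// ltW.
rewrite !mulrDr mulrDl in h5 *; lra.
Qed.

End uniform_limits.

Section sobolev_series.
Variables (R : realType) (p : nat).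
Local Notation q := (p%:R : R).
Local Notation H := (sobolev q).
Implicit Types (u : H) (a : int -> R).

Lemma wn_sqr_weight k : wn R k ^+ (2 * p) = weight q `|k|%N.
Proof.
rewrite weight_nat !exprM; congr (_ ^+ p); rewrite /wn !exprMn; congr (_ * _).
by rewrite -[RHS](sqrrN) -[k%:~R ^+ 2]real_normK ?num_real// -intr_norm -abszE sqrrN.
Qed.

Lemma sqr_n2_Dn_S n a : n2 (Dn p (S n a)) ^+ 2 = nq q n a.
Proof. by rewrite sqr_n2 Parseval_Dn; apply: eq_bigr => k _; rewrite wn_sqr_weight. Qed.

Lemma S_sub n m a : (m <= n)%N -> S m a = S n (fun k => if k \in idx m then a k else 0).
Proof.
move=> mn; rewrite /S -(sum_idx_sub _ mn) big_mkcond; apply: eq_bigr => k _.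
by case: ifP => // _; rewrite tpC0 mul0r.
Qed.

Lemma n2_Dn_tail u n m : (m <= n)%N -> n2 (Dn p (S n u - S m u)) <= `|u - trunc p m u|.
Proof.
move=> mn; apply: le_n2 => //; rewrite -sqr_n2 (S_sub u mn) -SB sqr_n2_Dn_S.
apply: le_trans (nq_le_norm n (u - trunc p m u)); rewrite le_eqVlt; apply/orP; left; apply/eqP.
by apply: eq_bigr => k _; rewrite sob_coefB truncE.
Qed.

Lemma n2_Dn_norm u n : n2 (Dn p (S n u)) <= `|u|.
Proof. by apply: le_n2 => //; rewrite -sqr_n2 sqr_n2_Dn_S; exact: nq_le_norm. Qed.

Lemma sup_tail u j n m x : (j < p)%N -> (m <= n)%N ->
  `|Dn j (S n u) x - Dn j (S m u) x| <= `|u - trunc p m u|.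
Proof.
move=> jp mn; apply: le_trans (n2_Dn_tail u mn).
rewrite -tp_opp -tp_add -DnB; apply: sup_Dn => //.
by rewrite IB !I_S subrr.
Qed.

(** For all orders below [p] the truncated series converge uniformly at the one rate
    [|u - trunc p m u|], so the derivatives of the sum are the limits of the derivatives. *)
Lemma synth_derivatives u : exists L : nat -> R -> R,
  (forall j m x, (j < p)%N -> `|Dn j (S m u) x - L j x| <= `|u - trunc p m u|) /\
  (forall j, (j < p)%N -> derive1n j (synth u) = L j).
Proof.
have HL (j : nat) : exists L : R -> R, (j < p)%N -> forall m x, `|Dn j (S m u) x - L x| <= `|u - trunc p m u|.
  have [jp|pj] := ltnP j p; last by exists (fun=> 0).
  have [|L HL] := @uniform_limit R (fun m => Dn j (S m u)) _ (trunc_cvg u).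
    by move=> m n x mn; exact: sup_tail.
  by exists L.
have [L {}HL] := choice HL; exists L; split=> [j m x jp|]; first exact: HL.
elim=> [p0|j IH jp].
  apply/funext => x; apply/cvg_lim => //.
  have := cvg_dist_le (trunc_cvg u) (fun m => HL 0%N p0 m x).
  by under eq_fun do rewrite Dn0 SE.
have jp' : (j < p)%N by exact: ltnW.
apply/funext => x; rewrite derive1nS IH// derive1E.
have := uniform_derive (trunc_cvg u) (HL j jp') (L' := L j.+1) _ x.
by move=> h; apply: (@derive_val _ _ _ _ _ _ _ (h _)) => m y; rewrite -DnS; exact: HL.
Qed.

End sobolev_series.

(** * Limits in $L^2$ and the derivative of top order *)

Section L2_limits.
Variable R : realType.
Local Notation leb := (@lebesgue_measure R).
Local Notation U := (`[0 : R, 1]%classic).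
Implicit Types (X : nat -> tpoly R) (tau : nat -> R) (w : R -> R).

Lemma integral_tp (X : tpoly R) : (\int[leb]_(x in U) (X x)%:E = (I X)%:E)%E.
Proof.
by rewrite IE /torus_int /Rintegral fineK//; apply: integrable_fin_num => //; exact: tp_integrable.
Qed.

Lemma measurable_tp (X : tpoly R) : measurable_fun setT X.
Proof. by apply: continuous_measurable_fun; exact: tp_continuous. Qed.

(* AM-GM: [2 |f| <= t + f ^ 2 / t] *)
Lemma L1_le_L2 (f : R -> R) (D : set R) (t : R) : measurable_fun setT f -> 0 < t ->
  measurable D -> D `<=` U ->
  (\int[leb]_(x in U) (f x ^+ 2)%:E <= (t ^+ 2)%:E)%E ->
  (\int[leb]_(x in D) (`|f x|)%:E <= t%:E)%E.
Proof.
move=> mf t0 mD DU H.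
have mf2 : measurable_fun setT (fun x => f x ^+ 2) by exact: measurable_funX.
have mn : measurable_fun setT (fun x => `|f x|) by exact: measurableT_comp.
apply: (@le_trans _ _ (\int[leb]_(x in U) (`|f x|)%:E)%E).
  by apply: ge0_subset_integral => //; apply/measurable_EFinP/measurable_funTS.
apply: (@le_trans _ _ (\int[leb]_(x in U) ((t / 2)%:E + (2 * t)^-1%:E * (f x ^+ 2)%:E))%E).
  apply: ge0_le_integral => //.
  - by apply/measurable_EFinP/measurable_funTS.
  - apply: emeasurable_funD => //; apply: emeasurable_funM => //.
    by apply/measurable_EFinP/measurable_funTS.
  - move=> x _; rewrite -EFinM -EFinD lee_fin -subr_ge0.
    rewrite -[f x ^+ 2]real_normK ?num_real//.
    have -> : t / 2 + (2 * t)^-1 * `|f x| ^+ 2 - `|f x| = (2 * t)^-1 * (`|f x| - t) ^+ 2.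
      by field; rewrite gt_eqF.
    by rewrite mulr_ge0 ?sqr_ge0// invr_ge0 mulr_ge0// ltW.
rewrite ge0_integralD//; last 3 first.
- by move=> x _; rewrite lee_fin divr_ge0// ltW.
- by move=> x _; rewrite -EFinM lee_fin mulr_ge0 ?sqr_ge0// invr_ge0 mulr_ge0// ltW.
- by apply: emeasurable_funM => //; apply/measurable_EFinP/measurable_funTS.
rewrite integral_cst//= ge0_integralZl//; last 3 first.
- by apply/measurable_EFinP/measurable_funTS.
- by move=> x _; rewrite lee_fin sqr_ge0.
- by rewrite lee_fin invr_ge0 mulr_ge0// ltW.
rewrite lebesgue_measure_itv /= lte_fin ltr01 oppr0 adde0 mule1.
apply: (@le_trans _ _ ((t / 2)%:E + (2 * t)^-1%:E * (t ^+ 2)%:E)%E).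
  by rewrite leeD2l// lee_wpmul2l// lee_fin invr_ge0 mulr_ge0// ltW.
by rewrite -EFinM -EFinD lee_fin le_eqVlt; apply/orP; left; apply/eqP; field; rewrite gt_eqF.
Qed.

Lemma integral_sqr_tp (X : tpoly R) : (\int[leb]_(x in U) (X x ^+ 2)%:E = (n2 X ^+ 2)%:E)%E.
Proof. by rewrite sqr_n2 -integral_tp; apply: eq_integral => x _; rewrite tp_mul expr2. Qed.

(** Riesz-Fischer: along a subsequence with geometric gaps the increments are summable almost
    everywhere, which produces the limit, and the lemma of Fatou transfers the rate. The limit is
    set to 0 off the set of convergence in order to be measurable everywhere. *)
Lemma L2_limit X tau : (forall n, 0 <= tau n) -> tau @ \oo --> (0 : R) ->
  (forall m n, (m <= n)%N -> n2 (X n - X m) <= tau m) ->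
  exists w, measurable_fun setT w /\
    forall m, (\int[leb]_(x in U) ((w x - X m x) ^+ 2)%:E <= (tau m ^+ 2)%:E)%E.
Proof.
move=> tau0 t0 HX.
have half0 k : 0 < 2^-1 ^+ k :> R by rewrite exprn_gt0// invr_gt0.
have HN k : exists n, forall m, (n <= m)%N -> tau m <= 2^-1 ^+ k.
  move/cvgrPdist_le: t0 => /(_ _ (half0 k))[n _ h]; exists n => m nm.
  by have := h m nm; rewrite sub0r normrN; apply: le_trans; exact: ler_norm.
have [N {}HN] := choice HN.
(* Summing makes the subsequence at once monotone, at least [k] and at least [N k]. *)
pose ph k := (\sum_(i < k.+1) (N i).+1)%N.
have phk k : (k <= ph k)%N.
  by rewrite /ph -[leqLHS](card_ord) -sum1_card big_ord_recr /=; apply: leq_trans (leq_addr _ _); apply: leq_sum.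
have phS k : (ph k <= ph k.+1)%N by rewrite /ph [leqRHS]big_ord_recr /= leq_addr.
have Nph k : (N k <= ph k)%N by rewrite /ph big_ord_recr /= addnS ltnW// ltnS leq_addl.
pose Y k := X (ph k).
pose a k x := `|Y k.+1 x - Y k x|.
have ma k : measurable_fun setT (a k).
  by apply: measurableT_comp => //; apply: measurable_funB; exact: measurable_tp.
have ia k : (\int[leb]_(x in U) (a k x)%:E <= (2^-1 ^+ k)%:E)%E.
  apply: (@L1_le_L2 (Y k.+1 - Y k) U) => //; first exact: measurable_tp.
  rewrite integral_sqr_tp lee_fin ler_sqr ?nnegrE ?n2_ge0 ?(ltW (half0 k))//.
  exact: le_trans (HX _ _ (phS k)) (HN _ _ (Nph k)).
pose A x := (\sum_(k <oo) (a k x)%:E)%E.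
have a0 k x : 0 <= a k x by exact: normr_ge0.
have mA : measurable_fun U A.
  apply: ge0_emeasurable_sum => [k x _ _|k _]; [by rewrite lee_fin|by apply/measurable_EFinP; exact: measurable_funTS (ma k)].
have iA : leb.-integrable U A.
  apply/integrableP; split => //.
  have -> : (\int[leb]_(x in U) `|A x| = \int[leb]_(x in U) A x)%E.
    by apply: eq_integral => x _; rewrite gee0_abs//; apply: nneseries_ge0 => k _ _; rewrite lee_fin.
  rewrite /A integral_nneseries//; last 2 first.
  - by move=> k; apply/measurable_EFinP; exact: measurable_funTS (ma k).
  - by move=> k x _; rewrite lee_fin.
  apply: (@le_lt_trans _ _ 2%:E); last exact: ltry.
  apply: lime_le; first by apply: is_cvg_nneseries => k _ _; apply: integral_ge0 => x _; rewrite lee_fin.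
  apply: nearW => n; apply: (@le_trans _ _ (\sum_(0 <= k < n) (2^-1 ^+ k)%:E)%E).
    by apply: lee_sum => k _; exact: ia.
  rewrite sumEFin lee_fin; suff -> : \sum_(0 <= k < n) 2^-1 ^+ k = 2 - 2 * 2^-1 ^+ n :> R.
    by rewrite gerBl mulr_ge0// ltW.
  elim: n => [|n IH]; first by rewrite big_nil expr0; ring.
  by rewrite big_nat_recr//= IH exprS; field.
have mU : measurable (U : set (measurableTypeR R)) by exact: measurable_itv.
have [E [mE E0 hE]] := integrable_ae mU iA.
have cvgY x : x \in U `\` E -> cvgn (fun k => Y k x).
  rewrite inE => -[Ux nEx]; have fx : A x \is a fin_num.
    by apply: contrapT => nf; apply: nEx; apply: hE => /= /(_ Ux).
  have cs : cvgn (series (fun k => Y k.+1 x - Y k x)).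
    apply: normed_cvg; apply/cvg_ex; exists (fine (A x)).
    suff : (fun n => (\sum_(0 <= k < n) a k x)%:E) @ \oo --> (fine (A x))%:E by move=> /fine_cvgP[_].
    rewrite fineK//; under eq_fun do rewrite -sumEFin.
    by apply: is_cvg_nneseries => k _ _; rewrite lee_fin.
  have E2 : (fun k => Y k x) = (fun k => series (fun k => Y k.+1 x - Y k x) k + Y 0%N x).
    by apply/funext => k; rewrite seriesEnat /= telescope_sumr// subrK.
  by rewrite E2; apply: is_cvgD => //; exact: is_cvg_cst.
pose h k x := Y k x * \1_(U `\` E) x.
have cvgh x : cvgn (h ^~ x).
  rewrite /h; have [xU|xU] := boolP (x \in U `\` E).
    by under eq_fun do rewrite indicE xU mulr1; exact: cvgY.
  by under eq_fun do rewrite indicE (negbTE xU) mulr0; exact: is_cvg_cst.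
exists (fun x => limn (h ^~ x)); split.
  apply: (@measurable_fun_cvg _ _ _ setT h) => // k.
  apply: measurable_funM; first exact: measurable_tp.
  by apply: measurable_indic; apply: measurableD.
set w := (fun x => limn (h ^~ x)) => m.
have mw : measurable_fun setT w.
  apply: (@measurable_fun_cvg _ _ _ setT h) => // k.
  apply: measurable_funM; first exact: measurable_tp.
  by apply: measurable_indic; apply: measurableD.
have mwX : measurable_fun setT (fun x => (w x - X m x) ^+ 2).
  by apply: measurable_funX; apply: measurable_funB => //; exact: measurable_tp.
rewrite (ge0_negligible_integral mE)//; last 2 first.
- by apply/measurable_EFinP/measurable_funTS.
- by move=> x _; rewrite lee_fin sqr_ge0.
pose f k x := ((Y k x - X m x) ^+ 2)%:E : \bar R.
have mf k : measurable_fun setT (f k).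
  by apply/measurable_EFinP; apply: measurable_funX; apply: measurable_funB; exact: measurable_tp.
have := @fatou _ _ _ leb (U `\` E) (measurableD mU mE) f
  (fun k => measurable_funTS (mf k)) (fun k x _ => ltac:(by rewrite lee_fin sqr_ge0)).
have E3 : (\int[leb]_(x in U `\` E) limn_einf (f^~ x) = \int[leb]_(x in U `\` E) ((w x - X m x) ^+ 2)%:E)%E.
  apply: eq_integral => x xU; have c : f ^~ x @ \oo --> ((w x - X m x) ^+ 2)%:E.
    apply/cvg_EFin; first exact: nearW.
    have hY : (fun k => h k x) = (fun k => Y k x) by apply/funext => k; rewrite /h indicE xU mulr1.
    have cw : (fun k => Y k x) @ \oo --> w x by rewrite -hY; exact: cvgh.
    have cB : (fun k => Y k x - X m x) @ \oo --> (w x - X m x : R).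
      by apply: cvgB; [exact: cw|exact: cvg_cst].
    have cM : (fun k => (Y k x - X m x) * (Y k x - X m x)) @ \oo --> ((w x - X m x) * (w x - X m x) : R).
      by apply: cvgM.
    exact: cM.
  by have [-> _] := cvg_limn_einf_sup c.
rewrite E3 => HF; apply: le_trans HF _.
rewrite limn_einf_lim; apply: lime_le; first exact: is_cvg_einfs.
apply: nearW => k; apply: (@le_trans _ _ (\int[leb]_(x in U `\` E) f (maxn k m) x)%E).
  by apply: ereal_inf_lbound; exists (maxn k m) => //=; exact: leq_maxl.
apply: (@le_trans _ _ (\int[leb]_(x in U) f (maxn k m) x)%E).
  apply: ge0_subset_integral => //; first exact: measurableD.
    exact: (measurable_funTS (mf _)).
  by move=> x _; rewrite lee_fin sqr_ge0.
rewrite (_ : (\int[leb]_(x in U) f (maxn k m) x = (n2 (Y (maxn k m) - X m) ^+ 2)%:E)%E).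
  rewrite lee_fin ler_sqr ?nnegrE ?n2_ge0//; apply: HX.
  exact: leq_trans (leq_maxr k m) (phk _).
by rewrite -integral_sqr_tp.
Qed.

End L2_limits.

Section J_convergence.
Variable R : realType.
Local Notation leb := (@lebesgue_measure R).
Local Notation U := (`[0 : R, 1]%classic).

Import HBNNSimple.

Let mU : measurable (U : set (measurableTypeR R)). Proof. exact: measurable_itv. Qed.

(* [f] need not be measurable: the integral of a nonnegative function is a supremum over simple functions. *)
Lemma integral_ae_ge0 (E : set (measurableTypeR R)) (f g : R -> \bar R) :
  measurable E -> leb E = 0%E -> measurable_fun U g ->
  (forall x, 0 <= f x)%E -> (forall x, 0 <= g x)%E ->
  (forall x, U x -> ~ E x -> f x = g x) ->
  (\int[leb]_(x in U) f x = \int[leb]_(x in U) g x)%E.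
Proof.
move=> mE E0 mg f0 g0 fg.
have mUE : measurable (U `\` E : set (measurableTypeR R)) by exact: measurableD.
have mono (a b : R -> \bar R) : (forall x, 0 <= a x)%E -> (forall x, a x <= b x)%E ->
    (\int[leb]_x a x <= \int[leb]_x b x)%E.
  move=> a0 ab; have b0 x : (0 <= b x)%E by exact: le_trans (a0 x) (ab x).
  rewrite !ge0_integralTE//; apply: ereal_sup_le => _ [h hh <-].
  by exists h => // x; exact: le_trans (hh x) (ab x).
apply/eqP; rewrite eq_le; apply/andP; split; last first.
  rewrite (ge0_negligible_integral mE mU mg) //.
  rewrite [leLHS]integral_mkcond [leRHS]integral_mkcond; apply: mono => x.
    by rewrite patchE; case: ifP.
  rewrite !patchE; case: ifP => [|_]; [rewrite inE => -[Ux nEx]|by case: ifP].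
  by rewrite mem_set// fg.
rewrite [leLHS]integral_mkcond ge0_integralTE; last by move=> x; rewrite patchE; case: ifP.
apply: ge_ereal_sup => _ [h hh <-].
rewrite -integralT_nnsfun.
have mh : measurable_fun setT (fun x => (h x)%:E) by apply/measurable_EFinP.
rewrite (ge0_negligible_integral mE measurableT mh)//; last by move=> x _; rewrite lee_fin.
rewrite (ge0_negligible_integral mE mU mg)//.
rewrite [leLHS]integral_mkcond [leRHS]integral_mkcond.
apply: mono => x; first by rewrite patchE; case: ifP => // _; rewrite lee_fin.
rewrite !patchE; case: ifP => [|_]; [rewrite inE => -[_ nEx]|by case: ifP].
apply: le_trans (hh x) _; rewrite patchE; have [Ux|Ux] := pselect (U x).
  by rewrite mem_set// mem_set// fg.
by rewrite memNset// memNset// => -[].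
Qed.

(** Meant for the density of [J_density], whose derivative of order [p] is identified only almost
    everywhere: just the representative [g] has to be measurable. *)
Lemma Rintegral_ae (E : set (measurableTypeR R)) (f g : R -> R) :
  measurable E -> leb E = 0%E -> measurable_fun setT g ->
  (forall x, U x -> ~ E x -> f x = g x) -> torus_int f = torus_int g.
Proof.
move=> mE E0 mg fg; rewrite /torus_int /Rintegral; congr fine.
have mgE : measurable_fun U (fun x => (g x)%:E) by apply/measurable_EFinP; exact: measurable_funTS.
rewrite integralE [RHS]integralE; congr (_ - _)%E; apply: (integral_ae_ge0 mE E0) => //.
- exact: measurable_funepos.
- by move=> x Ux nEx; rewrite !funeposE fg.
- exact: measurable_funeneg.
- by move=> x Ux nEx; rewrite !funenegE fg.
Qed.

Lemma tp_FTC (X : tpoly R) (x : R) : 0 < x ->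
  X x = X 0 + \int[leb]_(t in `[0, x]) D X t.
Proof.
move=> x0; rewrite /Rintegral (@continuous_FTC2 _ (D X) X)//=.
- by rewrite [RHS]addrC subrK.
- exact/continuous_subspaceT/tp_continuous.
- split.
  + by move=> t _; exact: tp_derivable.
  + exact/cvg_at_right_filter/tp_continuous.
  + exact/cvg_at_left_filter/tp_continuous.
- by move=> t _; rewrite DE.
Qed.

(* The primitive of the [L^2] limit of the derivatives is the limit of the functions. *)
Lemma ae_derive1 (X : nat -> tpoly R) (tau : nat -> R) (F w : R -> R) :
  tau @ \oo --> (0 : R) -> (forall n, 0 <= tau n) ->
  (forall m x, `|X m x - F x| <= tau m) -> measurable_fun setT w ->
  (forall m, (\int[leb]_(x in U) ((w x - D (X m) x) ^+ 2)%:E <= (tau m ^+ 2)%:E)%E) ->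
  exists E : set (measurableTypeR R), [/\ measurable E, leb E = 0%E &
    forall x, U x -> ~ E x -> derive1 F x = w x].
Proof.
move=> t0 tau0 XF mw Hw.
have iwX m : leb.-integrable U (EFin \o (fun x => w x - D (X m) x)).
  apply/integrableP; split.
    by apply/measurable_EFinP; apply: measurable_funTS; apply: measurable_funB => //; exact: measurable_tp.
  apply: (@le_lt_trans _ _ (tau m + 1)%:E); last exact: ltry.
  apply: (@L1_le_L2 R (fun x => w x - D (X m) x) U) => //.
  - by apply: measurable_funB => //; exact: measurable_tp.
  - by have := tau0 m; lra.
  - apply: le_trans (Hw m) _; rewrite lee_fin ler_sqr ?nnegrE ?tau0//; have := tau0 m; lra.
have iw : leb.-integrable U (EFin \o w).
  have := integrableD mU (iwX 0%N) (@tp_integrable R (D (X 0%N))).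
  by apply: eq_integrable => // x _; rewrite /= -EFinD subrK.
(* Extension by 0 makes [w] integrable on the line, as the fundamental theorem of calculus for
   locally integrable functions requires. *)
pose f : R -> R := w \_ U.
have mf : measurable_fun setT f by apply/(measurable_restrictT w mU)/measurable_funTS.
have if_ (B : set (measurableTypeR R)) : measurable B -> leb.-integrable B (EFin \o f).
  move=> mB; apply: (integrableS measurableT) => //.
  by have [h _] := @integrable_mkcond _ _ _ leb U (EFin \o w) mU; have := h iw; rewrite restrict_EFin.
have loc : locally_integrable [set: R] f.
  by apply: open_integrable_locally; [exact: openT|exact: if_].
have := @FTC1 R f (BLeft 0) (fun y => if_ _ (measurable_itv _)) loc.
set Ff := (fun x => _) => -[E [mE E0 hE]].
have FfE (x : R) : 0 < x < 1 -> F x = F 0 + Ff x.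
  move=> /andP[x0 x1]; have xU : `[0, x]%classic `<=` U.
    by move=> t; rewrite /= !in_itv/= => /andP[-> /le_trans]; apply; exact: ltW.
  have mx : measurable (`[0, x]%classic : set (measurableTypeR R)) by exact: measurable_itv.
  apply/eqP; rewrite -subr_eq0 -normr_le0; apply: (@le_add_null _ _ _ 3 tau t0) => n.
  rewrite add0r; apply/ler_addgt0Pr => e e0.
  have h1 := XF n x; have h2 := XF n 0; have h3 := tp_FTC (X n) x0.
  have ifx : leb.-integrable `[0, x] (EFin \o w) by exact: integrableS iw.
  have iDx : leb.-integrable `[0, x] (EFin \o D (X n)).
    by apply: integrableS (@tp_integrable R (D (X n))).
  have fw : Ff x = \int[leb]_(t in `[0, x]) w t.
    by apply: eq_Rintegral => t; rewrite inE => /xU tU; rewrite /f patchE mem_set.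
  have h4 : `|Ff x - \int[leb]_(t in `[0, x]) D (X n) t| <= tau n + e.
    rewrite fw -RintegralB//; apply: le_trans (le_normr_Rintegral mx _) _.
      by apply: integrableS (iwX n).
    rewrite -lee_fin /Rintegral fineK; last first.
      apply: integrable_fin_num => //.
      by have := integrable_norm (integrableS mU mx xU (iwX n)).
    apply: (@L1_le_L2 R (fun x => w x - D (X n) x)) => //.
    - by apply: measurable_funB => //; exact: measurable_tp.
    - by have := tau0 n; lra.
    - apply: le_trans (Hw n) _; rewrite lee_fin ler_sqr ?nnegrE ?tau0//; have := tau0 n; lra.
  have -> : F x - (F 0 + Ff x) = (F x - X n x) + (X n 0 - F 0) - (Ff x - (X n x - X n 0)) by ring.
  have h5 : `|Ff x - (X n x - X n 0)| <= tau n + e by rewrite h3 addrAC subrr add0r.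
  apply: le_trans (ler_normB _ _) _; apply: le_trans (lerD (ler_normD _ _) h5) _.
  rewrite distrC in h1; lra.
exists (E `|` [set 0; 1]); split.
- by apply: measurableU => //; exact: measurableU.
- apply/eqP; rewrite eq_le measure_ge0 andbT.
  have h01 : leb [set 0; 1] = 0%E.
    by apply: countable_lebesgue_measure0; apply: finite_set_countable; exact: finite_set2.
  apply: (@le_trans _ _ (leb E + leb [set 0%R; 1%R])%E).
    by apply: measureU2 => //; exact: measurableU.
  by rewrite h01 adde0 -[leRHS]E0.
move=> x; rewrite /= in_itv/= => /andP[x0 x1] nE.
have xn0 : x != 0 by apply/eqP => x0'; apply: nE; right; left.
have xn1 : x != 1 by apply/eqP => x0'; apply: nE; right; right.
have x01 : 0 < x < 1 by rewrite !lt_neqAle x0 x1 eq_sym xn0 xn1.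
have [dF dF'] : derivable Ff x 1 /\ derive1 Ff x = f x.
  apply: contrapT => h; apply: nE; left; apply: hE => /= h'; apply: h; apply: h'.
  by rewrite lte_fin; case/andP: x01.
have hd : is_derive x 1 Ff (w x).
  apply: DeriveDef => //; rewrite -derive1E dF' /f patchE mem_set//=.
  by rewrite in_itv/= x0.
suff h : is_derive x 1 F (w x) by rewrite derive1E; exact: derive_val.
apply: eps_is_derive => e e0; have [eta eta0 He] := is_derive_eps hd e0.
exists (Num.min eta (Num.min x (1 - x) / 2)).
  by rewrite lt_min eta0 divr_gt0// lt_min subr_gt0.
move=> t; rewrite le_min => /andP[te]; rewrite ler_pdivlMr// le_min => /andP[tx tx1].
have xt : 0 < x + t < 1.
  have := ler_norm t; have := ler_norm (- t); rewrite normrN; case/andP: x01 => *.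
  by apply/andP; split; have := normr_ge0 t; lra.
rewrite (FfE _ x01) (FfE _ xt).
by have := He t te; rewrite (_ : F 0 + Ff (x + t) - (F 0 + Ff x) = Ff (x + t) - Ff x)//; ring.
Qed.

End J_convergence.

(** * The functional $J_p$ as a limit over truncations *)

Section J_limit.
Variables (R : realType) (p : nat) (c : R) (K : mpoly.mpoly p R).
Local Notation q := (p%:R : R).
Local Notation H := (sobolev q).
Local Notation leb := (@lebesgue_measure R).
Local Notation U := (`[0 : R, 1]%classic).
Hypothesis p0 : (0 < p)%N.
Implicit Types (u : H).

Let mU : measurable (U : set (measurableTypeR R)). Proof. exact: measurable_itv. Qed.

Lemma meval_lip (r : R) : exists2 C : R, 0 <= C & forall (v w : 'I_p -> R) (s : R),
  (forall i, `|v i| <= r) -> (forall i, `|w i - v i| <= s) -> s <= r ->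
  `|mpoly.meval w K - mpoly.meval v K| <= C * s.
Proof.
have [d [_ _ /(_ r)[C C0 HC]]] := polyfun_meval K.
exists (C * p%:R + C * p%:R ^+ 2 * `|r|); first by rewrite addr_ge0 ?mulr_ge0 ?sqr_ge0.
move=> v w s vr ws sr.
have [i0|s0] := ltP s 0.
  have i : 'I_p := Ordinal p0; have := le_trans (normr_ge0 _) (ws i); lra.
have [_ hd ht] := HC v (fun i => w i - v i) vr (fun i => le_trans (ws i) sr).
have E : v \+ (fun i => w i - v i) = w by apply/funext => i /=; rewrite addrC subrK.
rewrite E in ht.
have S1 : \sum_i `|w i - v i| <= p%:R * s.
  apply: le_trans (ler_sum _ (G := fun=> s) (fun i _ => ws i)) _.
  by rewrite sumr_const card_ord mulr_natl.
have S0 : 0 <= \sum_i `|w i - v i| by apply: sumr_ge0.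
have h1 : `|\sum_i d i v * (w i - v i)| <= C * (p%:R * s).
  apply: le_trans (ler_norm_sum _ _ _) _; apply: le_trans (_ : C * \sum_i `|w i - v i| <= _).
    by rewrite mulr_sumr; apply: ler_sum => i _; rewrite normrM ler_wpM2r.
  by rewrite ler_wpM2l.
have h2 : C * (\sum_i `|w i - v i|) ^+ 2 <= C * ((p%:R * s) * (p%:R * `|r|)).
  rewrite ler_wpM2l// expr2 ler_pM//; apply: le_trans S1 _.
  by rewrite ler_wpM2l//; apply: le_trans sr (ler_norm _).
rewrite (_ : mpoly.meval w K - mpoly.meval v K = (mpoly.meval w K - mpoly.meval v K - \sum_i d i v * (w i - v i)) + \sum_i d i v * (w i - v i)); last by rewrite subrK.
apply: le_trans (ler_normD _ _) _; apply: le_trans (lerD (le_trans ht h2) h1) _.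
by rewrite le_eqVlt; apply/orP; left; apply/eqP; ring.
Qed.

Lemma integral_dist (g h b : R -> R) (B : R) : measurable_fun setT g -> measurable_fun setT b ->
  leb.-integrable U (EFin \o h) -> (forall x, U x -> `|g x - h x| <= b x) ->
  (\int[leb]_(x in U) (b x)%:E <= B%:E)%E -> `|torus_int g - torus_int h| <= B.
Proof.
move=> mg mb ih gh bB.
have mh := measurable_int _ ih.
have mgh : measurable_fun U (EFin \o (fun x => g x - h x)).
  apply: (eq_measurable_fun (fun x => (g x)%:E - (h x)%:E)%E); first by [].
  by apply: emeasurable_funB => //; apply/measurable_EFinP; exact: measurable_funTS.
have b0 x : U x -> 0 <= b x by move=> Ux; apply: le_trans (gh x Ux).
have igh : leb.-integrable U (EFin \o (fun x => g x - h x)).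
  apply/integrableP; split=> //; apply: (@le_lt_trans _ _ B%:E); last exact: ltry.
  apply: le_trans bB; apply: ge0_le_integral => //.
  - exact: measurableT_comp.
  - by apply/measurable_EFinP; exact: measurable_funTS.
have ig : leb.-integrable U (EFin \o g).
  have := integrableD mU igh ih; apply: eq_integrable => // x _.
  by rewrite /= -EFinD subrK.
rewrite /torus_int -RintegralB//; apply: le_trans (le_normr_Rintegral mU igh) _.
rewrite -lee_fin /Rintegral fineK; last first.
  by apply: integrable_fin_num => //; have := integrable_norm igh.
apply: le_trans bB; apply: ge0_le_integral => //.
- by have := measurable_int _ (integrable_norm igh).
- by apply/measurable_EFinP; exact: measurable_funTS.
Qed.

(** Lower derivatives converge uniformly. The derivative of order [p] converges in $L^2$ to some
    [w], which by [ae_derive1] is almost everywhere the derivative that [J_density] integrates. The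
    square of this derivative therefore converges in $L^1$. *)
Lemma JX_limit u (C r : R) : `|u| <= r -> 1 <= r ->
  (forall m, `|JX c K (S m u)| <= C) ->
  (fun m => JX c K (S m u)) @ \oo --> J_density c K u.
Proof.
move=> ur r1 HC.
have [L [HL dL]] := synth_derivatives u.
pose tau m := `|u - trunc p m u|; have t0 : tau @ \oo --> (0 : R) := trunc_cvg u.
have tau0 m : 0 <= tau m by exact: normr_ge0.
have [w [mw Hw]] := @L2_limit R (fun m => Dn p (S m u)) tau tau0 t0
  (fun m n mn => ltac:(rewrite -DnB; exact: n2_Dn_tail)).
have pp : p.-1.+1 = p by rewrite prednK.
have pm : (p.-1 < p)%N by rewrite pp.
have [E [mE E0 dE]] := @ae_derive1 R (fun m => Dn p.-1 (S m u)) tau (L p.-1) w t0 tau0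
  (fun m x => HL p.-1 m x pm) mw (fun m => ltac:(by rewrite -DnS pp)).
pose ev x := mpoly.meval (fun i : 'I_p => L i x) K.
pose g x := c * L 0%N x * w x ^+ 2 + ev x.
have mL j : (j < p)%N -> measurable_fun setT (L j).
  move=> jp; apply: (@measurable_fun_cvg _ _ _ setT (fun m => Dn j (S m u))) => //.
    by move=> m; exact: measurable_tp.
  by move=> x _; apply: (cvg_dist_le t0) => m; exact: HL.
have bS j m x : (j < p)%N -> `|Dn j (S m u) x| <= r.
  move=> jp; apply: le_trans (sup_Dn x (I_S _ _) jp) _.
  by apply: le_trans ur; exact: n2_Dn_norm.
have [Ce Ce0 HCe] := meval_lip r.
have evm m x : tau m <= r -> `|ev x - evT K (jet (S m u)) x| <= Ce * tau m.
  move=> tr; rewrite evTE; apply: HCe => // i; first exact: bS.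
  by rewrite distrC; exact: HL.
have ev_cvg x : (fun m => evT K (jet (S m u)) x) @ \oo --> ev x.
  apply/cvgrPdist_le => e e0.
  have d0 : 0 < Num.min r (e / (Ce + 1)) by rewrite lt_min divr_gt0 ?andbT//; lra.
  move/cvgrPdist_le : t0 => /(_ _ d0); apply: filterS => m.
  rewrite sub0r normrN ger0_norm// le_min => /andP[tr te].
  apply: le_trans (evm m x tr) _; apply: le_trans (_ : (Ce + 1) * tau m <= _).
    by rewrite ler_wpM2r// lerDl.
  by rewrite mulrC -ler_pdivlMr//; lra.
have mev : measurable_fun setT ev.
  by apply: (@measurable_fun_cvg _ _ _ setT (fun m => evT K (jet (S m u)))) => // m; exact: measurable_tp.
have mg : measurable_fun setT g.
  apply: measurable_funD => //; apply: measurable_funM; last exact: measurable_funX.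
  by apply: measurable_funM => //; exact: mL.
have JE : J_density c K u = torus_int g.
  rewrite /J_density; apply: (Rintegral_ae mE E0 mg) => x Ux nE.
  rewrite /g /ev -(dL 0%N p0); congr (_ * _ ^+ 2 + _).
    have -> : derive1n p (synth u) x = derive1 (derive1n p.-1 (synth u)) x by rewrite -derive1nS pp.
    by rewrite (dL _ pm) dE.
  by congr mpoly.meval; apply/funext => i; rewrite dL.
have alg (s a d si : R) : 0 <= s * a ^+ 2 + 2 * a * d + si * d ^+ 2 ->
    a ^+ 2 <= (a + d) ^+ 2 + (1 + si) * d ^+ 2 + s * a ^+ 2.
  move=> h; rewrite -subr_ge0.
  rewrite (_ : _ - _ = (s * a ^+ 2 + 2 * a * d + si * d ^+ 2) + 2 * d ^+ 2); last by ring.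
  by rewrite addr_ge0// mulr_ge0// sqr_ge0.
rewrite JE; apply/cvgrPdist_le => e e0.
(* [t] is the parameter of $|w^2-A^2|\le(1+t^{-1})(w-A)^2+tA^2$. For fixed [t] the bound tends to
   $|c|tr^3$, and [t] is chosen last. *)
pose B (t : R) m := `|c| * (r ^+ 2 * tau m + r * ((1 + t^-1) * tau m ^+ 2 + t * r ^+ 2)) + Ce * tau m.
have key t m : 0 < t -> tau m <= r -> `|torus_int g - JX c K (S m u)| <= B t m.
  move=> t1 tr; rewrite /JX IE.
  set X := S m u; set A := Dn p X.
  pose b x := `|c| * (tau m * A x ^+ 2 + r * ((1 + t^-1) * (w x - A x) ^+ 2 + t * A x ^+ 2)) + Ce * tau m.
  have mA2 : measurable_fun setT (fun x => A x ^+ 2) by apply: measurable_funX; exact: measurable_tp.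
  have mwA : measurable_fun setT (fun x => (w x - A x) ^+ 2).
    by apply: measurable_funX; apply: measurable_funB => //; exact: measurable_tp.
  have ti : 0 <= 1 + t^-1 by rewrite addr_ge0// invr_ge0 ltW.
  have r0 : 0 <= r by lra.
  apply: (@integral_dist g _ b) => //.
  - apply: measurable_funD => //; apply: measurable_funM => //; apply: measurable_funD.
      exact: measurable_funM.
    by apply: measurable_funM => //; apply: measurable_funD; apply: measurable_funM.
  - exact: tp_integrable.
  - move=> x Ux; rewrite tp_add !tp_mul /g /b.
    have h1 := evm m x tr; have h2 := HL 0%N m x p0; have h3 := bS 0%N m x p0.
    rewrite Dn0 -/X -/A in h1 h2 h3 *.
    have h4 : `|w x ^+ 2 - A x ^+ 2| <= (1 + t^-1) * (w x - A x) ^+ 2 + t * A x ^+ 2.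
      have y1 := young_sqr (w x - A x) (A x) (ltac:(by rewrite invr_gt0) : 0 < t^-1).
      have y2 : A x ^+ 2 <= w x ^+ 2 + (1 + t^-1) * (w x - A x) ^+ 2 + t * A x ^+ 2.
        have ty : t^-1 * (t * A x + (w x - A x)) ^+ 2 >= 0 by rewrite mulr_ge0 ?sqr_ge0// invr_ge0 ltW.
        have E1 : t^-1 * (t * A x + (w x - A x)) ^+ 2 = t * A x ^+ 2 + 2 * A x * (w x - A x) + t^-1 * (w x - A x) ^+ 2.
          by field; rewrite gt_eqF.
        rewrite E1 in ty; have := alg _ _ _ _ ty.
        by rewrite (_ : A x + (w x - A x) = w x)//; ring.
      rewrite subrK invrK in y1; apply/ler_normlP; split; lra.
    have Lr : `|L 0%N x| <= r.
      apply: (@le_add_null _ _ _ 1 tau t0) => n; rewrite mul1r.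
      have := HL 0%N n x p0; have := bS 0%N n x p0; rewrite /tau.
      move: (Dn 0 (S n u) x) (L 0%N x) `|_ - trunc _ _ _| => y z s; clear => /ler_normlP[? ?] /ler_normlP[? ?].
      by apply/ler_normlP; split; lra.
    rewrite (_ : c * L 0%N x * w x ^+ 2 + ev x - (c * (X x * (A x * A x)) + evT K (jet X) x) =
      c * ((L 0%N x - X x) * A x ^+ 2 + L 0%N x * (w x ^+ 2 - A x ^+ 2)) + (ev x - evT K (jet X) x)); last by ring.
    apply: le_trans (ler_normD _ _) _; apply: lerD h1; rewrite normrM ler_wpM2l//.
    apply: le_trans (ler_normD _ _) _; rewrite !normrM; apply: lerD.
      by rewrite -expr2 real_normK ?num_real// ler_wpM2r ?sqr_ge0// distrC.
    by rewrite ler_pM.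
  - have iA : (\int[leb]_(x in U) (A x ^+ 2)%:E <= (r ^+ 2)%:E)%E.
      rewrite integral_sqr_tp lee_fin ler_sqr ?nnegrE ?n2_ge0//.
      by apply: le_trans ur; exact: n2_Dn_norm.
    have iw := Hw m; rewrite -/A in iw.
    pose k1 := `|c| * (tau m + r * t); pose k2 := `|c| * (r * (1 + t^-1)).
    have k10 : 0 <= k1 by rewrite mulr_ge0// addr_ge0// mulr_ge0// ltW.
    have k20 : 0 <= k2 by rewrite !mulr_ge0.
    have bE x : (b x)%:E = (k1%:E * (A x ^+ 2)%:E + (k2%:E * ((w x - A x) ^+ 2)%:E + (Ce * tau m)%:E))%E.
      by rewrite -!EFinM -!EFinD /b /k1 /k2; congr (_%:E); ring.
    under eq_integral do rewrite bE.
    have m1 : measurable_fun U (fun x => (A x ^+ 2)%:E) by apply/measurable_EFinP; exact: measurable_funTS.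
    have m2 : measurable_fun U (fun x => ((w x - A x) ^+ 2)%:E) by apply/measurable_EFinP; exact: measurable_funTS.
    have p1 x : (0 <= (A x ^+ 2)%:E :> \bar R)%E by rewrite lee_fin sqr_ge0.
    have p2 x : (0 <= ((w x - A x) ^+ 2)%:E :> \bar R)%E by rewrite lee_fin sqr_ge0.
    have p3 : (0 <= (Ce * tau m)%:E :> \bar R)%E by rewrite lee_fin mulr_ge0.
    rewrite ge0_integralD//; last 4 first.
    + by move=> x _; rewrite mule_ge0// lee_fin.
    + by apply: emeasurable_funM.
    + by move=> x _; rewrite adde_ge0// mule_ge0// lee_fin.
    + by apply: emeasurable_funD => //; apply: emeasurable_funM.
    rewrite ge0_integralD//; last 2 first.
    + by move=> x _; rewrite mule_ge0// lee_fin.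
    + by apply: emeasurable_funM.
    rewrite !ge0_integralZl//= integral_cst//= lebesgue_measure_itv /= lte_fin ltr01 oppr0 adde0 mule1.
    apply: (@le_trans _ _ (k1%:E * (r ^+ 2)%:E + (k2%:E * (tau m ^+ 2)%:E + (Ce * tau m)%:E))%E).
      by apply: leeD; [rewrite lee_wpmul2l// lee_fin|apply: leeD => //; rewrite lee_wpmul2l// lee_fin].
    rewrite -!EFinM -!EFinD lee_fin /k1 /k2 /B le_eqVlt; apply/orP; left; apply/eqP; ring.
pose t := e / (2 * (`|c| * r ^+ 3 + 1)).
have cr : 0 < `|c| * r ^+ 3 + 1 by rewrite ltr_wpDl// mulr_ge0// exprn_ge0//; lra.
have tt : 0 < t by rewrite divr_gt0// mulr_gt0.
pose G := `|c| * (r ^+ 2 + r * ((1 + t^-1) * r)) + Ce.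
have ti : 0 <= 1 + t^-1 by rewrite addr_ge0// invr_ge0 ltW.
have r0 : 0 <= r by lra.
have G0 : 0 <= G by rewrite addr_ge0// mulr_ge0// addr_ge0 ?sqr_ge0// !mulr_ge0.
have d0 : 0 < Num.min r (e / (2 * (G + 1))) by rewrite lt_min divr_gt0 ?mulr_gt0 ?andbT//; lra.
move/cvgrPdist_le : t0 => /(_ _ d0); apply: filterS => m.
rewrite sub0r normrN ger0_norm// le_min => /andP[tr te].
apply: le_trans (key t m tt tr) _.
have h1 : B t m <= G * tau m + t * (`|c| * r ^+ 3).
  have -> : G * tau m + t * (`|c| * r ^+ 3) = `|c| * (r ^+ 2 * tau m + r * ((1 + t^-1) * (r * tau m) + t * r ^+ 2)) + Ce * tau m.
    by rewrite /G; ring.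
  rewrite lerD2r ler_wpM2l// lerD2l ler_wpM2l// lerD2r ler_wpM2l// expr2 ler_wpM2r//.
have h2 : t * (`|c| * r ^+ 3) <= e / 2.
  apply: le_trans (_ : t * (`|c| * r ^+ 3 + 1) <= _); first by rewrite ler_wpM2l ?(ltW tt)// lerDl.
  by rewrite /t invfM mulrA divfK ?gt_eqF.
have h3 : G * tau m <= e / 2.
  apply: le_trans (_ : (G + 1) * tau m <= _); first by rewrite ler_wpM2r// lerDl.
  rewrite mulrC -ler_pdivlMr; last by lra.
  by apply: le_trans te _; rewrite invfM mulrA.
by apply: le_trans h1 _; rewrite [e]splitr addrC lerD.
Qed.

End J_limit.

(** * The splitting scheme *)

Section shear_lists.
Variables (R : realType) (p : nat).
Local Notation q := (p%:R : R).
Local Notation H := (sobolev q).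
Local Notation bH := (borelH R p).
Implicit Types (u v : H) (k : int) (n m : nat) (h : R).

(* one coordinate shear [u + h * drift u *: bas mode], with dilation factor [1 + h * dil u] *)
Record item := Item { mode : int ; drift : H -> R ; dil : H -> R }.
Implicit Types (it : item) (its : seq item).

Definition move h it u : H := shear (mode it) (fun v => h * drift it v) u.
(** A list is run from its head. In [good] below membership in [Dm] is asked before each shear and
    not after the last one, as [coordinate_shear] asks for it at the source only. *)
Fixpoint run h its u : H := if its is it :: s then run h s (move h it u) else u.
Fixpoint good h (Dm : set H) its u : Prop :=
  if its is it :: s then Dm u /\ good h Dm s (move h it u) else True.
Fixpoint jac h its u : R :=
  if its is it :: s then (1 + h * dil it u) * jac h s (move h it u) else 1.

Lemma run_cat h s t u : run h (s ++ t) u = run h t (run h s u).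
Proof. by elim: s u => //= it s IH u; rewrite IH. Qed.
Lemma jac_cat h s t u : jac h (s ++ t) u = jac h s u * jac h t (run h s u).
Proof. by elim: s u => [|it s IH] u /=; rewrite ?mul1r// IH mulrA. Qed.
Lemma good_cat h Dm s t u : good h Dm (s ++ t) u <-> good h Dm s u /\ good h Dm t (run h s u).
Proof. by elim: s u => [|it s IH] u /=; [tauto|rewrite IH; tauto]. Qed.

(** The hypotheses of [coordinate_shear] for one item, with expansion factor [1 + h * dil]. *)
Definition shear_ok h (Dm : set H) it := [/\ mode it != 0,
  measurable_fun [set: bH] (drift it : bH -> R), measurable_fun [set: bH] (dil it : bH -> R),
  (forall u x, dil it (upd (mode it) u x) = dil it u) &
  forall u, Dm u -> 0 < 1 + h * dil it u /\ forall x, Dm (upd (mode it) u x) ->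
    (1 + h * dil it u) * `|x - coef u (mode it)| <=
    `|x + h * drift it (upd (mode it) u x) - (coef u (mode it) + h * drift it u)|].

Section inequality.
Variable eta : probability bH R.
Hypothesis eta_gauss : is_gaussian eta.
Variables (h : R) (Dm : set bH) (m : nat).
Hypothesis mDm : measurable Dm.

Lemma gauss_sd_wn k : k != 0 -> (gauss_sd R p k ^+ 2 *+ 2)^-1 = 2^-1 * wn R k ^+ (2 * p.+1).
Proof.
move=> k0; rewrite /gauss_sd -mulr_natl invfM; congr (_ * _).
rewrite exprVn invrK -exprM mulnC exprM [RHS]exprM; congr (_ ^+ _).
by rewrite /wn !exprMn real_normK ?num_real.
Qed.

Let En u := nq p.+1%:R m u.

(** A shear changes one coefficient, so the increment of its Gaussian exponent is the increment of
    the whole truncated energy; written this way the exponents telescope along a list. *)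
Lemma energy_move it u : mode it \in idx m ->
  (coef (move h it u) (mode it) ^+ 2 - coef u (mode it) ^+ 2) / (gauss_sd R p (mode it) ^+ 2 *+ 2) =
  2^-1 * (En (move h it u) - En u).
Proof.
move=> km; have k0 := idx_neq0 km; rewrite gauss_sd_wn//.
have E0 (w : H) : En w = weight p.+1%:R `|mode it|%N * coef w (mode it) ^+ 2 +
    \sum_(k <- idx m | k != mode it) weight p.+1%:R `|k|%N * coef w k ^+ 2.
  by rewrite /En /nq (bigD1_seq (mode it)) ?uniq_idx.
rewrite !E0; set s1 := (X in (_ + X - _)); set s2 := (X in (_ - (_ + X))).
have -> : s1 = s2.
  by apply: eq_bigr => k kk; rewrite /move coef_shear// (negbTE kk) mulr0 addr0.
rewrite -(wn_sqr_weight R p.+1 (mode it)); ring.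
Qed.

Lemma measurable_move it : shear_ok h Dm it -> measurable_fun [set: bH] (move h it : bH -> bH).
Proof.
by move=> [k0 mg _ _ _]; apply: measurable_shear => //; exact: measurable_funM.
Qed.

Lemma measurable_run its : (forall it, List.In it its -> shear_ok h Dm it) ->
  measurable_fun [set: bH] (run h its : bH -> bH).
Proof.
elim: its => [|it s IH] H0 /=; first exact: measurable_id.
have m1 := measurable_move (H0 it (or_introl erefl)).
have m2 := IH (fun i hi => H0 i (or_intror hi)).
exact: (measurableT_comp m2 m1).
Qed.

Lemma measurable_jac its : (forall it, List.In it its -> shear_ok h Dm it) ->
  measurable_fun [set: bH] (jac h its : bH -> R).
Proof.
elim: its => [|it s IH] H0 /=; first exact: measurable_cst.
have m1 := measurable_move (H0 it (or_introl erefl)).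
have m2 := IH (fun i hi => H0 i (or_intror hi)).
have [_ _ mj _ _] := H0 it (or_introl erefl).
apply: measurable_funM; last exact: (measurableT_comp m2 m1).
by apply: measurable_funD => //; exact: measurable_funM.
Qed.

Lemma measurable_good its : (forall it, List.In it its -> shear_ok h Dm it) ->
  measurable ([set u | good h Dm its u] : set bH).
Proof.
elim: its => [|it s IH] H0 /=.
  by rewrite (_ : [set _ | True] = setT)//; apply/seteqP; split.
have m1 := measurable_move (H0 it (or_introl erefl)).
have m2 := IH (fun i hi => H0 i (or_intror hi)).
apply: (@measurableI _ bH _ _ mDm).
by have := m1 measurableT _ m2; rewrite setTI.
Qed.

Lemma measurable_nq r n : measurable_fun [set: bH] (fun u : bH => nq r n (u : H)).
Proof.
rewrite /nq; apply: measurable_sum => k; apply: measurable_funM => //.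
by apply: measurable_funX; exact: measurable_coef.
Qed.

Lemma jac_gt0 its u : (forall it, List.In it its -> shear_ok h Dm it) -> good h Dm its u -> 0 < jac h its u.
Proof.
elim: its u => [|it s IH] u H0 //= [Du gs].
have [_ _ _ _ /(_ _ Du)[j0 _]] := H0 it (or_introl erefl).
by rewrite mulr_gt0// IH// => i hi; apply: H0; right.
Qed.

(** Induction on the list: the inequality for the tail is composed with that of the first shear.
    Energies telescope and dilation factors multiply. *)
Lemma shear_list_inequality its (phi : bH -> \bar R) :
  (forall it, List.In it its -> shear_ok h Dm it /\ mode it \in idx m) ->
  measurable_fun [set: bH] phi -> (forall u, 0 <= phi u)%E ->
  (\int[eta]_u ((\1_[set u | good h Dm its u] u * (jac h its u *
     expR (- (2^-1 * (En (run h its u) - En u)))))%:E * phi (run h its u)) <= \int[eta]_u phi u)%E.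
Proof.
move=> + mphi phi0; elim: its => [|it s IH] H0.
  apply: ge0_le_integral => //=.
  - by move=> u _; rewrite mule_ge0// lee_fin !mulr_ge0// expR_ge0.
  - apply: emeasurable_funM => //; apply/measurable_EFinP; apply: measurable_funM.
      apply: measurable_indic; rewrite (_ : [set _ | True] = setT)//; apply/seteqP; split => //.
    under eq_fun do rewrite subrr mulr0 oppr0 expR0 mulr1; exact: measurable_cst.
  - by move=> u _; rewrite indicE mem_set// subrr mulr0 oppr0 expR0 !mul1r mul1e.
have H1 i : List.In i s -> shear_ok h Dm i /\ mode i \in idx m by move=> hi; apply: H0; right.
have [ok km] := H0 it (or_introl erefl).
have ok1 i : List.In i s -> shear_ok h Dm i by move=> /H1[].
have ok0 i : List.In i (it :: s) -> shear_ok h Dm i by move=> /H0[].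
pose psi (u : bH) : \bar R := ((\1_[set u | good h Dm s u] u * (jac h s u *
     expR (- (2^-1 * (En (run h s u) - En u)))))%:E * phi (run h s u))%E.
have mE : measurable_fun [set: bH] (fun u : bH => En u) by exact: measurable_nq.
have psi0 u : (0 <= psi u)%E.
  rewrite mule_ge0// lee_fin indicE; have [gu|gu] := pselect (good h Dm s u).
    by rewrite mem_set// mul1r mulr_ge0 ?expR_ge0// ltW// jac_gt0.
  by rewrite memNset// mul0r.
have mpsi : measurable_fun [set: bH] psi.
  have mr := measurable_run ok1.
  apply: emeasurable_funM; last exact: (measurableT_comp mphi mr).
  apply/measurable_EFinP; apply: measurable_funM; first by apply: measurable_indic; exact: measurable_good ok1.
  apply: measurable_funM; first exact: measurable_jac.
  apply: measurableT_comp => //; apply: measurableT_comp => //; apply: measurable_funM => //.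
  by apply: measurable_funB => //; exact: (measurableT_comp mE mr).
apply: le_trans (IH H1).
have [k0 mg mj jk Dok] := ok.
have := @coordinate_shear _ _ eta eta_gauss (mode it) (fun v => h * drift it v) (fun v => 1 + h * dil it v)
   Dm psi k0 mDm _ _ _ _ _ mpsi psi0.
move=> /(_ (measurable_funM (measurable_cst h) mg)).
have mj' : measurable_fun [set: bH] (fun v : bH => 1 + h * dil it v).
  by apply: measurable_funD => //; exact: measurable_funM.
move=> /(_ mj').
move=> /(_ (fun u Du => (Dok u Du).1)).
have jk' u x : 1 + h * dil it (upd (mode it) u x) = 1 + h * dil it u by rewrite jk.
move=> /(_ jk' (fun u x Du Dx => (Dok u Du).2 x Dx)).
apply: le_trans; rewrite le_eqVlt; apply/orP; left; apply/eqP; apply: eq_integral => u _.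
rewrite -/(move h it u) /psi muleA; congr (_ * _)%E; rewrite -EFinM; congr (_%:E).
rewrite mulNr energy_move//= !indicE.
have [Du|Du] := pselect (Dm u); last first.
  by rewrite (memNset Du) memNset ?mul0r// => -[].
rewrite (mem_set Du).
have [gu|gu] := pselect (good h Dm s (move h it u)); last first.
  by rewrite [in RHS]memNset// memNset ?mul0r ?mulr0// => -[].
rewrite [in RHS]mem_set// mem_set//= !mul1r mulrACA -expRD; congr (_ * expR _).
ring.
Qed.

End inequality.

Section taylor.
Variables (h A B r : R).
Hypotheses (h0 : 0 <= h) (A0 : 0 <= A) (B0 : 0 <= B).

(** The radius [r + 1] leaves room for the intermediate points of a run that starts in the ball of
    radius [r]. *)
Definition tame it := [/\ `|bas R p (mode it)| <= B,
  forall u, `|u| <= r + 1 -> `|drift it u| <= A /\ `|dil it u| <= A &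
  forall u v, `|u| <= r + 1 -> `|v| <= r + 1 ->
    `|drift it u - drift it v| <= A * `|u - v| /\ `|dil it u - dil it v| <= A * `|u - v|].

Let e := h * (A * (B + 1)).
Let e0 : 0 <= e. Proof. by rewrite !mulr_ge0// addr_ge0. Qed.

Lemma ln_ge (y : R) : `|y| <= 2^-1 -> expR (y - 2 * y ^+ 2) <= 1 + y.
Proof.
move=> /ler_normlP[y1 y2].
have h1 : 1 - y + 2 * y ^+ 2 <= expR (- (y - 2 * y ^+ 2)).
  by have := expR_ge1Dx (- (y - 2 * y ^+ 2)); lra.
have h2 : 0 < 1 - y + 2 * y ^+ 2 by have := sqr_ge0 y; lra.
rewrite -[leLHS]invrK -expRN -[leRHS]invrK; rewrite lef_pV2 ?posrE ?expR_gt0//; last by rewrite invr_gt0; lra.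
apply: le_trans h1; rewrite -[(1 + y)^-1]mul1r ler_pdivrMr; last by lra.
have -> : (1 - y + 2 * y ^+ 2) * (1 + y) = 1 + y ^+ 2 * (1 + 2 * y) by ring.
by rewrite lerDl mulr_ge0 ?sqr_ge0//; lra.
Qed.

Let drift_budget (s a z x y : R) : 0 <= s -> 0 <= a -> 0 <= z -> x <= s * a ->
  y <= z * (a + s + z) -> y + x <= (z + s) * (a + (z + s)).
Proof. by move=> s0 a0 z0 xs yz; nra. Qed.

Let dil_budget (s a z x1 x2 y : R) : 0 <= s -> 0 <= a -> 0 <= z -> x2 - s * a <= y ->
  y ^+ 2 <= s ^+ 2 ->
  x2 + x1 - (z + s) * (2 * (a + (z + s))) <= y - 2 * y ^+ 2 + (x1 - z * (2 * (a + s + z))).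
Proof. by move=> s0 a0 z0 xs yz; nra. Qed.

(** Drifts and dilations are compared with their values at the starting point [u], while the run has
    moved to [v]; the induction therefore carries the distance [a], which grows by at most [e] with
    each shear. *)
Lemma run_taylor_aux its u v a : (forall it, List.In it its -> tame it) ->
  `|u| <= r -> `|v - u| <= a -> a + (size its)%:R * e <= 2^-1 ->
  [/\ good h [set w | `|w| <= r + 1] its v,
    `|run h its v - v - h *: (\sum_(it <- its) drift it u *: bas R p (mode it))| <=
       (size its)%:R * e * (a + (size its)%:R * e),
    `|run h its v - v| <= (size its)%:R * e &
    expR (h * (\sum_(it <- its) dil it u) - (size its)%:R * e * (2 * (a + (size its)%:R * e))) <= jac h its v].
Proof.
elim: its v a => [|it s IH] v a /= ht ur va ae.
  by rewrite !big_nil scaler0 !mul0r subrr subr0 normr0 mulr0 subr0 expR0; split.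
have a0 : 0 <= a := le_trans (normr_ge0 _) va.
have [tB tA tL] := ht it (or_introl erefl).
have sE : (size s).+1%:R * e = (size s)%:R * e + e by rewrite -natr1 mulrDl mul1r.
rewrite sE in ae *; have s0 : 0 <= (size s)%:R * e by rewrite mulr_ge0.
have e0' := e0; have ur1 : `|u| <= r + 1 by apply: le_trans ur _; rewrite lerDl.
have vr : `|v| <= r + 1.
  have := ler_normD (v - u) u; rewrite subrK.
  move: (`|v|) (`|v - u|) (`|u|) va ur => y1 y2 y3; lra.
have [gv jv] := tA v vr; have [gu ju] := tA u ur1; have [gL jL] := tL v u vr ur1.
set v' := move h it v.
have v'v : `|v' - v| <= e.
  rewrite /v' /move /shear addrAC subrr add0r normrZ normrM ger0_norm// /e -mulrA ler_wpM2l//.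
  by rewrite ler_pM// (le_trans tB)// lerDl.
have v'u : `|v' - u| <= a + e.
  rewrite (_ : v' - u = (v - u) + (v' - v)); last by rewrite [RHS]addrC addrA subrK.
  by apply: le_trans (ler_normD _ _) _; exact: lerD.
have ae' : a + e + (size s)%:R * e <= 2^-1 by rewrite -addrA (addrC e).
have [IH1 IH2 IH3 IH4] := IH v' (a + e) (fun i hi => ht i (or_intror hi)) ur v'u ae'.
split.
- by split.
- rewrite big_cons scalerDr.
  have -> : run h s v' - v - (h *: (drift it u *: bas R p (mode it)) + h *: (\sum_(j <- s) drift j u *: bas R p (mode j)))
    = (run h s v' - v' - h *: (\sum_(j <- s) drift j u *: bas R p (mode j))) + h *: ((drift it v - drift it u) *: bas R p (mode it)).
    have -> : v' = v + h *: (drift it v *: bas R p (mode it)) by rewrite /v' /move /shear scalerA.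
    rewrite scalerBl scalerBr; move: (h *: (drift it v *: _)) (h *: (drift it u *: _)) (h *: (\sum_(_ <- _) _)) => x y z.
    move: (run _ _ _) => w; rewrite !opprD !addrA.
    by rewrite [in RHS](addrAC _ (- z) x) subrK addrAC.
  apply: le_trans (ler_normD _ _) _.
  have : `|h *: ((drift it v - drift it u) *: bas R p (mode it))| <= e * a.
    rewrite !normrZ ger0_norm// /e -!mulrA ler_wpM2l//.
    apply: le_trans (_ : (A * a) * (B + 1) <= _); last by rewrite -mulrA (mulrC a).
    by apply: ler_pM => //; [apply: le_trans gL _; rewrite ler_wpM2l|rewrite (le_trans tB)// lerDl].
  by move=> h1; apply: drift_budget.
- rewrite -(subrK v' (run h s v')) -addrA; apply: le_trans (ler_normD _ _) _; exact: lerD.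
- rewrite big_cons mulrDr.
  set y := h * dil it v.
  have yA : `|y| <= e.
    rewrite normrM ger0_norm// /e ler_wpM2l//; apply: le_trans jv _.
    by rewrite ler_peMr// lerDr.
  have yu : h * dil it u - e * a <= y.
    have : `|y - h * dil it u| <= e * a.
      rewrite -mulrBr normrM ger0_norm// /e -mulrA ler_wpM2l//; apply: le_trans jL _.
      rewrite -mulrA ler_wpM2l//; apply: le_trans va _; rewrite ler_peMl// lerDr//.
    by rewrite ler_distl => /andP[].
  have y2 : y ^+ 2 <= e ^+ 2 by rewrite -[y ^+ 2]real_normK ?num_real// lerXn2r ?nnegrE.
  have y12 : `|y| <= 2^-1.
    by apply: le_trans yA _; apply: le_trans ae; rewrite addrA lerDr addr_ge0.
  have l1 := ln_ge y12.
  apply: le_trans (ler_pM (expR_ge0 _) (expR_ge0 _) l1 IH4).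
  rewrite -expRD ler_expR.
  exact: dil_budget.
Qed.

Lemma run_taylor its u : (forall it, List.In it its -> tame it) ->
  `|u| <= r -> (size its)%:R * e <= 2^-1 ->
  [/\ good h [set w | `|w| <= r + 1] its u,
    `|run h its u - u - h *: (\sum_(it <- its) drift it u *: bas R p (mode it))| <= ((size its)%:R * e) ^+ 2 &
    expR (h * (\sum_(it <- its) dil it u) - 2 * ((size its)%:R * e) ^+ 2) <= jac h its u].
Proof.
move=> ht ur he; have [||h1 h2 _ h4] := @run_taylor_aux its u u 0 ht ur.
- by rewrite subrr normr0.
- by rewrite add0r.
split=> //; first by move: h2; rewrite add0r expr2.
by move: h4; rewrite add0r expr2 mulrCA.
Qed.

End taylor.
End shear_lists.

Lemma In_map (I : eqType) (J : Type) (g : I -> J) s y :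
  List.In y (map g s) -> exists2 x, x \in s & y = g x.
Proof.
elim: s => //= x s IH [<-|/IH[z zs ->]]; first by exists x; rewrite ?mem_head.
by exists z => //; rewrite in_cons zs orbT.
Qed.

Lemma In_cat (J : Type) (s t : seq J) y : List.In y (s ++ t) -> List.In y s \/ List.In y t.
Proof. by elim: s => [|x s IH] /=; [right|move=> [->|/IH[]]; tauto]. Qed.

(* Lipschitz from [H^0] to [H^2] on a ball of [H^p], in terms of truncations. *)
Local Notation two_smoothing fc r L := (forall u v, `|u| <= r -> `|v| <= r ->
  forall M, (forall n, n2 (S n (coef (u - v))) <= M) ->
  forall n, n2 (Dn 2 (S n (fun k => fc u k - fc v k))) <= L * M).
Local Notation locally_two_smoothing fc := (forall r, exists2 L, 0 <= L & two_smoothing fc r L).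
Local Notation smoothing_bound p fc := (forall r, exists2 L, 0 <= L & forall u, `|u| <= r ->
  forall n, n2 (Dn (p + 2) (S n (fc u))) <= L).

(** * The shears of the truncated equation *)

Section splitting_scheme.
Variables (R : realType) (p : nat).
Local Notation q := (p%:R : R).
Local Notation H := (sobolev q).
Local Notation bH := (borelH R p).
Hypothesis p3 : (3 <= p)%N.
Implicit Types (u v : H) (k : int) (n m : nat) (h r : R).

(** Lipschitz on bounded sets: it gives measurability as well as the constants of [tame]. *)
Definition lipb (g : H -> R) := forall r, exists2 K : R, 0 <= K &
  forall u v, `|u| <= r -> `|v| <= r -> `|g u - g v| <= K * `|u - v|.

Lemma lipbZ (c : R) g : lipb g -> lipb (fun u => c * g u).
Proof.
move=> hg r; have [K K0 hK] := hg r; exists (`|c| * K); first by rewrite mulr_ge0.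
by move=> u v ur vr; rewrite -mulrBr normrM -mulrA ler_wpM2l// hK.
Qed.

Lemma lipb_cst (c : R) : lipb (fun=> c).
Proof. by move=> r; exists 0 => // u v _ _; rewrite subrr normr0 mul0r. Qed.

Lemma lipb_measurable g : lipb g -> measurable_fun [set: bH] (g : bH -> R).
Proof. by move=> hg; apply: continuous_measurableH; apply: lip_continuous. Qed.

Definition lip_item (it : item R p) := [/\ lipb (drift it) & lipb (dil it)].

Lemma tame_ex r (its : seq (item R p)) : 0 <= r -> (forall it, List.In it its -> lip_item it) ->
  exists A B : R, [/\ 0 <= A, 0 <= B & forall it, List.In it its -> tame A B r it].
Proof.
move=> r0; elim: its => [|it s IH] H0; first by exists 0, 0; split.
have [A [B [A0 B0 hs]]] := IH (fun i hi => H0 i (or_intror hi)).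
have [hg hj] := H0 it (or_introl erefl).
have [K1 K10 h1] := hg (r + 1); have [K2 K20 h2] := hj (r + 1).
pose A' := A + (K1 * (r + 1) + `|drift it 0| + K1 + (K2 * (r + 1) + `|dil it 0| + K2)).
pose B' := B + `|bas R p (mode it)|.
have r1 : 0 <= r + 1 by rewrite addr_ge0.
have b1 : 0 <= K1 * (r + 1) by rewrite mulr_ge0.
have b2 : 0 <= K2 * (r + 1) by rewrite mulr_ge0.
have a1 := normr_ge0 (drift it 0); have a2 := normr_ge0 (dil it 0).
have AA : A <= A' by rewrite /A'; lra.
have bnd (g : H -> R) K (u : H) : 0 <= K -> (forall u v, `|u| <= r + 1 -> `|v| <= r + 1 -> `|g u - g v| <= K * `|u - v|) ->
    `|u| <= r + 1 -> `|g u| <= K * (r + 1) + `|g 0|.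
  move=> K0 hK ur; have := hK u 0 ur (ltac:(by rewrite normr0)); rewrite subr0 => hu.
  have := ler_normD (g u - g 0) (g 0); rewrite subrK => t; apply: le_trans t _.
  by rewrite lerD2r; apply: le_trans hu _; rewrite ler_wpM2l.
exists A', B'; split=> //; first by apply: le_trans AA.
  by rewrite addr_ge0.
move=> it' /= [<-|hi].
  split; first by rewrite lerDr.
    move=> u ur; have := bnd _ _ u K10 h1 ur; have := bnd _ _ u K20 h2 ur.
    by move: (`|drift it u|) (`|dil it u|) => x y; rewrite /A' => ? ?; split; lra.
  move=> u v ur vr; split.
    by apply: le_trans (h1 u v ur vr) _; rewrite ler_wpM2r// /A'; lra.
  by apply: le_trans (h2 u v ur vr) _; rewrite ler_wpM2r// /A'; lra.
have [t1 t2 t3] := hs it' hi; split.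
- by apply: le_trans t1 _; rewrite lerDl.
- by move=> u ur; have [x y] := t2 u ur; split; [apply: le_trans x _|apply: le_trans y _].
- move=> u v ur vr; have [x y] := t3 u v ur vr.
  by split; [apply: le_trans x _|apply: le_trans y _]; rewrite ler_wpM2r.
Qed.

Lemma n2_Dn_S_le j u n : (j <= p)%N -> n2 (Dn j (S n u)) <= `|u|.
Proof. by move=> jp; apply: le_trans (n2_Dn_norm u n); apply: le_n2Dn => //; exact: I_S. Qed.

Lemma S_subH n u v : S n (coef u) - S n (coef v) = S n (coef (u - v)).
Proof. by rewrite -SB; apply: eq_S => k _; rewrite sob_coefB. Qed.

Lemma lipb_kdvW m (Z : tpoly R) : lipb (fun u => I (kdvW (S m u) * Z)).
Proof.
move=> r; have [r0|r0] := leP r 0.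
  exists 0 => // u v ur vr.
  have -> : u = 0 by apply/eqP; rewrite -normr_le0; apply: le_trans ur r0.
  have -> : v = 0 by apply/eqP; rewrite -normr_le0; apply: le_trans vr r0.
  by rewrite subrr normr0 mul0r.
exists (n2 (Dn 3 Z) + 6 * r * n2 (D Z)); first by rewrite addr_ge0 ?n2_ge0// !mulr_ge0 ?n2_ge0// ltW.
move=> u v ur vr.
apply: le_trans (kdvW_lip Z (I_S _ _) (I_S _ _) (le_trans (n2_Dn_S_le _ _ p3) ur) (le_trans (n2_Dn_S_le _ _ p3) vr)) _.
rewrite mulrC ler_wpM2l//; first by rewrite addr_ge0 ?n2_ge0// !mulr_ge0 ?n2_ge0// ltW.
by rewrite S_subH; have := n2_Dn_S_le (u - v) m (leq0n p); rewrite Dn0.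
Qed.

Lemma lipb_I_D m (Z : tpoly R) : lipb (fun u => I (D (S m u) * Z)).
Proof.
move=> r; exists (n2 Z); first exact: n2_ge0.
move=> u v _ _; rewrite -IB -mulrBl -DB S_subH.
apply: le_trans (n2_CS _ _) _; rewrite mulrC ler_wpM2l ?n2_ge0//.
exact: (n2_Dn_S_le (u - v) m (leq_trans (leqnSn _) (leq_trans (leqnSn _) p3))).
Qed.

Variable (fc : H -> int -> R) (L r1 : R).
Hypothesis fc_lip : locally_two_smoothing fc.
Hypothesis L0 : 0 <= L.
Hypothesis fc_lip1 : two_smoothing fc r1 L.

Lemma coef_le_n2 (a : int -> R) j k n : k \in idx n -> `|wn R k ^+ j * a k| <= n2 (Dn j (S n a)).
Proof.
move=> kn; rewrite -[leLHS]sqrtr_sqr; apply: ler_wsqrtr; rewrite Parseval_Dn (bigD1_seq k) ?uniq_idx//=.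
rewrite exprMn -exprM mulnC lerDl sumr_ge0// => i _; rewrite mulr_ge0 ?sqr_ge0//.
by rewrite exprM exprn_ge0// sqr_ge0.
Qed.

Lemma fc_coef K u v M k : k != 0 ->
  (forall n, n2 (Dn 2 (S n (fun k => fc u k - fc v k))) <= K * M) ->
  `|fc u k - fc v k| <= K / wn R k ^+ 2 * M.
Proof.
move=> k0 hK; rewrite mulrAC ler_pdivlMr ?exprn_even_gt0 ?wn_eq0// mulrC.
rewrite -[wn R k ^+ 2]ger0_norm ?sqr_ge0// -normrM.
apply: le_trans (hK `|k|%N.+1); apply: coef_le_n2 (fun k => fc u k - fc v k) _ _ _ _.
by rewrite mem_idx k0 ltnSn.
Qed.

Lemma lipb_fc m k : k != 0 -> lipb (fun u => fc (trunc p m u) k).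
Proof.
move=> k0 r; have [K K0 hK] := fc_lip r.
exists (K / wn R k ^+ 2); first by rewrite divr_ge0 ?sqr_ge0.
move=> u v ur vr.
apply: fc_coef k0 _; apply: hK; try by apply: le_trans (norm_trunc_le _ _) _.
move=> n; rewrite -[S _ _]Dn0; apply: le_trans (n2_Dn_S_le _ _ (leq0n p)) _.
have -> : trunc p m u - trunc p m v = trunc p m (u - v) :> H.
  by apply: sob_ext => j _; rewrite sob_coefB !truncE; case: ifP; rewrite ?sob_coefB ?subrr.
exact: norm_trunc_le.
Qed.

Variables (sg eps : R) (m : nat).
Hypotheses (sg1 : `|sg| = 1) (eps0 : 0 <= eps).

(** The slope of the [k]-th component of the KdV field in the [k]-th coefficient; see [kdv_upd]. *)
Definition beta k u : R := 3 * I (D (S m u) * (e R k * e R k)).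
Definition kdv_item k : item R p := Item k (fun u => sg * I (kdvW (S m u) * e R k)) (fun u => sg * beta k u).
(** The perturbation is not affine in the [k]-th coefficient. Its [dil] is a constant lower bound
    for the expansion, the negative of the Lipschitz constant in that coefficient, and serves both
    signs [sg]; its decay in [k] comes from the gain of two derivatives. *)
Definition pert_item k : item R p :=
  Item k (fun u => sg * (eps * fc (trunc p m u) k)) (fun=> - (eps * L / wn R k ^+ 2)).
Definition its : seq (item R p) := map kdv_item (idx m) ++ map pert_item (idx m).

Lemma In_its it : List.In it its -> exists2 k, k \in idx m & it = kdv_item k \/ it = pert_item k.
Proof.
move=> hi; have [h1|h1] := In_cat hi.
  by have [k km ->] := @In_map int _ kdv_item (idx m) it h1; exists k; tauto.
by have [k km ->] := @In_map int _ pert_item (idx m) it h1; exists k; tauto.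
Qed.

Lemma its_mode it : List.In it its -> mode it \in idx m.
Proof. by move=> /In_its[k km [->|->]]. Qed.

Lemma its_lip it : List.In it its -> lip_item it.
Proof.
move=> /In_its[k km [->|->]]; split=> /=.
- exact: lipbZ (lipb_kdvW _ _).
- apply: lipbZ; exact: lipbZ (lipb_I_D _ _).
- apply: lipbZ; apply: lipbZ; exact: lipb_fc (idx_neq0 km).
- exact: lipb_cst.
Qed.

Lemma S_upd k u x : k \in idx m -> S m (upd k u x) = S m u + tpC (x - coef u k) * e R k.
Proof.
move=> km; have k0 := idx_neq0 km.
have -> : tpC (x - coef u k) * e R k = S m (fun j => if j == k then x - coef u k else 0).
  rewrite /S (bigD1_seq k) ?uniq_idx//= eqxx big1 ?addr0// => j jk.
  by rewrite (negbTE jk) tpC0 mul0r.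
rewrite -SD; apply: eq_S => j _; rewrite updE//; case: eqP => [->|_]; rewrite ?addr0//.
by rewrite addrC subrK.
Qed.

Lemma I_Deee k : I (D (e R k) * (e R k * e R k)) = 0.
Proof.
have := I_D (e R k * e R k * e R k); rewrite !DM.
set E := e R k; set E' := D E.
have -> : (E' * E + E * E') * E + E * E * E' = tpC 3 * (E' * (E * E)) by rewrite (tpCn R 3); ring.
by rewrite IZ => /eqP; rewrite mulf_eq0 pnatr_eq0 => /eqP.
Qed.

Lemma I_DeeE k : I (D (e R k * e R k) * e R k) = 0.
Proof.
rewrite DM; set E := e R k; set E' := D E.
have -> : (E' * E + E * E') * E = tpC 2 * (E' * (E * E)) by rewrite (tpCn R 2); ring.
by rewrite IZ I_Deee mulr0.
Qed.

Lemma beta_upd k u x : k \in idx m -> beta k (upd k u x) = beta k u.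
Proof.
move=> km; rewrite /beta S_upd// DD DCM; set s := tpC _; set X := D (S m u); set E := e R k; set E' := D E.
have -> : (X + s * E') * (E * E) = X * (E * E) + s * (E' * (E * E)) by ring.
by rewrite ID IZ I_Deee mulr0 addr0.
Qed.

(** The dependence on one coefficient is quadratic a priori; the quadratic term is proportional to
    $\int(e_k^2)'e_k=0$, so it is affine and the shear is exactly linear on each fibre. *)
Lemma kdv_upd k u x : k \in idx m ->
  I (kdvW (S m (upd k u x)) * e R k) = I (kdvW (S m u) * e R k) + (x - coef u k) * beta k u.
Proof.
move=> km; rewrite S_upd//; set s := x - _; set X := S m u; set E := e R k.
have -> : kdvW (X + tpC s * E) * E = kdvW X * E + (tpC (- s) * (Dn 3 E * E) +
   (tpC (6 * s) * (D (E * X) * E) + tpC (3 * s ^+ 2) * (D (E * E) * E))).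
  rewrite !kdvWE DnD DnCM !(DCM, DM, DD) !(tpCM, tpCN) !(tpCn R 3) !(tpCn R 6).
  by ring.
rewrite !ID !IZ I_D3X I_DeeE !mulr0 addr0 add0r (I_transport E X) /beta -/X -/E (mulrA (D X)).
by field.
Qed.

(** [h * A <= 2^-1] keeps the factors positive. The KdV shears expand by exactly their factor; those
    of the perturbation by at least theirs, as changing one coefficient by $s$ moves the truncation
    by at most $|s|$ in $L^2$. *)
Lemma its_ok h A B it : 0 <= h -> 0 <= A -> h * A <= 2^-1 -> 0 < r1 -> tame A B (r1 - 1) it ->
  List.In it its -> shear_ok h [set u | `|u| <= r1] it.
Proof.
move=> h0 A0 hA r10 [_ + _] hit; rewrite subrK => tA.
have [hg hj] := its_lip hit; have km := its_mode hit; have k0 := idx_neq0 km.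
have j1 u : `|u| <= r1 -> 0 < 1 + h * dil it u.
  move=> ur; have [_] := tA u ur; move=> /ler_normlP[j1 j2].
  by have := ler_wpM2l h0 j1; rewrite mulrN; lra.
split; [exact: k0|exact: lipb_measurable|exact: lipb_measurable| |].
  by move: hit => /In_its[k kk [->|->]] u x //=; rewrite beta_upd.
move=> u ur; split; first exact: j1.
move=> x xr; have j1u := j1 u ur.
move: hit km k0 hg hj tA j1 j1u xr => /In_its[k kk [->|->]] /= km k0 hg hj tA j1 j1u xr.
  rewrite kdv_upd//; set b := I _; set y := coef u k; set z := sg * beta k u in j1u *.
  have -> : x + h * (sg * (b + (x - y) * beta k u)) - (y + h * (sg * b)) = (1 + h * z) * (x - y).
    by rewrite /z; ring.
  by rewrite normrM (gtr0_norm j1u).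
set y := coef u k; set f1 := fc _ k; set f2 := fc _ k.
have hM n : n2 (S n (coef (trunc p m (upd k u x) - trunc p m u : H))) <= `|x - y|.
  have -> : trunc p m (upd k u x) - trunc p m u = (x - y) *: bas R p k :> H.
    apply: sob_ext => j j0; rewrite sob_coefB !truncE sob_coefZ basE// updE//.
    case: ifP => jm; first by case: eqP => [->|_]; rewrite ?mulr1// ?mulr0 subrr.
    by case: eqP => [jk|_]; rewrite ?subrr ?mulr0//; rewrite jk km in jm.
  rewrite -[leRHS]mulr1.
  have -> : S n (coef ((x - y) *: bas R p k)) = tpC (x - y) * S n (bas R p k).
    by rewrite -SZ; apply: eq_S => j _; rewrite sob_coefZ.
  rewrite n2Z ler_wpM2l//; apply: le_n2 => //.
  rewrite Parseval expr1n (eq_big_seq (fun j => (j == k)%:R * (j == k)%:R)); last by move=> j /idx_neq0 j0; rewrite basE.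
  by rewrite sum_idx_delta eqxx mul1r; case: (_ \in _).
have hf : `|f1 - f2| <= L / wn R k ^+ 2 * `|x - y|.
  exact: fc_coef k0 (fc_lip1 (le_trans (norm_trunc_le _ _) xr) (le_trans (norm_trunc_le _ _) ur) hM).
have -> : x + h * (sg * (eps * f1)) - (y + h * (sg * (eps * f2))) = (x - y) + h * (sg * (eps * (f1 - f2))) by ring.
have : `|h * (sg * (eps * (f1 - f2)))| <= h * (eps * (L / wn R k ^+ 2 * `|x - y|)).
  rewrite !normrM sg1 mul1r (ger0_norm h0) (ger0_norm eps0) ler_wpM2l// ler_wpM2l//.
have := lerB_normD (x - y) (h * (sg * (eps * (f1 - f2)))).
rewrite mulrDl mul1r -[eps * L / _]mulrA mulrN mulNr -!mulrA.
by move=> h1 h2; apply: le_trans h1; rewrite lerD2l lerN2.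
Qed.

Lemma trig_sqr n x : (0 < n)%N -> trig n%:Z x ^+ 2 + trig (- n%:Z) x ^+ 2 = 2 :> R.
Proof.
move=> n0; rewrite trig_nat// trig_Nnat !exprMn sqrrN -mulrDr cos2Dsin2 mulr1.
by rewrite sqr_sqrtr.
Qed.

(** The truncated KdV field is divergence free: $\sum_ke_k^2$ is constant, so the sum is a multiple
    of $\int u_x$. *)
Lemma sum_beta u : \sum_(k <- idx m) beta k u = 0.
Proof.
rewrite -mulr_sumr -Isum -mulr_sumr.
have -> : \sum_(k <- idx m) e R k * e R k = tpC (\sum_(1 <= i < m) 2).
  apply: tp_eq => x; rewrite big_idx tp_sum big_nat [RHS]big_nat; apply: eq_bigr => i /andP[i0 _].
  by rewrite tp_add !tp_mul !eE -!expr2 trig_sqr.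
by rewrite (mulrC (D _)) IZ I_D !mulr0.
Qed.

Lemma sum_dil u : - (eps * L) <= \sum_(it <- its) dil it u.
Proof.
rewrite big_cat/= !big_map/= -mulr_sumr sum_beta mulr0 add0r sumrN lerN2 -mulr_sumr.
rewrite -[leRHS]mulr1 ler_wpM2l ?mulr_ge0//; apply: le_trans (sum_wn R m) _.
by rewrite invf_le1//; lra.
Qed.

Definition V u : H := trunc p m (fun k => sg * (I (kdvW (S m u) * e R k) + eps * fc (trunc p m u) k)).

Lemma sum_drift u : \sum_(it <- its) drift it u *: bas R p (mode it) = V u.
Proof.
rewrite /V trunc_sum big_cat/= !big_map/= -big_split/=; apply: eq_bigr => k _.
by rewrite -scalerDl -mulrDr.
Qed.

Lemma S_V u : S m (V u) = tpC sg * (P m (kdvW (S m u)) + tpC eps * S m (fc (trunc p m u))).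
Proof.
rewrite /P -SZ -SD -SZ; apply: eq_S => k km.
by rewrite truncE km.
Qed.

End splitting_scheme.

Section galerkin_identities.
Variable R : realType.
Implicit Types (X Y : tpoly R) (a b : int -> R) (n m j : nat).

Lemma P_adjoint X m b : I (P m X * S m b) = I (X * S m b).
Proof.
rewrite !I_Sl; apply: eq_big_seq => k km; congr (_ * _).
by rewrite /P coef_S ?km ?mulr1//; exact: idx_neq0 km.
Qed.

Lemma I_Dn_P j X m b : I (Dn j (P m X) * Dn j (S m b)) = I (Dn j X * Dn j (S m b)).
Proof. by rewrite !I_partsn -Dn_add addnn -mul2n Dn2_S P_adjoint. Qed.

Lemma P_S_le n m a : (m <= n)%N -> P m (S n a) = S m a.
Proof.
move=> mn; apply: eq_S => k km; rewrite /coe coef_S; last exact: idx_neq0 km.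
suff -> : k \in idx n by rewrite mulr1.
by move: km; rewrite !mem_idx => /andP[-> /=] km; exact: leq_trans mn.
Qed.

(** The factor grows with [m], so the inequality is reserved for remainders of order $h^2$. *)
Lemma Bernstein j m a : n2 (Dn j.+1 (S m a)) <= 2 * pi * m%:R * n2 (Dn j (S m a)).
Proof.
have c0 : 0 <= 2 * pi * m%:R :> R by rewrite !mulr_ge0 ?pi_ge0.
apply: le_n2; first by rewrite mulr_ge0 ?n2_ge0.
rewrite exprMn sqr_n2 !Parseval_Dn mulr_sumr big_seq [leRHS]big_seq.
apply: ler_sum => k; rewrite mem_idx => /andP[_ km].
rewrite [leRHS]mulrA; apply: ler_wpM2r; first exact: sqr_ge0.
rewrite mulnS exprD; apply: ler_wpM2r; first by rewrite exprM exprn_ge0 ?sqr_ge0.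
rewrite -[leLHS]real_normK ?num_real// lerXn2r ?nnegrE// normrM ger0_norm ?mulr_ge0 ?pi_ge0//.
rewrite ler_wpM2l ?mulr_ge0 ?pi_ge0// -intr_norm -abszE.
by rewrite -[leLHS]/(`|k|%N%:R) ler_nat ltnW.
Qed.

End galerkin_identities.

(** * One sweep through all modes *)

Section macro_step.
Variables (R : realType) (p : nat) (c : R) (K : mpoly.mpoly p R).
Local Notation q := (p%:R : R).
Local Notation H := (sobolev q).
Local Notation bH := (borelH R p).
Hypothesis p3 : (3 <= p)%N.
Implicit Types (u v : H) (k : int) (n m : nat) (h r : R).

Variable G : tpoly R -> 'I_p -> tpoly R.
Hypothesis G_bnd : bounded_gradient p G.
Hypothesis G_taylor : taylor_functional p c K G.
Hypothesis Psi_conserved : forall X, I X = 0 -> conserved p.+1 X = Psi c K X.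

Variable fc : H -> int -> R.
Hypothesis fc_lip : locally_two_smoothing fc.
Hypothesis fc_bound : smoothing_bound p fc.

Variable r : R.
Hypothesis r0 : 0 <= r.

(** The size of the truncation defect in [zhidkov], evaluated at the truncation of [u]. *)
Definition rho m u : R := n2 (Q m (S m u * Dn p (S m u))) + n2 (Q m (Dn p (S m u * S m u))).

Lemma rho_ge0 m u : 0 <= rho m u.
Proof. by rewrite addr_ge0 ?n2_ge0. Qed.

Let pp j n (u : H) : (j <= p)%N -> `|u| <= r -> n2 (Dn j (S n u)) <= r.
Proof. by move=> jp; apply: le_trans; apply: n2_Dn_S_le. Qed.

Lemma energy_V : exists2 C : R, 0 <= C & forall (sg eps : R) m u, `|sg| = 1 -> 0 <= eps <= 1 -> `|u| <= r ->
  `|I (Dn p (S m u) * Dn p (S m (V fc sg eps m u)))| <= C.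
Proof.
have [C C0 hC] := @energy_kdv R p (ltnW p3); have [F F0 hF] := fc_bound r.
exists (C * r ^+ 3 + r * F); first by rewrite addr_ge0 ?mulr_ge0 ?exprn_ge0.
move=> sg eps m u sg1 /andP[e0 e1] ur; rewrite S_V DnCM DnD DnCM mulrCA IZ normrM sg1 mul1r mulrDr ID.
rewrite (mulrCA _ (tpC eps)) IZ; apply: le_trans (ler_normD _ _) _; apply: lerD.
  rewrite mulrC I_Dn_P mulrC; apply: le_trans (hC _ (I_S _ _)) _.
  by rewrite ler_wpM2l// lerXn2r ?nnegrE ?n2_ge0//; exact: pp.
rewrite normrM (ger0_norm e0) -[leRHS]mul1r ler_pM//.
apply: le_trans (n2_CS _ _) _; apply: ler_pM; rewrite ?n2_ge0//; first exact: pp.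
apply: le_trans (hF _ (le_trans (norm_trunc_le m u) ur) m).
by apply: le_n2Dn; rewrite ?I_S ?leq_addr.
Qed.

(** The KdV part contributes only the truncation defect. In the perturbation one derivative is moved
    from $\partial^{p+1}u$ onto $f$, which is affordable since $f$ is bounded in $H^{p+2}$. The
    constant depends neither on [m] nor on [eps]. *)
Lemma psi_V : exists2 C : R, 0 <= C & forall (sg eps : R) m u, `|sg| = 1 -> 0 <= eps <= 1 -> `|u| <= r ->
  `|dPsi c G (S m u) (S m (V fc sg eps m u))| <= C * rho m u + eps * C.
Proof.
have [F F0 hF] := fc_bound r.
have [C1 C10 h1] := zhidkov c (ltnW p3) G_bnd r.
have [C2 C20 h2] := G_taylor (r + F).
exists (C1 + (r * F + C2 * F)); first by rewrite !addr_ge0 ?mulr_ge0.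
move=> sg eps m u sg1 /andP[e0 e1] ur.
have inv := @dPsi_kdvW R p c K G G_taylor Psi_conserved.
rewrite S_V dPsiZ normrM sg1 mul1r dPsiD dPsiZ.
apply: le_trans (ler_normD _ _) _; rewrite (mulrDl C1) -addrA; apply: lerD.
  rewrite dPsi_galerkin ?I_S ?inv ?I_S//; last exact: deg_S.
  by rewrite normrN; apply: h1; [exact: deg_S|exact: I_S|exact: pp].
set Z := S m (fc _).
have Zb j : (j <= p + 2)%N -> n2 (Dn j Z) <= F.
  move=> jp; apply: le_trans (hF _ (le_trans (norm_trunc_le m u) ur) m).
  by apply: le_n2Dn; rewrite ?I_S.
have Fr : r <= r + F by rewrite lerDl.
have Fr' : F <= r + F by rewrite lerDr.
have hZ : `|dPsi c G (S m u) Z| <= r * F + C2 * F.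
  apply: le_trans (ler_normD _ _) _; apply: lerD.
    rewrite [Dn p.+1 (S m u)]DnS I_parts normrN -DnS.
    apply: le_trans (n2_CS _ _) _; apply: ler_pM; rewrite ?n2_ge0//; first exact: pp.
    by apply: Zb; rewrite addn2.
  have [||_ h3 _] := h2 (S m u) Z (I_S _ _) (I_S _ _).
  - exact: le_trans (pp _ (leqnn p) ur) Fr.
  - by apply: le_trans (Zb _ (leq_addr _ _)) _.
  by apply: le_trans h3 _; rewrite ler_wpM2l// Zb// leq_addr.
rewrite normrM (ger0_norm e0).
have X0 : 0 <= r * F + C2 * F by rewrite addr_ge0 ?mulr_ge0.
apply: le_trans (ler_wpM2l e0 hZ) _; rewrite [eps * (C1 + _)]mulrDr addrA lerDr.
by rewrite addr_ge0// mulr_ge0// rho_ge0.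
Qed.

Lemma norm_sum_In (V0 : normedModType R) (J : Type) (s : seq J) (F : J -> V0) (M : R) :
  (forall x, List.In x s -> `|F x| <= M) -> `|\sum_(x <- s) F x| <= (size s)%:R * M.
Proof.
elim: s => [|x s IH] h; first by rewrite big_nil normr0 mul0r.
rewrite big_cons -natr1 mulrDl mul1r addrC; apply: le_trans (ler_normD _ _) _.
by apply: lerD; [apply: IH => y ys; apply: h; right|apply: h; left].
Qed.

Let energy_budget (a D w y C d h : R) : 0 <= h <= 1 -> 0 <= D -> 0 <= d -> 0 <= w -> 0 <= y -> 0 <= a -> a <= r ->
  w ^+ 2 <= a ^+ 2 + 2 * h * C + h ^+ 2 * D ^+ 2 -> w <= a + h * D -> y <= w + d * h ^+ 2 ->
  y ^+ 2 <= a ^+ 2 + 2 * h * C + (D ^+ 2 + d * (2 * (r + D) + d)) * h ^+ 2.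
Proof.
move=> /andP[h0 h1] D0 d0 w0 y0 a0 ar w1 w2 y1.
have w3 : w <= r + D by nra.
have h2 : h ^+ 2 <= 1 by rewrite expr_le1.
have h3 := sqr_ge0 h.
have y2 : y ^+ 2 <= (w + d * h ^+ 2) ^+ 2 by rewrite lerXn2r ?nnegrE ?addr_ge0 ?mulr_ge0.
have e1 : (w + d * h ^+ 2) ^+ 2 = w ^+ 2 + d * h ^+ 2 * (2 * w + d * h ^+ 2) by ring.
have e2 : d * h ^+ 2 * (2 * w + d * h ^+ 2) <= d * h ^+ 2 * (2 * (r + D) + d).
  apply: ler_wpM2l; first by rewrite mulr_ge0.
  by apply: lerD; [lra|rewrite -[leRHS]mulr1 ler_wpM2l].
have e3 : (D ^+ 2 + d * (2 * (r + D) + d)) * h ^+ 2 = h ^+ 2 * D ^+ 2 + d * h ^+ 2 * (2 * (r + D) + d) by ring.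
rewrite e3; lra.
Qed.

Let budget_sum (x y z w t : R) : 0 <= x -> 0 <= y -> 0 <= z -> 0 <= w -> t <= x ->
  [/\ x <= 2 * x + y + z + w, y <= 2 * x + y + z + w, z <= 2 * x + y + z + w,
    2 * t <= 2 * x + y + z + w & w <= 2 * x + y + z + w].
Proof. by move=> x0 y0 z0 w0 tx; split; lra. Qed.

Let psi_budget (x1 x2 x3 x4 x5 x6 x7 x8 x9 z1 z2 z3 z4 : R) : x1 - x2 - x3 = x6 + x5 ->
  x6 <= x7 -> x8 <= x9 -> x3 <= z1 + z2 -> x5 <= x4 -> z3 <= z4 -> z3 = z2 + x7 + x9 ->
  x4 <= x8 -> x1 <= x2 + z1 + z4.
Proof. by move=> *; lra. Qed.

(** The effect of one sweep of step [h] at level [m]. The rates [L], [C1], [C2] are meant to be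
    uniform in [m]; [C], which multiplies $h^2$ only, may depend on it. *)
Definition macro_ok (L sg eps C1 C2 : R) m h C :=
  (forall it, List.In it (its fc L sg eps m) -> shear_ok h [set u | `|u| <= r + 1] it) /\
  forall u, `|u| <= r ->
  [/\ good h [set w | `|w| <= r + 1] (its fc L sg eps m) u,
    `|run h (its fc L sg eps m) u - u - h *: V fc sg eps m u| <= C * h ^+ 2,
    `|run h (its fc L sg eps m) u| ^+ 2 <= `|u| ^+ 2 + 2 * h * C1 + C * h ^+ 2,
    Psi c K (S m (run h (its fc L sg eps m) u)) <= Psi c K (S m u) + h * (C2 * rho m u + eps * C2) + C * h ^+ 2 &
    expR (- (h * (eps * L) + C * h ^+ 2)) <= jac h (its fc L sg eps m) u] /\ `|V fc sg eps m u| <= C.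

Section one_level.
Variables (sg eps L C1 C2 : R) (m : nat).
Hypotheses (sg1 : `|sg| = 1) (eps01 : 0 <= eps <= 1) (L0 : 0 <= L).
Hypothesis fc_lip1 : two_smoothing fc (r + 1) L.
Hypothesis C1P : forall u, `|u| <= r -> `|I (Dn p (S m u) * Dn p (S m (V fc sg eps m u)))| <= C1.
Hypothesis C2P : forall u, `|u| <= r -> `|dPsi c G (S m u) (S m (V fc sg eps m u))| <= C2 * rho m u + eps * C2.
Local Notation V := (V fc sg eps m).
Local Notation items := (its fc L sg eps m).

Lemma nq_line n u h : `|u| <= r -> 0 <= h ->
  nq q n (u + h *: V u) <= `|u| ^+ 2 + 2 * h * C1 + h ^+ 2 * `|V u| ^+ 2.
Proof.
move=> ur h0; apply: le_trans (nq_mono p _ (leq_maxl n m)) _; set N := maxn n m.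
rewrite -sqr_n2_Dn_S.
have -> : S N (coef (u + h *: V u)) = S N u + tpC h * S N (V u).
  by rewrite -SZ -SD; apply: eq_S => k _; rewrite sob_coefD sob_coefZ.
rewrite DnD DnCM sqr_n2; set A := Dn p (S N u); set B := Dn p (S N (V u)).
have -> : (A + tpC h * B) * (A + tpC h * B) = A * A + (tpC (2 * h) * (A * B) + tpC (h ^+ 2) * (B * B)).
  by rewrite expr2 !tpCM (tpCn R 2); ring.
rewrite !ID !IZ addrA -!sqr_n2; apply: lerD; first apply: lerD.
- by rewrite lerXn2r ?nnegrE ?n2_ge0//; exact: n2_Dn_norm.
- apply: ler_wpM2l; first by rewrite mulr_ge0.
  have E : S N (V u) = S m (V u).
    rewrite [RHS](S_sub _ (leq_maxr n m)); apply: eq_S => k _.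
    by rewrite truncE; case: ifP.
  rewrite /A /B E -I_Dn_P P_S_le ?leq_maxr//; apply: le_trans (ler_norm _) _; exact: C1P.
- by rewrite ler_wpM2l ?sqr_ge0// lerXn2r ?nnegrE ?n2_ge0//; exact: n2_Dn_norm.
Qed.

(** A sweep is an Euler step for the field [V] up to an error of order $h^2$. The constant of that
    error involves the number of shears and the factor of Bernstein, hence depends on [m]. *)
Lemma macro_step : exists C h0 : R, [/\ 0 <= C, 0 < h0 & forall h, 0 <= h <= h0 -> macro_ok L sg eps C1 C2 m h C].
Proof.
have [e0 e1] := andP eps01.
have [A [B [A0 B0 tm]]] := tame_ex r0 (@its_lip R p p3 fc L fc_lip sg eps m).
set N := (size items)%:R : R; have N0 : 0 <= N by [].
(* Bounds both the field [V] and, after multiplication by [h], the total displacement of a sweep. *)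
pose E := N * (A * (B + 1)); have E0 : 0 <= E by rewrite !mulr_ge0 ?addr_ge0.
pose D := E + E ^+ 2.
have D0 : 0 <= D by rewrite addr_ge0 ?sqr_ge0.
have [C3 C30 h3] := G_taylor (r + D).
have [b [b0 Bern]] : exists b : R, 0 <= b /\ forall j a, n2 (Dn j.+1 (S m a)) <= b * n2 (Dn j (S m a)).
  exists (2 * pi * m%:R); split; last by move=> j a; exact: Bernstein.
  by rewrite mulr_ge0// mulr_ge0// pi_ge0.
pose Ce := E ^+ 2 + 1; pose Cn := E ^+ 2 + Ce * (2 * (r + E) + Ce).
pose Cp := (b * (b * r) + C3) * Ce + 2^-1 * (b * D) ^+ 2 + C3 * D ^+ 2.
have Ce0 : 0 <= Ce by rewrite addr_ge0 ?sqr_ge0.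
have Cn0 : 0 <= Cn by rewrite addr_ge0 ?sqr_ge0// mulr_ge0// addr_ge0// mulr_ge0// addr_ge0.
have Cp0 : 0 <= Cp.
  apply: addr_ge0; last by rewrite mulr_ge0 ?sqr_ge0.
  apply: addr_ge0; last by rewrite mulr_ge0 ?sqr_ge0 ?invr_ge0.
  by rewrite mulr_ge0// addr_ge0// mulr_ge0// mulr_ge0.
have M0 : 0 < 2 * (E + A + 1) by rewrite mulr_gt0// ltr_wpDl ?addr_ge0.
(* The step bound gives at once [h <= 1], [h * E <= 2^-1] and [h * A <= 2^-1]. *)
exists (2 * Ce + Cn + Cp + E), (2 * (E + A + 1))^-1; split.
- by apply: addr_ge0 => //; apply: addr_ge0 => //; apply: addr_ge0 => //; rewrite mulr_ge0.
- by rewrite invr_gt0.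
move=> h /andP[h0 hle].
have hM : h * (2 * (E + A + 1)) <= 1 by rewrite -ler_pdivlMr// mul1r.
have hE0 : 0 <= h * E by rewrite mulr_ge0.
have hA0 : 0 <= h * A by rewrite mulr_ge0.
have h1 : h <= 1 by lra.
have hE : h * E <= 2^-1 by lra.
have hA : h * A <= 2^-1 by lra.
have h20 := sqr_ge0 h.
have h2h : h ^+ 2 <= h by rewrite expr2 -[leRHS]mulr1 ler_wpM2l.
split.
  move=> it hi; have := tm it hi; rewrite -[X in tame _ _ X](addrK 1) => tm'.
  apply: its_ok tm' hi => //.
  by rewrite ltr_wpDl.
move=> u ur.
have Ne : N * (h * (A * (B + 1))) = h * E by rewrite /E mulrCA.
have [g1 g2 g3] := @run_taylor R p h A B r h0 A0 B0 items u tm ur (ltac:(by rewrite -/N Ne)).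
rewrite -/N Ne in g2 g3; rewrite sum_drift in g2.
have ur1 : `|u| <= r + 1 by apply: le_trans ur _; rewrite lerDl.
have Vb : `|V u| <= E.
  rewrite -(sum_drift fc L); apply: norm_sum_In => it hi; have [t1 t2 _] := tm it hi.
  rewrite normrZ; apply: ler_pM => //; first by have [] := t2 u ur1.
  by apply: le_trans t1 _; rewrite lerDl.
set y := run h items u in g2 *.
have rem : `|y - u - h *: V u| <= Ce * h ^+ 2.
  by apply: le_trans g2 _; rewrite exprMn mulrC ler_wpM2r// lerDl.
have g2' : `|y - u - h *: V u| <= E ^+ 2 * h by apply: le_trans g2 _; rewrite exprMn mulrC ler_wpM2l ?sqr_ge0.
have yu : `|y - u| <= D * h.
  rewrite -(subrK (h *: V u) (y - u)) addrC mulrDl; apply: le_trans (ler_normD _ _) _; apply: lerD => //.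
  by rewrite normrZ (ger0_norm h0) mulrC ler_wpM2r.
have yub : `|y - u| <= D by apply: le_trans yu _; rewrite -[leRHS]mulr1 ler_wpM2l.
have CC : [/\ Ce <= 2 * Ce + Cn + Cp + E, Cn <= 2 * Ce + Cn + Cp + E, Cp <= 2 * Ce + Cn + Cp + E,
    2 * E ^+ 2 <= 2 * Ce + Cn + Cp + E & E <= 2 * Ce + Cn + Cp + E].
  by apply: budget_sum => //; rewrite lerDl.
move: CC; set CC := (X in Ce <= X) => -[c1 c2 c3 c4 c5].
split; last by apply: le_trans c5.
split=> //.
- by apply: le_trans rem _; rewrite ler_wpM2r.
- apply: le_trans (_ : `|u| ^+ 2 + 2 * h * C1 + Cn * h ^+ 2 <= _); last by rewrite lerD2l ler_wpM2r.
  have hE2 : 0 <= `|u| ^+ 2 + 2 * h * C1 + h ^+ 2 * E ^+ 2.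
    have C10 : 0 <= C1 := le_trans (normr_ge0 _) (C1P ur).
    apply: addr_ge0; last by rewrite mulr_ge0 ?sqr_ge0.
    by apply: addr_ge0; rewrite ?sqr_ge0// mulr_ge0// mulr_ge0.
  apply: (@energy_budget `|u| E `|u + h *: V u| `|y| C1 Ce h) => //; rewrite ?h0//.
  + rewrite -[leRHS](sqr_sqrtr hE2) lerXn2r ?nnegrE ?sqrtr_ge0//; apply: sob_norm_le; first exact: sqrtr_ge0.
    move=> n; rewrite sqr_sqrtr//; apply: le_trans (nq_line n ur h0) _.
    by rewrite lerD2l ler_wpM2l// lerXn2r ?nnegrE.
  + by apply: le_trans (ler_normD _ _) _; rewrite lerD2l normrZ (ger0_norm h0) ler_wpM2l.
  + have -> : y = (u + h *: V u) + (y - u - h *: V u) by rewrite [RHS]addrC -[y - u - _]addrA -opprD subrK.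
    by apply: le_trans (ler_normD _ _) _; rewrite lerD2l.
- have SZ0 : S m y = S m u + S m (coef (y - u)) by rewrite -SD; apply: eq_S => k _; rewrite sob_coefB addrC subrK.
  set Z := S m (coef (y - u)) in SZ0.
  have ZE : Z = tpC h * S m (V u) + S m (coef (y - u - h *: V u)).
    rewrite -SZ -SD; apply: eq_S => k _; by rewrite !sob_coefB sob_coefZ [RHS]addrC subrK.
  set W := S m (coef (y - u - h *: V u)) in ZE.
  have Zn : n2 (Dn p Z) <= `|y - u| := n2_Dn_norm _ _.
  have Wn : n2 (Dn p W) <= Ce * h ^+ 2 := le_trans (n2_Dn_norm _ _) rem.
  have rD : r <= r + D by rewrite lerDl.
  have Dr : D <= r + D by rewrite lerDr.
  have [||_ _ t1] := h3 (S m u) Z (I_S _ _) (I_S _ _).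
  + exact: le_trans (pp _ (leqnn p) ur) rD.
  + exact: le_trans Zn (le_trans yub Dr).
  have [||_ t2 _] := h3 (S m u) W (I_S _ _) (I_S _ _).
  + exact: le_trans (pp _ (leqnn p) ur) rD.
  + apply: le_trans (n2_Dn_norm _ _) (le_trans (le_trans g2' _) Dr).
    by apply: le_trans (_ : E ^+ 2 * 1 <= _); [rewrite ler_wpM2l ?sqr_ge0|rewrite mulr1 lerDr].
  have pD := PsiD c K G (S m u) Z.
  have ZD : n2 (Dn p Z) <= D * h := le_trans Zn yu.
  have b1 : n2 (Dn p.+1 Z) <= b * D * h.
    by apply: le_trans (Bern _ _) _; rewrite -mulrA ler_wpM2l.
  have b2 : 2^-1 * n2 (Dn p.+1 Z) ^+ 2 <= 2^-1 * (b * D) ^+ 2 * h ^+ 2.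
    by rewrite -mulrA -exprMn ler_wpM2l ?invr_ge0// lerXn2r ?nnegrE ?n2_ge0// !mulr_ge0.
  have b3 : C3 * n2 (Dn p Z) ^+ 2 <= C3 * D ^+ 2 * h ^+ 2.
    by rewrite -mulrA -exprMn ler_wpM2l// lerXn2r ?nnegrE ?n2_ge0// mulr_ge0.
  have b4 : `|dPsi c G (S m u) W| <= (b * (b * r) + C3) * Ce * h ^+ 2.
    apply: le_trans (ler_normD _ _) _; rewrite -mulrA mulrDl; apply: lerD; last first.
      by apply: le_trans t2 _; rewrite ler_wpM2l.
    apply: le_trans (n2_CS _ _) _.
    apply: le_trans (ler_pM (n2_ge0 _) (n2_ge0 _) (Bern _ _) (Bern _ _)) _.
    rewrite (_ : b * (b * r) * (Ce * h ^+ 2) = (b * r) * (b * (Ce * h ^+ 2))); last by ring.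
    apply: ler_pM; rewrite ?mulr_ge0 ?n2_ge0//; last exact: ler_wpM2l b0 _ _ Wn.
    exact: ler_wpM2l b0 _ _ (pp _ (leqnn p) ur).
  have b5 : dPsi c G (S m u) Z <= h * (C2 * rho m u + eps * C2) + (b * (b * r) + C3) * Ce * h ^+ 2.
    rewrite ZE dPsiD dPsiZ; apply: lerD; last exact: le_trans (ler_norm _) b4.
    by rewrite ler_wpM2l//; apply: le_trans (ler_norm _) (C2P ur).
  rewrite SZ0; have b6 := ler_norm (JX c K (S m u + Z) - JX c K (S m u) - dJ c G (S m u) Z).
  have b7 : Cp * h ^+ 2 <= CC * h ^+ 2 by rewrite ler_wpM2r.
  have b8 : Cp * h ^+ 2 = (b * (b * r) + C3) * Ce * h ^+ 2 + 2^-1 * (b * D) ^+ 2 * h ^+ 2 + C3 * D ^+ 2 * h ^+ 2 by rewrite /Cp; ring.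
  exact: psi_budget pD b2 b3 b5 b6 b7 b8 t1.
- apply: le_trans g3; rewrite ler_expR opprD; apply: lerD.
    by rewrite -mulrN ler_wpM2l// sum_dil.
  by rewrite lerN2 exprMn mulrCA mulrC ler_wpM2r.
Qed.

End one_level.
End macro_step.

(** * Size of the truncation defect *)

Section galerkin_error.
Variables (R : realType) (p : nat).
Local Notation q := (p%:R : R).
Local Notation H := (sobolev q).
Hypothesis p3 : (3 <= p)%N.
Implicit Types (u v : H) (X Y : tpoly R) (k : int) (n m : nat) (h r : R).

Lemma n2_Dn_mul X Y : I X = 0 -> I Y = 0 ->
  n2 (Dn p (X * Y)) <= 2 ^+ p * (n2 (Dn p X) * n2 (Dn p Y)).
Proof.
move=> X0 Y0; rewrite Leibniz.
have -> : 2 ^+ p = \sum_(i < p.+1) 'C(p, i)%:R :> R.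
  have := exprDn (1 : R) 1 p; rewrite -[1 + 1]/2%:R => ->.
  by apply: eq_bigr => i _; rewrite !expr1n mulr1.
apply: le_trans (n2_sum _ _) _; rewrite mulr_suml; apply: ler_sum => i _.
rewrite -(tpCn R) n2Z ger0_norm//; apply: ler_wpM2l => //.
have [ip|pi] := ltnP i p.
  apply: le_trans (n2M _ (M := n2 (Dn p X)) _) _; first by move=> x _; exact: sup_Dn.
  by rewrite ler_wpM2l ?n2_ge0// le_n2Dn ?leq_subr.
have -> : (i : nat) = p by apply/eqP; rewrite eqn_leq pi -ltnS ltn_ord.
rewrite subnn mulrC; apply: le_trans (n2M _ (M := n2 (Dn p Y)) _) _; last by rewrite mulrC.
by move=> x _; apply: sup_Dn => //; apply: leq_trans p3.
Qed.

Lemma n2_mul_Dn X Y : I X = 0 -> n2 (X * Dn p Y) <= n2 (Dn p X) * n2 (Dn p Y).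
Proof.
move=> X0; apply: n2M => x _; rewrite -[X]Dn0; rewrite Dn0; apply: (@sup_Dn _ 0 p) => //.
exact: leq_trans p3.
Qed.

Lemma quadratic_dist X Y r d : I X = 0 -> I Y = 0 -> n2 (Dn p X) <= r -> n2 (Dn p Y) <= r ->
  n2 (Dn p (X - Y)) <= d ->
  n2 (X * Dn p X - Y * Dn p Y) <= 2 * r * d /\ n2 (Dn p (X * X) - Dn p (Y * Y)) <= 2 ^+ p * 2 * r * d.
Proof.
move=> I1 I2 Xr Yr XY.
have I3 : I (X - Y) = 0 by rewrite IB I1 I2 subrr.
have I4 : I (X + Y) = 0 by rewrite ID I1 I2 addr0.
split.
  have -> : X * Dn p X - Y * Dn p Y = X * Dn p (X - Y) + (X - Y) * Dn p Y by rewrite DnB; ring.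
  apply: le_trans (n2D _ _) _; rewrite (_ : 2 * r * d = r * d + r * d); last by ring.
  apply: lerD.
    by apply: le_trans (n2_mul_Dn _ I1) _; apply: ler_pM; rewrite ?n2_ge0.
  by apply: le_trans (n2_mul_Dn _ I3) _; rewrite mulrC; apply: ler_pM; rewrite ?n2_ge0.
rewrite -DnB; have -> : X * X - Y * Y = (X - Y) * (X + Y) by ring.
apply: le_trans (n2_Dn_mul I3 I4) _; rewrite -!mulrA ler_wpM2l ?exprn_ge0//.
rewrite [leRHS]mulrA mulrC; apply: ler_pM; rewrite ?n2_ge0// DnD (_ : 2 * r = r + r); last by ring.
by apply: le_trans (n2D _ _) _; exact: lerD.
Qed.

(** Products of two truncations at level [l] have degree at most [l + l], hence are annihilated by
    [Q m]; only the tail of [u] beyond level [l] remains. *)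
Lemma rho_le_dist m l u r : `|u| <= r -> (l + l <= m)%N ->
  rho m u <= (2 + 2 ^+ p * 2) * r * `|u - trunc p l u|.
Proof.
move=> ur lm; rewrite /rho; set X := S m u; set Y := S l u; set d := `|_|.
have lm' : (l <= m)%N by apply: leq_trans lm; rewrite leq_addr.
have Xr : n2 (Dn p X) <= r := le_trans (n2_Dn_norm _ _) ur.
have Yr : n2 (Dn p Y) <= r := le_trans (n2_Dn_norm _ _) ur.
have XY : n2 (Dn p (X - Y)) <= d by apply: n2_Dn_tail.
have [h1 h2] := quadratic_dist (I_S _ _) (I_S _ _) Xr Yr XY.
have degY j : trig_deg m (Y * Dn j Y).
  by apply: (@trig_degS _ (l + l)) => //; apply: trig_degM; [exact: deg_S|apply: deg_Dn; exact: deg_S].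
have -> : Q m (X * Dn p X) = Q m (X * Dn p X - Y * Dn p Y) by rewrite QB (Q_deg (degY p)) subr0.
have -> : Q m (Dn p (X * X)) = Q m (Dn p (X * X) - Dn p (Y * Y)).
  by rewrite QB (@Q_deg _ _ (Dn p (Y * Y))) ?subr0//; apply: deg_Dn; have := degY 0%N; rewrite Dn0.
by rewrite mulrDl mulrDl; apply: lerD; apply: le_trans (n2_Q _ _) _.
Qed.

Lemma n2_dist X Y : `|n2 X - n2 Y| <= n2 (X - Y).
Proof.
rewrite ler_distl; apply/andP; split.
  by rewrite lerBlDr; have := n2D X (Y - X); rewrite addrC subrK (n2_distC Y X).
by have := n2D Y (X - Y); rewrite addrC subrK addrC.
Qed.

Lemma lipb_rho m : lipb (rho m : H -> R).
Proof.
move=> r; have [r0|r0] := leP 0 r; last first.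
  by exists 0 => // u v ur; have := lt_le_trans (le_lt_trans ur r0) (normr_ge0 u); rewrite ltxx.
exists ((2 + 2 ^+ p * 2) * r); first by rewrite mulr_ge0// addr_ge0// mulr_ge0// exprn_ge0.
move=> u v ur vr; have Xr := le_trans (n2_Dn_norm u m) ur; have Yr := le_trans (n2_Dn_norm v m) vr.
have XY : n2 (Dn p (S m u - S m v)) <= `|u - v| by rewrite S_subH; exact: n2_Dn_norm.
have [h1 h2] := quadratic_dist (I_S _ _) (I_S _ _) Xr Yr XY.
rewrite /rho opprD addrACA mulrDl mulrDl; apply: le_trans (ler_normD _ _) _.
by apply: lerD; apply: le_trans (n2_dist _ _) _; rewrite -QB; apply: le_trans (n2_Q _ _) _.
Qed.

Lemma rho_bound m u r : `|u| <= r -> rho m u <= (2 + 2 ^+ p * 2) * r * r.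
Proof.
move=> ur; apply: le_trans (@rho_le_dist m 0 u r ur isT) _.
rewrite ler_wpM2l//; last first.
  apply: le_trans ur; rewrite (_ : trunc p 0 u = 0) ?subr0//.
  by apply: sob_ext => k _; rewrite truncE.
by rewrite mulr_ge0 ?(le_trans (normr_ge0 _) ur)// addr_ge0// mulr_ge0// exprn_ge0.
Qed.

(** Take [l = m./2] in the previous estimate. The convergence is pointwise, with no rate on balls of
    $H^p$. *)
Lemma rho_cvg u : (fun m => rho m u) @ \oo --> (0 : R).
Proof.
pose C := (2 + 2 ^+ p * 2) * `|u|.
have h1 : (fun m => C * `|u - trunc p (m./2) u|) @ \oo --> C * (0 : R).
  apply: cvgM; first exact: cvg_cst.
  apply: (@cvg_comp _ _ _ half (fun l => `|u - trunc p l u|) \oo \oo); last exact: trunc_cvg.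
  move=> A [N _ NA]; exists N.*2 => // n /= Nn; apply: NA => /=.
  by rewrite -[N]doubleK; apply: half_leq.
rewrite mulr0 in h1.
apply: (cvg_dist_le h1) => m; rewrite subr0 ger0_norm ?rho_ge0//.
apply: rho_le_dist => //; rewrite addnn -[leqRHS]odd_double_half; exact: leq_addl.
Qed.

End galerkin_error.

(** * Iterated sweeps *)

Section multi_step.
Variables (R : realType) (p : nat) (c : R) (K : mpoly.mpoly p R).
Local Notation q := (p%:R : R).
Local Notation H := (sobolev q).
Local Notation bH := (borelH R p).
Hypothesis p3 : (3 <= p)%N.
Implicit Types (u v : H) (k : int) (n m j : nat) (h r : R).

Variable G : tpoly R -> 'I_p -> tpoly R.
Hypothesis G_taylor : taylor_functional p c K G.

Lemma JX_bound r : exists2 C, 0 <= C & forall m u, `|u| <= r -> `|JX c K (S m u)| <= C.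
Proof.
have [C C0 hC] := G_taylor r; exists C => // m u ur.
have X1 := le_trans (n2_Dn_norm u m) ur.
by have [] := hC (S m u) (S m u) (I_S _ _) (I_S _ _) X1 X1.
Qed.

Lemma lipb_JX m : lipb (fun u : H => JX c K (S m u)).
Proof.
move=> r; have [C C0 hC] := G_taylor (`|r| + `|r|).
exists (C + C * (`|r| + `|r|)); first by rewrite addr_ge0// mulr_ge0.
move=> u v ur vr; have rr := ler_norm r; have rr0 := normr_ge0 r.
have X1 : n2 (Dn p (S m v)) <= `|r| + `|r|.
  by apply: le_trans (n2_Dn_norm _ _) _; apply: le_trans vr _; apply: le_trans rr _; rewrite lerDl.
have uv : `|u - v| <= `|r| + `|r|.
  by apply: le_trans (ler_normB _ _) _; apply: lerD; apply: le_trans rr.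
have [|_ h1 h2] := hC (S m v) (S m (coef (u - v))) (I_S _ _) (I_S _ _) X1.
  exact: le_trans (n2_Dn_norm _ _) uv.
have E : S m v + S m (coef (u - v)) = S m u by rewrite -S_subH addrC subrK.
rewrite E in h2; have n2uv := n2_Dn_norm (u - v) m.
rewrite -[X in `|X|](subrK (dJ c G (S m v) (S m (coef (u - v))))).
apply: le_trans (ler_normD _ _) _; rewrite addrC mulrDl; apply: lerD.
  by apply: le_trans h1 _; rewrite ler_wpM2l.
apply: le_trans h2 _; rewrite -mulrA ler_wpM2l// expr2; apply: ler_pM; rewrite ?n2_ge0//.
exact: le_trans n2uv uv.
Qed.

Variables (fc : H -> int -> R) (L sg eps C1 C2 R0 h C : R) (m : nat).
Hypotheses (R00 : 0 <= R0) (h0 : 0 <= h) (C0 : 0 <= C) (C10 : 0 <= C1) (C20 : 0 <= C2).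
Local Notation r := (R0 + 1).
Hypothesis hok : macro_ok c K fc r L sg eps C1 C2 m h C.
Local Notation items := (its fc L sg eps m).
Local Notation Y j := (iter j (run h items)).
Local Notation list N := (flatten (nseq N items)).

Lemma run_flatten N u : run h (list N) u = Y N u.
Proof. by elim: N u => //= N IH u; rewrite run_cat IH -iterSr. Qed.

Lemma In_flatten N it : List.In it (list N) -> List.In it items.
Proof. by elim: N => //= N IH hi; have [//|/IH] := In_cat hi. Qed.

(** Over the allowed time the squared norm grows by at most 1, and $R_0^2+1\le(R_0+1)^2$. *)
Lemma iter_norm N u j : `|u| <= R0 -> N%:R * h * (2 * C1 + C * h) <= 1 -> (j <= N)%N ->
  `|Y j u| <= r.
Proof.
move=> uR hN.
have A0 : 0 <= h * (2 * C1 + C * h) by rewrite mulr_ge0// addr_ge0 ?mulr_ge0.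
suff E : (j <= N)%N -> `|Y j u| ^+ 2 <= R0 ^+ 2 + j%:R * (h * (2 * C1 + C * h)) /\ `|Y j u| <= r by move=> /E[].
elim: j => [|j IH] jN.
  rewrite mul0r addr0; split; first by rewrite lerXn2r ?nnegrE.
  by apply: le_trans uR _; rewrite lerDl.
have [IH1 IH2] := IH (ltnW jN).
have [[_ _ E _ _] _] := hok.2 _ IH2.
have E2 : `|Y j.+1 u| ^+ 2 <= R0 ^+ 2 + j.+1%:R * (h * (2 * C1 + C * h)).
  apply: le_trans E _; rewrite -[j.+1%:R]natr1.
  rewrite (_ : R0 ^+ 2 + _ = (R0 ^+ 2 + j%:R * (h * (2 * C1 + C * h))) + (2 * h * C1 + C * h ^+ 2)); last by ring.
  by rewrite -addrA lerD2r.
split=> //; rewrite -(@ler_pXn2r _ 2) ?nnegrE ?addr_ge0//; apply: le_trans E2 _.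
have : j.+1%:R * (h * (2 * C1 + C * h)) <= 1.
  by apply: le_trans hN; rewrite -mulrA ler_wpM2r// ler_nat.
move=> hz; have -> : r ^+ 2 = R0 ^+ 2 + (2 * R0 + 1) by ring.
by rewrite lerD2l; apply: le_trans hz _; rewrite lerDr mulr_ge0.
Qed.

Lemma multi_step N u : `|u| <= R0 -> N%:R * h * (2 * C1 + C * h) <= 1 ->
  [/\ good h [set w | `|w| <= r + 1] (list N) u,
    Psi c K (S m (Y N u)) <= Psi c K (S m u) + h * C2 * (\sum_(j < N) rho m (Y j u)) + N%:R * h * (eps * C2 + C * h) &
    expR (- (N%:R * h * (eps * L + C * h))) <= jac h (list N) u].
Proof.
move=> uR hN; suff E n : (n <= N)%N -> [/\ good h [set w | `|w| <= r + 1] (list n) u,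
    Psi c K (S m (Y n u)) <= Psi c K (S m u) + h * C2 * (\sum_(j < n) rho m (Y j u)) + n%:R * h * (eps * C2 + C * h) &
    expR (- (n%:R * h * (eps * L + C * h))) <= jac h (list n) u] by exact: E.
elim: n => [|n IH] nN.
  by rewrite big_ord0 mulr0 !mul0r !addr0 oppr0 expR0; split.
have [g1 g2 g3] := IH (ltnW nN).
have [[a1 _ _ a2 a3] _] := hok.2 _ (iter_norm uR hN (ltnW nN)).
have E : list n.+1 = list n ++ items.
  by rewrite -addn1 nseqD flatten_cat /= cats0.
rewrite E; split.
- by apply/good_cat; split=> //; rewrite run_flatten.
- rewrite iterS; apply: le_trans a2 _; rewrite big_ord_recr/= -natr1.
  apply: le_trans (_ : Psi c K (S m u) + h * C2 * (\sum_(j < n) rho m (Y j u)) + n%:R * h * (eps * C2 + C * h) + h * (C2 * rho m (Y n u) + eps * C2) + C * h ^+ 2 <= _).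
    by rewrite !lerD2r.
  by rewrite le_eqVlt; apply/orP; left; apply/eqP; ring.
- rewrite jac_cat run_flatten; apply: le_trans (ler_pM (expR_ge0 _) (expR_ge0 _) g3 a3).
  rewrite -expRD ler_expR le_eqVlt; apply/orP; left; apply/eqP; rewrite -natr1; ring.
Qed.

Variable eta : probability bH R.
Hypothesis eta_gauss : is_gaussian eta.

Lemma measurable_Y N : measurable_fun [set: bH] (Y N : bH -> bH).
Proof.
have := @measurable_run R p h [set u | `|u| <= r + 1] (list N) (fun it hi => hok.1 it (In_flatten hi)).
by rewrite (_ : run h (list N) = Y N)//; apply/funext => u; rewrite run_flatten.
Qed.

Let exponent_budget (n a1 a2 a3 a4 a5 : R) :
  2^-1 * a3 + a5 <= 2^-1 * a2 + a4 + h * C2 * a1 + n * h * (eps * C2 + C * h) ->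
  - (h * C2 * a1) - n * h * (eps * (L + C2) + C * h *+ 2) - a4 <=
  - (n * h * (eps * L + C * h)) - 2^-1 * (a3 - a2) - a5.
Proof. by move=> ?; lra. Qed.

(** Applying the shear inequality to [phi] times $e^{-J}$ completes the increment of the Gaussian
    energy to an increment of [Psi], which [multi_step] controls. The two copies of [C * h] come
    from the dilations and from [Psi]. *)
Lemma list_inequality N (phi : bH -> \bar R) : N%:R * h * (2 * C1 + C * h) <= 1 ->
  measurable_fun [set: bH] phi -> (forall u, 0 <= phi u)%E ->
  (\int[eta]_u ((\1_(closed_ballH R0 : set H) u *
      expR (- (h * C2 * (\sum_(j < N) rho m (Y j u))) - N%:R * h * (eps * (L + C2) + C * h *+ 2) - JX c K (S m u)))%:E * phi (Y N u)) <=
   \int[eta]_u ((expR (- JX c K (S m u)))%:E * phi u))%E.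
Proof.
move=> hN mphi phi0.
have mJ : measurable_fun [set: bH] (fun u : bH => JX c K (S m (u : H))) by exact: lipb_measurable (lipb_JX m).
have mrho : measurable_fun [set: bH] (rho m : bH -> R) by exact: lipb_measurable (lipb_rho p3 m).
have mD : measurable ([set w | `|w| <= r + 1] : set bH) by exact: measurable_closed_ballH.
have ok it : List.In it (list N) -> shear_ok h [set w | `|w| <= r + 1] it /\ mode it \in idx m.
  by move=> /In_flatten hi; split; [exact: hok.1|exact: its_mode hi].
have ok1 it : List.In it (list N) -> shear_ok h [set w | `|w| <= r + 1] it by move=> /ok[].
have mexp : measurable_fun [set: bH] (fun u : bH => expR (- JX c K (S m (u : H)))).
  by apply: measurableT_comp => //; exact: measurableT_comp.
pose phi' (u : bH) := ((expR (- JX c K (S m (u : H))))%:E * phi u)%E.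
have mphi' : measurable_fun [set: bH] phi' by apply: emeasurable_funM => //; exact/measurable_EFinP.
have phi'0 u : (0 <= phi' u)%E by rewrite mule_ge0// lee_fin expR_ge0.
apply: le_trans (@shear_list_inequality R p eta eta_gauss h _ m mD (list N) phi' ok mphi' phi'0).
have mY := measurable_Y N.
apply: ge0_le_integral => //.
- by move=> u _; rewrite mule_ge0// lee_fin mulr_ge0 ?expR_ge0.
- apply: emeasurable_funM; last exact: (measurableT_comp mphi mY).
  apply/measurable_EFinP; apply: measurable_funM.
    by apply: measurable_indic; exact: measurable_closed_ballH.
  apply: measurableT_comp => //; apply: measurable_funB => //; apply: measurable_funB => //.
  apply: measurableT_comp => //; apply: measurable_funM => //.
  by apply: measurable_sum => j; exact: (measurableT_comp mrho (measurable_Y j)).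
- apply: emeasurable_funM; last first.
    by apply: (measurableT_comp mphi'); exact: (measurable_run ok1).
  have mE : measurable_fun [set: bH] (fun u : bH => nq p.+1%:R m (u : H)) by exact: measurable_nq.
  apply/measurable_EFinP; apply: measurable_funM.
    by apply: measurable_indic; exact: (measurable_good mD ok1).
  apply: measurable_funM; first exact: (measurable_jac ok1).
  apply: measurableT_comp => //; apply: measurableT_comp => //; apply: measurable_funM => //.
  by apply: measurable_funB => //; exact: (measurableT_comp mE (measurable_run ok1)).
- move=> u _; rewrite !indicE.
  have [uB|uB] := pselect (closed_ballH R0 u); last first.
    rewrite (memNset uB) mul0r mul0e mule_ge0// lee_fin.
    have [gu|gu] := pselect (good h [set w | `|w| <= r + 1] (list N) u).
      by rewrite mem_set// mul1r mulr_ge0 ?expR_ge0// ltW// (jac_gt0 ok1).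
    by rewrite memNset// mul0r.
  have [g1 g2 g3] := multi_step uB hN.
  rewrite !mem_set// !mul1r run_flatten /phi' muleA; apply: lee_wpmul2r => //.
  rewrite -EFinM lee_fin; rewrite /Psi !sqr_n2_Dn_S in g2.
  apply: le_trans (_ : expR (- (N%:R * h * (eps * L + C * h))) * expR (- (2^-1 * (nq p.+1%:R m (Y N u) - nq p.+1%:R m u))) *
     expR (- JX c K (S m (Y N u))) <= _); last first.
    by rewrite !ler_wpM2r ?expR_ge0.
  rewrite -!expRD ler_expR; exact: exponent_budget g2.
Qed.

End multi_step.

(** * Passage to the limit *)

Section bounded_integrals.
Variables (d : measure_display) (X : measurableType d) (R : realType) (eta : probability X R).
Implicit Types (f g : X -> R) (B : R).

Definition EE f : R := fine (\int[eta]_u (f u)%:E)%E.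

Lemma bounded_integrable f B : measurable_fun [set: X] f -> (forall u, `|f u| <= B) ->
  eta.-integrable [set: X] (EFin \o f).
Proof.
move=> mf fB; apply: (@le_integrable _ _ _ eta setT measurableT (EFin \o f) (EFin \o cst B)).
- exact/measurable_EFinP.
- by move=> u _ /=; rewrite lee_fin (le_trans (fB u))// ler_norm.
- by apply: finite_measure_integrable_cst.
Qed.

Lemma EE_EFin f B : measurable_fun [set: X] f -> (forall u, `|f u| <= B) ->
  (\int[eta]_u (f u)%:E)%E = (EE f)%:E.
Proof. by move=> mf fB; rewrite fineK//; exact: integrable_fin_num (bounded_integrable mf fB). Qed.

Lemma le_EE f g B : measurable_fun [set: X] f -> measurable_fun [set: X] g ->
  (forall u, `|f u| <= B) -> (forall u, `|g u| <= B) -> (forall u, f u <= g u) -> EE f <= EE g.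
Proof.
move=> mf mg fB gB fg; rewrite -lee_fin -(EE_EFin mf fB) -(EE_EFin mg gB).
apply: le_integral => //; try exact: bounded_integrable.
by move=> u _; rewrite lee_fin.
Qed.

Lemma EE_add f g B : measurable_fun [set: X] f -> measurable_fun [set: X] g ->
  (forall u, `|f u| <= B) -> (forall u, `|g u| <= B) -> EE (fun u => f u + g u) = EE f + EE g.
Proof.
move=> mf mg fB gB; apply: EFin_inj; rewrite EFinD -(EE_EFin mf fB) -(EE_EFin mg gB).
rewrite -(EE_EFin (B := B + B)); [|exact: measurable_funD|]; last first.
  by move=> u; apply: le_trans (ler_normD _ _) _; exact: lerD.
under eq_integral do rewrite EFinD.
by rewrite integralD//; exact: bounded_integrable.
Qed.

Lemma EE_scale f B (c : R) : measurable_fun [set: X] f -> (forall u, `|f u| <= B) ->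
  EE (fun u => c * f u) = c * EE f.
Proof.
move=> mf fB; apply: EFin_inj; rewrite EFinM -(EE_EFin mf fB).
rewrite -(EE_EFin (B := `|c| * B)); [|exact: measurable_funM|]; last first.
  by move=> u; rewrite normrM ler_wpM2l.
under eq_integral do rewrite EFinM.
by rewrite integralZl//; exact: bounded_integrable.
Qed.

Lemma EE_cvg (F : nat -> X -> R) f B : (forall n, measurable_fun [set: X] (F n)) ->
  measurable_fun [set: X] f -> (forall n u, `|F n u| <= B) -> (forall u, (fun n => F n u) @ \oo --> f u) ->
  (fun n => EE (F n)) @ \oo --> EE f.
Proof.
move=> mF mf FB Ff.
have B0 : 0 <= B := le_trans (normr_ge0 _) (FB 0%N point).
have [] := @dominated_convergence _ _ _ eta setT measurableT (fun n => EFin \o F n) (EFin \o f) (EFin \o cst B).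
- by move=> n; exact/measurable_EFinP.
- exact/measurable_EFinP.
- by apply/aeW => u _ /=; apply: cvg_EFin; [exact: nearW|exact: Ff].
- by apply: finite_measure_integrable_cst.
- by apply/aeW => u n _ /=; rewrite lee_fin.
move=> intf _ h; rewrite /EE; apply: fine_cvg; rewrite fineK; first exact: h.
exact: integrable_fin_num intf.
Qed.

End bounded_integrals.
Arguments EE_EFin {d X R eta f B}.
Arguments EE_scale {d X R eta f B}.
Arguments EE_add {d X R eta f g}.

Section measure_limit.
Variables (R : realType) (p : nat) (c : R) (K : mpoly.mpoly p R).
Local Notation q := (p%:R : R).
Local Notation H := (sobolev q).
Local Notation bH := (borelH R p).
Hypothesis p3 : (3 <= p)%N.
Implicit Types (u v : H) (k : int) (n m j : nat).

Variable G : tpoly R -> 'I_p -> tpoly R.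
Hypothesis G_taylor : taylor_functional p c K G.

Variable eta : probability bH R.
Hypothesis eta_gauss : is_gaussian eta.

Variables (fc : H -> int -> R) (L sg eps C1 C2 R0 delta : R) (h C : nat -> R) (N : nat -> nat).
Hypotheses (R00 : 0 <= R0) (C10 : 0 <= C1) (C20 : 0 <= C2) (L0 : 0 <= L) (eps01 : 0 <= eps <= 1).
Hypotheses (h0 : forall m, 0 <= h m) (C0 : forall m, 0 <= C m).
Hypotheses (Nh : forall m, (N m)%:R * h m = delta) (Ch : forall m, C m * h m <= m.+1%:R^-1).
Hypothesis delta_small : delta * (2 * C1 + 1) <= 1.
Local Notation r := (R0 + 1).
Local Notation items m := (its fc L sg eps m).
Hypothesis hok : forall m, macro_ok c K fc r L sg eps C1 C2 m (h m) (C m).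
Local Notation Y m j := (iter j (run (h m) (items m))).
Variable J : H -> R.
Hypothesis J_lim : forall u, (fun m => JX c K (S m u)) @ \oo --> J u.
Local Notation E := (EE eta).
Local Notation ball M := (closed_ballH M : set H).

Let delta0 : 0 <= delta. Proof. by rewrite -(Nh 0) mulr_ge0. Qed.
Let Ch1 m : C m * h m <= 1.
Proof. by apply: le_trans (Ch m) _; rewrite invf_le1// ler1n. Qed.
Let step_le m j : (j <= N m)%N -> j%:R * h m <= delta.
Proof. by move=> jN; rewrite -(Nh m) ler_wpM2r// ler_nat. Qed.
Let step_ok m j : (j <= N m)%N -> j%:R * h m * (2 * C1 + C m * h m) <= 1.
Proof.
move=> jN; apply: le_trans delta_small; apply: ler_pM; rewrite ?mulr_ge0//.
- by rewrite addr_ge0 ?mulr_ge0.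
- exact: step_le.
- by rewrite lerD2l.
Qed.

Let mJX m : measurable_fun [set: bH] (fun u : bH => JX c K (S m (u : H))).
Proof. exact: lipb_measurable (lipb_JX G_taylor m). Qed.
Let mrho m : measurable_fun [set: bH] (rho m : bH -> R).
Proof. exact: lipb_measurable (lipb_rho p3 m). Qed.
Let mY m j : measurable_fun [set: bH] (Y m j : bH -> bH).
Proof. exact: measurable_Y (hok m) j. Qed.
Let mball M : measurable (closed_ballH M : set bH). Proof. exact: measurable_closed_ballH. Qed.
Let m1 (A : set bH) : measurable A -> measurable_fun [set: bH] (\1_A : bH -> R).
Proof. exact: measurable_indic. Qed.
Let ind01 (A : set bH) u : 0 <= (\1_A u : R) <= 1.
Proof. by rewrite indicE; case: (_ \in _); rewrite ?lexx ?ler01. Qed.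

Let Kr := (2 + 2 ^+ p * 2) * r * r : R.
Let r0 : 0 <= r. Proof. by rewrite addr_ge0. Qed.
Let Kr0 : 0 <= Kr.
Proof. by rewrite !mulr_ge0// addr_ge0// mulr_ge0// exprn_ge0. Qed.

Let theta m j u := h m * C2 * \sum_(i < j) rho m (Y m i u).
Let theta0 m j u : 0 <= theta m j u.
Proof. by rewrite mulr_ge0 ?mulr_ge0// sumr_ge0// => i _; rewrite rho_ge0. Qed.
Let mtheta m j : measurable_fun [set: bH] (theta m j : bH -> R).
Proof.
apply: measurable_funM => //; apply: measurable_sum => i.
exact: (measurableT_comp (mrho m) (mY m i)).
Qed.

Let Y_ball m j u : `|u| <= R0 -> (j <= N m)%N -> `|Y m j u| <= r.
Proof. by move=> uR jN; apply: (iter_norm R00 (h0 m) (C0 m) C10 (hok m) uR (step_ok jN)). Qed.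

Let theta_bound m j u : `|u| <= R0 -> (j <= N m)%N -> theta m j u <= delta * C2 * Kr.
Proof.
move=> uR jN; apply: le_trans (_ : h m * C2 * (j%:R * Kr) <= _).
  apply: ler_wpM2l; first by rewrite mulr_ge0.
  apply: le_trans (_ : \sum_(i < j) Kr <= _); last by rewrite sumr_const card_ord mulr_natl.
  apply: ler_sum => i _.
  by apply: rho_bound => //; apply: Y_ball => //; apply: leq_trans jN; apply: ltnW.
have := step_le jN; rewrite (_ : h m * C2 * (j%:R * Kr) = (j%:R * h m) * (C2 * Kr)); last by ring.
by move=> hj; rewrite -(mulrA delta) ler_wpM2r// mulr_ge0.
Qed.

(** [phi] lives on the ball of radius [r], where the truncated functional is bounded uniformly in
    [m]; both sides are then expectations of bounded functions. [theta] is the accumulated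
    truncation defect along the scheme. *)
Lemma level_inequality m j (phi : bH -> R) (B CJ : R) : (j <= N m)%N ->
  (forall u, `|u| <= r -> `|JX c K (S m u)| <= CJ) ->
  measurable_fun [set: bH] phi -> (forall u, 0 <= phi u <= B) -> (forall u, r < `|u| -> phi u = 0) ->
  E (fun u => \1_(ball R0) u * (expR (- theta m j u - JX c K (S m u)) * phi (Y m j u))) <=
  expR (delta * (eps * (L + C2) + C m * h m *+ 2)) * E (fun u => expR (- JX c K (S m u)) * phi u).
Proof.
move=> jN hCJ mphi phiB phi0; set x := delta * _.
have x0 : 0 <= x.
  have [e0 _] := andP eps01.
  by rewrite mulr_ge0// addr_ge0 ?mulr_ge0 ?addr_ge0 ?mulrn_wge0 ?mulr_ge0.
have B0 : 0 <= B by have /andP[a b] := phiB 0; exact: le_trans a b.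
have f1 u : 0 <= expR (- JX c K (S m u)) * phi u <= expR CJ * B.
  have /andP[a b] := phiB u; rewrite mulr_ge0 ?expR_ge0//=.
  have [ur|ur] := leP `|u| r; last by rewrite (phi0 _ ur) mulr0 mulr_ge0 ?expR_ge0.
  by apply: ler_pM; rewrite ?expR_ge0// ler_expR; have /ler_normlP[] := hCJ u ur.
have f2 u : 0 <= \1_(ball R0) u * (expR (- theta m j u - JX c K (S m u)) * phi (Y m j u)) <= expR CJ * B.
  have /andP[a b] := phiB (Y m j u); rewrite !mulr_ge0 ?expR_ge0 ?(andP (ind01 _ _)).1//=.
  rewrite indicE; have [uB|uB] := pselect (ball R0 u); last by rewrite memNset// mul0r mulr_ge0// expR_ge0.
  rewrite mem_set// mul1r; apply: ler_pM; rewrite ?expR_ge0// ler_expR.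
  have ur : `|u| <= r by apply: le_trans uB _; rewrite lerDl.
  have /ler_normlP[] := hCJ u ur; have := theta0 m j u; lra.
have mg1 : measurable_fun [set: bH] (fun u : bH => expR (- JX c K (S m (u : H))) * phi u).
  by apply: measurable_funM => //; apply: measurableT_comp => //; exact: measurableT_comp.
have mg2 : measurable_fun [set: bH] (fun u : bH => \1_(ball R0) u * (expR (- theta m j u - JX c K (S m (u : H))) * phi (Y m j u))).
  apply: measurable_funM; first exact: m1.
  apply: measurable_funM; last exact: (measurableT_comp mphi (mY m j)).
  apply: measurableT_comp => //; apply: measurable_funB => //; exact: measurableT_comp.
have f2' u := f2 u; have f1' u := f1 u.
have g1 u : `|expR (- JX c K (S m u)) * phi u| <= expR CJ * B by rewrite ger0_norm; have /andP[] := f1 u.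
have g2 u : `|\1_(ball R0) u * (expR (- theta m j u - JX c K (S m u)) * phi (Y m j u))| <= expR CJ * B.
  by rewrite ger0_norm; have /andP[] := f2 u.
have := @list_inequality R p c K p3 G G_taylor fc L sg eps C1 C2 R0 (h m) (C m) m R00 (h0 m) (C0 m) C10 (hok m) eta eta_gauss j (fun u => (phi u)%:E) (step_ok jN) _ _.
move=> /(_ ltac:(exact/measurable_EFinP) ltac:(by move=> u; rewrite lee_fin; have /andP[] := phiB u)).
rewrite [X in (_ <= X)%E -> _](_ : _ = (E (fun u => expR (- JX c K (S m u)) * phi u))%:E); last first.
  by refine (etrans _ (EE_EFin mg1 g1)); apply: eq_integral => u _; rewrite EFinM.
move=> hle; rewrite -ler_pdivrMl ?expR_gt0// -expRN -(EE_scale _ mg2 g2) -lee_fin; apply: le_trans hle.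
rewrite -(EE_EFin (B := expR CJ * B)); last 2 first.
- exact: measurable_funM.
- move=> u; rewrite normrM -[leRHS]mul1r; apply: ler_pM => //.
  by rewrite gtr0_norm ?expR_gt0// -expR0 ler_expR oppr_le0.
apply: ge0_le_integral => //.
- by move=> u _; rewrite lee_fin mulr_ge0 ?expR_ge0//; have /andP[] := f2 u.
- by apply/measurable_EFinP; exact: measurable_funM.
- apply: emeasurable_funM; last by apply/measurable_EFinP; exact: (measurableT_comp mphi (mY m j)).
  apply/measurable_EFinP; apply: measurable_funM; first exact: m1.
  apply: measurableT_comp => //; apply: measurable_funB => //; apply: measurable_funB => //.
  by apply: measurableT_comp => //; exact: mtheta.
- move=> u _; rewrite -EFinM lee_fin mulrCA -[leRHS]mulrA; apply: ler_wpM2l; first by case/andP: (ind01 (ball R0) u).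
  rewrite mulrA -expRD; apply: ler_wpM2r; first by have /andP[] := phiB (Y m j u).
  rewrite ler_expR -/(theta m j u).
  have : j%:R * h m * (eps * (L + C2) + C m * h m *+ 2) <= x.
    have [e0 _] := andP eps01.
    by apply: ler_wpM2r (step_le jN); rewrite addr_ge0 ?mulr_ge0 ?addr_ge0 ?mulrn_wge0 ?mulr_ge0.
  move: (theta m j u) (JX _ _ _) (_ * _ * (_ + _)) => z1 z2 z3; lra.
Qed.

Let mEJ m : measurable_fun [set: bH] (fun u : bH => expR (- JX c K (S m (u : H)))).
Proof. by apply: measurableT_comp => //; exact: measurableT_comp. Qed.

(** The defect at the moving point is an expectation of [rho] under the image of the measure.
    [level_inequality] with [phi] equal to [rho] on the ball compares it, up to a constant factor,
    with the expectation of [rho] itself, which tends to 0 by dominated convergence. The factor is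
    the same for all [N m] sweeps, and their total length is [delta]. *)
Lemma theta_null : (fun m => E (fun u => \1_(ball R0) u * theta m (N m) u)) @ \oo --> (0 : R).
Proof.
have [CJ CJ0 hCJ] := JX_bound G_taylor r.
pose W := delta * C2 * Kr; have W0 : 0 <= W by rewrite !mulr_ge0.
pose X0 := delta * (eps * (L + C2) + 1 *+ 2).
pose I0 m := E (fun u => \1_(ball r) u * rho m u).
have br m (u : H) : 0 <= \1_(ball r) u * rho m u <= Kr.
  rewrite indicE; have [ur|ur] := pselect (ball r u); last by rewrite memNset// mul0r lexx Kr0.
  by rewrite mem_set// mul1r rho_ge0/= rho_bound.
have br' m (u : H) : `|\1_(ball r) u * rho m u| <= Kr by rewrite ger0_norm; have /andP[] := br m u.
have mbr m : measurable_fun [set: bH] (fun u : bH => \1_(ball r) u * rho m u).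
  by apply: measurable_funM => //; exact: m1.
have I0c : I0 @ \oo --> (0 : R).
  have := @EE_cvg _ _ _ eta (fun m u => \1_(ball r) u * rho m u) (fun=> 0) Kr mbr (measurable_cst _) br'.
  rewrite {2}/EE integral0 /=; apply=> u; rewrite -[X in _ --> X](mulr0 (\1_(ball r) u)).
  by apply: cvgM; [exact: cvg_cst|exact: rho_cvg].
have Q0 m j u : (j <= N m)%N -> 0 <= \1_(ball R0) u * rho m (Y m j u) <= Kr.
  move=> jN; rewrite indicE; have [ur|ur] := pselect (ball R0 u); last by rewrite memNset// mul0r lexx Kr0.
  by rewrite mem_set// mul1r rho_ge0/= rho_bound// Y_ball.
have Q0' m j u : (j <= N m)%N -> `|\1_(ball R0) u * rho m (Y m j u)| <= Kr.
  by move=> jN; rewrite ger0_norm; have /andP[] := Q0 m j u jN.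
have mQ m j : measurable_fun [set: bH] (fun u : bH => \1_(ball R0) u * rho m (Y m j u)).
  by apply: measurable_funM; [exact: m1|exact: (measurableT_comp (mrho m) (mY m j))].
have one m j : (j <= N m)%N -> E (fun u => \1_(ball R0) u * rho m (Y m j u)) <= expR (W + X0 + CJ *+ 2) * I0 m.
  move=> jN.
  have := @level_inequality m j (fun u => \1_(ball r) u * rho m u) Kr CJ jN (hCJ m) (mbr m) (br m) _.
  move=> /(_ ltac:(by move=> u; rewrite indicE => ur; rewrite memNset ?mul0r// => /(lt_le_trans ur); rewrite ltxx)).
  set F1 := (fun u => _); set F2 := (fun u => _).
  (* Bounding [theta] by the constant [W] loses only a factor independent of [m], which is harmless
     since [I0] tends to 0. *)
  have b1 u : expR (- (W + CJ)) * (\1_(ball R0) u * rho m (Y m j u)) <= F1 u <= expR CJ * Kr.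
    rewrite /F1 !indicE; have [uR|uR] := pselect (ball R0 u); last first.
      by rewrite (memNset uR) !mul0r mulr0 lexx mulr_ge0 ?expR_ge0.
    have ur : `|u| <= r by apply: le_trans uR _; rewrite lerDl.
    rewrite (mem_set uR) mem_set; last exact: Y_ball.
    have rb := rho_ge0 m (Y m j u); have rb' := @rho_bound R p p3 m (Y m j u) r (Y_ball uR jN).
    have t1 := theta_bound uR jN; have t2 := theta0 m j u; have /ler_normlP[t3 t4] := hCJ m u ur.
    rewrite !mul1r; apply/andP; split.
      by apply: ler_wpM2r => //; rewrite ler_expR -/W; move: t1; rewrite -/W; lra.
    by apply: ler_pM; rewrite ?expR_ge0// ler_expR; lra.
  have mF1 : measurable_fun [set: bH] (F1 : bH -> R).
    apply: measurable_funM; first exact: m1.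
    apply: measurable_funM; last exact: (measurableT_comp (mbr m) (mY m j)).
    by apply: measurableT_comp => //; apply: measurable_funB => //; exact: measurableT_comp.
  have mF2 : measurable_fun [set: bH] (F2 : bH -> R) by apply: measurable_funM.
  have b2 u : 0 <= F2 u <= expR CJ * (\1_(ball r) u * rho m u).
    rewrite /F2; have /andP[w1 w2] := br m u; rewrite mulr_ge0 ?expR_ge0//=.
    rewrite indicE; have [ur|ur] := pselect (ball r u); last by rewrite memNset// !mul0r !mulr0.
    rewrite mem_set// mul1r; apply: ler_wpM2r; first exact: rho_ge0.
    by rewrite ler_expR; have /ler_normlP[] := hCJ m u ur.
  have a1 : expR (- (W + CJ)) * E (fun u => \1_(ball R0) u * rho m (Y m j u)) <= E F1.
    rewrite -(EE_scale _ (mQ m j) (Q0' m j ^~ jN)); apply: (@le_EE _ _ _ _ _ _ (expR CJ * Kr)).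
    - exact: measurable_funM.
    - exact: mF1.
    - move=> u; have /andP[v1 v2] := b1 u; rewrite ger0_norm; first exact: le_trans v1 v2.
      by rewrite mulr_ge0 ?expR_ge0//; have /andP[] := Q0 m j u jN.
    - move=> u; have /andP[v1 v2] := b1 u; rewrite ger0_norm//; apply: le_trans v1.
      by rewrite mulr_ge0 ?expR_ge0//; have /andP[] := Q0 m j u jN.
    - by move=> u; have /andP[] := b1 u.
  have a2 : E F2 <= expR CJ * I0 m.
    rewrite -(EE_scale _ (mbr m) (br' m)); apply: (@le_EE _ _ _ _ _ _ (expR CJ * Kr)) => //.
    - exact: measurable_funM.
    - move=> u; have /andP[v1 v2] := b2 u; rewrite ger0_norm//; apply: le_trans v2 _.
      by rewrite ler_wpM2l ?expR_ge0//; have /andP[] := br m u.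
    - move=> u; have /andP[w1 w2] := br m u; rewrite ger0_norm ?mulr_ge0 ?expR_ge0 ?rho_ge0//.
      by rewrite ler_wpM2l ?expR_ge0.
    - by move=> u; have /andP[] := b2 u.
  move=> a3.
  have I00 : 0 <= I0 m.
    have := @le_EE _ _ _ eta (fun=> 0) (fun u => \1_(ball r) u * rho m u) Kr (measurable_cst _) (mbr m) _ (br' m) _.
    rewrite {1}/EE integral0 /=; apply => u; first by rewrite normr0.
    by have /andP[] := br m u.
  have a4 : expR (delta * (eps * (L + C2) + C m * h m *+ 2)) <= expR X0.
    by rewrite ler_expR ler_wpM2l// lerD2l lerMn2r Ch1 orbT.
  have a5 : expR (- (W + CJ)) * E (fun u => \1_(ball R0) u * rho m (Y m j u)) <= expR X0 * (expR CJ * I0 m).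
    apply: le_trans a1 (le_trans a3 _); apply: le_trans (_ : expR (delta * (eps * (L + C2) + C m * h m *+ 2)) * (expR CJ * I0 m) <= _).
      by rewrite ler_wpM2l ?expR_ge0.
    by rewrite ler_wpM2r// mulr_ge0 ?expR_ge0.
  move: a5; rewrite expRN ler_pdivrMl ?expR_gt0// mulrA mulrA -!expRD.
  by rewrite (_ : W + CJ + (X0 + CJ) = W + X0 + CJ *+ 2)//; ring.
have sumb m n : (n <= N m)%N -> E (fun u => \1_(ball R0) u * theta m n u) <= n%:R * (h m * C2 * (expR (W + X0 + CJ *+ 2) * I0 m)).
  elim: n => [|n IH] nN.
    rewrite mul0r (_ : (fun u => _) = (fun=> 0)); first by rewrite /EE integral0.
    by apply/funext => u; rewrite /theta big_ord0 !mulr0.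
  have -> : (fun u => \1_(ball R0) u * theta m n.+1 u) =
      (fun u => \1_(ball R0) u * theta m n u + (h m * C2) * (\1_(ball R0) u * rho m (Y m n u))).
    by apply/funext => u; rewrite /theta big_ord_recr/=; ring.
  have hC : 0 <= h m * C2 by rewrite mulr_ge0.
  rewrite (EE_add (W + h m * C2 * Kr)).
  - rewrite -natr1 mulrDl mul1r; apply: lerD; first by apply: IH; exact: ltnW.
    rewrite (EE_scale _ (mQ m n) (Q0' m n ^~ (ltnW nN))); apply: ler_wpM2l => //; apply: one; exact: ltnW.
  - by apply: measurable_funM => //; exact: m1.
  - exact: measurable_funM.
  - move=> u; apply: le_trans (_ : W <= _); last by rewrite lerDl mulr_ge0.
    rewrite indicE; have [uR|uR] := pselect (ball R0 u); last by rewrite memNset// mul0r normr0.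
    by rewrite mem_set// mul1r ger0_norm//; apply: theta_bound => //; exact: ltnW.
  - move=> u; rewrite normrM (ger0_norm hC); apply: le_trans (_ : h m * C2 * Kr <= _); last by rewrite lerDr.
    by apply: ler_wpM2l => //; apply: Q0'; exact: ltnW.
pose BB := delta * C2 * expR (W + X0 + CJ *+ 2).
have lim0 : (fun m => BB * I0 m) @ \oo --> BB * 0 by apply: cvgM => //; exact: cvg_cst.
rewrite mulr0 in lim0; apply: (cvg_dist_le lim0) => m; rewrite subr0.
have pos u : 0 <= \1_(ball R0) u * theta m (N m) u by rewrite mulr_ge0//; case/andP: (ind01 (ball R0) u).
have ub u : `|\1_(ball R0) u * theta m (N m) u| <= W.
  rewrite indicE; have [uR|uR] := pselect (ball R0 u); last by rewrite memNset// mul0r normr0.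
  by rewrite mem_set// mul1r ger0_norm//; exact: theta_bound.
rewrite ger0_norm.
  apply: le_trans (sumb m (N m) (leqnn _)) _; rewrite /BB -(Nh m) le_eqVlt; apply/orP; left; apply/eqP; ring.
have := @le_EE _ _ _ eta (fun=> 0) (fun u => \1_(ball R0) u * theta m (N m) u) W (measurable_cst _) _ _ ub pos.
rewrite {1}/EE integral0 /=; apply; last by move=> u; rewrite normr0.
by apply: measurable_funM => //; exact: m1.
Qed.

(** At level [m] the loss caused by the defect is bounded by the expectation of [theta], which
    vanishes in the limit. The hypothesis on [A] makes the indicator of [O] along the scheme equal
    to 1 eventually, and all other terms converge by dominated convergence. *)
Lemma measure_limit (A O : set bH) : measurable A -> measurable O -> A `<=` ball R0 ->
  (forall u, A u -> \forall m \near \oo, O (Y m (N m) u)) ->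
  E (fun u => \1_A u * expR (- J u)) <=
  expR (delta * (eps * (L + C2))) * E (fun u => \1_(O `&` ball r) u * expR (- J u)).
Proof.
move=> mA mO AB hO; have [CJ CJ0 hCJ] := JX_bound G_taylor r.
have mOB : measurable (O `&` ball r : set bH) by exact: measurableI.
have Jb u : `|u| <= r -> `|J u| <= CJ.
  move=> ur; apply: (cvgr_to_le (cvg_norm (@J_lim u))).
  by apply: nearW => m; exact: hCJ.
have mJ : measurable_fun [set: bH] (J : bH -> R).
  by apply: (measurable_fun_cvg mJX) => u _; exact: J_lim.
have mA1 := m1 mA; have mO1 := m1 mO; have mOB1 := m1 mOB.
have eJ m u : `|u| <= r -> expR (- JX c K (S m u)) <= expR CJ.
  by move=> ur; rewrite ler_expR; have /ler_normlP[] := hCJ m u ur.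
have eJ' u : `|u| <= r -> expR (- J u) <= expR CJ.
  by move=> ur; rewrite ler_expR; have /ler_normlP[] := Jb u ur.
have Ar u : A u -> `|u| <= r by move=> /AB uB; apply: le_trans uB _; rewrite lerDl.
have i01 (B : set bH) u : (0 <= (\1_B u : R)) * ((\1_B u : R) <= 1) by case/andP: (ind01 B u).
pose F m u := \1_A u * (\1_O (Y m (N m) u) * expR (- JX c K (S m u))).
have mF m : measurable_fun [set: bH] (F m : bH -> R).
  apply: measurable_funM => //; apply: measurable_funM => //.
  exact: (measurableT_comp mO1 (mY m (N m))).
have FB m u : `|F m u| <= expR CJ.
  rewrite ger0_norm ?mulr_ge0 ?expR_ge0 ?i01// /F [in \1_A u]indicE.
  have [Au|Au] := pselect (A u); last by rewrite memNset// mul0r expR_ge0.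
  rewrite mem_set// mul1r -[leRHS]mul1r; apply: ler_pM; rewrite ?i01 ?expR_ge0//; exact: eJ (Ar _ Au).
have Flim u : (fun m => F m u) @ \oo --> \1_A u * expR (- J u).
  rewrite /F [in X in _ --> X]indicE; have [Au|Au] := pselect (A u); last first.
    rewrite memNset// mul0r; under eq_fun do rewrite indicE memNset// mul0r; exact: cvg_cst.
  rewrite (_ : _ * expR _ = \1_A u * (1 * expR (- J u))); last by rewrite indicE mul1r.
  apply: cvgM; first exact: cvg_cst.
  apply: cvgM.
    apply: cvg_near_cst.
    by apply: filterS (hO u Au) => m Om; rewrite indicE mem_set.
  apply: (continuous_cvg _ (@continuous_expR R _)); exact: cvgN (@J_lim u).
have mJA : measurable_fun [set: bH] (fun u : bH => \1_A u * expR (- J u)).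
  by apply: measurable_funM => //; apply: measurableT_comp => //; exact: measurableT_comp.
have la := @EE_cvg _ bH R eta F _ (expR CJ) mF mJA FB Flim.
pose Gm m u := expR (- JX c K (S m u)) * \1_(O `&` ball r) u.
have mG m : measurable_fun [set: bH] (Gm m : bH -> R) by exact: measurable_funM.
have GB m u : `|Gm m u| <= expR CJ.
  rewrite ger0_norm ?mulr_ge0 ?expR_ge0 ?i01// /Gm [in \1_(_) u]indicE.
  have [Au|Au] := pselect ((O `&` ball r) u); last by rewrite memNset// mulr0 expR_ge0.
  by rewrite mem_set// mulr1; apply: eJ Au.2.
have Glim u : (fun m => Gm m u) @ \oo --> \1_(O `&` ball r) u * expR (- J u).
  rewrite mulrC; apply: cvgM; last exact: cvg_cst.
  apply: (continuous_cvg _ (@continuous_expR R _)); exact: cvgN (@J_lim u).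
have mJO : measurable_fun [set: bH] (fun u : bH => \1_(O `&` ball r) u * expR (- J u)).
  by apply: measurable_funM => //; apply: measurableT_comp => //; exact: measurableT_comp.
have lb := @EE_cvg _ bH R eta Gm _ (expR CJ) mG mJO GB Glim.
pose x m := delta * (eps * (L + C2) + C m * h m *+ 2).
have lx : (fun m => expR (x m)) @ \oo --> expR (delta * (eps * (L + C2))).
  apply: (continuous_cvg _ (@continuous_expR R _)).
  rewrite (_ : delta * _ = delta * (eps * (L + C2) + 0 *+ 2)); last by rewrite mul0rn addr0.
  apply: cvgM; first exact: cvg_cst.
  apply: cvgD; first exact: cvg_cst.
  apply: cvgMn.
  apply: (@cvg_dist_le _ _ _ (fun m => m.+1%:R^-1)); first exact: cvg_harmonic.
  by move=> m; rewrite subr0 ger0_norm ?mulr_ge0.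
have lt : (fun m => expR CJ * E (fun u => \1_(ball R0) u * theta m (N m) u)) @ \oo --> expR CJ * 0.
  by apply: cvgM; [exact: cvg_cst|exact: theta_null].
have lr : (fun m => expR (x m) * E (Gm m) + expR CJ * E (fun u => \1_(ball R0) u * theta m (N m) u)) @ \oo -->
    expR (delta * (eps * (L + C2))) * E (fun u : bH => \1_(O `&` ball r) u * expR (- J u)) + expR CJ * 0.
  by apply: cvgD => //; exact: cvgM.
rewrite mulr0 addr0 in lr.
refine (ler_cvg_to la lr _); apply: nearW => m /=.
have phiB u : 0 <= (\1_(O `&` ball r) u : R) <= 1 := ind01 _ _.
have := @level_inequality m (N m) (\1_(O `&` ball r)) 1 CJ (leqnn _) (hCJ m) mOB1 phiB _.
move=> /(_ ltac:(by move=> u; rewrite indicE => ur; rewrite memNset// => -[_ /(lt_le_trans ur)]; rewrite ltxx)).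
set F1 := (fun u => _).
have mF1 : measurable_fun [set: bH] (F1 : bH -> R).
  apply: measurable_funM; first exact: m1.
  apply: measurable_funM; last exact: (measurableT_comp mOB1 (mY m (N m))).
  by apply: measurableT_comp => //; apply: measurable_funB => //; exact: measurableT_comp.
have F10 u : 0 <= F1 u by rewrite !mulr_ge0 ?expR_ge0 ?i01.
have F1B u : `|F1 u| <= expR CJ.
  rewrite ger0_norm// /F1 [in \1_(ball R0) u]indicE.
  have [uB|uB] := pselect (ball R0 u); last by rewrite memNset// mul0r expR_ge0.
  have ur : `|u| <= r by apply: le_trans uB _; rewrite lerDl.
  rewrite mem_set// mul1r -[leRHS]mulr1; apply: ler_pM; rewrite ?i01 ?expR_ge0//.
  by rewrite ler_expR; have /ler_normlP[] := hCJ m u ur; have := theta0 m (N m) u; lra.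
pose W := delta * C2 * Kr; have W0 : 0 <= W by rewrite !mulr_ge0.
pose T u := \1_(ball R0) u * theta m (N m) u.
have mT : measurable_fun [set: bH] (T : bH -> R) by apply: measurable_funM => //; exact: m1.
have T0 u : 0 <= T u by rewrite mulr_ge0 ?i01.
have TB u : `|T u| <= W.
  rewrite ger0_norm// /T [in \1_(ball R0) u]indicE; have [uR|uR] := pselect (ball R0 u); last by rewrite memNset// mul0r.
  by rewrite mem_set// mul1r; exact: theta_bound.
move=> hle; apply: le_trans (_ : E F1 + expR CJ * E T <= _); last by rewrite lerD2r.
rewrite -(EE_scale _ mT TB) -(EE_add (expR CJ * (1 + W))); first last.
- move=> u; rewrite normrM gtr0_norm ?expR_gt0// ler_wpM2l ?expR_ge0//; apply: le_trans (TB u) _.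
  by rewrite lerDr.
- by move=> u; apply: le_trans (F1B u) _; rewrite -[leLHS]mulr1 ler_wpM2l ?expR_ge0// lerDl.
- exact: measurable_funM.
- exact: mF1.
apply: (@le_EE _ _ _ _ _ _ (expR CJ * (1 + W))) => //.
- by apply: measurable_funD => //; exact: measurable_funM.
- by move=> u; apply: le_trans (FB m u) _; rewrite -[leLHS]mulr1 ler_wpM2l ?expR_ge0// lerDl.
- move=> u; apply: le_trans (ler_normD _ _) _; rewrite mulrDr mulr1; apply: lerD => //.
  by rewrite normrM gtr0_norm ?expR_gt0// ler_wpM2l ?expR_ge0.
move=> u; have rhs0 : 0 <= F1 u + expR CJ * T u by rewrite addr_ge0// mulr_ge0 ?expR_ge0.
rewrite {1}/F indicE; have [Au|Au] := pselect (A u); last by rewrite memNset// mul0r.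
rewrite mem_set// mul1r indicE; have [Ou|Ou] := pselect (O (Y m (N m) u)); last by rewrite memNset// mul0r.
rewrite mem_set// mul1r /F1 /T !indicE mem_set ?mul1r; last exact: AB.
rewrite mem_set; last by split=> //; apply: Y_ball => //; exact: AB.
(* What remains is $1\le e^{-s}+s$, multiplied by a weight that is at most [expR CJ]. *)
rewrite mulr1 expRD; set s := theta _ _ _.
have h1 := eJ m u (Ar u Au); have h2 := expR_ge1Dx (- s); have h3 : 0 <= s := theta0 _ _ _.
have h4 := expR_ge0 (- JX c K (S m u)).
move: (expR (- s)) (expR (- JX _ _ _)) (expR CJ) h1 h2 h4 => z1 z2 z3 h1 h2 h4; nra.
Qed.

End measure_limit.

(** * The inequality of Gronwall *)

Section gronwall.
Variable R : realType.

Lemma is_derive_big (J : eqType) (s : seq J) (f : J -> R -> R) (d : J -> R) (x : R) :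
  (forall k, k \in s -> is_derive x 1 (f k) (d k)) ->
  is_derive x 1 (fun t => \sum_(k <- s) f k t) (\sum_(k <- s) d k).
Proof.
elim: s => [|k s IH] H.
  rewrite big_nil (_ : (fun t => _) = cst 0); last by apply/funext => t; rewrite big_nil.
  exact: is_derive_cst.
rewrite big_cons (_ : (fun t => _) = f k + (fun t => \sum_(j <- s) f j t)); last first.
  by apply/funext => t; rewrite big_cons.
have h1 := H k (mem_head _ _); have h2 := IH (fun j js => H j (ltac:(by rewrite in_cons js orbT))).
exact: is_deriveD.
Qed.

Lemma continuous_big (T : topologicalType) (J : eqType) (s : seq J) (f : J -> T -> R) :
  (forall k, k \in s -> continuous (f k)) -> continuous (fun t => \sum_(k <- s) f k t).
Proof.
elim: s => [|k s IH] H x.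
  rewrite (_ : (fun t => _) = cst 0); last by apply/funext => t; rewrite big_nil.
  exact: cvg_cst.
rewrite (_ : (fun t => _) = f k + (fun t => \sum_(j <- s) f j t)); last first.
  by apply/funext => t; rewrite big_cons.
apply: cvgD; first by apply: H; rewrite mem_head.
by apply: IH => j js; apply: H; rewrite in_cons js orbT.
Qed.

(** The function $e^{-a(t-t_0)}g(t)-b(t-t_0)$ is nonincreasing, by the mean value theorem. *)
Lemma gronwall_step (g g' : R -> R) (a b t0 h : R) : 0 <= b -> 0 <= a -> 0 < h ->
  {within `[t0, t0 + h], continuous g} ->
  (forall t, t0 < t < t0 + h -> is_derive t 1 g (g' t)) ->
  (forall t, t0 < t < t0 + h -> g' t <= a * g t + b) ->
  g (t0 + h) <= expR (a * h) * (g t0 + b * h).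
Proof.
move=> b0 a0 h0 cg dg g'le.
pose f t := expR (- a * (t - t0)) * g t - b * (t - t0).
pose f' t := expR (- a * (t - t0)) * (g' t - a * g t) - b.
have df (t : R) : t \in `]t0, t0 + h[ -> is_derive t 1 f (f' t).
  rewrite in_itv/= => tt; have dgt := dg t tt.
  have d1 : is_derive t 1 (fun s : R => - a * (s - t0)) (- a).
    by apply: is_derive_eq; rewrite /GRing.scale/= ; ring.
  have d2 : is_derive t 1 (fun s : R => expR (- a * (s - t0))) (expR (- a * (t - t0)) * - a).
    by apply: is_derive_eq; rewrite /GRing.scale/=; ring.
  by apply: is_derive_eq; rewrite /f' /GRing.scale/=; ring.
have cf : {within `[t0, t0 + h], continuous f}.
  have c0 : continuous (fun s : R => - a * (s - t0)).
    by move=> s; apply: cvgM; [exact: cvg_cst|apply: cvgB; [exact: cvg_id|exact: cvg_cst]].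
  have c1 : {within `[t0, t0 + h], continuous (fun s : R => expR (- a * (s - t0)))}.
    apply: continuous_subspaceT => s; apply: (continuous_cvg _ (@continuous_expR R _)); exact: c0.
  have c2 : {within `[t0, t0 + h], continuous (fun s : R => b * (s - t0))}.
    apply: continuous_subspaceT => s.
    by apply: cvgM; [exact: cvg_cst|apply: cvgB; [exact: cvg_id|exact: cvg_cst]].
  move=> s; apply: cvgB; last exact: c2.
  by apply: cvgM; [exact: c1|exact: cg].
have lth : t0 < t0 + h by rewrite ltrDl.
have [s] := MVT lth df cf.
rewrite in_itv/= => st; have := g'le s st.
have ef : expR (- a * (s - t0)) <= 1.
  have /andP[s1 _] := st.
  by rewrite -expR0 ler_expR mulNr oppr_le0 mulr_ge0// subr_ge0 ltW.
have e0 := expR_ge0 (- a * (s - t0)).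
move=> h1 h2.
have h3 : f' s <= 0.
  rewrite /f' subr_le0; apply: le_trans (_ : expR (- a * (s - t0)) * b <= _).
    by rewrite ler_wpM2l// lerBlDl.
  by rewrite -[leRHS]mul1r ler_wpM2r.
have h4 : f (t0 + h) <= f t0.
  by rewrite -subr_le0 h2 mulr_le0_ge0// subr_ge0 ltW.
move: h4; rewrite /f subrr !mulr0 expR0 mul1r subr0 addrAC subrr add0r mulNr expRN.
by rewrite lerBlDr mulrC ler_pdivrMr ?expR_gt0// mulrC.
Qed.

End gronwall.

(** * The weak KdV field as a limit over truncations *)

Section vector_field_limit.
Variables (R : realType) (p : nat).
Local Notation q := (p%:R : R).
Local Notation H := (sobolev q).
Hypothesis p3 : (3 <= p)%N.
Implicit Types (u v : H) (k : int) (n m : nat).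

Definition Wk u k : R := torus_int (fun x => synth u x * derive1n 3 (trig k) x +
           6 * synth u x * derive1 (synth u) x * trig k x).

(** Unlike the $H^p$ tail, the $L^2$ tail has a rate that is uniform on balls, hence along a whole
    trajectory. *)
Lemma tail_n2 u n m : (m <= n)%N -> n2 (S n (coef u) - S m (coef u)) <= `|u| / m.+1%:R.
Proof.
move=> mn; apply: le_n2; first by rewrite divr_ge0.
rewrite (S_sub _ mn) -SB Parseval exprMn exprVn ler_pdivlMr ?exprn_gt0// mulr_suml.
apply: le_trans (nq_le_norm n u); rewrite /nq big_seq [leRHS]big_seq; apply: ler_sum => k kn.
have k0 := idx_neq0 kn; case: ifPn => km.
  by rewrite subrr !mul0r mulr_ge0 ?sqr_ge0// weight_ge0.
rewrite subr0 -expr2 mulrC ler_wpM2r ?sqr_ge0// -wn_sqr_weight.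
have km' : (m <= `|k|)%N by move: km; rewrite mem_idx k0/= -leqNgt.
have k1 : (0 < `|k|)%N by rewrite absz_gt0.
have w1 : m.+1%:R <= `|wn R k|.
  rewrite /wn normrM (gtr0_norm (mulr_gt0 _ (pi_gt0 R)))//.
  rewrite -intr_norm -abszE -[_%:~R]/(`|k|%N%:R).
  apply: le_trans (_ : 2 * `|k|%:R <= _).
    by rewrite -natrM ler_nat mul2n -addnn -addn1 leq_add.
  by rewrite ler_wpM2r// ler_peMr//; have := pi_ge2 R; lra.
apply: le_trans (_ : `|wn R k| ^+ (2 * p) <= _).
  apply: le_trans (_ : m.+1%:R ^+ (2 * p) <= _); last by rewrite lerXn2r ?nnegrE.
  by apply: ler_weXn2l; [rewrite ler1n|case: (p) p3 => // p' _; rewrite mulnS].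
by rewrite exprM real_normK ?num_real// -exprM.
Qed.

(** After integration by parts only [u] and its first derivative occur, and both converge
    uniformly. *)
Lemma W_limit u k : k != 0 -> (fun n => I (kdvW (S n (coef u)) * e R k)) @ \oo --> Wk u k.
Proof.
move=> k0; have [L [hL dL]] := synth_derivatives u.
have p0 : (0 < p)%N by apply: leq_trans p3.
have p1 : (1 < p)%N by apply: leq_trans p3.
have L0 : synth u = L 0%N := dL 0%N p0; have L1 : derive1 (synth u) = L 1%N := dL 1%N p1.
pose Z := Dn 3 (e R k).
have E k' : k' != 0 -> I (e R k') = 0 by exact: I_e.
have sb (X : tpoly R) x : I X = 0 -> `|X x| <= n2 (D X) by exact: sup_n2.
pose b1 := n2 (D Z); pose b2 := n2 (D (e R k)).
have Zb x : `|Z x| <= b1 by apply: sb; apply: I_Dn; exact: I_e.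
have eb x : `|e R k x| <= b2 by apply: sb; exact: I_e.
pose tau n := `|u - trunc p n u|.
have IW X : I (kdvW X * e R k) = I (X * Z + 6 * (X * D X * e R k)).
  rewrite kdvWE mulrDl mulNr ID IN I_partsn ID; congr (_ + _).
    by rewrite /Z; move: (I _) => z; rewrite !exprS expr0; ring.
  by congr (I _); rewrite DM; ring.
have Lb j x : (j < p)%N -> `|L j x| <= `|u|.
  move=> jp; have := hL j 0%N x jp.
  have -> : S 0 (coef u) = 0 by rewrite /S big_nil.
  rewrite DnZ0 (_ : trunc p 0 u = 0); first by rewrite -[(0 : tpoly R) x]/(0 : R) sub0r normrN subr0.
  by apply: sob_ext => i _; rewrite truncE.
have Xb j n x : (j < p)%N -> `|Dn j (S n (coef u)) x| <= `|u|.
  by move=> jp; apply: le_trans (sup_Dn x (I_S _ _) jp) (n2_Dn_norm _ _).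
have B0 : 0 <= b1 + 12 * `|u| * b2 by rewrite addr_ge0 ?mulr_ge0 ?n2_ge0.
have lim0 : (fun n => (b1 + 12 * `|u| * b2) * tau n) @ \oo --> (b1 + 12 * `|u| * b2) * 0.
  by apply: cvgM; [exact: cvg_cst|exact: trunc_cvg].
rewrite mulr0 in lim0.
have mL j : (j < p)%N -> measurable_fun setT (L j).
  move=> jp; apply: (@measurable_fun_cvg _ _ _ setT (fun n => tpfun (Dn j (S n (coef u))))).
    by move=> n; exact: measurable_tp.
  by move=> x _; apply: cvg_dist_le (trunc_cvg u) _ => n; exact: hL.
apply: (cvg_dist_le lim0) => n; rewrite distrC IW IE.
have tr : trig k = e R k :> (R -> R) by [].
have d3 : derive1n 3 (trig k) = Z :> (R -> R) by rewrite tr derive1n_tp.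
rewrite /Wk L1 L0 d3.
apply: (integral_dist (b := cst ((b1 + 12 * `|u| * b2) * tau n))).
- apply: measurable_funD; first by apply: measurable_funM; [exact: mL|exact: measurable_tp].
  apply: measurable_funM; last exact: (measurable_tp (e R k)).
  by apply: measurable_funM; [apply: measurable_funM => //; exact: mL|exact: mL].
- exact: measurable_cst.
- exact: tp_integrable.
- move=> x _.
  have -> : tpfun (S n (coef u) * Z + 6 * (S n (coef u) * D (S n (coef u)) * e R k)) x =
      S n (coef u) x * Z x + 6 * (S n (coef u) x * D (S n (coef u)) x * e R k x).
    by rewrite tp_add !tp_mul -(tpCn R 6).
  rewrite /cst.
  set X := S n (coef u) x; set DX := D (S n (coef u)) x.
  have -> : L 0%N x * Z x + 6 * L 0%N x * L 1%N x * trig k x - (X * Z x + 6 * (X * DX * e R k x)) =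
     - ((X - L 0%N x) * (Z x + 6 * L 1%N x * e R k x) + (DX - L 1%N x) * (6 * X * e R k x)).
    by rewrite tr; ring.
  have t1 : `|X - L 0%N x| <= tau n := hL 0%N n x p0.
  have t2 : `|DX - L 1%N x| <= tau n := hL 1%N n x p1.
  have t3 : `|X| <= `|u| := Xb 0%N n x p0.
  have t4 := Lb 1%N x p1; have t5 := eb x; have t6 := Zb x.
  rewrite normrN; apply: le_trans (ler_normD _ _) _; rewrite !normrM.
  have t7 : `|Z x + 6 * L 1%N x * e R k x| <= b1 + 6 * `|u| * b2.
    apply: le_trans (ler_normD _ _) _; apply: lerD => //; rewrite !normrM ger0_norm//.
    by apply: ler_pM => //; rewrite ?mulr_ge0// ler_wpM2l.
  have t8 : `|6 : R| * `|X| * `|e R k x| <= 6 * `|u| * b2.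
    by rewrite ger0_norm//; apply: ler_pM => //; rewrite ?mulr_ge0// ler_wpM2l.
  have -> : (b1 + 12 * `|u| * b2) * tau n = tau n * (b1 + 6 * `|u| * b2) + tau n * (6 * `|u| * b2) by ring.
  by apply: lerD; apply: ler_pM => //; rewrite ?mulr_ge0.
- rewrite /cst integral_cst//= lebesgue_measure_itv /= lte_fin ltr01 oppr0 adde0 mule1; exact: lexx.
Qed.

End vector_field_limit.

(** * Convergence of the scheme to the solutions *)

Section scheme_convergence.
Variables (R : realType) (p : nat) (c : R) (K : mpoly.mpoly p R).
Local Notation q := (p%:R : R).
Local Notation H := (sobolev q).
Hypothesis p3 : (3 <= p)%N.
Implicit Types (u v : H) (k : int) (n m j : nat).

Variables (fc : H -> int -> R) (L sg eps C1 C2 R0 delta : R).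
Hypotheses (R00 : 0 <= R0) (C10 : 0 <= C1) (L0 : 0 <= L) (sg1 : `|sg| = 1) (eps01 : 0 <= eps <= 1).
Local Notation r := (R0 + 1).
Hypothesis fc_lip1 : two_smoothing fc (r + 1) L.

(** A bounded solution in the coefficientwise sense; [sg = -1] describes the equation with time
    reversed. *)
Definition trajectory (g : R -> H) :=
  [/\ forall t, 0 <= t <= delta -> `|g t| <= R0,
      forall k, k != 0 -> {within `[0, delta], continuous (fun t => coef (g t) k)} &
      forall t, 0 < t < delta -> forall k, k != 0 ->
        is_derive t 1 (fun s => coef (g s) k) (sg * (Wk (g t) k + eps * fc (g t) k))].

Section one_step.
Variables (m : nat) (Y w : H) (s B : R).
Hypotheses (Yr : `|Y| <= r) (wR : `|w| <= R0) (s0 : 0 <= s) (sB : s * B <= m.+1%:R^-1).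
Local Notation V := (V fc sg eps m Y).
Hypothesis VB : `|V| <= B.
Let kap := m.+1%:R^-1 : R.
Let z := S m (coef (Y + s *: V)) - S m (coef w).
Let rho := r + 1.

Let kap01 : 0 <= kap <= 1. Proof. by rewrite invr_ge0 ler0n invf_le1// ler1n. Qed.
Let R0rho : R0 <= rho. Proof. by rewrite /rho; lra. Qed.
Let rrho : r <= rho. Proof. by rewrite /rho; lra. Qed.
Let rho0 : 0 <= rho. Proof. exact: le_trans R00 R0rho. Qed.
Let sV : `|s *: V| <= kap. Proof. by rewrite normrZ ger0_norm//; apply: le_trans sB; rewrite ler_wpM2l. Qed.
Let Ys : `|Y + s *: V| <= rho.
Proof. by apply: le_trans (ler_normD _ _) _; apply: lerD => //; apply: le_trans sV _; case/andP: kap01. Qed.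
Let n3 n (u : H) M : `|u| <= M -> n2 (Dn 3 (S n (coef u))) <= M.
Proof. by apply: le_trans; exact: n2_Dn_S_le. Qed.
Let zE : z = S m (coef (Y + s *: V - w)). Proof. by rewrite /z S_subH. Qed.
Let zb : n2 z <= rho + rho.
Proof.
rewrite zE -[S _ _]Dn0; apply: le_trans (n2_Dn_S_le _ _ (leq0n p)) _; apply: le_trans (ler_normB _ _) _.
by apply: lerD => //; exact: le_trans R0rho.
Qed.

(** The field at [w] exists only weakly, so [w] is replaced by its truncations at level [n], to
    which [stability] applies, and [n] tends to infinity. The shift from [Y] to [Y + s *: V] inside
    one step is paid for by [kdvW_lip]. *)
Lemma kdv_drift_gap : `|\sum_(k <- idx m) (coef (Y + s *: V) k - coef w k) * (I (kdvW (S m (coef Y)) * e R k) - Wk w k)| <=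
  3 * rho * n2 z ^+ 2 + (12 * rho ^+ 2 * R0 + (rho + rho + 6 * rho * (rho + rho))) * kap.
Proof.
pose T n := \sum_(k <- idx m) (coef (Y + s *: V) k - coef w k) * (I (kdvW (S m (coef Y)) * e R k) - I (kdvW (S n (coef w)) * e R k)).
have Tl : T @ \oo --> \sum_(k <- idx m) (coef (Y + s *: V) k - coef w k) * (I (kdvW (S m (coef Y)) * e R k) - Wk w k).
  rewrite /T; have : {subset idx m <= predC1 0} by move=> k /idx_neq0.
  elim: (idx m) => [|k l IH] H0.
    rewrite big_nil (_ : (fun n => _) = cst 0); last by apply/funext => n; rewrite big_nil.
    exact: cvg_cst.
  rewrite big_cons (_ : (fun n => _) = (fun n => (coef (Y + s *: V) k - coef w k) * (I (kdvW (S m (coef Y)) * e R k) - I (kdvW (S n (coef w)) * e R k)) + \sum_(k <- l) (coef (Y + s *: V) k - coef w k) * (I (kdvW (S m (coef Y)) * e R k) - I (kdvW (S n (coef w)) * e R k)))); last first.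
    by apply/funext => n; rewrite big_cons.
  apply: cvgD; last by apply: IH => k' kl; apply: H0; rewrite in_cons kl orbT.
  apply: cvgM; first exact: cvg_cst.
  apply: cvgB; first exact: cvg_cst.
  by apply: W_limit => //; exact: (H0 k (mem_head _ _)).
apply: (cvgr_to_le (cvg_norm Tl)); exists m => // n /= mn.
have TE : T n = I ((kdvW (S m (coef Y)) - kdvW (S m (coef (Y + s *: V)))) * z) + I ((kdvW (S m (coef (Y + s *: V))) - kdvW (S n (coef w))) * z).
  rewrite -ID -mulrDl subrKA [z in RHS]zE I_Sl /T; apply: eq_bigr => k _.
  by congr (_ * _); rewrite [in RHS]mulrBl IB.
rewrite TE; apply: le_trans (ler_normD _ _) _; rewrite addrC (mulrDl (12 * _ * _)) addrA; apply: lerD.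
  have Pw : P m (S n (coef w)) = S m (coef w) by exact: P_S_le.
  have := @stability R m (S m (coef (Y + s *: V))) (S n (coef w)) rho (deg_S _ _) (I_S _ _) (I_S _ _) (n3 _ Ys) (n3 _ (le_trans wR R0rho)).
  rewrite Pw -/z => st; apply: le_trans st _; rewrite lerD2l -[leRHS]mulrA; apply: ler_wpM2l; first by rewrite mulr_ge0 ?sqr_ge0.
  have -> : Q m (S n (coef w)) = S n (coef w) - S m (coef w) by rewrite /Q /Pi I_S Pw tpC0 add0r.
  by apply: le_trans (tail_n2 p3 w mn) _; rewrite ler_wpM2r//; case/andP: kap01.
rewrite mulrBl IB; apply: le_trans (kdvW_lip _ (I_S _ _) (I_S _ _) (n3 _ (le_trans Yr rrho)) (n3 _ Ys)) _.
rewrite mulrC; apply: ler_pM; rewrite ?n2_ge0 ?addr_ge0 ?mulr_ge0 ?n2_ge0//.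
  have zj j : (j <= p)%N -> n2 (Dn j z) <= rho + rho.
    move=> jp; rewrite zE; apply: le_trans (n2_Dn_S_le _ _ jp) _; apply: le_trans (ler_normB _ _) _.
    by apply: lerD => //; exact: le_trans R0rho.
  apply: lerD; first exact: zj.
  apply: ler_wpM2l; first by rewrite mulr_ge0.
  by apply: (zj 1%N); apply: leq_trans p3.
rewrite S_subH (_ : Y - (Y + s *: V) = - (s *: V)); last by rewrite opprD addrA subrr add0r.
by rewrite -[S _ _]Dn0; apply: le_trans (n2_Dn_S_le _ _ (leq0n p)) _; rewrite normrN.
Qed.

Lemma pert_drift_gap : `|\sum_(k <- idx m) (coef (Y + s *: V) k - coef w k) * (fc (trunc p m Y) k - fc w k)| <=
  L * n2 z ^+ 2 + (rho + rho) * L * (1 + R0) * kap.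
Proof.
have [k0 k1] := andP kap01.
pose M := n2 z + kap + R0 * kap.
have hMge n : (m <= n)%N -> n2 (S n (coef (trunc p m Y - w))) <= M.
  move=> mn; have -> : S n (coef (trunc p m Y - w)) = S m (coef Y) - S n (coef w).
    by rewrite (S_sub (coef Y) mn) -SB; apply: eq_S => k _; rewrite sob_coefB truncE.
  have zz : z = S m (coef Y) + S m (coef (s *: V)) - S m (coef w) by rewrite /z -SD.
  have -> : S m (coef Y) - S n (coef w) = z - S m (coef (s *: V)) - (S n (coef w) - S m (coef w)).
    by rewrite zz; ring.
  have sVm : n2 (S m (coef (s *: V))) <= kap.
    by rewrite -[S _ _]Dn0; apply: le_trans (n2_Dn_S_le _ _ (leq0n p)) _.
  apply: le_trans (n2B _ _) _; apply: lerD; first by apply: le_trans (n2B _ _) _; exact: lerD.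
  by apply: le_trans (tail_n2 p3 w mn) _; rewrite ler_wpM2r.
have hM n : n2 (S n (coef (trunc p m Y - w))) <= M.
  rewrite -(P_S_le _ (leq_maxl n m)); apply: le_trans (n2_P _ (I_S _ _)) _.
  exact: hMge (leq_maxr n m).
have Yt : `|trunc p m Y| <= r + 1.
  by apply: le_trans (norm_trunc_le _ _) _; apply: le_trans Yr _; rewrite lerDl.
have hf := fc_lip1 Yt (le_trans wR R0rho) hM m.
have -> : \sum_(k <- idx m) (coef (Y + s *: V) k - coef w k) * (fc (trunc p m Y) k - fc w k) =
    I (z * S m (fun k => fc (trunc p m Y) k - fc w k)).
  by rewrite zE Parseval; apply: eq_bigr => k _; rewrite sob_coefB.
apply: le_trans (n2_CS _ _) _.
set F := S m _; have Fb : n2 F <= L * M.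
  by apply: le_trans hf; rewrite -[X in n2 X <= _]Dn0; apply: le_n2Dn => //; exact: I_S.
apply: le_trans (ler_wpM2l (n2_ge0 _) Fb) _; rewrite /M.
have zn := n2_ge0 z; have LR : 0 <= L * (kap + R0 * kap) by rewrite mulr_ge0// addr_ge0// mulr_ge0.
have e1 : n2 z * (L * (n2 z + kap + R0 * kap)) = L * n2 z ^+ 2 + n2 z * (L * (kap + R0 * kap)) by ring.
rewrite e1 lerD2l; apply: le_trans (ler_wpM2r LR zb) _.
by rewrite le_eqVlt; apply/orP; left; apply/eqP; ring.
Qed.

Definition alpha : R := 2 * (3 * rho + L).
Definition beta0 : R := 2 * (12 * rho ^+ 2 * R0 + (rho + rho + 6 * rho * (rho + rho)) + (rho + rho) * L * (1 + R0)).

Let gap_budget (a1 a2 a3 a4 a5 b b' : R) : a3 <= 3 * rho * a5 + b * kap -> a4 <= L * a5 + b' * kap ->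
  a1 <= a3 -> a2 <= a4 -> 2 * (a1 + a2) <= 2 * (3 * rho + L) * a5 + 2 * (b + b') * kap.
Proof. by move=> *; lra. Qed.

Lemma drift_gap : 2 * (\sum_(k <- idx m) (coef (Y + s *: V) k - coef w k) *
    (coef V k - sg * (Wk w k + eps * fc w k))) <= alpha * n2 z ^+ 2 + beta0 * kap.
Proof.
have [e0 e1] := andP eps01.
have -> : \sum_(k <- idx m) (coef (Y + s *: V) k - coef w k) * (coef V k - sg * (Wk w k + eps * fc w k)) =
  sg * (\sum_(k <- idx m) (coef (Y + s *: V) k - coef w k) * (I (kdvW (S m (coef Y)) * e R k) - Wk w k)) +
  sg * (eps * \sum_(k <- idx m) (coef (Y + s *: V) k - coef w k) * (fc (trunc p m Y) k - fc w k)).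
  rewrite !mulr_sumr -big_split/=; apply: eq_big_seq => k km.
  by rewrite ?truncE km; ring.
have h1 := kdv_drift_gap; have h2 := pert_drift_gap.
set x := \sum_(k <- idx m) _ in h1 *; set y := \sum_(k <- idx m) _ in h2 *.
have sx : sg * x <= `|x| by apply: le_trans (ler_norm _) _; rewrite normrM sg1 mul1r.
have sy : sg * (eps * y) <= `|y|.
  apply: le_trans (ler_norm _) _; rewrite !normrM sg1 mul1r (ger0_norm e0).
  by rewrite -[leRHS]mul1r ler_wpM2r.
rewrite /alpha /beta0.
exact: gap_budget h1 h2 sx sy.
Qed.

End one_step.

Variable g : R -> H.
Hypothesis gP : trajectory g.

(** The scheme is interpolated linearly within a step, and Gronwall is applied to the squared $L^2$
    distance from the truncated trajectory. *)
Lemma one_step_gap m (Y : H) (t0 h B : R) : `|Y| <= r -> 0 < h -> 0 <= t0 -> t0 + h <= delta -> h * B <= m.+1%:R^-1 ->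
  `|V fc sg eps m Y| <= B ->
  n2 (S m (coef (Y + h *: V fc sg eps m Y)) - S m (coef (g (t0 + h)))) ^+ 2 <=
  expR (alpha * h) * (n2 (S m (coef Y) - S m (coef (g t0))) ^+ 2 + beta0 / m.+1%:R * h).
Proof.
move=> Yr h0 t00 th hB VB; have [g1 g2 g3] := gP.
have B0 : 0 <= B := le_trans (normr_ge0 _) VB.
set v := V fc sg eps m Y in VB *.
pose G t := \sum_(k <- idx m) (coef Y k + (t - t0) * coef v k - coef (g t) k) ^+ 2.
have GE t : G t = n2 (S m (coef (Y + (t - t0) *: v)) - S m (coef (g t))) ^+ 2.
  rewrite S_subH sqr_n2 Parseval; apply: eq_bigr => k _.
  by rewrite sob_coefB sob_coefD sob_coefZ expr2.
have E1 : n2 (S m (coef (Y + h *: v)) - S m (coef (g (t0 + h)))) ^+ 2 = G (t0 + h).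
  by rewrite GE addrAC subrr add0r.
have E0 : n2 (S m (coef Y) - S m (coef (g t0))) ^+ 2 = G t0 by rewrite GE subrr scale0r addr0.
rewrite E1 E0.
pose G' t := 2 * (\sum_(k <- idx m) (coef (Y + (t - t0) *: v) k - coef (g t) k) * (coef v k - sg * (Wk (g t) k + eps * fc (g t) k))).
apply: (@gronwall_step R G G').
- rewrite divr_ge0// /beta0; have := R00; have := L0 => l0 r0.
  by rewrite mulr_ge0// !addr_ge0 ?mulr_ge0 ?sqr_ge0 ?addr_ge0.
- by rewrite /alpha; have := R00; have := L0 => l0 r0; rewrite mulr_ge0// addr_ge0// mulr_ge0// !addr_ge0.
- exact: h0.
- apply: continuous_big => k km x.
  have kc : {within `[t0, t0 + h], continuous (fun t => coef (g t) k)}.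
    apply: continuous_subspaceW (g2 k (idx_neq0 km)) => y; rewrite /= !in_itv/= => /andP[y1 y2].
    by rewrite (le_trans t00 y1) (le_trans y2 th).
  have lc : {within `[t0, t0 + h], continuous (fun t => coef Y k + (t - t0) * coef v k)}.
    apply: continuous_subspaceT => y; apply: cvgD; first exact: cvg_cst.
    by apply: cvgM; [apply: cvgB; [exact: cvg_id|exact: cvg_cst]|exact: cvg_cst].
  have dc := cvgB (lc x) (kc x).
  rewrite (_ : (fun t => _) = (fun t => (coef Y k + (t - t0) * coef v k - coef (g t) k) * (coef Y k + (t - t0) * coef v k - coef (g t) k))); last first.
    by apply/funext => t; rewrite expr2.
  by apply: cvgM; exact: dc.
- move=> t /andP[t1 t2].
  have tt : 0 < t < delta by rewrite (le_lt_trans t00 t1) (lt_le_trans t2 th).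
  rewrite /G' mulr_sumr; apply: is_derive_big => k km.
  have dk := g3 t tt k (idx_neq0 km).
  rewrite sob_coefD sob_coefZ.
  have d1 : is_derive t 1 (fun s : R => coef Y k + (s - t0) * coef v k) (coef v k).
    by apply: is_derive_eq; rewrite /GRing.scale/=; ring.
  have d2 := is_deriveB d1 dk.
  have d3 := is_deriveX 1 d2.
  rewrite (_ : (fun s => _) = ((fun s : R => coef Y k + (s - t0) * coef v k) - (fun s => coef (g s) k)) ^+ 2); last first.
    by apply/funext => s; rewrite fctE.
  by apply: is_derive_eq; rewrite /GRing.scale/= !fctE; ring.
- move=> t /andP[t1 t2]; rewrite GE.
  apply: (drift_gap (B := B)) => //.
  + by apply: g1; rewrite (le_trans t00 (ltW t1)) (le_trans (ltW t2) th).
  + by rewrite subr_ge0 ltW.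
  + by apply: le_trans hB; rewrite ler_wpM2r// lerBlDl ltW.
Qed.

Variables (h C : nat -> R) (N : nat -> nat).
Hypotheses (h0 : forall m, 0 < h m) (C0 : forall m, 0 <= C m).
Hypotheses (Nh : forall m, (N m)%:R * h m = delta) (Ch : forall m, C m * h m <= m.+1%:R^-1).
Hypothesis delta_small : delta * (2 * C1 + 1) <= 1.
Local Notation items m := (its fc L sg eps m).
Hypothesis hok : forall m, macro_ok c K fc r L sg eps C1 C2 m (h m) (C m).
Local Notation Y m j := (iter j (run (h m) (items m)) (g 0)).

Let delta0 : 0 <= delta. Proof. by rewrite -(Nh 0) mulr_ge0// ltW. Qed.

(** [beta0] is the drift error of one step. The rest comes from squaring the sum of a gap of at most
    [2 * (r + 1)] and a remainder of at most 1. *)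
Definition gap_const : R := beta0 + 4 * (r + 1) + 1.

(** Discrete Gronwall: every step adds an error of order [h m / m.+1] to the squared gap, and the
    gap is zero at the start. *)
Lemma scheme_gap m j : (j <= N m)%N ->
  n2 (S m (coef (Y m j)) - S m (coef (g (j%:R * h m)))) ^+ 2 <=
  expR (alpha * (j%:R * h m)) * (j%:R * h m * (gap_const / m.+1%:R)).
Proof.
have [g1 _ _] := gP.
have l0 := L0; have R0' := R00; have rr : 0 <= r + 1 by rewrite !addr_ge0.
have al0 : 0 <= alpha by rewrite /alpha mulr_ge0// addr_ge0// mulr_ge0.
have b0 : 0 <= beta0 by rewrite /beta0 mulr_ge0// !addr_ge0 ?mulr_ge0 ?sqr_ge0 ?addr_ge0.
set kap : R := m.+1%:R^-1.
have k0 : 0 <= kap by rewrite invr_ge0.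
have k1 : kap <= 1 by rewrite invf_le1// ler1n.
have d1 : delta <= 1 by apply: le_trans delta_small; rewrite ler_peMr// lerDr mulr_ge0.
have hm := h0 m; have hm' := ltW hm.
have step_le i : (i <= N m)%N -> i%:R * h m <= delta by move=> iN; rewrite -(Nh m) ler_wpM2r// ler_nat.
have step_ok i : (i <= N m)%N -> i%:R * h m * (2 * C1 + C m * h m) <= 1.
  move=> iN; apply: le_trans delta_small; apply: ler_pM; rewrite ?mulr_ge0 ?addr_ge0 ?mulr_ge0//; first exact: step_le.
  by rewrite lerD2l; apply: le_trans (Ch m) k1.
have gR i : (i <= N m)%N -> `|g (i%:R * h m)| <= R0.
  by move=> iN; apply: g1; rewrite mulr_ge0//= step_le.
have Yb i : (i <= N m)%N -> `|Y m i| <= r.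
  move=> iN; apply: (iter_norm R00 hm' (C0 m) C10 (hok m) _ (step_ok i iN)) => //.
  by apply: g1; rewrite lexx.
elim: j => [|j IH] jN.
  by rewrite !mul0r subrr n2_0 expr0n/= !mulr0.
have jN' := ltnW jN; have {}IH := IH jN'.
have jS : j.+1%:R * h m = j%:R * h m + h m by rewrite -natr1 mulrDl mul1r.
have [[_ rem _ _ _] VB] := (hok m).2 _ (Yb j jN').
have jh0 : 0 <= j%:R * h m by rewrite mulr_ge0.
have jhd : j%:R * h m + h m <= delta by rewrite -jS; exact: step_le.
have hC : h m * C m <= kap by rewrite mulrC; exact: Ch.
have gap := one_step_gap (Yb j jN') hm jh0 jhd hC VB.
rewrite -jS in gap; set y := Y m j in IH VB rem gap *.
set z1 := S m (coef (y + h m *: V fc sg eps m y)) - _ in gap.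
have yS : S m (coef (Y m j.+1)) - S m (coef (g (j.+1%:R * h m))) =
   z1 + S m (coef (Y m j.+1 - y - h m *: V fc sg eps m y)).
  have -> : S m (coef (Y m j.+1 - y - h m *: V fc sg eps m y)) = S m (coef (Y m j.+1)) - S m (coef (y + h m *: V fc sg eps m y)).
    by rewrite S_subH opprD addrA.
  by rewrite /z1 [RHS]addrC subrKA.
have remb : n2 (S m (coef (Y m j.+1 - y - h m *: V fc sg eps m y))) <= kap * h m.
  rewrite -[S _ _]Dn0; apply: le_trans (n2_Dn_S_le _ _ (leq0n p)) _; apply: le_trans rem _.
  by rewrite expr2 mulrA ler_wpM2r//; exact: Ch.
have z1b : n2 z1 <= 2 * (r + 1).
  rewrite /z1 S_subH -[S _ _]Dn0; apply: le_trans (n2_Dn_S_le _ _ (leq0n p)) _.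
  apply: le_trans (ler_normB _ _) _.
  have v1 : `|h m *: V fc sg eps m y| <= 1.
    by rewrite normrZ ger0_norm//; apply: le_trans k1; apply: le_trans hC; rewrite ler_wpM2l.
  have v2 : `|y + h m *: V fc sg eps m y| <= r + 1.
    by apply: le_trans (ler_normD _ _) _; apply: lerD => //; exact: Yb.
  have v3 : `|g (j.+1%:R * h m)| <= R0 := gR _ jN.
  have -> : 2 * (r + 1) = (r + 1) + (r + 1) by ring.
  by apply: lerD => //; apply: le_trans v3 _; rewrite -addrA lerDl.
rewrite yS.
apply: le_trans (_ : (n2 z1 + kap * h m) ^+ 2 <= _).
  rewrite lerXn2r ?nnegrE ?n2_ge0 ?addr_ge0 ?n2_ge0 ?mulr_ge0//.
  by apply: le_trans (n2D _ _) _; rewrite lerD2l.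
have kh1 : kap * h m <= 1.
  rewrite -[leRHS]mulr1; apply: ler_pM => //; apply: le_trans d1; apply: le_trans jhd; by rewrite lerDr.
have sq : (n2 z1 + kap * h m) ^+ 2 <= n2 z1 ^+ 2 + kap * h m * (4 * (r + 1) + 1).
  have -> : (n2 z1 + kap * h m) ^+ 2 = n2 z1 ^+ 2 + kap * h m * (2 * n2 z1 + kap * h m) by ring.
  rewrite lerD2l; apply: ler_wpM2l; first by rewrite mulr_ge0.
  apply: lerD => //; rewrite (_ : 4 * (r + 1) = 2 * (2 * (r + 1))); last by ring.
  by rewrite ler_wpM2l.
apply: le_trans sq _.
have e1 : 1 <= expR (alpha * h m) by rewrite -expR0 ler_expR mulr_ge0.
have e2 : 1 <= expR (alpha * (j%:R * h m)) by rewrite -{1}expR0 ler_expR; exact: mulr_ge0.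
have eE : expR (alpha * (j.+1%:R * h m)) = expR (alpha * h m) * expR (alpha * (j%:R * h m)).
  by rewrite jS mulrDr expRD mulrC.
have w0 : 0 <= kap * h m * (4 * (r + 1) + 1) by rewrite !mulr_ge0 ?addr_ge0 ?mulr_ge0.
have w1 : 0 <= beta0 * kap * h m by apply: mulr_ge0 => //; exact: mulr_ge0.
apply: le_trans (lerD gap (lexx _)) _.
apply: le_trans (_ : expR (alpha * h m) * (expR (alpha * (j%:R * h m)) * (j%:R * h m * (gap_const * kap)) + beta0 * kap * h m + kap * h m * (4 * (r + 1) + 1)) <= _).
  rewrite [leRHS]mulrDr; apply: lerD; last by rewrite ler_peMl.
  by apply: ler_wpM2l; [exact: expR_ge0|rewrite lerD2r].
rewrite eE -[leRHS]mulrA; apply: ler_wpM2l; first exact: expR_ge0.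
have -> : expR (alpha * (j%:R * h m)) * (j.+1%:R * h m * (gap_const * kap)) =
  expR (alpha * (j%:R * h m)) * (j%:R * h m * (gap_const * kap)) + expR (alpha * (j%:R * h m)) * (beta0 * kap * h m + kap * h m * (4 * (r + 1) + 1)).
  by rewrite jS /gap_const; ring.
rewrite -addrA lerD2l ler_peMl// addr_ge0//.
Qed.

Lemma scheme_cvg k : k != 0 -> (fun m => coef (Y m (N m)) k) @ \oo --> coef (g delta) k.
Proof.
move=> k0; pose B := expR (alpha * delta) * (delta * gap_const).
have l0 := L0; have R0' := R00; have rr : 0 <= r + 1 by rewrite !addr_ge0.
have b0 : 0 <= beta0 by rewrite /beta0 mulr_ge0// !addr_ge0 ?mulr_ge0 ?sqr_ge0 ?addr_ge0.
have gc0 : 0 <= gap_const.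
  by rewrite /gap_const; apply: addr_ge0 => //; apply: addr_ge0 => //; rewrite mulr_ge0.
have B0 : 0 <= B by rewrite mulr_ge0 ?expR_ge0// mulr_ge0.
have lim : (fun m : nat => Num.sqrt (B * m.+1%:R^-1)) @ \oo --> Num.sqrt (B * 0).
  apply: (continuous_cvg _ (@sqrt_continuous R _)); apply: cvgM; first exact: cvg_cst.
  exact: cvg_harmonic.
rewrite mulr0 sqrtr0 in lim.
(* The mode [k] belongs to [idx m] only when [m] exceeds its absolute value. *)
rewrite -(cvg_shiftn `|k|.+1); apply: (cvg_dist_le _ (tau := fun m => Num.sqrt (B * (m + `|k|.+1).+1%:R^-1))).
  by have := lim; rewrite -(cvg_shiftn `|k|.+1).
move=> n /=; set m := (n + _)%N.
have km : k \in idx m by rewrite mem_idx k0/= /m addnS ltnS leq_addl.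
have := scheme_gap (leqnn (N m)); rewrite Nh S_subH => hg.
rewrite -sob_coefB; have := @coef_le_n2 R (coef (Y m (N m) - g delta)) 0 k m km.
rewrite expr0 mul1r Dn0 => h1; apply: le_trans h1 _.
rewrite -[leLHS]ger0_norm ?n2_ge0// -sqrtr_sqr ler_wsqrtr//; apply: le_trans hg _.
by rewrite /B -!mulrA.
Qed.

End scheme_convergence.

(** * Comparison of measures along the flow *)

Section coordinate_topology.
Variables (R : realType) (p : nat).
Local Notation q := (p%:R : R).
Local Notation H := (sobolev q).
Local Notation bH := (borelH R p).
Implicit Types (u v : H) (k : int) (A O F : set bH).

Definition coef_cvg (v : nat -> H) u := forall k, k != 0 -> (fun n => coef (v n) k) @ \oo --> coef u k.
(** Openness tested on sequences that converge coefficient by coefficient, the only convergence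
    established for the scheme. *)
Definition seq_open (O : set bH) := forall (v : nat -> H) u, coef_cvg v u -> O u -> \forall n \near \oo, O (v n).

Lemma seq_open_bigcup (O : nat -> set bH) : (forall n, seq_open (O n)) -> seq_open (\bigcup_n O n).
Proof.
move=> h v u vu [n _ On]; apply: filterS (h n v u vu On) => m Om; by exists n.
Qed.

Lemma seq_open_setI O1 O2 : seq_open O1 -> seq_open O2 -> seq_open (O1 `&` O2).
Proof. by move=> h1 h2 v u vu [ o1 o2]; apply: filterI; [exact: h1 vu o1|exact: h2 vu o2]. Qed.

Variable eta : probability bH R.

Definition regular_set A := forall e : R, 0 < e -> exists F O : set bH,
  [/\ seq_open (~` F) /\ seq_open O, measurable F /\ measurable O, F `<=` A, A `<=` O & (eta (O `\` F) <= e%:E)%E].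

Lemma regular_setC A : regular_set A -> regular_set (~` A).
Proof.
move=> h e e0; have [F [ O [[sF sO] [mF mO] FA AO le]]] := h e e0.
exists (~` O), (~` F); split.
- by rewrite setCK.
- by split; exact: measurableC.
- exact: subsetC.
- exact: subsetC.
- by apply: le_trans le; rewrite le_eqVlt; apply/orP; left; apply/eqP; congr (eta _); rewrite !setDE setCK setIC.
Qed.

Lemma regular_setI A B : regular_set A -> regular_set B -> regular_set (A `&` B).
Proof.
move=> hA hB e e0; have e20 : 0 < e / 2 by rewrite divr_gt0.
have [F [ O [[sF sO] [mF mO] FA AO le]]] := hA _ e20.
have [F' [ O' [[sF' sO'] [mF' mO'] FA' AO' le']]] := hB _ e20.
exists (F `&` F'), (O `&` O'); split.
- split; last exact: seq_open_setI.
  rewrite setCI => v u vu [Fu|Fu].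
    by apply: filterS (sF v u vu Fu) => n ?; left.
  by apply: filterS (sF' v u vu Fu) => n ?; right.
- by split; exact: measurableI.
- exact: setISS.
- exact: setISS.
- apply: le_trans (_ : eta ((O `\` F) `|` (O' `\` F')) <= _)%E.
    apply: le_measure; rewrite ?inE.
    + by apply: measurableD; exact: measurableI.
    + by apply: measurableU; exact: measurableD.
    + move=> u [[ o1 o2]] nF; have [f|f] := pselect (F u); [right|left]; split=> // f'.
      by apply: nF.
  apply: le_trans (measureU2 _ _ _) _; rewrite ?inE; try exact: measurableD.
  by apply: le_trans (leeD le le') _; rewrite -EFinD -splitr.
Qed.

(** A countable union of inner sets need not be closed; a finite one is, and continuity from above
    makes its defect small. *)
Lemma regular_bigcup (A : nat -> set bH) : (forall n, regular_set (A n)) -> regular_set (\bigcup_n A n).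
Proof.
move=> hA e e0; have e20 : 0 < e / 2 by rewrite divr_gt0.
pose en n : R := e / 2 / (2 ^ n.+1)%:R.
have en0 n : 0 < en n by rewrite divr_gt0// ltr0n expn_gt0.
have /choice[F /choice[ O hFO]] : forall n, exists F O : set bH, [/\ seq_open (~` F) /\ seq_open O,
    measurable F /\ measurable O, F `<=` A n, A n `<=` O & (eta (O `\` F) <= (en n)%:E)%E].
  by move=> n; exact: hA.
have mF n : measurable (F n) by have [_ []] := hFO n.
have mO n : measurable (O n) by have [_ []] := hFO n.
pose Oo := \bigcup_n O n; have mOo : measurable Oo by exact: bigcup_measurable.
pose Fn n := \bigcup_(i in `I_n) F i.
have mFn n : measurable (Fn n) by apply: bigcup_measurable.
have lim : eta (Oo `\` Fn n) @[n --> \oo] --> eta (\bigcap_n (Oo `\` Fn n)).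
  apply: nonincreasing_cvg_mu.
  - by apply: (@le_lt_trans _ _ 1%E); [exact: probability_le1 (measurableD mOo (mFn 0%N))|rewrite ltry].
  - by move=> n; exact: measurableD.
  - by apply: bigcap_measurable => // n _; exact: measurableD.
  - move=> n m nm; apply/subsetPset => u [ Ou nF]; split=> // -[i /= im Fi]; apply: nF; exists i => //=.
    exact: leq_trans nm.
have lim_le : (eta (\bigcap_n (Oo `\` Fn n)) <= (e / 2)%:E)%E.
  have h1 : (eta (\bigcap_n (Oo `\` Fn n)) <= \sum_(n <oo) eta (O n `\` F n))%E.
    apply: measure_sigma_subadditive.
    - by move=> n; exact: measurableD.
    - by apply: bigcap_measurable => // n _; exact: measurableD.
    - move=> u nF; have [[n _ On] _] := nF 0%N Logic.I; exists n => //; split=> // Fnu.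
      by have [_] := nF n.+1 Logic.I; apply; exists n => /=.
  apply: le_trans h1 _; apply: le_trans (_ : (\sum_(n <oo) (en n)%:E <= _)%E).
    by apply: lee_nneseries => [n _ _|n _]; [exact: measure_ge0|have [_ _ _ _] := hFO n].
  exact: epsilon_trick0 (ltW e20).
have [n hn] : exists n, (eta (Oo `\` Fn n) <= e%:E)%E.
  apply: contrapT => hno.
  have : (e%:E <= eta (\bigcap_n (Oo `\` Fn n)))%E.
    apply: (cvge_to_ge lim); apply: nearW => n; rewrite leNgt; apply/negP => lt; apply: hno.
    by exists n; exact: ltW.
  move=> /le_trans/(_ lim_le); rewrite lee_fin leNgt => /negP; apply.
  by rewrite ltr_pdivrMr// ltr_pMr// ltr1n.
exists (Fn n), Oo; split.
- split; last by apply: seq_open_bigcup => i; have [[_ ?] _ _ _ _] := hFO i.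
  move=> v u vu nF.
  have : \forall m \near \oo, forall i : 'I_n, ~ F i (v m).
    apply: filter_forall => i; have [[sF _] _ _ _ _] := hFO i.
    by apply: (sF v u vu) => Fi; apply: nF; exists i => /=.
  apply: filterS => m hm [i /= im Fi]; exact: hm (Ordinal im) Fi.
- by split.
- by move=> u [i _ Fi]; exists i => //; have [_ _ FA _ _] := hFO i; exact: FA.
- by move=> u [i _ Ai]; exists i => //; have [_ _ _ AO _] := hFO i; exact: AO.
- exact: hn.
Qed.

Lemma seq_open_coef k (B : set R) : k != 0 -> open B -> seq_open [set u : H | B (coef u k)].
Proof.
by move=> k0 oB v u vu Bu; apply: (vu k k0); exact: open_nbhs_nbhs.
Qed.

(** The sets that can be approximated form a sigma-algebra. It contains the open half-lines in each
    coefficient, approximated from inside by closed ones, hence the cylinders and all Borel sets. *)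
Lemma regular_measurable (A : set bH) : measurable A -> regular_set A.
Proof.
have sigma_closed : sigma_algebra setT [set A : set bH | regular_set A].
  have r0 : regular_set set0.
    move=> e e0; exists set0, set0; split => //.
    - by split; [rewrite setC0 => v u _ _; exact: nearW|move=> v u _ []].
    - by rewrite setD0 measure0 lee_fin ltW.
  split=> //; first by move=> B hB; rewrite /= setTD; exact: regular_setC.
  exact: regular_bigcup.
have [s0 sC sU] := sigma_closed.
have mk k (D : set R) : measurable D -> measurable ([set u : H | D (coef u k)] : set bH).
  by move=> mD; have := @measurable_coef R p k measurableT _ mD; rewrite setTI.
have ray k (x : R) : k != 0 -> regular_set [set u : H | `]x, +oo[%classic (coef u k)].
  move=> k0 e e0; pose F n : set bH := [set u : H | `[x + n.+1%:R^-1, +oo[%classic (coef u k)].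
  set A0 := [set u : H | _]; have mA0 : measurable (A0 : set bH) by apply: mk.
  have mF n : measurable (F n) by apply: mk.
  have lim : eta (A0 `\` F n) @[n --> \oo] --> eta (\bigcap_n (A0 `\` F n)).
    apply: nonincreasing_cvg_mu.
    - by apply: (@le_lt_trans _ _ 1%E); [exact: probability_le1 (measurableD mA0 (mF 0%N))|rewrite ltry].
    - by move=> n; exact: measurableD.
    - by apply: bigcap_measurable => // n _; exact: measurableD.
    - move=> n m nm; apply/subsetPset => u [Au nF]; split=> // Fm; apply: nF; move: Fm.
      rewrite /F /= !in_itv/= !andbT; apply: le_trans; rewrite lerD2l lef_pV2 ?posrE ?ltr0n//.
      by rewrite ler_nat ltnS.
  have E0 : \bigcap_n (A0 `\` F n) = set0.
    apply/seteqP; split => // u nF; have [Au _] := nF 0%N Logic.I.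
    move: Au; rewrite /A0 /= in_itv/= andbT => xu.
    have ux : 0 < coef u k - x by rewrite subr_gt0.
    have [n hn] := ltr_add_invr ux.
    have [_] := nF n Logic.I; apply; rewrite /F /= in_itv/= andbT -lerBrDl.
    by move: hn; rewrite add0r => /ltW.
  rewrite E0 measure0 in lim.
  have [n hn] : exists n, (eta (A0 `\` F n) <= e%:E)%E.
    apply: contrapT => hno.
    have : (e%:E <= 0)%E.
      apply: (cvge_to_ge lim); apply: nearW => n; rewrite leNgt; apply/negP => lt; apply: hno.
      by exists n; exact: ltW.
    by rewrite lee_fin leNgt e0.
  exists (F n), A0; split=> //.
  - split; last by apply: (@seq_open_coef k `]x, +oo[%classic) => //; exact: interval_open.
    rewrite (_ : ~` F n = [set u : H | `]-oo, (x + n.+1%:R^-1)[%classic (coef u k)]).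
      by apply: seq_open_coef => //; exact: interval_open.
    apply/seteqP; split => u; rewrite /F /= !in_itv/= ?andbT => h; first by rewrite ltNge; apply/negP.
    by apply/negP; rewrite -ltNge.
  - move=> u; rewrite /F /A0 /= !in_itv/= !andbT; apply: lt_le_trans.
    by rewrite ltrDl invr_gt0 ltr0n.
have one k B : k != 0 -> measurable B -> regular_set [set u : H | B (coef u k)].
  move=> k0 mB; have : <<s @RGenOInfty.G R >> B.
    have E1 : <<s @ocitv R >> = <<s @RGenOInfty.G R >> := RGenOInfty.measurableE R.
    by rewrite -E1.
  suff : <<s @RGenOInfty.G R >> `<=` [set B' | regular_set [set u : H | B' (coef u k)]] by move=> h /h.
  apply: smallest_sub.
    split.
    - by rewrite /= (_ : [set u | _] = set0).
    - move=> B' hB'; rewrite /= (_ : [set u : H | _] = ~` [set u : H | B' (coef u k)]); first exact: regular_setC.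
      by apply/seteqP; split => u /=; [move=> []|].
    - move=> F hF; rewrite /= (_ : [set u : H | _] = \bigcup_n [set u : H | F n (coef u k)]); first exact: regular_bigcup.
      by apply/seteqP; split.
  by move=> _ [x ->] /=; exact: ray.
move=> mA; have : <<s @cyl R p >> A by move: mA; rewrite measurable_cyl.
suff : <<s @cyl R p >> `<=` [set A : set bH | regular_set A] by move=> h /h.
apply: smallest_sub => // _ [s [B [_ s0' mB ->]]] /=.
elim: s s0' => [|k s IH] s0'.
  rewrite (_ : [set u | _] = ~` set0); first exact: regular_setC.
  by rewrite setC0; apply/seteqP; split.
move: s0'; rewrite in_cons negb_or eq_sym => /andP[k0 s0'].
rewrite (_ : [set u | _] = [set u : H | B k (coef u k)] `&` [set u : H | forall k, k \in s -> B k (coef u k)]).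
  by apply: regular_setI; [exact: one|exact: IH].
apply/seteqP; split => u /=.
  by move=> h; split; [apply: h; rewrite mem_head|move=> j js; apply: h; rewrite in_cons js orbT].
by move=> [h1 h2] j; rewrite in_cons => /predU1P[->|/h2].
Qed.

End coordinate_topology.

Section coordinate_limits.
Variables (R : realType) (p : nat).
Local Notation q := (p%:R : R).
Local Notation H := (sobolev q).
Local Notation bH := (borelH R p).
Variable Z : nat -> bH -> bH.
Hypothesis mZ : forall m, measurable_fun [set: bH] (Z m).

(** The upper limit is measurable whether or not the scheme converges at [y]; where these values do
    not define an element of the space, [limH] is 0. *)
Definition limcoef (y : H) (k : int) : R :=
  if k == 0 then 0 else fine (limn_esup (fun m => (coef (Z m y : H) k)%:E)).
Definition limH (y : H) : H := insubd 0 (limcoef y).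

Lemma limH_eq (y w : H) : (forall k, k != 0 -> (fun m => coef (Z m y : H) k) @ \oo --> coef w k) -> limH y = w.
Proof.
move=> h; have E : limcoef y = coef w.
  apply/funext => k; rewrite /limcoef; case: eqP => [->|/eqP k0]; first by have [] := coefP w.
  have hc : (fun m => (coef (Z m y : H) k)%:E) @ \oo --> (coef w k)%:E.
    by apply: cvg_EFin; [exact: nearW|exact: h].
  by rewrite (cvg_limn_einf_sup hc).2.
by rewrite /limH E; apply: val_inj; rewrite insubdK//; exact: valP.
Qed.

Lemma measurable_limH : measurable_fun [set: bH] (limH : bH -> bH).
Proof.
have ml k : measurable_fun [set: bH] (fun y : bH => limcoef y k).
  rewrite /limcoef; case: eqP => [_|_]; first exact: measurable_cst.
  apply: measurableT_comp; first exact: fine_measurable.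
  apply: measurable_fun_limn_esup => m; apply/measurable_EFinP.
  exact: (measurableT_comp (@measurable_coef R p k) (mZ m)).
pose D : set bH := [set y : H | limcoef y \in sob_pred q].
have mD : measurable D.
  rewrite (_ : D = \bigcup_M \bigcap_n [set y : H | nq q n (limcoef y) <= M%:R ^+ 2]).
    apply: bigcup_measurable => M _; apply: bigcap_measurable => // n _.
    have mn : measurable_fun [set: bH] (fun y : bH => nq q n (limcoef y)).
      rewrite /nq; apply: measurable_sum => k; apply: measurable_funM => //.
      by apply: measurable_funX; exact: ml.
    have := mn measurableT _ (measurable_itv `]-oo, (M%:R ^+ 2)]); rewrite setTI.
    by congr (measurable _); apply/seteqP; split => y /=; rewrite in_itv.
  apply/seteqP; split => y /=.
    rewrite /D /= => /asboolP[_ fin].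
    have [M _ hM] : exists2 M : nat, True & coef_norm q (limcoef y) <= M%:R.
      by exists (Num.truncn (coef_norm q (limcoef y))).+1 => //; exact/ltW/truncnS_gt.
    exists M => // n _ /=; apply: le_trans (nq_le _ fin) _.
    by rewrite lerXn2r ?nnegrE// coef_norm_ge0.
  move=> [M _ hM]; apply/asboolP; split; first by rewrite /limcoef eqxx.
  by have [] := @coef_norm_le R q (limcoef y) M%:R (ler0n _ _) (fun n => hM n Logic.I).
apply: measurable_toH => k k0.
rewrite (_ : (fun t => _) = (fun y => \1_D y * limcoef y k)).
  by apply: measurable_funM => //; exact: measurable_indic.
apply/funext => y; rewrite /limH indicE.
have -> : coef (insubd (0 : H) (limcoef y)) k = (if limcoef y \in sob_pred q then limcoef y else coef (0 : H)) k.
  by rewrite -[coef (insubd (0 : H) _)]/(val (insubd (0 : H) (limcoef y))) val_insubd.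
have [hy|hy] := boolP (limcoef y \in sob_pred q); first by rewrite mem_set// mul1r.
by rewrite memNset ?mul0r//; apply/negP.
Qed.

End coordinate_limits.

Lemma within_comp (R : realType) (f : R -> R) (phi : R -> R) (a b : R) : continuous phi ->
  (forall s, 0 <= s <= a -> 0 <= phi s <= b) -> {within `[0, b], continuous f} ->
  {within `[0, a], continuous (f \o phi)}.
Proof.
move=> cphi hphi /subspace_continuousP cf; apply/subspace_continuousP => s sa.
have pb : `[0, b]%classic (phi s) by rewrite /= in_itv/=; apply: hphi; move: sa; rewrite /= in_itv.
apply: cvg_comp (cf _ pb) => P; rewrite /= => hP.
have hP' : nbhs (phi s) [set y | `[0, b]%classic y -> P y] := hP.
have h2 : nbhs s (phi @^-1` [set y | `[0, b]%classic y -> P y]) := cphi s _ hP'.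
suff : nbhs s [set x | `[0, a]%classic x -> P (phi x)] by [].
apply: filterS h2 => x hx xa; apply: hx.
by rewrite /= in_itv/=; apply: hphi; move: xa; rewrite /= in_itv.
Qed.

(** * Comparison over a short time *)

Section flow_comparison.
Variables (R : realType) (p : nat) (c : R) (K : mpoly.mpoly p R).
Local Notation q := (p%:R : R).
Local Notation H := (sobolev q).
Local Notation bH := (borelH R p).
Hypothesis p3 : (3 <= p)%N.
Implicit Types (u v : H) (k : int) (n m j : nat).

Lemma trajectory_rev (fc : H -> int -> R) sg eps R0 delta (g : R -> H) : trajectory fc sg eps R0 delta g ->
  trajectory fc (- sg) eps R0 delta (fun t => g (delta - t)).
Proof.
move=> [g1 g2 g3]; split.
- by move=> t /andP[t0 t1]; apply: g1; rewrite subr_ge0 t1/= gerBl.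
- move=> k k0; apply: (@within_comp _ (fun t => coef (g t) k) (fun t => delta - t) _ delta) (g2 k k0).
    by move=> s; apply: cvgB; [exact: cvg_cst|exact: cvg_id].
  by move=> s /andP[s0 s1]; rewrite subr_ge0 s1/= gerBl.
- move=> t /andP[t0 t1] k k0.
  have tt : 0 < delta - t < delta by rewrite subr_gt0 t1/= gtrBl.
  have d1 := g3 _ tt k k0.
  have d2 : is_derive t 1 (fun s : R => delta - s) (- 1) by apply: is_derive_eq; rewrite /GRing.scale/=; ring.
  have := @is_derive1_comp R (fun s => coef (g s) k) (fun s => delta - s) t _ _ d1 d2.
  rewrite (_ : - sg * _ = sg * (Wk (g (delta - t)) k + eps * fc (g (delta - t)) k) * - 1)//.
  by ring.
Qed.

Variable G : tpoly R -> 'I_p -> tpoly R.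
Hypothesis G_bnd : bounded_gradient p G.
Hypothesis G_taylor : taylor_functional p c K G.
Hypothesis Psi_conserved : forall X, I X = 0 -> conserved p.+1 X = Psi c K X.

Variable fc : H -> int -> R.
Hypothesis fc_lip : locally_two_smoothing fc.
Hypothesis fc_bound : smoothing_bound p fc.

Variable eta : probability bH R.
Hypothesis eta_gauss : is_gaussian eta.
Variable J : H -> R.
Hypothesis J_lim : forall u, (fun m => JX c K (S m u)) @ \oo --> J u.
Local Notation E := (EE eta).
Local Notation ball M := (closed_ballH M : set bH).

(** [d0] and [Cst] depend on the radius alone, not on [sg] or [eps]: [d0] is the time during which
    the scheme provably stays in the ball of radius [R0 + 1]. *)
Lemma approximate_flow (R0 : R) : 0 <= R0 -> exists d0 Cst : R, [/\ 0 < d0, 0 <= Cst &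
  forall sg eps delta : R, `|sg| = 1 -> 0 <= eps <= 1 -> 0 < delta <= d0 ->
  exists Z : nat -> bH -> bH, [/\ forall m, measurable_fun [set: bH] (Z m),
    forall g, trajectory fc sg eps R0 delta g -> forall k, k != 0 ->
      (fun m => coef (Z m (g 0) : H) k) @ \oo --> coef (g delta) k &
    forall A O : set bH, measurable A -> measurable O -> A `<=` ball R0 ->
      (forall u, A u -> \forall m \near \oo, O (Z m u)) ->
      E (fun u => \1_A u * expR (- J u)) <=
      expR (delta * (eps * Cst)) * E (fun u => \1_(O `&` ball (R0 + 1)) u * expR (- J u))]].
Proof.
move=> R00; pose r := R0 + 1; have r0 : 0 <= r by rewrite addr_ge0.
have [C1 C10 hC1] := energy_V p3 fc_bound r0.
have [C2 C20 hC2] := psi_V p3 G_bnd G_taylor Psi_conserved fc_bound r0.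
have [L L0 hL] := fc_lip (r + 1).
have d00 : 0 < (2 * C1 + 1)^-1 by rewrite invr_gt0 ltr_wpDl// mulr_ge0.
exists (2 * C1 + 1)^-1, (L + C2); split=> //; first by rewrite addr_ge0.
move=> sg eps delta sg1 eps01 /andP[d1 d2].
have dsmall : delta * (2 * C1 + 1) <= 1.
  by rewrite -ler_pdivlMr ?div1r// ltr_wpDl// mulr_ge0.
have : forall m, exists x : nat * (R * R), [/\ 0 < x.2.1, 0 <= x.2.2, x.1%:R * x.2.1 = delta,
    x.2.2 * x.2.1 <= m.+1%:R^-1 & macro_ok c K fc r L sg eps C1 C2 m x.2.1 x.2.2].
  move=> m.
  have [C [h0 [C0 h00 hh]]] := @macro_step R p c K p3 G G_taylor fc fc_lip r r0 sg eps L C1 C2 m sg1 eps01 L0 hL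
    (fun u ur => hC1 sg eps m u sg1 eps01 ur) (fun u ur => hC2 sg eps m u sg1 eps01 ur).
  pose y := delta / h0 + C * delta * m.+1%:R.
  have y0 : 0 <= delta / h0 by rewrite divr_ge0// ltW.
  have y1 : 0 <= C * delta * m.+1%:R by rewrite !mulr_ge0// ltW.
  pose N := (Num.truncn y).+1.
  have yN : y <= N%:R by exact/ltW/truncnS_gt.
  have N0 : (0 : R) < N%:R by rewrite ltr0n.
  exists (N, (delta / N%:R, C)) => /=; split=> //.
  - by rewrite divr_gt0.
  - by rewrite mulrC divfK// gt_eqF.
  - rewrite mulrA ler_pdivrMr// [leRHS]mulrC ler_pdivlMr ?ltr0n//.
    by apply: le_trans yN; rewrite /y lerDr.
  - apply: hh; apply/andP; split; first by rewrite divr_ge0 ?ltW.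
    rewrite ler_pdivrMr// mulrC -ler_pdivrMr//.
    by apply: le_trans yN; rewrite /y lerDl.
move=> /choice[x hx].
pose N m := (x m).1; pose h m := (x m).2.1; pose C m := (x m).2.2.
have h0 m : 0 < h m by have [] := hx m.
have C0 m : 0 <= C m by have [] := hx m.
have Nh m : (N m)%:R * h m = delta by have [] := hx m.
have Ch m : C m * h m <= m.+1%:R^-1 by have [] := hx m.
have hok m : macro_ok c K fc r L sg eps C1 C2 m (h m) (C m) by have [] := hx m.
exists (fun m => iter (N m) (run (h m) (its fc L sg eps m))); split.
- by move=> m; exact: (measurable_Y (hok m) (N m)).
- move=> g gP k k0.
  exact: (scheme_cvg p3 R00 C10 L0 sg1 eps01 hL gP h0 C0 Nh Ch dsmall hok k0).
- move=> A O mA mO AB hO.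
  exact: (measure_limit p3 G_taylor eta_gauss R00 C10 C20 L0 eps01 (fun m => ltW (h0 m)) C0 Nh Ch dsmall hok J_lim mA mO AB hO).
Qed.

Lemma J_ball_bound r : exists2 C, 0 <= C & forall u, `|u| <= r -> `|J u| <= C.
Proof.
have [CJ CJ0 hCJ] := JX_bound G_taylor r; exists CJ => // u ur.
by apply: (cvgr_to_le (cvg_norm (@J_lim u))); apply: nearW => m; exact: hCJ.
Qed.

Lemma measurable_J : measurable_fun [set: bH] (J : bH -> R).
Proof.
apply: (@measurable_fun_cvg _ _ _ _ (fun m (u : bH) => JX c K (S m (coef (u : H))))).
  by move=> m; exact: lipb_measurable (lipb_JX G_taylor m).
by move=> u _; exact: J_lim.
Qed.

Let w (u : bH) := expR (- J u).
Let mw : measurable_fun [set: bH] w.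
Proof. by apply: measurableT_comp => //; apply: measurableT_comp => //; exact: measurable_J. Qed.

Lemma ind_bound r : exists2 B : R, 0 <= B & forall (A : set bH) u, A `<=` ball r -> `|\1_A u * w u| <= B.
Proof.
have [C C0 hC] := J_ball_bound r; exists (expR C); first exact: expR_ge0.
move=> A u AB; rewrite indicE; have [Au|Au] := pselect (A u); last by rewrite memNset// mul0r normr0 expR_ge0.
rewrite mem_set// mul1r ger0_norm ?expR_ge0// ler_expR.
by have /ler_normlP[] := hC u (AB u Au).
Qed.

(** Uniqueness of trajectories comes for free, since the scheme depends on the starting point alone.
    The inequality for [sg = -1] is the one that bounds the measure of the image from above. *)
Lemma flow_le (R0 : R) : 0 <= R0 -> exists d0 Cst : R, [/\ 0 < d0, 0 <= Cst &
  forall eps delta : R, 0 <= eps <= 1 -> 0 < delta <= d0 ->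
  [/\ forall sg (A A' : set bH), `|sg| = 1 -> measurable A -> measurable A' -> A `<=` ball R0 -> A' `<=` ball R0 ->
      (forall u, A u -> exists g, [/\ trajectory fc sg eps R0 delta g, g 0 = u & A' (g delta)]) ->
      E (fun u => \1_A u * w u) <= expR (delta * (eps * Cst)) * E (fun u => \1_A' u * w u),
    forall g g', trajectory fc 1 eps R0 delta g -> trajectory fc 1 eps R0 delta g' -> g 0 = g' 0 ->
      g delta = g' delta &
    forall A : set bH, measurable A -> (forall u, A u -> exists2 g, trajectory fc 1 eps R0 delta g & g 0 = u) ->
      measurable ([set y : H | exists g, [/\ trajectory fc 1 eps R0 delta g, A (g 0) & g delta = y]] : set bH)]].
Proof.
move=> R00; have [d0 [Cst [d00 Cst0 hZ]]] := approximate_flow R00.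
exists d0, Cst; split=> // eps delta eps01 dd; have [Z [mZ Zl Zm]] := hZ 1 eps delta (normr1 _) eps01 dd.
have [d1 _] := andP dd.
split.
- move=> sg A A' sg1 mA mA' AB AB' hA.
  have [Z' [mZ' Zl' Zm']] := hZ sg eps delta sg1 eps01 dd.
  have [B B0 hB] := ind_bound (R0 + 1).
  have rR : ball R0 `<=` ball (R0 + 1) by move=> u; move/le_trans; apply; rewrite lerDl.
  have [CJ CJ0 hCJ] := J_ball_bound (R0 + 1).
  apply/ler_addgt0Pr => e e0.
  pose x := expR (delta * (eps * Cst)); have x0 : 0 < x := expR_gt0 _.
  have e1 : 0 < e / (x * expR CJ) by rewrite divr_gt0// mulr_gt0// expR_gt0.
  (* The scheme issued from [A] eventually enters the outer set [O], and the excess of [O] over [A']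
     costs at most [e] once weighted. *)
  have [F [ O [[_ sO] [mF mO] FA AO le]]] := regular_measurable eta mA' e1.
  have hO u : A u -> \forall m \near \oo, O (Z' m u).
    move=> Au; have [g [gP g0 Ag]] := hA u Au.
    by rewrite -g0; apply: sO (AO _ Ag) => k k0; exact: Zl'.
  apply: le_trans (Zm' A O mA mO AB hO) _; rewrite -/x.
  have mOA : measurable (O `\` A') by exact: measurableD.
  have EO : E (fun u => \1_(O `&` ball (R0 + 1)) u * w u) <= E (fun u => \1_A' u * w u) + expR CJ * E (\1_(O `\` A')).
    have mi D : measurable D -> measurable_fun [set: bH] (\1_D : bH -> R) by exact: measurable_indic.
    have ib D u : `|\1_D u : R| <= 1 by rewrite indicE ger0_norm//; case: (_ \in _).
    rewrite -(EE_scale _ (mi _ mOA) (ib _)) -(EE_add (B + expR CJ)).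
    + apply: (@le_EE _ _ _ _ _ _ (B + expR CJ + (B + expR CJ))).
      * by apply: measurable_funM => //; apply: mi; apply: measurableI => //; exact: measurable_closed_ballH.
      * apply: measurable_funD; first by apply: measurable_funM => //; exact: mi.
        by apply: measurable_funM => //; exact: mi.
      * move=> u; apply: le_trans (hB _ u (@subIsetr _ _ _)) _.
        by rewrite -addrA lerDl !addr_ge0 ?expR_ge0.
      * move=> u; apply: le_trans (ler_normD _ _) _; apply: lerD.
          by apply: le_trans (hB A' u (subset_trans AB' rR)) _; rewrite lerDl expR_ge0.
        rewrite normrM (gtr0_norm (expR_gt0 _)); apply: le_trans (_ : expR CJ * 1 <= _).
          by rewrite ler_wpM2l ?expR_ge0.
        by rewrite mulr1 lerDr.
      * move=> u; rewrite !indicE.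
        have [[Ou ur]|nO] := pselect ((O `&` ball (R0 + 1)) u); last first.
          by rewrite memNset// mul0r addr_ge0// mulr_ge0 ?expR_ge0.
        rewrite [in leLHS]mem_set// mul1r.
        have [Au|Au] := pselect (A' u).
          by rewrite mem_set// mul1r lerDl mulr_ge0 ?expR_ge0.
        rewrite memNset// mul0r add0r mem_set// mulr1 ler_expR.
        by have /ler_normlP[] := hCJ u ur.
    + by apply: measurable_funM => //; exact: mi.
    + by apply: measurable_funM => //; exact: mi.
    + by move=> u; apply: le_trans (hB A' u (subset_trans AB' rR)) _; rewrite lerDl expR_ge0.
    + move=> u; rewrite normrM (gtr0_norm (expR_gt0 _)); apply: le_trans (_ : expR CJ * 1 <= _).
        by rewrite ler_wpM2l ?expR_ge0.
      by rewrite mulr1 lerDr.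
  have Ee : E (\1_(O `\` A')) <= e / (x * expR CJ).
    rewrite -lee_fin -(EE_EFin (B := 1)).
    + apply: le_trans (_ : eta (O `\` A') <= _)%E; first by rewrite integral_indic// setIT.
      apply: le_trans le; apply: le_measure; rewrite ?inE; try exact: measurableD.
      by move=> u [Ou nA]; split=> // Fu; apply: nA; exact: FA.
    + exact: measurable_indic.
    + by move=> u; rewrite indicE ger0_norm//; case: (_ \in _).
  apply: le_trans (ler_wpM2l (ltW x0) EO) _; rewrite mulrDr lerD2l mulrA.
  apply: le_trans (_ : x * expR CJ * (e / (x * expR CJ)) <= _).
    by rewrite ler_wpM2l// mulr_ge0 ?expR_ge0// ltW.
  by rewrite mulrC divfK// gt_eqF// mulr_gt0// expR_gt0.
- move=> g g' gP gP' gg; apply: sob_ext => k k0.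
  have h1 := Zl g gP k k0; have h2 := Zl g' gP' k k0; rewrite -gg in h2.
  exact: (cvg_unique _ h1 h2).
- move=> A mA hA; have [Z' [mZ' Zl' _]] := hZ (- 1) eps delta (normrN1 _) eps01 dd.
  have mS := measurable_limH mZ; have mV := measurable_limH mZ'.
  have back g : trajectory fc 1 eps R0 delta g -> limH Z' (g delta) = g 0.
    move=> gP; apply: limH_eq => k k0.
    have := Zl' _ (trajectory_rev gP) k k0; rewrite subr0 subrr; exact.
  have forw g : trajectory fc 1 eps R0 delta g -> limH Z (g 0) = g delta.
    by move=> gP; apply: limH_eq => k k0; exact: Zl.
  pose dist k (y : bH) := coef (limH Z (limH Z' (y : H))) k - coef (y : H) k.
  have md k : measurable_fun [set: bH] (dist k).
    have mk := @measurable_coef R p k.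
    by apply: measurable_funB => //; apply: (measurableT_comp mk); exact: (measurableT_comp mS mV).
  have mz k : measurable ([set y | dist k y = 0] : set bH).
    by have := md k measurableT _ (measurable_set1 0); rewrite setTI.
  (* [y] is in the image exactly when the backward limit leads into [A] and the forward limit brings
     it back to [y]; both limits are measurable maps, and equality is tested on the coefficients. *)
  rewrite (_ : [set y | _] = [set y : H | A (limH Z' y)] `&` \bigcap_n ([set y : H | dist n%:Z y = 0] `&` [set y : H | dist (- n%:Z) y = 0])).
    apply: measurableI; first by have := mV measurableT _ mA; rewrite setTI.
    by apply: bigcap_measurable => // n _; exact: measurableI.
  apply/seteqP; split => y /=.
    move=> [g [gP Ag <-]]; rewrite back//; split=> // n _.
    by split; rewrite /= /dist back// forw// subrr.
  move=> [AV hk]; have [g gP g0] := hA _ AV; exists g; split=> //; first by rewrite g0.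
  apply: sob_ext => k k0; rewrite -forw// g0; apply/eqP; rewrite -subr_eq0; apply/eqP.
  have [h1 h2] := hk `|k|%N Logic.I.
  have [E1|E1] : k = `|k|%N%:Z \/ k = - `|k|%N%:Z by lia.
    by move: h1; rewrite -E1.
  by move: h2; rewrite -E1.
Qed.

End flow_comparison.

(** * From the hypotheses on $J_p$ and on $f$ to the estimates *)

Lemma finite_support_sob (R : realType) (q : R) (n : nat) (a : int -> R) :
  sob_coef q (fun k => if k \in idx n then a k else 0).
Proof.
split; first by rewrite mem_idx eqxx.
set b := (fun k => _).
apply: le_lt_trans (ltry (nq q n b)); apply: sqsum_le => m.
rewrite /nq -(sum_idx_sub _ (leq_maxl m n)) -(sum_idx_sub _ (leq_maxr m n)).
rewrite big_mkcond [leRHS]big_mkcond; apply: ler_sum => k _.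
rewrite /b; case: (k \in idx n); last by case: ifP => // _; rewrite expr0n mulr0.
by case: ifP => // _; rewrite mulr_ge0 ?sqr_ge0 ?weight_ge0.
Qed.

Lemma synth_tp (R : realType) (p : nat) (n : nat) (a : int -> R) : (3 <= p)%N ->
  synth (coef (trunc p n a)) = S n a :> (R -> R).
Proof.
move=> p3; have [L [hL dL]] := synth_derivatives (trunc p n a).
have p0 : (0 < p)%N by apply: leq_trans p3.
apply/funext => x; have := dL 0%N p0; rewrite /derive1n /= => ->.
have := hL 0%N n x p0; rewrite Dn0.
have -> : trunc p n (coef (trunc p n a)) = trunc p n a.
  by apply: sob_ext => k _; rewrite !truncE; case: (k \in idx n).
rewrite subrr normr0 normr_le0 subr_eq0 => /eqP <-.
by congr (tpfun _ x); apply: eq_S => k kn; rewrite truncE kn.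
Qed.

(** The identity [is_J] is given on sequences lying in all Sobolev spaces, which include those with
    finite support. There the coefficient norm and [J_density] are limits of eventually constant
    sequences, so they agree with the terms of [Psi]. *)
Lemma conserved_Psi (R : realType) (p : nat) (c : R) (Q : mpoly.mpoly p R) : (3 <= p)%N -> is_J c Q ->
  forall X : tpoly R, I X = 0 -> conserved p.+1 X = Psi c Q X.
Proof.
move=> p3 hJ X X0; have [n Xn] := mean0_S X0.
pose u := trunc p n (coe X).
have E m : (n <= m)%N -> S m (coef u) = X.
  by move=> nm; rewrite [RHS]Xn [RHS](S_sub _ nm); apply: eq_S => k _; rewrite truncE.
have := hJ (coef u) (fun q => finite_support_sob q n (coe X)).
rewrite synth_tp// -[S n (coe X)]Xn => ->; rewrite /Psi mulrC; congr (_ * _ + _).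
  have h1 := nq_cvg (finite_support_sob p.+1%:R n (coe X)).2.
  have h2 : (fun m => nq p.+1%:R m (coef u)) @ \oo --> n2 (Dn p.+1 X) ^+ 2.
    by apply: cvg_near_cst; exists n => // m /= nm; rewrite -sqr_n2_Dn_S E.
  exact: (cvg_unique _ h1 h2).
have r1 : 1 <= `|u| + 1 by rewrite lerDr.
have r2 : `|u| <= `|u| + 1 by rewrite lerDl.
have p0 : (0 < p)%N by apply: leq_trans p3.
have [G [_ hG]] := @J_taylor R p c Q p0.
have [CJ _ hCJ] := JX_bound hG (`|u| + 1).
have h1 := JX_limit p0 r2 r1 (fun m => hCJ m u r2).
have h2 : (fun m => JX c Q (S m (coef u))) @ \oo --> JX c Q X.
  by apply: cvg_near_cst; exists n => // m /= nm; rewrite E.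
exact: (cvg_unique _ h1 h2).
Qed.

(** The case [q = 0] of the assumption: [f] is analytic from $H^0$ to $H^2$, hence Lipschitz on
    balls by the Cauchy estimate. *)
Lemma perturbation_lip (R : realType) (p : nat) (f : (int -> R) -> (int -> R)) : assumption_ii p f ->
  locally_two_smoothing (fun u : sobolev (p%:R : R) => f (coef u)).
Proof.
move=> hf r; have [|fq fqan fqE] := hf 0; first by rewrite lexx ler0n.
have [K K0 hK] := analytic_sob_lip r fqan.
(* Elements of $H^p$ are viewed in $H^0$, with norm controlled by the $L^2$ norms of their
   truncations. *)
have emb (u : sobolev (p%:R : R)) : exists2 v : sobolev (0 : R), coef v = coef u & forall M, 0 <= M -> (forall n, n2 (S n (coef u)) <= M) -> `|v| <= M.
  have hn M : 0 <= M -> (forall n, n2 (S n (coef u)) <= M) -> (sqsum 0 (coef u) < +oo)%E /\ coef_norm 0 (coef u) <= M.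
    move=> M0 h; apply: coef_norm_le => // n; have := sqr_n2_Dn_S 0 n (coef u); rewrite Dn0 mulr0n => <-.
    by rewrite lerXn2r ?nnegrE ?n2_ge0.
  have h0 n : n2 (S n (coef u)) <= `|u|.
    by rewrite -[S _ _]Dn0; apply: le_trans (le_n2Dn (I_S _ _) (leq0n p)) (n2_Dn_norm u n).
  have su : coef u \in sob_pred 0.
    by apply/asboolP; split; [have [] := coefP u|have [] := hn _ (normr_ge0 u) h0].
  by exists (Sobolev su) => // M M0 h; have [] := hn M M0 h.
exists K => // u v ur vr M hM n.
have M0 : 0 <= M := le_trans (n2_ge0 _) (hM 0%N).
have [u' uE hu] := emb u; have [v' vE hv] := emb v.
have nb (w : sobolev (p%:R : R)) m : `|w| <= r -> n2 (S m (coef w)) <= r.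
  by move=> wr; rewrite -[S _ _]Dn0; apply: le_trans (le_n2Dn (I_S _ _) (leq0n p)) (le_trans (n2_Dn_norm w m) wr).
have r0 : 0 <= r := le_trans (normr_ge0 _) ur.
have h1 := hK u' v' (hu r r0 (fun m => nb u m ur)) (hv r r0 (fun m => nb v m vr)).
have uv : `|u' - v'| <= M.
  have [w' wE hw] := emb (u - v).
  have -> : u' - v' = w'; last exact: hw.
  apply: val_inj; rewrite /= -[val w']/(coef w') wE; apply/funext => k.
  by rewrite sob_coefB -uE -vE.
apply: le_trans (le_trans h1 (ler_wpM2l K0 uv)).
rewrite -[leLHS]ger0_norm ?n2_ge0// -sqrtr_sqr -[leRHS]ger0_norm// -sqrtr_sqr; apply: ler_wsqrtr.
rewrite sqr_n2_Dn_S; have -> (a : int -> R) : nq 2 n a = nq (0 + 2) n a by rewrite add0r.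
by have := nq_le_norm n (fq u' - fq v'); rewrite -uE -vE -!fqE.
Qed.

(** The case [q = p] of the assumption, which yields the two derivatives gained at the top order. *)
Lemma perturbation_bound (R : realType) (p : nat) (f : (int -> R) -> (int -> R)) : assumption_ii p f ->
  smoothing_bound p (fun u : sobolev (p%:R : R) => f (coef u)).
Proof.
move=> hf r; have [|fq fqan fqE] := hf p%:R; first by rewrite ler0n lexx.
have [K K0 hK] := analytic_sob_bound r fqan.
exists K => // u ur n; apply: le_trans (hK u ur).
rewrite -[leLHS]ger0_norm ?n2_ge0// -sqrtr_sqr -[leRHS]ger0_norm// -sqrtr_sqr; apply: ler_wsqrtr.
by rewrite sqr_n2_Dn_S natrD -fqE; exact: nq_le_norm.
Qed.

Section solutions.
Variables (R : realType) (p : nat) (f : (int -> R) -> (int -> R)).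
Local Notation H := (sobolev (p%:R : R)).

Lemma solution_trajectory (eps L R0 delta t0 : R) (u0 : H) (u : R -> H) :
  is_solution f eps L u0 u -> (forall t, 0 <= t <= L -> `|u t| <= R0) -> 0 <= t0 -> t0 + delta <= L ->
  trajectory (fun v => f (coef v)) 1 eps R0 delta (fun s => u (t0 + s)).
Proof.
move=> [_ cu du] uR t00 tL; split.
- move=> t /andP[t1 t2]; apply: uR; rewrite addr_ge0//=.
  by apply: le_trans tL; rewrite lerD2l.
- move=> k k0; apply: (@within_comp _ (fun t => coef (u t) k) (fun t => t0 + t) _ L).
  + by move=> s; apply: cvgD; [exact: cvg_cst|exact: cvg_id].
  + by move=> s /andP[s0 s1]; rewrite addr_ge0//= (le_trans _ tL)// lerD2l.
  + move=> s; apply: (continuous_cvg _ (@coef_continuous R p k (u s))); exact: cu.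
- move=> t /andP[t1 t2] k k0.
  have tt : 0 < t0 + t < L by rewrite ltr_wpDl//= (lt_le_trans _ tL)// ltrD2l.
  have d1 := du _ tt k k0.
  have d2 : is_derive t 1 (fun s : R => t0 + s) 1 by apply: is_derive_eq; rewrite /GRing.scale/=; ring.
  have := @is_derive1_comp R (fun s => coef (u s) k) (fun s => t0 + s) t _ _ d1 d2.
  by rewrite mulr1 mul1r.
Qed.

End solutions.

(** * Concatenation of short times *)

Section assembly.
Variables (R : realType) (p : nat) (T : R) (f : (int -> R) -> (int -> R)).
Variables (c : R) (Q : mpoly.mpoly p R) (eta : probability (borelH R p) R).
Local Notation H := (sobolev (p%:R : R)).
Local Notation bH := (borelH R p).
Hypotheses (p3 : (3 <= p)%N) (T0 : 0 < T) (hA : assumptionA p f T) (hJ : is_J c Q) (eta_gauss : is_gaussian eta).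
Local Notation J := (fun u : H => J_density c Q u).
Local Notation E := (EE eta).
Local Notation w := (fun u : bH => expR (- J_density c Q (coef (u : H)))).
Local Notation ball M := (closed_ballH M : set bH).

Variable G : tpoly R -> 'I_p -> tpoly R.
Hypothesis G_bnd : bounded_gradient p G.
Hypothesis G_taylor : taylor_functional p c Q G.

Let J_lim (u : H) : (fun m => JX c Q (S m (coef u))) @ \oo --> J u.
Proof.
have r1 : 1 <= `|u| + 1 by rewrite lerDr.
have r2 : `|u| <= `|u| + 1 by rewrite lerDl.
have [CJ _ hCJ] := JX_bound G_taylor (`|u| + 1).
by apply: (JX_limit _ r2 r1 (fun m => hCJ m u r2)); apply: leq_trans p3.
Qed.

Let mw : measurable_fun [set: bH] w.
Proof. by apply: measurableT_comp => //; apply: measurableT_comp => //; exact: (measurable_J G_taylor J_lim). Qed.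

Lemma mu_of_EE M (A : set bH) : measurable A -> A `<=` ball M -> mu_of eta J A = (E (fun u => \1_A u * w u))%:E.
Proof.
move=> mA AB; have [B B0 hB] := ind_bound G_taylor J_lim M.
rewrite -(EE_EFin (B := B)); last 2 first.
- by apply: measurable_funM => //; exact: measurable_indic.
- by move=> u; exact: hB.
rewrite /mu_of integral_mkcond; apply: eq_integral => u _.
by rewrite patchE indicE; case: ifPn => h; rewrite ?mul1r ?mul0r.
Qed.

Lemma mu_regular : regular_measure (mu_of eta J).
Proof.
move=> g gan gne; have N0 := zero_set_null eta_gauss gan gne.
have mg : measurable_fun [set: bH] (g : bH -> R) by apply: continuous_measurableH; exact: analytic_fun_continuous.
apply: null_set_integral => //.
- by have := mg measurableT _ (measurable_set1 0); rewrite setTI.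
- by apply/measurable_EFinP; exact: measurable_funTS.
Qed.

Lemma mu_ball M : 0 < M -> (0 < mu_of eta J (closed_ballH M) < +oo)%E.
Proof.
move=> M0; have mB : measurable (ball M) by exact: measurable_closed_ballH.
rewrite (mu_of_EE (M := M) mB)// ltry andbT lte_fin.
have [CJ CJ0 hCJ] := J_ball_bound G_taylor J_lim M; have [B B0 hB] := ind_bound G_taylor J_lim M.
have mi : measurable_fun [set: bH] (\1_(ball M) : bH -> R) by exact: measurable_indic.
have ib u : `|\1_(ball M) u : R| <= 1 by rewrite indicE ger0_norm//; case: (_ \in _).
have p0 : 0 < E (\1_(ball M)).
  rewrite -lte_fin -(EE_EFin mi ib); apply: lt_le_trans (closed_ball_gt0 eta_gauss M0) _.
  by rewrite integral_indic// setIT.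
apply: lt_le_trans (_ : 0 < expR (- CJ) * E (\1_(ball M))) _; first by rewrite mulr_gt0 ?expR_gt0.
rewrite -(EE_scale _ mi ib); apply: (@le_EE _ _ _ _ _ _ (B + 1)).
- exact: measurable_funM.
- exact: measurable_funM.
- move=> u; rewrite normrM gtr0_norm ?expR_gt0//; apply: le_trans (_ : 1 * 1 <= _); last by rewrite mul1r lerDr.
  by apply: ler_pM => //; rewrite ?expR_ge0// -expR0 ler_expR oppr_le0.
- by move=> u; apply: le_trans (hB _ u (fun=> id)) _; rewrite lerDl.
- move=> u; rewrite mulrC indicE; have [uB|uB] := pselect (ball M u); last by rewrite memNset// !mul0r.
  by rewrite mem_set// !mul1r ler_expR lerN2; have /ler_normlP[] := hCJ u uB.
Qed.

(** The a priori bound confines every solution issued from the ball to one ball of radius [R0] up to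
    time [T / eps], so the same short-time estimate serves all pieces. The factors multiply to
    $e^{t\epsilon C}$, and $t\epsilon=\tau$. *)
Lemma mu_quasi_invariant M : 0 < M -> exists C : R, forall (eps tau : R) (A : set H),
  0 < eps <= 1 -> 0 <= tau <= T -> measurable (A : set bH) -> A `<=` closed_ballH M ->
  ((expR (- (tau * C)))%:E * mu_of eta J A <= mu_of eta J (slow_flow f T eps tau @` A)
     <= (expR (tau * C))%:E * mu_of eta J A)%E.
Proof.
move=> M0; have [[Cap [Cbd hsol]] hii] := hA.
have [K0 hK0] := Cbd M.
(* [K0] bounds the solutions issued from the ball of radius [M]; the maximum also makes [R0]
   nonnegative and keeps [A] in the ball. *)
pose R0 := Num.max K0 M; have R00 : 0 <= R0 by rewrite le_max (ltW M0) orbT.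
have [d0 [Cst [d00 Cst0 hflow]]] := flow_le p3 G_bnd G_taylor (conserved_Psi p3 hJ)
   (perturbation_lip hii) (perturbation_bound hii) eta_gauss J_lim R00.
exists Cst => eps tau A eps01 /andP[tau0 tauT] mA AB.
have [e0 e1] := andP eps01; have eps01' : 0 <= eps <= 1 by rewrite ltW.
pose Lt := T / eps; have t_le : tau / eps <= Lt by rewrite ler_pM2r ?invr_gt0.
(* The same choice of solution as in [slow_flow], so that the image of [A] is [W (tau / eps)] by
   computation. *)
pose U (om : H) := xget (fun=> om) [set u | is_solution f eps Lt om u].
have Usol om : is_solution f eps Lt om (U om).
  have [u [us _ _]] := hsol eps om eps01.
  by apply: (@xgetPex _ _ [set u | is_solution f eps Lt om u]); exists u.
have Ubd om : A om -> forall t, 0 <= t <= Lt -> `|U om t| <= R0.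
  move=> Aom t tt; have [u [us uu ub]] := hsol eps om eps01.
  rewrite (uu _ (Usol om) t tt); apply: le_trans (ub t tt) _.
  rewrite le_max hK0// normr_ge0/=; exact: AB.
pose W (t : R) : set bH := [set U om t | om in (A : set H)].
have slow : slow_flow f T eps tau @` A = W (tau / eps) by [].
have WA : W 0 = A.
  apply/seteqP; split => [_ [om Aom <-]|om Aom]; first by have [-> _ _] := Usol om.
  by exists om => //; have [] := Usol om.
have AR : A `<=` ball R0 by move=> u /AB uM; rewrite /closed_ballH /= le_max [X in _ || X](uM : _) orbT.
rewrite slow; have [tz|tz] := eqVneq tau 0.
  by rewrite tz !mul0r WA oppr0 expR0 !mul1e lexx.
have tau1 : 0 < tau by rewrite lt_neqAle eq_sym tz.
pose t := tau / eps; have tpos : 0 < t by rewrite divr_gt0.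
(* The number of pieces grows like the inverse of [eps], but each one has length at most [d0]. *)
pose n := (Num.truncn (t / d0)).+1; pose delta := t / n%:R.
have n0 : (0 : R) < n%:R by rewrite ltr0n.
have dpos : 0 < delta by rewrite divr_gt0.
have dd : 0 < delta <= d0.
  rewrite dpos/= ler_pdivrMr// mulrC -ler_pdivrMr//; exact/ltW/truncnS_gt.
have [hle huniq himg] := hflow eps delta eps01' dd.
have nd : n%:R * delta = t by rewrite mulrC divfK// gt_eqF.
have jL j : (j <= n)%N -> j%:R * delta <= Lt.
  by move=> jn; apply: le_trans t_le; rewrite -/t -nd ler_wpM2r ?ler_nat// ltW.
have Wb s : 0 <= s <= Lt -> W s `<=` ball R0 by move=> ss _ [om Aom <-]; exact: Ubd.
have piece om j : A om -> (j < n)%N ->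
    trajectory (fun v => f (coef v)) 1 eps R0 delta (fun s => U om (j%:R * delta + s)).
  move=> Aom jn; apply: solution_trajectory (Usol om) (Ubd om Aom) _ _; first by rewrite mulr_ge0// ltW.
  by rewrite -[X in _ + X]mul1r -mulrDl natr1 jL.
have jS j : j%:R * delta + delta = j.+1%:R * delta by rewrite -natr1 mulrDl mul1r.
have ind j : (j <= n)%N -> [/\ measurable (W (j%:R * delta)),
    E (fun u => \1_A u * w u) <= expR (j%:R * delta * (eps * Cst)) * E (fun u => \1_(W (j%:R * delta)) u * w u) &
    E (fun u => \1_(W (j%:R * delta)) u * w u) <= expR (j%:R * delta * (eps * Cst)) * E (fun u => \1_A u * w u)].
  elim: j => [|j IH] jn; first by rewrite !mul0r WA expR0 !mul1r.
  have [mW h1 h2] := IH (ltnW jn).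
  have sj i : (i <= n)%N -> 0 <= i%:R * delta <= Lt by move=> /jL ->; rewrite mulr_ge0// ltW.
  have mW' : measurable (W (j.+1%:R * delta)).
    (* By uniqueness over a short time, every trajectory that starts in [W] at time [j%:R * delta]
       is a piece of some [U om]; the next [W] is thus an image to which [himg] applies. *)
    have -> : W (j.+1%:R * delta) = [set y : H | exists g, [/\ trajectory (fun v => f (coef v)) 1 eps R0 delta g, W (j%:R * delta) (g 0) & g delta = y]].
      apply/seteqP; split => y.
        move=> [om Aom <-]; exists (fun s => U om (j%:R * delta + s)); split; first exact: piece.
          by rewrite addr0; exists om.
        by rewrite jS.
      move=> [g [gP [om Aom g0] gd]]; exists om => //.
      by rewrite -jS -gd; apply: (huniq _ _ (piece om j Aom jn) gP); rewrite addr0.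
    apply: himg => // u [om Aom <-]; exists (fun s => U om (j%:R * delta + s)); first exact: piece.
    by rewrite addr0.
  have f1 := hle 1 _ _ (normr1 _) mW mW' (Wb _ (sj _ (ltnW jn))) (Wb _ (sj _ jn)).
  have f2 := hle (- 1) _ _ (normrN1 _) mW' mW (Wb _ (sj _ jn)) (Wb _ (sj _ (ltnW jn))).
  have g1 : E (fun u => \1_(W (j%:R * delta)) u * w u) <= expR (delta * (eps * Cst)) * E (fun u => \1_(W (j.+1%:R * delta)) u * w u).
    apply: f1 => _ [om Aom <-]; exists (fun s => U om (j%:R * delta + s)); split; first exact: piece.
      by rewrite addr0.
    by rewrite jS; exists om.
  have g2 : E (fun u => \1_(W (j.+1%:R * delta)) u * w u) <= expR (delta * (eps * Cst)) * E (fun u => \1_(W (j%:R * delta)) u * w u).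
    apply: f2 => _ [om Aom <-]; exists (fun s => U om (j%:R * delta + (delta - s))); split.
    - exact: trajectory_rev (piece om j Aom jn).
    - by rewrite subr0 jS.
    - by rewrite subrr addr0; exists om.
  have eS : expR (j.+1%:R * delta * (eps * Cst)) = expR (j%:R * delta * (eps * Cst)) * expR (delta * (eps * Cst)).
    by rewrite -jS mulrDl expRD.
  split=> //; rewrite eS.
    by apply: le_trans h1 _; rewrite -[leRHS]mulrA ler_wpM2l ?expR_ge0.
  by apply: le_trans g2 _; rewrite [expR _ * expR _]mulrC -[leRHS]mulrA ler_wpM2l ?expR_ge0.
have [mW h1 h2] := ind n (leqnn n).
have tC : n%:R * delta * (eps * Cst) = tau * Cst by rewrite nd /t mulrA divfK// gt_eqF.
rewrite tC nd in h1 h2 mW.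
have tt : 0 <= t <= Lt by rewrite ltW.
rewrite (mu_of_EE (M := R0) mA AR) (mu_of_EE (M := R0) mW (Wb _ tt)) -!EFinM !lee_fin h2 andbT.
by rewrite expRN mulrC ler_pdivrMr ?expR_gt0// mulrC.
Qed.

End assembly.

Theorem theorem4p1 (R : realType) (p : nat) (T : R)
    (f : (int -> R) -> (int -> R))
    (c : R) (Q : mpoly.mpoly p R) (eta : probability (borelH R p) R) :
  (3 <= p)%N -> 0 < T ->
  assumptionA p f T ->
  is_J c Q ->
  is_gaussian eta ->
  forall M : R, 0 < M ->
    quasi_invariant T M (slow_flow f T)
      (mu_of eta (fun u : sobolev (p%:R : R) => J_density c Q u)).
Proof.
move=> p3 T0 hA hJ eta_gauss M M0.
have [|G [G_bnd G_taylor]] := @J_taylor R p c Q; first by apply: leq_trans p3.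
split.
- exact: (@mu_regular R p c Q eta p3 eta_gauss G G_taylor).
- exact: (mu_ball p3 eta_gauss G_taylor M0).
- exact: (mu_quasi_invariant p3 hA hJ eta_gauss G_bnd G_taylor M0).
Qed.
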